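(* Let $n=3$, let $\alpha\in(0,1)$, let $F$ be a double-well potential satisfying $F''(0)<0$ and $F''(0)\,t\le F'(t)$ for every $t\ge 0$, and let $\lambda>\lambda_*:=\dfrac{\pi}{(-F''(0))^{1/(2\alpha)}}$. Then there exists a solution $u:\mathbb{R}^3\to\mathbb{R}$ of the fractional Allen-Cahn equation $$(-\Delta)^\alpha u=-F'(u)\quad\text{in }\mathbb{R}^3$$ whose zero set is equal to the helicoid $H_\lambda$. This solution is invariant under the screw motion of parameter $\lambda$, i.e. $u\circ\sigma_\lambda^\beta=u$ for every $\beta\in\mathbb{R}$.
   Context: Double-well potential: $F:\mathbb{R}\to\mathbb{R}$ is an even, nonnegative function of class $C^{2,\gamma}$ with $\gamma>\max\{0,1-2\alpha\}$, such that $F(t)\ge F(\pm1)$ for all $t$, with equality if and only if $t=\pm1$ (model example: $F(t)=\frac14(1-t^2)^2$). $(-\Delta)^\alpha$ is the fractional Laplacian on $\mathbb{R}^3$ (Fourier symbol $|\xi|^{2\alpha}$). Equivalently (Caffarelli-Silvestre extension), $u$ solves $(-\Delta)^\alpha u=-F'(u)$ if and only if its extension $v=v(x,y)$ to $\mathbb{R}^{4}_+=\mathbb{R}^3\times(0,\infty)$, with $v(\cdot,0)=u$, satisfies $\mathrm{div}(y^{1-2\alpha}\nabla v)=0$ in $\mathbb{R}^4_+$ and $-\frac1{c_\alpha}\lim_{y\to0}y^{1-2\alpha}\partial_y v=-F'(v)$ on $\{y=0\}$, where $c_\alpha=\frac{2^{1-2\alpha}\Gamma(1-\alpha)}{\Gamma(\alpha)}$.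 Identify $\mathbb{R}^3=\mathbb{C}\times\mathbb{R}$. For $\lambda>0$, the helicoid is $H_\lambda=\{(te^{i\theta},\frac{\lambda}{\pi}\theta): t,\theta\in\mathbb{R}\}$. The screw motion of parameter $\lambda$ is, for $\beta\in\mathbb{R}$, $\sigma_\lambda^\beta(z,s)=(e^{i\beta}z,\,s+\frac{\lambda}{\pi}\beta)$, $(z,s)\in\mathbb{C}\times\mathbb{R}$. *)

(* Defs.v *)
From HB Require Import structures.
From mathcomp Require Import all_boot all_order all_algebra.
From mathcomp Require Import all_classical all_reals all_analysis.
Set Implicit Arguments.
Unset Strict Implicit.
Unset Printing Implicit Defensive.
Import Order.TTheory GRing.Theory Num.Theory.
Import numFieldNormedType.Exports.
Local Open Scope ring_scope.
Local Open Scope classical_set_scope.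

(** Double-well potentials. C^{2,gamma} is the local Hölder class, so that the
    model [fun t => (1 - t ^+ 2) ^+ 2 / 4] belongs to it. *)

Definition C2_holder (R : realType) (gamma : R) (F : R -> R) : Prop :=
  [/\ 0 < gamma <= 1,
      forall t, derivable F t 1,
      forall t, derivable (derive1 F) t 1 &
      forall M : R, exists C : R, forall s t, `|s| <= M -> `|t| <= M ->
        `|derive1 (derive1 F) s - derive1 (derive1 F) t| <= C * `|s - t| `^ gamma].

Record double_well (R : realType) (alpha : R) (F : R -> R) : Prop := DoubleWell {
  dw_even : forall t, F (- t) = F t;
  dw_ge0 : forall t, 0 <= F t;
  dw_reg : exists2 gamma, Num.max 0 (1 - 2 * alpha) < gamma & C2_holder gamma F;
  dw_min : forall t, F 1 <= F t /\ F (- 1) <= F t;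
  dw_argmin : forall t, F t = F 1 <-> t = 1 \/ t = - 1
}.

(** R^3 is ['rV[R]_3]. The closed half-space of R^4 is the set of [Z : 'rV[R]_4]
    whose last coordinate [height Z], the variable y, is nonnegative. *)

Section HalfSpace.
Variable R : realType.
Implicit Types (x : 'rV[R]_3) (y : R) (Z : 'rV[R]_4).

Definition height Z : R := Z ord0 ord_max.

Definition half_point x y : 'rV[R]_4 := row_mx x (y%:M : 'rV[R]_1).

Definition half_space : set 'rV[R]_4 := [set Z | 0 < height Z].

Definition closed_half_space : set 'rV[R]_4 := [set Z | 0 <= height Z].

Definition partial (i : 'I_4) (v : 'rV[R]_4 -> R) Z : R :=
  'D_(delta_mx ord0 i) v Z.

(** To be used on open sets [A] only: derivatives at points of [A] see the
    values of [v] in a neighbourhood. *)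
Definition C2_on (A : set 'rV[R]_4) (v : 'rV[R]_4 -> R) : Prop :=
  forall Z, A Z -> forall i : 'I_4,
    [/\ derivable v Z (delta_mx ord0 i),
        {for Z, continuous (partial i v)} &
        forall j : 'I_4,
          derivable (partial i v) Z (delta_mx ord0 j) /\
          {for Z, continuous (partial j (partial i v))}].

End HalfSpace.

Definition Gamma (R : realType) (a : R) : R :=
  \int[lebesgue_measure]_(t in `]0, +oo[) (t `^ (a - 1) * expR (- t)).

Definition c_ (R : realType) (alpha : R) : R :=
  2 `^ (1 - 2 * alpha) * Gamma (1 - alpha) / Gamma alpha.

(** [v] is the Caffarelli-Silvestre extension of [u]. Boundedness singles it out
    among the solutions of the Dirichlet problem: for instance [y `^ (2 * alpha)]
    is an unbounded solution with zero trace. *)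
Record cs_extension (R : realType) (alpha : R)
    (u : 'rV[R]_3 -> R) (v : 'rV[R]_4 -> R) : Prop := CSExtension {
  cs_bounded : exists M : R, forall Z, closed_half_space Z -> `|v Z| <= M;
  cs_continuous : {within @closed_half_space R, continuous v};
  cs_C2 : C2_on (@half_space R) v;
  cs_div : forall Z, half_space Z ->
    \sum_(i < 4) partial i
      (fun W => height W `^ (1 - 2 * alpha) * partial i v W) Z = 0;
  cs_trace : forall x, v (half_point x 0) = u x
}.

(** [(-Δ)^alpha u = f] in R^3, with [(-Δ)^alpha] the operator of symbol
    [|xi|^(2 alpha)] on bounded functions, realized as the normalized
    Dirichlet-to-Neumann operator of the extension. *)
Definition fractional_laplacian_eq (R : realType) (alpha : R)
    (u f : 'rV[R]_3 -> R) : Prop :=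
  exists2 v : 'rV[R]_4 -> R, cs_extension alpha u v &
    forall x, - (c_ alpha)^-1 *
        (y `^ (1 - 2 * alpha) * partial ord_max v (half_point x y))
      @[y --> 0^'+] --> f x.

Definition allen_cahn_solution (R : realType) (alpha : R) (F : R -> R)
    (u : 'rV[R]_3 -> R) : Prop :=
  fractional_laplacian_eq alpha u (fun x => - derive1 F (u x)).

(** [vec3 a b s] is (a + ib, s) under the identification R^3 = C x R. *)
Definition vec3 (R : realType) (a b s : R) : 'rV[R]_3 :=
  \row_(i < 3) [:: a; b; s]`_i.

Definition helicoid (R : realType) (lambda : R) : set 'rV[R]_3 :=
  [set p | exists t theta : R,
     p = vec3 (t * cos theta) (t * sin theta) (lambda / pi * theta)].

Definition screw (R : realType) (lambda beta : R) (p : 'rV[R]_3) : 'rV[R]_3 :=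
  let a := p ord0 0 in let b := p ord0 1 in let s := p ord0 ord_max in
  vec3 (cos beta * a - sin beta * b) (sin beta * a + cos beta * b)
        (s + lambda / pi * beta).

Definition lambda_star (R : realType) (alpha : R) (F : R -> R) : R :=
  pi / (- derive1 (derive1 F) 0) `^ (2 * alpha)^-1.

(* Main.v *)
(** Put k = pi / lambda, f = - F', and choose K such that f(t) + K t is
    nondecreasing on [-1, 1]. The function helix = b cos(k s) - a sin(k s) of
    (a + ib, s) vanishes exactly on the helicoid. Consider the functions that
    are invariant under the screw motions and odd under the half-turn
    (a, b, s) -> (a, -b, -s); they vanish on the helicoid. A maximum principle
    shows that the heat semigroup S_t preserves, in this class, nonnegativity on
    {helix >= 0}. Hence so does T = ((-Delta)^alpha + K)^-1, which is the
    average of S_t against the kernel rho >= 0 with Laplace transform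
    1 / (s^alpha + K). The Gaussian bump e^(- d r^2) helix satisfies
    S_t bump >= e^(- (k^2 + 8 d) t) bump on {helix >= 0}, and lambda > lambda_*
    says that (k^2 + 8 d)^alpha < - F''(0) for small d: a small multiple of the
    bump is a subsolution. The monotone iteration u |-> T (f(u) + K u) started
    there converges to a fixed point u, positive on {helix > 0}.

    The extension of u is the average of S_t u against the inverse Gamma law of
    parameter y^2 / 4. It is also a Poisson integral, whence its regularity and
    the differential equation. With g = f(u) + K u, its conormal derivative at x
    only depends on the function t |-> S_t g (x), through the Volterra equation
    that defines rho; this gives f(u(x)) without any regularity of u beyond
    continuity. *)
Require Import Defs.
From HB Require Import structures.
From mathcomp Require Import all_boot all_order all_algebra.
From mathcomp Require Import all_classical all_reals all_analysis.
From mathcomp Require Import measurable_realfun lebesgue_integral.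
From mathcomp Require Import ring lra.
Set Implicit Arguments.
Unset Strict Implicit.
Unset Printing Implicit Defensive.
Import Order.TTheory GRing.Theory Num.Theory.
Import numFieldNormedType.Exports.
Local Open Scope ring_scope.
Local Open Scope classical_set_scope.

(** * The standard normal law and the heat semigroup *)

(** [helix] is an eigenfunction of [- Delta] with eigenvalue [k^2], so [lambda_*] is the pitch at
    which [k^(2 alpha)] meets [- F''(0)]. As [helix] is unbounded it is cut off by a Gaussian, and
    the strict inequality leaves room for the cost [8 d]. The obstacle is nonlocality: on one side
    of the helicoid the fractional operator feels the opposite values on the other side, so the
    usual maximum principle does not apply there. The heat flow is local and odd solutions vanish on
    the helicoid, so a parabolic comparison does work on one side; subordination then transports it
    to the resolvent, since the kernel [rho] is nonnegative. Screw invariance leaves two space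
    variables, in which a quadratic penalty restores compactness. All space averages are
    expectations of [h (x + c xi)] for a Gaussian vector [xi]. Semigroup law, symmetries and
    smoothing are then read off one law, through its rotation invariance and its densities; the
    Poisson kernel is accordingly written relative to this law, with a factor
    [expR (|xi|^2 / 2)]. *)

Section affine.
Variable R : realType.
Local Notation mu := (@lebesgue_measure R).
Local Open Scope ereal_scope.

(** By uniqueness of Lebesgue measure it suffices to compare both sides on the intervals []p, q]].
    Their preimages change the closed end when [a < 0], whence two cases. *)
Let mu_affine (a b : R) : (a != 0)%R -> forall A, measurable A ->
  mu A = `|a|%:E * mu ((fun x => a * x + b)%R @^-1` A).
Proof.
move=> a0 A mA.
have mphi : @measurable_fun _ _ (measurableTypeR R) (measurableTypeR R) setT (fun x : R => a * x + b)%R.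
  by apply: measurable_funD => //; exact: mulrl_measurable.
pose phi : {mfun measurableTypeR R >-> measurableTypeR R} :=
  HB.pack (fun x : R => a * x + b)%R (isMeasurableFun.Build _ _ _ _ _ mphi).
have aa0 : (0 <= `|a|)%R by [].
suff : mu A = mscale (NngNum aa0) (pushforward mu phi) A by apply.
have ap : (0 < `|a|)%R by rewrite normr_gt0.
move=> mm; apply: lebesgue_measure_unique => // _ [[p q]] _ <-.
rewrite [RHS]/= /mscale/= /pushforward/= /preimage/=.
have [al|ag] : (a < 0)%R \/ (0 < a)%R by apply/orP; rewrite -neq_lt.
- have -> : [set x | (a * x + b)%R \in `]p, q]%R] = `[((q - b) / a)%R, ((p - b) / a)%R[%classic.
    apply/seteqP; split => x /=; rewrite !in_itv/= ler_ndivrMr// ltr_ndivlMr// lerBrDr ltrBlDr mulrC.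
      by move=> /andP[-> ->].
    by move=> /andP[-> ->].
  rewrite !lebesgue_measure_itv/= !lte_fin ltr_nM2r ?invr_lt0//.
  rewrite ltrD2r; case: ifPn => pq; last by rewrite mule0.
  rewrite -!EFinB -EFinM ltr0_norm//; congr EFin; field. exact: a0.
- have -> : [set x | (a * x + b)%R \in `]p, q]%R] = `]((p - b) / a)%R, ((q - b) / a)%R]%classic.
    apply/seteqP; split => x /=; rewrite !in_itv/= ler_pdivlMr// ltr_pdivrMr// lerBrDr ltrBlDr mulrC.
      by move=> /andP[-> ->].
    by move=> /andP[-> ->].
  rewrite !lebesgue_measure_itv/= !lte_fin ltr_pM2r ?invr_gt0//.
  rewrite ltrD2r; case: ifPn => pq; last by rewrite mule0.
  rewrite -!EFinB -EFinM gtr0_norm//; congr EFin; field. exact: a0.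
Qed.

Lemma ge0_integral_affine (a b : R) (f : R -> \bar R) : (a != 0)%R ->
  measurable_fun setT f -> (forall x, 0 <= f x) ->
  \int[mu]_x f x = `|a|%:E * \int[mu]_x f (a * x + b)%R.
Proof.
move=> a0 mf f0.
have mphi : @measurable_fun _ _ (measurableTypeR R) (measurableTypeR R) setT (fun x : R => a * x + b)%R.
  by apply: measurable_funD => //; exact: mulrl_measurable.
pose phi : {mfun measurableTypeR R >-> measurableTypeR R} :=
  HB.pack (fun x : R => a * x + b)%R (isMeasurableFun.Build _ _ _ _ _ mphi).
have aa0 : (0 <= `|a|)%R by [].
rewrite (@eq_measure_integral _ _ _ _ (mscale (NngNum aa0) (pushforward mu phi))); last first.
  by move=> A mA _; exact: (mu_affine b a0 mA).
rewrite ge0_integral_mscale//; congr (_ * _).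
by rewrite ge0_integral_pushforward// preimage_setT.
Qed.

End affine.

(** * Densities and rotation invariance of the standard normal law *)

Section density.
Local Open Scope ereal_scope.
Context d (T : measurableType d) (R : realType).
Variables (m nu : {measure set T -> \bar R}) (p : T -> R).
Hypothesis mp : measurable_fun setT p.
Hypothesis p0 : forall x, (0 <= p x)%R.
Hypothesis nuE : forall A, measurable A -> nu A = \int[m]_(x in A) (p x)%:E.

Import HBNNSimple.

(** Monotone convergence along simple approximations of [f] reduces the claim to indicators, where
    it is [nuE]. *)
Lemma ge0_integral_density (f : T -> \bar R) :
  measurable_fun setT f -> (forall x, 0 <= f x) ->
  \int[nu]_x f x = \int[m]_x (f x * (p x)%:E).
Proof.
move=> mf f0.
pose g := nnsfun_approx measurableT mf.
transitivity (limn (fun n => \int[nu]_x (g n x)%:E)).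
  rewrite -monotone_convergence//.
  - by apply: eq_integral => y _; apply/esym/cvg_lim => //; exact: cvg_nnsfun_approx.
  - by move=> n; exact/measurable_EFinP.
  - by move=> n y _; rewrite lee_fin.
  - by move=> y _ a b ab; rewrite lee_fin; exact/lefP/nd_nnsfun_approx.
transitivity (limn (fun n => \int[m]_x ((g n x)%:E * (p x)%:E))); last first.
  rewrite -monotone_convergence//.
  - apply: eq_integral => y _; apply/cvg_lim => //.
    apply: cvgeZr => //; exact: cvg_nnsfun_approx.
  - move=> n; apply: emeasurable_funM; exact/measurable_EFinP.
  - by move=> n y _; rewrite mule_ge0// lee_fin.
  - move=> y _ a b ab; rewrite lee_wpmul2r ?lee_fin//; exact/lefP/nd_nnsfun_approx.
congr (limn _); apply/funext => n.
under eq_integral do rewrite fimfunE -fsumEFin//.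
rewrite ge0_integral_fsum//; last 2 first.
- by move=> r; exact/measurable_EFinP/measurable_funM.
- by move=> r x _; rewrite nnfun_muleindic_ge0.
rewrite [RHS](_ : _ = \int[m]_x \sum_(k \in range (g n))
    ((k * \1_(g n @^-1` [set k]) x)%:E * (p x)%:E)); last first.
  apply: eq_integral => x _; rewrite {1}fimfunE -fsumEFin// ge0_mule_fsuml//.
  by move=> r; rewrite nnfun_muleindic_ge0.
rewrite ge0_integral_fsum//; last 2 first.
- move=> r; apply: emeasurable_funM; last exact/measurable_EFinP.
  by exact/measurable_EFinP/measurable_funM.
- by move=> r x _; rewrite mule_ge0 ?nnfun_muleindic_ge0// lee_fin.
apply: eq_fsbigr => r _.
rewrite (integralZl_indic _ (fun r => g n @^-1` [set r]))//; last first.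
  by move=> r0; rewrite preimage_nnfun0.
rewrite integral_indic// setIT nuE//.
(* The sum runs over all values of [g n]. A negative one has an empty preimage and contributes 0 on
   both sides, while pulling [r] into the integral below asks for [0 <= r]. *)
have [r0|r0] := ltP r 0%R.
  have h0 : g n @^-1` [set r] = set0 by rewrite preimage_nnfun0.
  rewrite h0 integral_set0 mule0; apply/esym.
  by apply: integral0_eq => x _; rewrite indic0/= mulr0 mul0e.
rewrite -ge0_integralZl_EFin//; last 2 first.
- by move=> x _; rewrite lee_fin.
- by apply/measurable_EFinP; exact: measurable_funTS.
rewrite integral_mkcond; apply: eq_integral => x _.
rewrite patchE indicE; case: ifPn => xE; first by rewrite mulr1.
by rewrite mulr0 mul0e.
Qed.
End density.

Section rotation.
Variable R : realType.
Local Notation mu := (@lebesgue_measure R).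
Local Open Scope ereal_scope.

(** For [a != 0] the rotation factors into two affine substitutions of one variable, in [x] and
    then, after Tonelli, in [y]; the factor [|a^-1|] produced by the first is the Jacobian absorbed
    by the second. For [a = 0] it is an exchange of the axes up to signs. *)
Lemma ge0_integral_rotation (a b : R) (F : R * R -> \bar R) :
  (a ^+ 2 + b ^+ 2 = 1)%R -> measurable_fun setT F -> (forall x, 0 <= F x) ->
  \int[mu]_y \int[mu]_x F (a * x - b * y, b * x + a * y)%R =
  \int[mu]_y \int[mu]_x F (x, y).
Proof.
move=> ab mF F0.
have mlin (T : measurableType _) (u v : T -> R) (c e : R) : measurable_fun setT u ->
   measurable_fun setT v -> measurable_fun setT (fun x => c * u x + e * v x)%R.
  by move=> mu_ mv; apply: measurable_funD; apply: measurable_funM => //.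
have mFp d (T : measurableType d) (u v : T -> R) : measurable_fun setT u ->
   measurable_fun setT v -> measurable_fun setT (fun x => F (u x, v x)).
  by move=> ? ?; apply: measurableT_comp => //; exact: measurable_fun_pair.
have [a0|a0] := eqVneq a 0%R.
  have bb : (`|b| = 1)%R.
    by apply/eqP; rewrite -sqrp_eq1// real_normK ?num_real// -ab a0 expr0n add0r.
  have b0 : b != 0%R by rewrite -normr_eq0 bb oner_eq0.
  transitivity (\int[mu]_x \int[mu]_y F (x, y)); last exact: (@fubini_tonelli _ _ _ _ _ mu mu F).
  rewrite [RHS](@ge0_integral_affine _ (- b)%R 0%R)//; last 3 first.
  - by rewrite oppr_eq0.
  - by apply: (@measurable_fun_fubini_tonelli_F _ _ _ _ _ mu F).
  - by move=> x; exact: integral_ge0.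
  rewrite normrN bb mul1e; apply: eq_integral => y _.
  rewrite [RHS](@ge0_integral_affine _ b 0%R)//; last first.
  - by apply: mFp.
  rewrite bb mul1e; apply: eq_integral => x _.
  by rewrite a0; congr (F (_, _)); ring.
transitivity (\int[mu]_y (`|a^-1|%:E * \int[mu]_x F (x, (b * x + y) / a)%R)).
  apply: eq_integral => y _.
  rewrite [in RHS](@ge0_integral_affine _ a (- b * y)%R)//; last first.
    apply: mFp => //; apply: measurable_funM => //; exact: measurable_funD.
  rewrite muleA -EFinM -normrM mulVf// normr1 mul1e.
  apply: eq_integral => x _; congr (F (_, _)); first by ring.
  have -> : (b * (a * x + - b * y) + y = a * (b * x) + (1 - b ^+ 2) * y)%R by ring.
  rewrite -ab addrK; field. exact: a0.
rewrite ge0_integralZl//; last 2 first.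
- apply: (@measurable_fun_fubini_tonelli_F _ _ _ _ _ mu (fun z => F (z.2, (b * z.2 + z.1) / a))%R) => //.
  apply: mFp => //; apply: measurable_funM => //; apply: measurable_funD => //.
  exact: measurable_funM.
- by move=> x _; exact: integral_ge0.
transitivity (`|a^-1|%:E * \int[mu]_x \int[mu]_y F (x, (b * x + y) / a)%R).
  congr (_ * _); apply/esym/(@fubini_tonelli _ _ _ _ _ mu mu (fun z => F (z.1, (b * z.1 + z.2) / a))%R) => //.
  apply: mFp => //; apply: measurable_funM => //; apply: measurable_funD => //.
  exact: measurable_funM.
transitivity (\int[mu]_x \int[mu]_y F (x, y)); last exact: (@fubini_tonelli _ _ _ _ _ mu mu F).
rewrite -ge0_integralZl//; last 2 first.
- apply: (@measurable_fun_fubini_tonelli_F _ _ _ _ _ mu (fun z => F (z.1, (b * z.1 + z.2) / a))%R) => //.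
  apply: mFp => //; apply: measurable_funM => //; apply: measurable_funD => //.
  exact: measurable_funM.
- by move=> x _; exact: integral_ge0.
apply: eq_integral => x _.
rewrite [RHS](@ge0_integral_affine _ a^-1 (b * x / a)%R)//; last 2 first.
- by rewrite invr_eq0.
- exact: mFp.
congr (_ * _); apply: eq_integral => y _; congr (F (_, _)); field. exact: a0.
Qed.

End rotation.

Section gauss.
Variable R : realType.
Local Notation mu := (@lebesgue_measure R).
Local Notation N := (normal_prob (0:R) 1).

Lemma ge0_integral_normal (m s : R) (f : R -> \bar R) :
  measurable_fun setT f -> (forall x, (0 <= f x)%E) ->
  (\int[normal_prob m s]_x f x = \int[mu]_x (f x * (normal_pdf m s x)%:E))%E.
Proof.
move=> mf f0; apply: ge0_integral_density => //.
- exact: measurable_normal_pdf.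
- exact: normal_pdf_ge0.
Qed.

Lemma measurable_EFin_normal_pdf (m s : R) :
  measurable_fun [set: R] (fun x => (normal_pdf m s x)%:E).
Proof. by apply/measurable_EFinP; exact: measurable_normal_pdf. Qed.

Lemma normal_pdf01 (x : R) :
  normal_pdf 0 1 x = (Num.sqrt (pi *+ 2))^-1 * expR (- x ^+ 2 / 2).
Proof.
rewrite normal_pdfE ?oner_eq0// /normal_peak /normal_fun.
by rewrite expr1n mul1r subr0.
Qed.

(** The product of two standard densities depends on [x ^+ 2 + y ^+ 2] only. *)
Lemma normal_pdf_rotation (a b x y : R) : a ^+ 2 + b ^+ 2 = 1 ->
  normal_pdf 0 1 (a * x - b * y) * normal_pdf 0 1 (b * x + a * y) =
  normal_pdf 0 1 x * normal_pdf 0 1 y.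
Proof.
move=> ab; rewrite !normal_pdf01.
rewrite mulrACA [in RHS]mulrACA; congr (_ * _); rewrite -!expRD; congr expR.
have -> : - (a * x - b * y) ^+ 2 / 2 + - (b * x + a * y) ^+ 2 / 2 =
  - ((a ^+ 2 + b ^+ 2) * (x ^+ 2 + y ^+ 2)) / 2 by field.
by rewrite ab mul1r; field.
Qed.

End gauss.

Section density_rotation.
Variables (R : realType) (N : probability (measurableTypeR R) R) (p : R -> R).
Local Notation mu := (@lebesgue_measure R).
Hypothesis mp : measurable_fun [set: R] p.
Hypothesis p0 : forall x, 0 <= p x.
Hypothesis Np : forall f : R -> \bar R, measurable_fun [set: R] f ->
  (forall x, (0 <= f x)%E) -> (\int[N]_x f x = \int[mu]_x (f x * (p x)%:E))%E.

Lemma ge0_integral_density2 (G : R * R -> \bar R) :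
  measurable_fun setT G -> (forall x, (0 <= G x)%E) ->
  (\int[N]_y \int[N]_x G (x, y) = \int[mu]_y \int[mu]_x
    (G (x, y) * (p x * p y)%:E))%E.
Proof.
move=> mG G0.
have mpE : measurable_fun [set: R] (fun x => (p x)%:E) by exact/measurable_EFinP.
have mGy y : measurable_fun setT (fun x => G (x, y)).
  by apply: measurableT_comp => //; exact: measurable_fun_pair.
rewrite Np; last 2 first.
- by apply: (@measurable_fun_fubini_tonelli_G _ _ _ _ _ N G).
- by move=> x; exact: integral_ge0.
apply: eq_integral => y _.
rewrite Np// -ge0_integralZr//; last 3 first.
- apply: emeasurable_funM; [exact: mGy|exact: mpE].
- by move=> x _; rewrite mule_ge0// lee_fin.
- by rewrite lee_fin.
by apply: eq_integral => x _; rewrite EFinM muleA.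
Qed.

Lemma ge0_density_rotation (a b : R) (F : R * R -> \bar R) :
  (forall x y, p (a * x - b * y) * p (b * x + a * y) = p x * p y) ->
  a ^+ 2 + b ^+ 2 = 1 -> measurable_fun setT F -> (forall x, (0 <= F x)%E) ->
  (\int[N]_y \int[N]_x F (a * x - b * y, b * x + a * y)%R =
  \int[N]_y \int[N]_x F (x, y))%E.
Proof.
move=> pab ab mF F0.
rewrite [LHS](@ge0_integral_density2 (fun z => F (a * z.1 - b * z.2, b * z.1 + a * z.2)))//; last first.
  apply: measurableT_comp => //; apply: measurable_fun_pair.
    by apply: measurable_funB; apply: measurable_funM.
  by apply: measurable_funD; apply: measurable_funM.
rewrite [RHS](ge0_integral_density2 mF F0).
have mpp : measurable_fun setT (fun z : R * R => p z.1 * p z.2).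
  by apply: measurable_funM; (apply: measurableT_comp; first exact: mp).
pose G z := (F z * (p z.1 * p z.2)%:E)%E.
have mG : measurable_fun setT G.
  by apply: emeasurable_funM => //; exact/measurable_EFinP.
have G0 x : (0 <= G x)%E by rewrite /G mule_ge0// lee_fin mulr_ge0.
rewrite -[RHS](ge0_integral_rotation ab mG G0).
by apply: eq_integral => y _; apply: eq_integral => x _; rewrite /G/= pab.
Qed.

End density_rotation.

Section gauss_law.
Variable R : realType.
Local Notation N := (normal_prob (0:R) 1).

Lemma ge0_normal_rotation (a b : R) (F : R * R -> \bar R) :
  a ^+ 2 + b ^+ 2 = 1 -> measurable_fun setT F -> (forall x, (0 <= F x)%E) ->
  (\int[N]_y \int[N]_x F (a * x - b * y, b * x + a * y)%R =
  \int[N]_y \int[N]_x F (x, y))%E.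
Proof.
move=> ab; apply: (@ge0_density_rotation _ N (normal_pdf 0 1)) => //.
- exact: measurable_normal_pdf.
- exact: normal_pdf_ge0.
- by move=> f mf f0; exact: ge0_integral_normal.
- by move=> x y; exact: normal_pdf_rotation.
Qed.

End gauss_law.

(** * Sequential limits, dominated convergence and Fubini for real integrals *)

Section seq_cvg.
Variables (R : realType) (T : pseudoMetricType R).

(** Dominated convergence speaks of sequences, so limits of integrals with a parameter are tested
    along sequences. If the limit failed, choosing a bad point at each radius [1 / (n + 1)] would
    give a sequence without the expected limit. *)
Lemma seq_cvg_within (A : set T) (f : T -> R) (x : T) (l : R) :
  (forall u : nat -> T, (forall n, A (u n)) -> u n @[n --> \oo] --> x ->
     f (u n) @[n --> \oo] --> l) ->
  f @ within A (nbhs x) --> l.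
Proof.
move=> H; apply/cvgrPdist_lt => e e0; apply: contrapT => nH.
have /choice [u Hu] : forall n : nat, exists y, [/\ ball x n.+1%:R^-1 y, A y & ~ `|l - f y| < e].
  move=> n; apply: contrapT => nu; apply: nH.
  rewrite near_withinE; apply/nbhs_ballP; exists n.+1%:R^-1 => /=.
    by rewrite invr_gt0.
  by move=> y by_ Ay; apply: contrapT => ny; apply: nu; exists y.
have ux : u n @[n --> \oo] --> x.
  apply/cvg_ballP => d d0; near=> n.
  have [bn _ _] := Hu n; apply: le_ball bn.
  rewrite ltW//; near: n; exact: (near_infty_natSinv_lt (PosNum d0)).
have Au n : A (u n) by have [] := Hu n.
have /cvgrPdist_lt /(_ e e0) [n _ /(_ n (leqnn n))] := H u Au ux.
by have [_ _] := Hu n.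
Unshelve. all: by end_near. Qed.

Lemma seq_continuous_at (f : T -> R) (x : T) :
  (forall u : nat -> T, u n @[n --> \oo] --> x ->
     f (u n) @[n --> \oo] --> f x) -> {for x, continuous f}.
Proof.
move=> H; rewrite /prop_for /continuous_at.
have : f @ within setT (nbhs x) --> f x.
  by apply: seq_cvg_within => u _; exact: H.
move=> /cvgrPdist_lt H'; apply/cvgrPdist_lt => e /H'; rewrite near_withinE.
by apply: filterS => y; apply.
Qed.

End seq_cvg.

Section Rintegral_tools.
Context d (T : measurableType d) (R : realType).

Lemma integrable_le_norm (m : {measure set T -> \bar R}) (D : set T) (f g : T -> R) :
  measurable D -> measurable_fun D f -> m.-integrable D (EFin \o g) ->
  (forall x, D x -> `|f x| <= g x) -> m.-integrable D (EFin \o f).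
Proof.
move=> mD mf ig fg; apply: le_integrable ig => //; first exact/measurable_EFinP.
by move=> x Dx /=; rewrite lee_fin (le_trans (fg _ Dx))// ler_norm.
Qed.

Lemma Rdominated_cvg (m : {measure set T -> \bar R}) (D : set T)
    (fn : nat -> T -> R) (f g : T -> R) : measurable D ->
  (forall n, measurable_fun D (fn n)) ->
  (forall x, D x -> fn n x @[n --> \oo] --> f x) ->
  m.-integrable D (EFin \o g) ->
  (forall n x, D x -> `|fn n x| <= g x) ->
  m.-integrable D (EFin \o f) /\
  \int[m]_(x in D) fn n x @[n --> \oo] --> \int[m]_(x in D) f x.
Proof.
move=> mD mfn fnf ig fng.
have mf : measurable_fun D f by apply: (measurable_fun_cvg mfn).
have iff : m.-integrable D (EFin \o f).
  apply: (integrable_le_norm mD mf ig) => x Dx.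
  apply: (closed_cvg (fun y : R => y <= g x)) (cvg_norm (fnf x Dx)).
  - exact: closed_le.
  - by apply: nearW => n; exact: fng.
split=> //; rewrite /Rintegral; apply: fine_cvg; rewrite fineK; last first.
  exact: integrable_fin_num.
apply: (@dominated_cvg _ _ _ m D mD (fun n => EFin \o fn n) (EFin \o f) (EFin \o g)) => //.
- by move=> n; exact/measurable_EFinP.
- by move=> x Dx; apply: cvg_EFin; [exact: nearW|exact: fnf].
Qed.

Variable P : probability T R.
Implicit Types (h : T -> R).

Lemma bounded_integrable h M : measurable_fun setT h -> (forall x, `|h x| <= M) ->
  P.-integrable setT (EFin \o h).
Proof.
move=> mh hM; apply: (@integrable_le_norm _ _ _ (cst M)) => //.
exact: finite_measure_integrable_cst.
Qed.

Lemma Rintegral_cst1 (c : R) : \int[P]_x c = c.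
Proof.
by rewrite Rintegral_cst// [X in fine X](@probability_setT _ _ _ P) mulr1.
Qed.

Lemma norm_Rintegral_le h M : measurable_fun setT h -> (forall x, `|h x| <= M) ->
  `|\int[P]_x h x| <= M.
Proof.
move=> mh hM; have ih := bounded_integrable mh hM.
apply: le_trans (le_normr_Rintegral _ ih) _ => //.
rewrite -[leRHS]Rintegral_cst1; apply: le_Rintegral => //.
- by apply: (integrable_norm ih).
- exact: finite_measure_integrable_cst.
Qed.

Lemma bounded_cvg_Rintegral (hn : nat -> T -> R) h M :
  (forall n, measurable_fun setT (hn n)) ->
  (forall n x, `|hn n x| <= M) -> (forall x, hn n x @[n --> \oo] --> h x) ->
  \int[P]_x hn n x @[n --> \oo] --> \int[P]_x h x.
Proof.
move=> mhn hM hc.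
have [||_ //] := @Rdominated_cvg P setT hn h (cst M) measurableT mhn (fun x _ => hc x).
  exact: finite_measure_integrable_cst.
by move=> n x _; exact: hM.
Qed.

End Rintegral_tools.

Section Rfubini.
Context d1 d2 (T1 : measurableType d1) (T2 : measurableType d2) (R : realType).
Variables (m1 : {sigma_finite_measure set T1 -> \bar R}) (m2 : {sigma_finite_measure set T2 -> \bar R}).
Variable f : T1 * T2 -> R.
Hypothesis f1 : forall x, m2.-integrable setT (fun y => (f (x, y))%:E).
Hypothesis f2 : forall y, m1.-integrable setT (fun x => (f (x, y))%:E).
Hypothesis f12 : (m1 \x m2)%E.-integrable setT (EFin \o f).

Lemma Rfubini12 : \int[m1]_x \int[m2]_y f (x, y) = \int[(m1 \x m2)%E]_z f z.
Proof.
rewrite /Rintegral -(integral12_prod_meas1 f12); congr fine.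
apply: eq_integral => x _; rewrite fineK//.
exact: integrable_fin_num.
Qed.

Lemma Rfubini21 : \int[m2]_y \int[m1]_x f (x, y) = \int[(m1 \x m2)%E]_z f z.
Proof.
rewrite /Rintegral -(integral21_prod_meas1 f12); congr fine.
apply: eq_integral => x _; rewrite fineK//.
exact: integrable_fin_num.
Qed.

Lemma measurable_Rfubini1 : measurable_fun setT (fun x => \int[m2]_y f (x, y)).
Proof.
apply/measurable_EFinP.
rewrite [X in measurable_fun _ X](_ : _ = (fun x => \int[m2]_y (f (x, y))%:E)%E); last first.
  apply/funext => x; rewrite /= /Rintegral fineK//.
  exact: integrable_fin_num.
exact: (measurable_fubini_F f12).
Qed.

Lemma measurable_Rfubini2 : measurable_fun setT (fun y => \int[m1]_x f (x, y)).
Proof.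
apply/measurable_EFinP.
rewrite [X in measurable_fun _ X](_ : _ = (fun y => \int[m1]_x (f (x, y))%:E)%E); last first.
  apply/funext => x; rewrite /= /Rintegral fineK//.
  exact: integrable_fin_num.
exact: (measurable_fubini_G f12).
Qed.

End Rfubini.

Section Rfubini_dom.
Context d1 d2 (T1 : measurableType d1) (T2 : measurableType d2) (R : realType).
Variables (m : {sigma_finite_measure set T1 -> \bar R}) (P : probability T2 R).
Variables (f : T1 * T2 -> R) (g : T1 -> R).
Hypothesis mf : measurable_fun setT f.
Hypothesis ig : m.-integrable setT (EFin \o g).
Hypothesis fg : forall x y, `|f (x, y)| <= g x.

Let f1 x : P.-integrable setT (fun y => (f (x, y))%:E).
Proof.
apply: (@bounded_integrable _ _ _ P (fun y => f (x, y)) (g x)) => //.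
by apply: measurableT_comp => //; exact: measurable_fun_pair.
Qed.

Let f2 y : m.-integrable setT (fun x => (f (x, y))%:E).
Proof.
apply: (@integrable_le_norm _ _ _ _ _ (fun x => f (x, y)) g) => //.
by apply: measurableT_comp => //; exact: measurable_fun_pair.
Qed.

Let f12 : (m \x P)%E.-integrable setT (EFin \o f).
Proof.
apply/integrable12ltyP; first exact/measurable_EFinP.
have /integrableP[_] := ig; apply: le_lt_trans.
apply: ge0_le_integral => //.
- by move=> x _; apply: integral_ge0.
- apply: (@measurable_fun_fubini_tonelli_F _ _ _ _ _ P (fun z => `|(f z)%:E|)%E) => //.
  by apply: measurableT_comp => //; exact/measurable_EFinP.
- by apply: measurableT_comp => //; case/integrableP: ig.
- move=> x _.
  have -> : `|(g x)%:E|%E = (\int[P]_y (cst `|g x|%:E y))%E.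
    by rewrite integral_cst// [X in (_ * X)%E]probability_setT mule1.
  apply: ge0_le_integral => //.
    by apply: measurableT_comp => //; case/integrableP: (f1 x).
  by move=> y _ /=; rewrite lee_fin (le_trans (fg x y))// ler_norm.
Qed.

(** A majorant of the first variable alone suffices because the second measure has mass 1. Typically
    the first variable is time, weighted by [rho], and the second is a Gaussian vector. *)
Lemma Rfubini_dom : \int[m]_x \int[P]_y f (x, y) = \int[P]_y \int[m]_x f (x, y).
Proof. by rewrite (Rfubini12 f1 f12) (Rfubini21 f2 f12). Qed.

Lemma Rfubini_dom12 : \int[m]_x \int[P]_y f (x, y) = \int[(m \x P)%E]_z f z.
Proof. by rewrite (Rfubini12 f1 f12). Qed.

Lemma measurable_Rfubini_dom1 : measurable_fun setT (fun x => \int[P]_y f (x, y)).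
Proof. exact: (measurable_Rfubini1 f1 f12). Qed.

Lemma measurable_Rfubini_dom2 : measurable_fun setT (fun y => \int[m]_x f (x, y)).
Proof. exact: (measurable_Rfubini2 f2 f12). Qed.

End Rfubini_dom.

(** * Gaussian laws on the line and on R^3 *)

Section gaussian_def.
Variable R : realType.
Local Notation mu := (@lebesgue_measure R).

Definition gpdf (c z : R) := (c * Num.sqrt (pi *+ 2))^-1 * expR (- z ^+ 2 / (2 * c ^+ 2)).

(* Density of the law N(a, c^2) with respect to N(0, 1). *)
Definition gratio (c a x : R) := c^-1 * expR (x ^+ 2 / 2 - (x - a) ^+ 2 / (2 * c ^+ 2)).

Lemma gratio_gt0 c a x : 0 < c -> 0 < gratio c a x.
Proof. by move=> c0; rewrite /gratio mulr_gt0 ?invr_gt0 ?expR_gt0. Qed.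

Lemma measurable_gratio c a : measurable_fun setT (gratio c a).
Proof.
apply: measurable_funM => //; apply: (measurableT_comp (@measurable_expR R)).
apply: measurable_funB; apply: measurable_funM => //; apply: measurable_funX => //.
exact: measurable_funB.
Qed.

Lemma gratioE c a x : 0 < c -> gratio c a x * gpdf 1 x = gpdf c (x - a).
Proof.
move=> c0; rewrite /gratio /gpdf mul1r mulrACA -expRD -invfM; congr (_ * expR _).
by field; rewrite gt_eqF.
Qed.

(* The measurable structure carrying [normal_prob] is not the default one of [R],
   whose products are used below; so only these two properties are retained. *)
Record gaussian (N : probability R R) : Prop := Gaussian {
  gaussian_rotation : forall (a b : R) (F : R * R -> \bar R),
    a ^+ 2 + b ^+ 2 = 1 -> measurable_fun setT F -> (forall x, (0 <= F x)%E) ->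
    (\int[N]_y \int[N]_x F (a * x - b * y, b * x + a * y)%R =
     \int[N]_y \int[N]_x F (x, y))%E;
  gaussian_density : forall (a c : R) (f : R -> \bar R), 0 < c ->
    measurable_fun setT f -> (forall x, (0 <= f x)%E) ->
    (\int[N]_x f (a + c * x)%R = \int[N]_x (f x * (gratio c a x)%:E))%E
}.

Let normal_density (a c : R) (f : R -> \bar R) : 0 < c ->
    measurable_fun setT f -> (forall x, (0 <= f x)%E) ->
    (\int[normal_prob 0 1]_x f (a + c * x)%R = \int[mu]_x (f x * (gpdf c (x - a))%:E))%E.
Proof.
move=> c0 mf f0.
have c0' : c != 0 by rewrite gt_eqF.
rewrite ge0_integral_normal; last 2 first.
- by apply: measurableT_comp => //; apply: measurable_funD => //; exact: measurable_funM.
- by [].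
rewrite (@ge0_integral_affine _ c^-1 (- a / c)); last 3 first.
- by rewrite invr_eq0.
- apply: emeasurable_funM; last exact: measurable_EFin_normal_pdf.
  by apply: measurableT_comp => //; apply: measurable_funD => //; exact: measurable_funM.
- by move=> x; rewrite mule_ge0// lee_fin normal_pdf_ge0.
rewrite -ge0_integralZl//; last 2 first.
- apply: emeasurable_funM.
    by apply: measurableT_comp => //; apply: measurable_funD => //; apply: measurable_funM => //; exact: measurable_funD.
  apply/measurable_EFinP; apply: measurableT_comp; first exact: measurable_normal_pdf.
  by apply: measurable_funD => //; exact: measurable_funM.
- by move=> x _; rewrite mule_ge0// lee_fin normal_pdf_ge0.
apply: eq_integral => x _.
have -> : a + c * (c^-1 * x + - a / c) = x by field.
rewrite muleCA -EFinM; congr (_ * _%:E)%E.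
rewrite normal_pdf01 /gpdf gtr0_norm ?invr_gt0// mulrA -invfM; congr (_ * expR _).
by field.
Qed.

(** The law is [normal_prob 0 1] pushed forward along the identity from [measurableTypeR R] to [R],
    which leaves every integral unchanged. *)
Lemma normal_gaussian : exists N : probability R R, gaussian N.
Proof.
have mid : @measurable_fun _ _ (measurableTypeR R) R setT id by [].
pose phi : {mfun measurableTypeR R >-> R} := HB.pack (fun x : R => x) (isMeasurableFun.Build _ _ _ _ _ mid).
pose N : probability R R := distribution (normal_prob (0:R) 1) phi.
have NE (f : R -> \bar R) : measurable_fun setT f -> (forall x, (0 <= f x)%E) ->
    (\int[N]_x f x = \int[normal_prob 0 1]_x f x)%E.
  by move=> mf f0; rewrite ge0_integral_distribution.
have NE2 (F : R * R -> \bar R) : measurable_fun setT F -> (forall x, (0 <= F x)%E) ->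
    (\int[N]_y \int[N]_x F (x, y) = \int[normal_prob 0 1]_y \int[normal_prob 0 1]_x F (x, y))%E.
  move=> mF F0.
  have mFy y : measurable_fun setT (fun x => F (x, y)).
    by apply: measurableT_comp => //; exact: measurable_fun_pair.
  rewrite NE.
  - by apply: eq_integral => y _; rewrite NE.
  - exact: (@measurable_fun_fubini_tonelli_G _ _ _ _ _ N F mF F0).
  - by move=> x; exact: integral_ge0.
exists N; split.
  move=> a b F ab mF F0.
  pose G (z : R * R) := F (a * z.1 - b * z.2, b * z.1 + a * z.2).
  have mG : measurable_fun setT G.
    apply: measurableT_comp => //; apply: measurable_fun_pair.
      by apply: measurable_funB; apply: measurable_funM.
    by apply: measurable_funD; apply: measurable_funM.
  rewrite (NE2 F mF F0) (NE2 G mG (fun z => F0 _)).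
  exact: ge0_normal_rotation.
move=> a c f c0 mf f0.
have mr := measurable_gratio c a.
rewrite NE//; last first.
  by apply: measurableT_comp => //; apply: measurable_funD => //; exact: measurable_funM.
rewrite normal_density// NE//; last 2 first.
- by apply: emeasurable_funM => //; exact/measurable_EFinP.
- by move=> x; rewrite mule_ge0// lee_fin ltW// gratio_gt0.
pose h x := (f x * (gratio c a x)%:E)%E.
have mh : measurable_fun setT h by apply: emeasurable_funM => //; exact/measurable_EFinP.
have h0 x : (0 <= h x)%E.
  by rewrite /h mule_ge0// lee_fin ltW// gratio_gt0.
(* [normal_density] is used twice, for mean [a] and scale [c] and for mean 0 and scale 1; the two
   Lebesgue densities differ by the factor [gratio c a]. *)
transitivity (\int[normal_prob 0 1]_x h (0 + 1 * x)%R)%E; last first.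
  by apply: eq_integral => x _; rewrite add0r mul1r.
rewrite (normal_density 0 ltr01 mh h0).
by apply: eq_integral => x _; rewrite subr0 /h -muleA -EFinM gratioE.
Qed.

End gaussian_def.

Section product_probability.
Variable R : realType.
Definition prob2 (N : probability R R) : probability (R * R)%type R := (N \x N)%E.
Definition prob3 (N : probability R R) : probability (R * R * R)%type R := (prob2 N \x N)%E.
End product_probability.

Section transfer.
Context d (T : measurableType d) (R : realType) (P : probability T R).

(** Transfers identities between integrals of nonnegative functions to bounded functions of any
    sign: add the bound [M], apply the nonnegative identity, cancel [M]. *)
Lemma integral_shift_bounded (h : T -> R) (M : R) :
  measurable_fun setT h -> (forall x, `|h x| <= M) ->
  (\int[P]_x (h x + M)%:E = (\int[P]_x h x + M)%:E)%E.
Proof.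
move=> mh hM; have ih := bounded_integrable P mh hM.
under eq_integral do rewrite EFinD.
rewrite integralD_EFin//; last exact: finite_measure_integrable_cst.
rewrite EFinD /Rintegral fineK; last exact: integrable_fin_num.
by rewrite integral_cst// [X in (_ + _ * X)%E](@probability_setT _ _ _ P) mule1.
Qed.

Lemma shift_ge0 (h : T -> R) (M : R) : (forall x, `|h x| <= M) ->
  forall x, (0 <= (h x + M)%:E)%E.
Proof.
by move=> hM x; rewrite lee_fin -lerBlDr sub0r; have /ler_normlP[] := hM x; rewrite lerNl.
Qed.

End transfer.

Section move.
Variable R : realType.
Local Notation R3 := (R * R * R)%type.

Definition mv (x : R3) (v : R) (e : R3) : R3 :=
  (x.1.1 + v * e.1.1, x.1.2 + v * e.1.2, x.2 + v * e.2).

Lemma measurable_R3 d (T : measurableType d) (f g h : T -> R) :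
  measurable_fun setT f -> measurable_fun setT g -> measurable_fun setT h ->
  measurable_fun setT (fun x => (f x, g x, h x)).
Proof. by move=> mf mg mh; do 2 (apply: measurable_fun_pair => //). Qed.

Lemma measurable_R3_1 : measurable_fun setT (fun x : R3 => x.1.1).
Proof. exact: measurableT_comp. Qed.
Lemma measurable_R3_2 : measurable_fun setT (fun x : R3 => x.1.2).
Proof. exact: measurableT_comp. Qed.

Lemma measurable_mv d (T : measurableType d) (f : T -> R3) (v : T -> R) (e : T -> R3) :
  measurable_fun setT f -> measurable_fun setT v -> measurable_fun setT e ->
  measurable_fun setT (fun x => mv (f x) (v x) (e x)).
Proof.
move=> mf mv_ me.
have f1 := measurableT_comp measurable_R3_1 mf.
have f2 := measurableT_comp measurable_R3_2 mf.
have f3 : measurable_fun setT (fun x => (f x).2) by exact: measurableT_comp.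
have e1 := measurableT_comp measurable_R3_1 me.
have e2 := measurableT_comp measurable_R3_2 me.
have e3 : measurable_fun setT (fun x => (e x).2) by exact: measurableT_comp.
apply: measurable_R3; apply: measurable_funD => //; exact: measurable_funM.
Qed.

End move.

(** * The heat semigroup on nonnegative functions *)

Section heat_e.
Variables (R : realType) (N : probability R R).
Hypothesis gN : gaussian N.
Local Notation R3 := (R * R * R)%type.
Local Notation N3 := (prob3 N).
Implicit Types (F : R3 -> \bar R).

(** Rotate the plane by the angle of cosine [b / c] and sine [a / c]: the second coordinate becomes
    [(a x + b y) / c]. The case [c = 0] forces [a = b = 0]. *)
Lemma ge0_gaussian_law (a b c : R) (F : R -> \bar R) :
  a ^+ 2 + b ^+ 2 = c ^+ 2 -> measurable_fun setT F -> (forall x, (0 <= F x)%E) ->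
  (\int[N]_y \int[N]_x F (a * x + b * y)%R = \int[N]_x F (c * x)%R)%E.
Proof.
have N1 (e : \bar R) : (\int[N]__ e = e)%E.
  by rewrite integral_cst// [X in (_ * X)%E]probability_setT mule1.
move=> abc mF F0.
have [c0|c0] := eqVneq c 0.
  have /eqP : a ^+ 2 + b ^+ 2 = 0 by rewrite abc c0 expr0n.
  rewrite paddr_eq0 ?sqr_ge0// !sqrf_eq0 => /andP[/eqP -> /eqP ->].
  rewrite c0; under eq_integral do under eq_integral do rewrite !mul0r addr0.
  under [RHS]eq_integral do rewrite mul0r.
  by rewrite !N1.
pose G (z : R * R) := F (c * z.2).
have mG : measurable_fun setT G.
  by apply: measurableT_comp => //; exact: measurable_funM.
have ab1 : (b / c) ^+ 2 + (a / c) ^+ 2 = 1.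
  by rewrite !expr_div_n -mulrDl addrC abc divff// expf_neq0.
have := gaussian_rotation gN ab1 mG (fun z => F0 _).
rewrite [RHS](_ : _ = (\int[N]_y F (c * y)%R)%E) => [<-|].
  apply: eq_integral => y _; apply: eq_integral => x _; congr F.
  by rewrite /=; field.
by apply: eq_integral => y _; rewrite -[RHS](N1 (F (c * y))).
Qed.

Lemma gaussian_sym (F : R -> \bar R) : measurable_fun setT F -> (forall x, (0 <= F x)%E) ->
  (\int[N]_x F (- x)%R = \int[N]_x F x)%E.
Proof.
move=> mF F0.
have := @ge0_gaussian_law (-1) 0 1 F _ mF F0.
rewrite expr0n addr0 sqrrN expr1n => /(_ erefl).
under [RHS]eq_integral do rewrite mul1r.
move=> <-.
under [RHS]eq_integral do under eq_integral do rewrite mul0r addr0 mulN1r.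
by rewrite integral_cst// [X in (_ * X)%E]probability_setT mule1.
Qed.

Definition op (e : R3) (c : R) F (x : R3) : \bar R := (\int[N]_u F (mv x (c * u) e))%E.

Lemma op_ge0 e c F : (forall x, (0 <= F x)%E) -> forall x, (0 <= op e c F x)%E.
Proof. by move=> F0 x; apply: integral_ge0. Qed.

Lemma measurable_op e c F : (forall x, (0 <= F x)%E) ->
  measurable_fun setT F -> measurable_fun setT (op e c F).
Proof.
move=> F0 mF.
pose G (z : R3 * R) := F (mv z.1 (c * z.2) e).
have mG : measurable_fun setT G.
  by apply: measurableT_comp => //; apply: measurable_mv => //; exact: measurable_funM.
exact: (@measurable_fun_fubini_tonelli_F _ _ _ _ _ N G mG (fun z => F0 _)).
Qed.

Lemma opC e e' a b F : (forall x, (0 <= F x)%E) -> measurable_fun setT F ->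
  op e a (op e' b F) = op e' b (op e a F).
Proof.
move=> F0 mF; apply/funext => x; rewrite /op.
pose G (z : R * R) := F (mv (mv x (a * z.1) e) (b * z.2) e').
have mG : measurable_fun setT G.
  by apply: measurableT_comp => //; do 2 (apply: measurable_mv => //; last exact: measurable_funM).
transitivity (\int[N]_u \int[N]_v G (u, v))%E; first by [].
transitivity (\int[N]_v \int[N]_u G (u, v))%E.
  exact: (@fubini_tonelli _ _ _ _ _ N N G mG (fun z => F0 _)).
apply: eq_integral => v _; apply: eq_integral => u _; rewrite /G; congr F.
by rewrite /mv/=; congr (_, _, _); ring.
Qed.

Lemma op_semigroup e a b c F : (forall x, (0 <= F x)%E) -> measurable_fun setT F ->
  a ^+ 2 + b ^+ 2 = c ^+ 2 -> op e a (op e b F) = op e c F.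
Proof.
move=> F0 mF abc; apply/funext => x; rewrite /op.
have abc' : b ^+ 2 + a ^+ 2 = c ^+ 2 by rewrite addrC.
pose G u := F (mv x u e).
have mG : measurable_fun setT G.
  by apply: measurableT_comp => //; exact: measurable_mv.
rewrite -[RHS](ge0_gaussian_law abc' mG (fun u => F0 _)).
apply: eq_integral => u _; apply: eq_integral => v _; rewrite /G; congr F.
by rewrite /mv/=; congr (_, _, _); ring.
Qed.

Definition hsE (c : R) F (x : R3) : \bar R := (\int[N3]_xi F (mv x c xi))%E.

Lemma N3E F : (forall x, (0 <= F x)%E) -> measurable_fun setT F ->
  (\int[N3]_xi F xi = \int[N]_s \int[N]_b \int[N]_a F (a, b, s))%E.
Proof.
move=> F0 mF.
transitivity (\int[N]_s fubini_G (prob2 N) F s)%E.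
  by rewrite /prob3; exact: (@fubini_tonelli2 _ _ _ _ _ (prob2 N) N F mF F0).
apply: eq_integral => s _.
pose G (z : R * R) := F (z, s).
have mG : measurable_fun setT G.
  by apply: measurableT_comp => //; exact: measurable_fun_pair.
by rewrite /fubini_G /prob2; exact: (@fubini_tonelli2 _ _ _ _ _ N N G mG (fun z => F0 _)).
Qed.

Let e1 : R3 := (1, 0, 0).
Let e2 : R3 := (0, 1, 0).
Let e3 : R3 := (0, 0, 1).

Lemma hsE_op c F : (forall x, (0 <= F x)%E) -> measurable_fun setT F ->
  hsE c F = op e3 c (op e2 c (op e1 c F)).
Proof.
move=> F0 mF; apply/funext => x; rewrite /hsE.
pose G xi := F (mv x c xi).
have mG : measurable_fun setT G.
  by apply: measurableT_comp => //; exact: measurable_mv.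
transitivity (\int[N]_s \int[N]_b \int[N]_a G (a, b, s))%E.
  exact: (N3E (fun z => F0 _) mG).
apply: eq_integral => s _; apply: eq_integral => b _; apply: eq_integral => a _.
by congr F; rewrite /mv/=; congr (_, _, _); ring.
Qed.

(** [hsE] is the product of the averages [op] along the three axes. Averages along different axes
    commute and those along the same axis compose by [op_semigroup], so the six factors regroup into
    three pairs. *)
Lemma hsE_semigroup a b c F : (forall x, (0 <= F x)%E) -> measurable_fun setT F ->
  a ^+ 2 + b ^+ 2 = c ^+ 2 -> hsE a (hsE b F) = hsE c F.
Proof.
move=> F0 mF abc.
have o0 e d G : (forall x, (0 <= G x)%E) -> forall x, (0 <= op e d G x)%E by exact: op_ge0.
have mo e d G : (forall x, (0 <= G x)%E) -> measurable_fun setT G ->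
  measurable_fun setT (op e d G) by exact: measurable_op.
have p1 e := o0 e b F F0; have m1 e := mo e b F F0 mF.
have q1 e := o0 e a F F0; have n1 e := mo e a F F0 mF.
have r1 e := o0 e c F F0; have s1 e := mo e c F F0 mF.
rewrite (hsE_op b F0 mF).
have p2 := o0 e2 b _ (p1 e1); have m2 := mo e2 b _ (p1 e1) (m1 e1).
have p3 := o0 e3 b _ p2; have m3 := mo e3 b _ p2 m2.
rewrite (hsE_op a p3 m3).
rewrite (opC e1 e3 a b p2 m2).
have p4 := o0 e1 a _ p2; have m4 := mo e1 a _ p2 m2.
rewrite (opC e2 e3 a b p4 m4).
have p5 := o0 e2 a _ p4; have m5 := mo e2 a _ p4 m4.
rewrite (op_semigroup e3 p5 m5 abc).
rewrite (opC e1 e2 a b (p1 e1) (m1 e1)).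
have p6 := o0 e1 a _ (p1 e1); have m6 := mo e1 a _ (p1 e1) (m1 e1).
rewrite (op_semigroup e2 p6 m6 abc) (op_semigroup e1 F0 mF abc).
by rewrite (hsE_op c F0 mF).
Qed.

Lemma N3_rotation (a b : R) F : a ^+ 2 + b ^+ 2 = 1 ->
  (forall x, (0 <= F x)%E) -> measurable_fun setT F ->
  (\int[N3]_xi F (a * xi.1.1 - b * xi.1.2, b * xi.1.1 + a * xi.1.2, xi.2)%R =
   \int[N3]_xi F xi)%E.
Proof.
move=> ab F0 mF.
pose G (xi : R3) := F (a * xi.1.1 - b * xi.1.2, b * xi.1.1 + a * xi.1.2, xi.2).
have mG : measurable_fun setT G.
  apply: measurableT_comp => //; apply: measurable_R3 => //.
  - by apply: measurable_funB; apply: measurable_funM => //; [exact: measurable_R3_1|exact: measurable_R3_2].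
  - by apply: measurable_funD; apply: measurable_funM => //; [exact: measurable_R3_1|exact: measurable_R3_2].
rewrite [RHS](N3E F0 mF).
transitivity (\int[N]_s \int[N]_b \int[N]_a G (a, b, s))%E.
  exact: (N3E (fun z => F0 _) mG).
apply: eq_integral => s _ /=.
pose H (z : R * R) := F (z, s).
have mH : measurable_fun setT H.
  by apply: measurableT_comp => //; exact: measurable_fun_pair.
exact: (gaussian_rotation gN ab mH (fun z => F0 _)).
Qed.

Lemma N3_flip F : (forall x, (0 <= F x)%E) -> measurable_fun setT F ->
  (\int[N3]_xi F (xi.1.1, - xi.1.2, - xi.2)%R = \int[N3]_xi F xi)%E.
Proof.
move=> F0 mF.
pose G (xi : R3) := F (xi.1.1, - xi.1.2, - xi.2).
have mN d (T : measurableType d) (f : T -> R) : measurable_fun setT f ->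
    measurable_fun setT (fun x => - f x).
  by move=> mf; apply: (measurableT_comp (measurable_funN (@measurable_id _ R setT)) mf).
have mG : measurable_fun setT G.
  apply: measurableT_comp => //; apply: measurable_R3 => //.
  - exact: measurable_R3_1.
  - by apply: mN; exact: measurable_R3_2.
  - exact: mN.
rewrite [RHS](N3E F0 mF).
transitivity (\int[N]_s \int[N]_b \int[N]_a G (a, b, s))%E.
  exact: (N3E (fun z => F0 _) mG).
pose F' (z : R * R * R) := F (z.2, z.1.1, z.1.2).
have mF' : measurable_fun setT F'.
  apply: measurableT_comp => //; apply: measurable_R3 => //.
  - exact: measurable_R3_1.
  - exact: measurable_R3_2.
pose F2 (z : R * R) := (\int[N]_a F (a, z.1, z.2))%E.
have mF2 : measurable_fun setT F2.
  exact: (@measurable_fun_fubini_tonelli_F _ _ _ _ _ N F' mF' (fun z => F0 _)).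
have F20 z : (0 <= F2 z)%E by apply: integral_ge0.
pose F3 (s : R) := (\int[N]_b \int[N]_a F (a, b, s))%E.
have mF3 : measurable_fun setT F3.
  exact: (@measurable_fun_fubini_tonelli_G _ _ _ _ _ N F2 mF2 F20).
have F30 s : (0 <= F3 s)%E by apply: integral_ge0 => b _; exact: integral_ge0.
rewrite -[RHS](gaussian_sym mF3 F30).
apply: eq_integral => s _ /=.
pose F4 b := F2 (b, - s).
have mF4 : measurable_fun setT F4.
  by apply: (measurableT_comp mF2) => //; exact: measurable_fun_pair.
exact: (gaussian_sym mF4 (fun b => F20 _)).
Qed.

End heat_e.

Section Rparam.
Context d1 d2 (T1 : measurableType d1) (T2 : measurableType d2) (R : realType).
Variables (P : probability T2 R) (f : T1 * T2 -> R) (M : R).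

(** The measurability part of Fubini asks for a finite measure on the space of parameters; the Dirac
    mass at [x0] serves. *)
Lemma measurable_Rint_param (x0 : T1) :
  measurable_fun setT f -> (forall z, `|f z| <= M) ->
  measurable_fun setT (fun x => \int[P]_y f (x, y)).
Proof.
move=> mf fM.
apply: (@measurable_Rfubini_dom1 _ _ _ _ _ (\d_x0 : probability T1 R) P f (cst M)) => //.
exact: finite_measure_integrable_cst.
Qed.

End Rparam.

Lemma cvg_pair2 (T1 T2 : topologicalType) (f : nat -> T1) (g : nat -> T2) (a : T1) (b : T2) :
  f n @[n --> \oo] --> a -> g n @[n --> \oo] --> b ->
  (f n, g n) @[n --> \oo] --> (a, b).
Proof. by move=> fa gb; exact: (cvg_pair fa gb). Qed.

(** * The heat semigroup on bounded functions *)

Section heat.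
Variables (R : realType) (N : probability R R).
Hypothesis gN : gaussian N.
Local Notation R3 := (R * R * R)%type.
Local Notation N3 := (prob3 N).
Implicit Types (h : R3 -> R).

(** The heat flow at time [c ^+ 2 / 2], parametrised by the standard deviation [c], in which the
    semigroup law is Pythagorean. *)
Definition hs (c : R) h (x : R3) : R := \int[N3]_xi h (mv x c xi).

Section one.
Variables (h : R3 -> R) (M : R).
Hypotheses (mh : measurable_fun setT h) (hM : forall x, `|h x| <= M).

Lemma measurable_mv1 x c : measurable_fun setT (fun xi => h (mv x c xi)).
Proof. by apply: measurableT_comp => //; exact: measurable_mv. Qed.

Lemma integrable_hs x c : N3.-integrable setT (fun xi => (h (mv x c xi))%:E).
Proof. exact: (bounded_integrable _ (measurable_mv1 x c) (fun xi => hM _)). Qed.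

Lemma hs_bound c x : `|hs c h x| <= M.
Proof. exact: (norm_Rintegral_le _ (measurable_mv1 x c) (fun xi => hM _)). Qed.

Lemma measurable_hs_param d (T : measurableType d) (x0 : T) (c : T -> R) (f : T -> R3) :
  measurable_fun setT c -> measurable_fun setT f ->
  measurable_fun setT (fun z => hs (c z) h (f z)).
Proof.
move=> mc mf.
apply: (@measurable_Rint_param _ _ _ _ _ N3 (fun z => h (mv (f z.1) (c z.1) z.2)) M x0) => //.
apply: measurableT_comp => //; apply: measurable_mv => //; exact: measurableT_comp.
Qed.

Lemma measurable_hs c : measurable_fun setT (hs c h).
Proof. exact: (@measurable_hs_param _ _ ((0, 0, 0) : R3) (fun=> c) id). Qed.

Lemma hs_hsE c x : (hs c h x + M)%:E = hsE N c (fun z => (h z + M)%:E) x.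
Proof.
by rewrite /hsE (integral_shift_bounded _ (measurable_mv1 x c) (fun xi => hM _)).
Qed.

Lemma hs_rotation (a b c d : R) x : a ^+ 2 + b ^+ 2 = 1 ->
  hs c (fun z => h (a * z.1.1 - b * z.1.2, b * z.1.1 + a * z.1.2, z.2 + d)) x =
  hs c h (a * x.1.1 - b * x.1.2, b * x.1.1 + a * x.1.2, x.2 + d).
Proof.
move=> ab; set y := (a * x.1.1 - b * x.1.2, b * x.1.1 + a * x.1.2, x.2 + d).
pose G xi := h (mv y c xi).
have mG : measurable_fun setT G := measurable_mv1 y c.
have GM xi : `|G xi| <= M by exact: hM.
pose r (xi : R3) : R3 := (a * xi.1.1 - b * xi.1.2, b * xi.1.1 + a * xi.1.2, xi.2).
have mr : measurable_fun setT r.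
  apply: measurable_R3 => //.
  - by apply: measurable_funB; apply: measurable_funM => //; [exact: measurable_R3_1|exact: measurable_R3_2].
  - by apply: measurable_funD; apply: measurable_funM => //; [exact: measurable_R3_1|exact: measurable_R3_2].
have -> : hs c (fun z => h (a * z.1.1 - b * z.1.2, b * z.1.1 + a * z.1.2, z.2 + d)) x =
    \int[N3]_xi G (r xi).
  apply: eq_Rintegral => xi _; rewrite /G /r /mv/=; congr (h (_, _, _)); ring.
have mGr : measurable_fun setT (fun xi => G (r xi)) := measurableT_comp mG mr.
have : (\int[N3]_xi G (r xi) + M)%:E = (\int[N3]_xi G xi + M)%:E.
  rewrite -(integral_shift_bounded _ mGr (fun xi => hM _)) -(integral_shift_bounded _ mG GM).
  apply: (N3_rotation gN ab (F := fun xi => (G xi + M)%:E)).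
  - exact: (shift_ge0 GM).
  - by apply/measurable_EFinP; apply: measurable_funD.
by case; exact: addIr.
Qed.

Lemma hs_flip c x :
  hs c (fun z => h (z.1.1, - z.1.2, - z.2)) x = hs c h (x.1.1, - x.1.2, - x.2).
Proof.
set y := (x.1.1, - x.1.2, - x.2).
pose G xi := h (mv y c xi).
have mG : measurable_fun setT G := measurable_mv1 y c.
have GM xi : `|G xi| <= M by exact: hM.
pose r (xi : R3) : R3 := (xi.1.1, - xi.1.2, - xi.2).
have mN d (T : measurableType d) (f : T -> R) : measurable_fun setT f ->
    measurable_fun setT (fun x => - f x).
  by move=> mf; apply: (measurableT_comp (measurable_funN (@measurable_id _ R setT)) mf).
have mr : measurable_fun setT r.
  apply: measurable_R3 => //.
  - exact: measurable_R3_1.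
  - by apply: mN; exact: measurable_R3_2.
  - exact: mN.
have -> : hs c (fun z => h (z.1.1, - z.1.2, - z.2)) x = \int[N3]_xi G (r xi).
  apply: eq_Rintegral => xi _; rewrite /G /r /mv/=; congr (h (_, _, _)); ring.
have mGr : measurable_fun setT (fun xi => G (r xi)) := measurableT_comp mG mr.
have : (\int[N3]_xi G (r xi) + M)%:E = (\int[N3]_xi G xi + M)%:E.
  rewrite -(integral_shift_bounded _ mGr (fun xi => hM _)) -(integral_shift_bounded _ mG GM).
  apply: (N3_flip gN (F := fun xi => (G xi + M)%:E)).
  - exact: (shift_ge0 GM).
  - by apply/measurable_EFinP; apply: measurable_funD.
by case; exact: addIr.
Qed.

End one.

Lemma hs_semigroup h M a b c : measurable_fun setT h -> (forall x, `|h x| <= M) ->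
  a ^+ 2 + b ^+ 2 = c ^+ 2 -> forall x, hs a (hs b h) x = hs c h x.
Proof.
move=> mh hM abc x.
pose F z := (h z + M)%:E.
have mF : measurable_fun setT F by apply/measurable_EFinP; exact: measurable_funD.
have : (hs a (hs b h) x + M)%:E = (hs c h x + M)%:E.
  rewrite (hs_hsE (measurable_hs mh hM b) (hs_bound mh hM b)).
  rewrite (hs_hsE mh hM) -(hsE_semigroup gN (shift_ge0 hM) mF abc).
  by congr (hsE N a _ x); apply/funext => z; rewrite (hs_hsE mh hM).
by case; exact: addIr.
Qed.

(** Joint in the scale and the point, and valid at [c = 0] where [hs] is the identity. It gives
    continuity in time, initial values, and continuity of the extension up to the boundary. *)
Lemma hs_cvg h M (cn : nat -> R) (xn : nat -> R3) c x :
  measurable_fun setT h -> (forall x, `|h x| <= M) -> continuous h ->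
  cn n @[n --> \oo] --> c -> xn n @[n --> \oo] --> x ->
  hs (cn n) h (xn n) @[n --> \oo] --> hs c h x.
Proof.
move=> mh hM ch cc xx.
apply: (@bounded_cvg_Rintegral _ _ _ _ _ _ M).
- by move=> n; exact: (measurable_mv1 mh).
- by move=> n xi; exact: hM.
move=> xi; apply: continuous_cvg; first exact: ch.
have x1 : (xn n).1 @[n --> \oo] --> x.1 by apply: (cvg_comp _ _ xx); exact: cvg_fst.
apply: cvg_pair2 => /=; first apply: cvg_pair2 => /=.
- apply: cvgD; last by apply: cvgM => //; exact: cvg_cst.
  by apply: (cvg_comp _ _ x1); exact: cvg_fst.
- apply: cvgD; last by apply: cvgM => //; exact: cvg_cst.
  by apply: (cvg_comp _ _ x1); exact: cvg_snd.
- apply: cvgD; last by apply: cvgM => //; exact: cvg_cst.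
  by apply: (cvg_comp _ _ xx); exact: cvg_snd.
Qed.

Lemma hs_cst c k x : hs c (cst k) x = k.
Proof. by rewrite /hs Rintegral_cst1. Qed.

Lemma hs_lin h1 h2 M1 M2 c k x : measurable_fun setT h1 -> measurable_fun setT h2 ->
  (forall x, `|h1 x| <= M1) -> (forall x, `|h2 x| <= M2) ->
  hs c (fun z => h1 z + k * h2 z) x = hs c h1 x + k * hs c h2 x.
Proof.
move=> m1 m2 b1 b2; have i1 := integrable_hs m1 b1 x c; have i2 := integrable_hs m2 b2 x c.
rewrite /hs RintegralD//; first by rewrite RintegralZl.
exact: (integrableZl _ k i2).
Qed.

Lemma hs0 h x : hs 0 h x = h x.
Proof.
rewrite /hs -[RHS](@Rintegral_cst1 _ _ _ N3); apply: eq_Rintegral => xi _.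
by rewrite /mv !mul0r !addr0; case: x => [[]].
Qed.

End heat.

(** * Moments and characteristic function of the normal law *)

Section gauss1.
Variables (R : realType) (N : probability R R).
Hypothesis gN : gaussian N.
Local Notation R3 := (R * R * R)%type.
Local Notation N3 := (prob3 N).

(** The symmetry of the law exchanges the integrals of the positive and negative parts of [f]. If
    both are infinite, their difference is an infinity, of which [fine] is 0. *)
Lemma gaussian_odd (f : R -> R) : measurable_fun setT f -> (forall x, f (- x) = - f x) ->
  \int[N]_x f x = 0.
Proof.
move=> mf fodd; rewrite /Rintegral integralE.
have mfE : measurable_fun setT (EFin \o f) by exact/measurable_EFinP.
rewrite -(gaussian_sym gN (measurable_funepos mfE) (fun x => funepos_ge0 _ x)).
rewrite [X in fine (X - _)%E](_ : _ = (\int[N]_x (EFin \o f)^\- x)%E).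
  by case: (\int[N]_x _)%E => [r| |]//=; rewrite subrr.
apply: eq_integral => x _.
by rewrite funeposE funenegE /= fodd.
Qed.

Lemma Rintegral_density (a c : R) (f : R -> R) : 0 < c -> measurable_fun setT f ->
  \int[N]_x f (a + c * x) = \int[N]_x (f x * gratio c a x).
Proof.
move=> c0 mf; rewrite /Rintegral; congr fine.
have mfE : measurable_fun setT (EFin \o f) by exact/measurable_EFinP.
rewrite [RHS]integralE (integralE _ _ (fun x => (f (a + c * x))%:E)); congr (_ - _)%E.
- transitivity (\int[N]_x ((EFin \o f)^\+ (a + c * x)%R))%E.
    by apply: eq_integral => x _; rewrite !funeposE.
  rewrite [LHS](gaussian_density gN a c0 (measurable_funepos mfE) (fun x => funepos_ge0 _ x)).
  apply: eq_integral => x _; rewrite !funeposE/= -!EFin_max -EFinM.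
  by rewrite maxr_pMl ?mul0r// ltW// gratio_gt0.
- transitivity (\int[N]_x ((EFin \o f)^\- (a + c * x)%R))%E.
    by apply: eq_integral => x _; rewrite !funenegE.
  rewrite [LHS](gaussian_density gN a c0 (measurable_funeneg mfE) (fun x => funeneg_ge0 _ x)).
  apply: eq_integral => x _; rewrite !funenegE/= -!EFin_max -EFinM.
  by rewrite maxr_pMl ?mul0r ?mulNr// ltW// gratio_gt0.
Qed.

Lemma gratio_mass c a : 0 < c -> (\int[N]_x (gratio c a x)%:E = 1)%E.
Proof.
move=> c0; have := gaussian_density gN a c0 (measurable_cst (1%:E : \bar R)) (fun=> lee01).
rewrite integral_cst// [X in (_ * X)%E](@probability_setT _ _ _ N) mule1 => ->.
by apply: eq_integral => x _; rewrite mul1e.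
Qed.

(** Completing the square: the factor on the left tilts the standard normal law into the normal law
    of mean [- 2 d a c / D] and variance [1 / D]. *)
Lemma expR_sqr_gratio (d a c x : R) : 0 < 1 + 2 * d * c ^+ 2 ->
  let D := 1 + 2 * d * c ^+ 2 in
  expR (- d * (a + c * x) ^+ 2) =
  (Num.sqrt D)^-1 * expR (- d * a ^+ 2 / D) * gratio (Num.sqrt D)^-1 (- 2 * d * a * c / D) x.
Proof.
move=> D0 D; have sD : 0 < Num.sqrt D by rewrite sqrtr_gt0.
rewrite /gratio invrK mulrACA mulVf ?gt_eqF// mul1r -expRD; congr expR.
rewrite exprVn sqr_sqrtr ?(ltW D0)//.
rewrite /D; field; rewrite gt_eqF//.
Qed.

Lemma integral_expR_sqr (d a c : R) : 0 < 1 + 2 * d * c ^+ 2 ->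
  let D := 1 + 2 * d * c ^+ 2 in
  (\int[N]_x (expR (- d * (a + c * x) ^+ 2))%:E =
   ((Num.sqrt D)^-1 * expR (- d * a ^+ 2 / D))%:E)%E.
Proof.
move=> D0 D; have sD : 0 < (Num.sqrt D)^-1 by rewrite invr_gt0 sqrtr_gt0.
under eq_integral do rewrite (expR_sqr_gratio a _ D0) EFinM.
rewrite ge0_integralZl//.
- by rewrite gratio_mass// mule1.
- by apply/measurable_EFinP; exact: measurable_gratio.
- by move=> x _; rewrite lee_fin ltW// gratio_gt0.
Qed.

Lemma measurable_expR_sqr (d a c : R) : measurable_fun setT (fun x : R => expR (- d * (a + c * x) ^+ 2)).
Proof.
apply: (measurableT_comp (@measurable_expR R)); apply: measurable_funM => //.
by apply: measurable_funX; apply: measurable_funD => //; exact: measurable_funM.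
Qed.

Lemma Rintegral_expR_sqr (d a c : R) : 0 < 1 + 2 * d * c ^+ 2 ->
  let D := 1 + 2 * d * c ^+ 2 in
  \int[N]_x expR (- d * (a + c * x) ^+ 2) = (Num.sqrt D)^-1 * expR (- d * a ^+ 2 / D).
Proof. by move=> D0 D; rewrite /Rintegral integral_expR_sqr. Qed.

(** The quadratic term of the exponential at [x ^+ 2 / 4]. The right side has a finite Gaussian
    integral by [integral_expR_sqr] with [d = - 1 / 4], which bounds the fourth moment. *)
Lemma le_exp4 (x : R) : x ^+ 4 <= 32 * expR (x ^+ 2 / 4).
Proof.
have y0 : 0 <= x ^+ 2 / 4 by rewrite divr_ge0// sqr_ge0.
have := expR_ge1Dxn 1 y0.
rewrite (_ : 2`!%:R = 2 :> R)// => h.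
have -> : x ^+ 4 = 32 * ((x ^+ 2 / 4) ^+ 2 / 2) by field.
rewrite ler_wpM2l//; apply: le_trans h; by rewrite lerDr.
Qed.

Lemma moment4 : (\int[N]_x (x ^+ 4)%:E < +oo)%E.
Proof.
have D0 : 0 < 1 + 2 * (- (1 / 4)) * 1 ^+ 2 :> R by lra.
apply: (@le_lt_trans _ _ (\int[N]_x (32 * expR (- (- (1 / 4)) * (0 + 1 * x) ^+ 2))%:E)%E).
  apply: ge0_le_integral => //.
  - by move=> x _; rewrite lee_fin exprn_even_ge0.
  - by apply/measurable_EFinP; exact: measurable_funX.
  - by apply/measurable_EFinP; apply: measurable_funM => //; exact: measurable_expR_sqr.
  - move=> x _; rewrite lee_fin add0r mul1r opprK.
    by rewrite (_ : 4^-1 * (1 * x) ^+ 2 = x ^+ 2 / 4) ?le_exp4//; field.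
under eq_integral do rewrite EFinM.
rewrite ge0_integralZl//; last first.
  by apply/measurable_EFinP; exact: measurable_expR_sqr.
by rewrite (integral_expR_sqr 0 D0) -EFinM ltry.
Qed.

(** Regularise by [expR (- d x ^+ 2)]. Since [(1 + z) expR (- z) <= 1], the integral of
    [d x ^+ 2 expR (- d x ^+ 2)] is at most [1 - 1 / sqrt (1 + 2 d)], which is at most [d] because
    [(1 - d)^2 (1 + 2 d) <= 1]. Then [d = 1 / (n + 1)] tends to 0. *)
Lemma moment2_le1 : (\int[N]_x (x ^+ 2)%:E <= 1)%E.
Proof.
pose f (n : nat) (x : R) := (x ^+ 2 * expR (- n.+1%:R^-1 * (0 + 1 * x) ^+ 2)).
have mf n : measurable_fun setT (f n).
  by apply: measurable_funM; [exact: measurable_funX|exact: measurable_expR_sqr].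
have fb n : (\int[N]_x (f n x)%:E <= 1)%E.
  set d : R := n.+1%:R^-1.
  have d0 : 0 < d by rewrite invr_gt0.
  have d1 : d <= 1 by rewrite invf_le1 ?ler1n.
  have D0 : 0 < 1 + 2 * d * 1 ^+ 2 by rewrite expr1n mulr1 addr_gt0// mulr_gt0.
  apply: (@le_trans _ _ (\int[N]_x (d^-1 * (1 - expR (- d * (0 + 1 * x) ^+ 2)))%:E)%E).
    apply: ge0_le_integral => //.
    - by move=> x _; rewrite lee_fin mulr_ge0 ?sqr_ge0 ?expR_ge0.
    - exact/measurable_EFinP.
    - apply/measurable_EFinP; apply: measurable_funM => //; apply: measurable_funB => //.
      exact: measurable_expR_sqr.
    - move=> x _; rewrite lee_fin /f -/d add0r mul1r ler_pdivlMl//.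
      have h : (1 + d * x ^+ 2) * expR (- d * x ^+ 2) <= 1.
        by rewrite mulNr expRN ler_pdivrMr ?expR_gt0// mul1r expR_ge1Dx.
      by move: h; rewrite mulrDl mul1r -mulrA lerBrDl.
  rewrite (_ : (\int[N]_x _ = (d^-1 * (1 - (Num.sqrt (1 + 2 * d * 1 ^+ 2))^-1))%:E)%E); last first.
    have i1 : N.-integrable setT (EFin \o (fun x => expR (- d * (0 + 1 * x) ^+ 2))).
      apply: (@bounded_integrable _ _ _ N _ 1); first exact: measurable_expR_sqr.
      by move=> x; rewrite ger0_norm ?expR_ge0// -expR0 ler_expR mulNr oppr_le0 mulr_ge0 ?sqr_ge0 ?ltW.
    under eq_integral do rewrite EFinM EFinB.
    rewrite integralZl//; last first.
      by apply: integrableB => //; exact: finite_measure_integrable_cst.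
    rewrite integralB_EFin//; last exact: finite_measure_integrable_cst.
    rewrite integral_cst// [X in (_ * (_ * X - _))%E](@probability_setT _ _ _ N) mule1.
    by rewrite (integral_expR_sqr 0 D0) expr0n mulr0 mul0r expR0 mulr1 -EFinB -EFinM.
  rewrite lee_fin ler_pdivrMl// mulr1 lerBlDr -lerBlDl.
  rewrite -[X in _ <= X]div1r ler_pdivlMr ?sqrtr_gt0// expr1n mulr1.
  have s0 : 0 <= 1 - d by rewrite subr_ge0.
  rewrite -(@ler_pXn2r _ 2)// ?nnegrE ?mulr_ge0 ?sqrtr_ge0// exprMn sqr_sqrtr; last first.
    by rewrite addr_ge0// mulr_ge0// ltW.
  rewrite expr1n -subr_ge0.
  have -> : 1 - (1 - d) ^+ 2 * (1 + 2 * d) = d ^+ 2 * (3 - 2 * d) by ring.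
  by rewrite mulr_ge0 ?sqr_ge0//; lra.
have lim x : (f n x)%:E @[n --> \oo] --> (x ^+ 2)%:E.
  apply: cvg_EFin; first exact: nearW.
  rewrite -[X in _ --> X]mulr1; apply: cvgM; first exact: cvg_cst.
  rewrite -[X in _ --> X]expR0; apply: continuous_cvg; first exact: continuous_expR.
  rewrite -[X in _ --> X](_ : - 0 * (0 + 1 * x) ^+ 2 = 0); last by rewrite oppr0 mul0r.
  apply: cvgM; last exact: cvg_cst.
  by apply: cvgN; exact: cvg_harmonic.
have e : (\int[N]_x (x ^+ 2)%:E = \int[N]_x (limn (fun n => (f n x)%:E)))%E.
  by apply: eq_integral => x _; apply/esym/cvg_lim => //; exact: lim.
rewrite e.
have C : ((\int[N]_x (f n x)%:E)%E @[n --> \oo] --> (\int[N]_x (limn (fun n => (f n x)%:E)))%E).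
  apply: cvg_monotone_convergence => //.
  - by move=> n; exact/measurable_EFinP.
  - by move=> n x _; rewrite lee_fin mulr_ge0 ?sqr_ge0 ?expR_ge0.
  - move=> x _ m n mn; rewrite lee_fin ler_wpM2l ?sqr_ge0// ler_expR ler_wpM2r ?sqr_ge0//.
    by rewrite lerN2 lef_pV2 ?posrE// ler_nat.
rewrite -(cvg_lim _ C)//; apply: lime_le; first by apply/cvg_ex; eexists; exact: C.
by apply: nearW => n; exact: fb.
Qed.

Lemma integrable_sqr : N.-integrable setT (EFin \o (fun x : R => x ^+ 2)).
Proof.
apply/integrableP; split; first by apply/measurable_EFinP; exact: measurable_funX.
rewrite (eq_integral (fun x : R => (x ^+ 2)%:E)); last first.
  by move=> x _ /=; rewrite ger0_norm ?sqr_ge0.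
by rewrite (le_lt_trans moment2_le1)// ltry.
Qed.

Lemma Rintegral_sqr_le1 : \int[N]_x (x ^+ 2) <= 1.
Proof.
rewrite /Rintegral -lee_fin fineK ?moment2_le1//.
exact: (integrable_fin_num measurableT integrable_sqr).
Qed.

Lemma gaussian_law_bounded (a b c M : R) (F : R -> R) :
  a ^+ 2 + b ^+ 2 = c ^+ 2 -> measurable_fun setT F -> (forall x, `|F x| <= M) ->
  \int[N]_y \int[N]_x F (a * x + b * y) = \int[N]_x F (c * x).
Proof.
move=> abc mF FM.
have mc (e d : R) : measurable_fun setT (fun x : R => F (e * x + d)).
  by apply: measurableT_comp => //; apply: measurable_funD => //; exact: measurable_funM.
have mF2 : measurable_fun setT (fun z : R * R => F (a * z.2 + b * z.1)).
  by apply: measurableT_comp => //; apply: measurable_funD; exact: measurable_funM.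
have m1 : measurable_fun setT (fun y => \int[N]_x F (a * x + b * y)).
  by apply: (measurable_Rint_param N (0 : R) mF2 (M := M)) => z; exact: FM.
have b1 y : `|\int[N]_x F (a * x + b * y)| <= M.
  by apply: norm_Rintegral_le.
have mc' : measurable_fun setT (fun x => F (c * x)).
  by apply: measurableT_comp => //; exact: measurable_funM.
have : (\int[N]_y \int[N]_x F (a * x + b * y) + M)%:E = (\int[N]_x F (c * x) + M)%:E.
  rewrite -(integral_shift_bounded N m1 b1) -(integral_shift_bounded N mc' (fun x => FM _)).
  rewrite -(ge0_gaussian_law gN abc (F := fun x => (F x + M)%:E)).
  - by apply: eq_integral => y _; rewrite (integral_shift_bounded N (mc a (b * y)) (fun x => FM _)).
  - by apply/measurable_EFinP; exact: measurable_funD.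
  - exact: shift_ge0.
by case; exact: addIr.
Qed.

(** The characteristic function of the normal law, that is [expR (- k^2 / 2)]; the lower bound
    [gcos_ge_exp] is what the bump requires. *)
Definition gcos (k : R) := \int[N]_x cos (k * x).

Lemma measurable_cosM (k : R) : measurable_fun setT (fun x : R => cos (k * x)).
Proof.
apply: measurableT_comp; last exact: measurable_funM.
by apply: continuous_measurable_fun; exact: continuous_cos.
Qed.

Lemma measurable_sinM (k : R) : measurable_fun setT (fun x : R => sin (k * x)).
Proof.
apply: measurableT_comp; last exact: measurable_funM.
by apply: continuous_measurable_fun; exact: continuous_sin.
Qed.

Lemma norm_cos_le1 (x : R) : `|cos x| <= 1.
Proof. by rewrite ler_norml cos_geN1 cos_le1. Qed.

Lemma norm_sin_le1 (x : R) : `|sin x| <= 1.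
Proof. by rewrite ler_norml sin_geN1 sin_le1. Qed.

Lemma cos_ge_sqr (x : R) : 1 - x ^+ 2 / 2 <= cos x.
Proof.
have sle (y : R) : 0 <= y -> `|sin y| <= y.
  move=> y0.
  have [->|yn0] := eqVneq y 0; first by rewrite sin0 normr0.
  have yp : 0 < y by rewrite lt_def yn0.
  have [z _] := @MVT R sin cos 0 y yp (fun z _ => is_derive_sin z)
     (continuous_subspaceT (fun x => @continuous_sin R x)).
  rewrite sin0 !subr0 => ->; rewrite normrM (ger0_norm y0) ler_piMl//.
  exact: norm_cos_le1.
have -> : cos x = 1 - 2 * (sin (x / 2)) ^+ 2.
  rewrite {1}(_ : x = (x / 2) *+ 2); last by rewrite -mulr_natr divfK.
  by rewrite cos_mulr2n cos2sin2 -mulr_natl; ring.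
rewrite lerD2l lerN2.
have : (sin (x / 2)) ^+ 2 <= (x / 2) ^+ 2.
  rewrite -(real_normK (num_real (sin _))) -[leRHS](real_normK (num_real _)).
  rewrite ler_pXn2r// ?nnegrE//.
  have [x0|x0] := leP 0 (x / 2).
    by rewrite (ger0_norm x0) sle.
  by rewrite -normrN -sinN -[leRHS]normrN [leRHS]ger0_norm ?sle// oppr_ge0 ltW.
rewrite exprMn exprVn; lra.
Qed.

(** Expand [cos (a x + b y)], whose law is that of [cos (c x)]; the product of sines averages to 0
    by oddness. *)
Lemma gcosM a b c : a ^+ 2 + b ^+ 2 = c ^+ 2 -> gcos c = gcos a * gcos b.
Proof.
move=> abc.
have mcos1 : measurable_fun setT (@cos R).
  by apply: continuous_measurable_fun; exact: continuous_cos.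
rewrite /gcos -(gaussian_law_bounded abc mcos1 norm_cos_le1).
have ic k : N.-integrable setT (EFin \o (fun x => cos (k * x))).
  by apply: (@bounded_integrable _ _ _ N _ 1) => [|x]; [exact: measurable_cosM|exact: norm_cos_le1].
have is_ k : N.-integrable setT (EFin \o (fun x => sin (k * x))).
  by apply: (@bounded_integrable _ _ _ N _ 1) => [|x]; [exact: measurable_sinM|exact: norm_sin_le1].
have s0 k : \int[N]_x sin (k * x) = 0.
  by apply: gaussian_odd => [|x]; [exact: measurable_sinM|rewrite mulrN sinN].
rewrite mulrC -[in RHS]RintegralZr//.
apply: eq_Rintegral => y _.
transitivity (\int[N]_x (cos (a * x) * cos (b * y) - sin (a * x) * sin (b * y))).
  by apply: eq_Rintegral => x _; rewrite cosD.
rewrite RintegralB//; last 2 first.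
- exact: (integrableZr _ (cos (b * y)) (ic a)).
- exact: (integrableZr _ (sin (b * y)) (is_ a)).
by rewrite !RintegralZr// s0 mul0r subr0 mulrC.
Qed.

Lemma gcos_ge_sqr k : 1 - k ^+ 2 / 2 <= gcos k.
Proof.
have i2 := integrable_sqr.
apply: (@le_trans _ _ (\int[N]_x (1 - k ^+ 2 / 2 * x ^+ 2))).
  rewrite RintegralB//; last 2 first.
  - exact: finite_measure_integrable_cst.
  - exact: (integrableZl _ (k ^+ 2 / 2) i2).
  rewrite Rintegral_cst1 RintegralZl// lerD2l lerN2 ler_piMr//.
  - by rewrite divr_ge0// sqr_ge0.
  - exact: Rintegral_sqr_le1.
apply: le_Rintegral => //.
- exact: (integrableB measurableT (finite_measure_integrable_cst N 1 measurableT) (integrableZl measurableT (k ^+ 2 / 2) i2)).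
- by apply: (@bounded_integrable _ _ _ N _ 1) => [|x]; [exact: measurable_cosM|exact: norm_cos_le1].
- by move=> x _; rewrite mulrAC -exprMn cos_ge_sqr.
Qed.

Lemma gcos_pow k n : gcos k = gcos (k / Num.sqrt n.+1%:R) ^+ n.+1.
Proof.
have s0 m : Num.sqrt m.+1%:R != 0 :> R by rewrite gt_eqF// sqrtr_gt0.
set e := k / _.
have H m : gcos (e * Num.sqrt m.+1%:R) = gcos e ^+ m.+1.
  elim: m => [|m IH]; first by rewrite sqrtr1 mulr1 expr1.
  rewrite exprS -IH; apply: gcosM.
  by rewrite !exprMn !sqr_sqrtr// -[m.+2%:R]natr1; ring.
by rewrite -H /e divfK.
Qed.

(** Infinite divisibility: [gcos k] is the power [n + 1] of [gcos (k / sqrt (n + 1))], which is at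
    least [1 - z] with [z = k^2 / (2 (n + 1))]. Then [1 - z >= expR (- z / (1 - z))], and [n] goes
    to infinity. *)
Lemma gcos_ge_exp k : expR (- (k ^+ 2 / 2)) <= gcos k.
Proof.
set x := k ^+ 2 / 2; have x0 : 0 <= x by rewrite divr_ge0// sqr_ge0.
have step n : x < n.+1%:R -> expR (- (x / (1 - x * n.+1%:R^-1))) <= gcos k.
  move=> xn.
  set z := x * n.+1%:R^-1; have z1 : z < 1 by rewrite ltr_pdivrMr// mul1r.
  have z0 : 0 <= z by rewrite mulr_ge0.
  have z1' : 0 < 1 - z by rewrite subr_gt0.
  rewrite (gcos_pow k n).
  have h1 : 1 - z <= gcos (k / Num.sqrt n.+1%:R).
    apply: le_trans (gcos_ge_sqr _); rewrite exprMn exprVn sqr_sqrtr//.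
    by rewrite /z /x mulrAC.
  have h2 : expR (- (z / (1 - z))) <= 1 - z.
    rewrite expRN invf_ple ?posrE ?expR_gt0//.
    rewrite [leLHS](_ : _ = 1 + z / (1 - z)); last by field; rewrite gt_eqF.
    exact: expR_ge1Dx.
  apply: (@le_trans _ _ (expR (- (z / (1 - z))) ^+ n.+1)).
    rewrite -expRM_natl mulrN ler_expR lerN2 /z.
    by rewrite mulrA mulrCA divff ?mulr1// pnatr_eq0.
  by apply: lerXn2r; rewrite ?nnegrE ?expR_ge0 ?(le_trans h2 h1) ?(le_trans (expR_ge0 _) (le_trans h2 h1)).
have lim : expR (- (x / (1 - x * n.+1%:R^-1))) @[n --> \oo] --> expR (- x).
  apply: continuous_cvg; first exact: continuous_expR.
  apply: cvgN; rewrite -[X in _ --> X]mulr1; apply: cvgM; first exact: cvg_cst.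
  rewrite -[X in _ --> X]invr1; apply: cvgV; first exact: oner_neq0.
  rewrite -[X in _ --> X]subr0; apply: cvgB; first exact: cvg_cst.
  rewrite -[X in _ --> X](mulr0 x); apply: cvgM; first exact: cvg_cst.
  exact: cvg_harmonic.
apply: (cvgr_to_le lim).
near=> n; apply: step; near: n.
have /cvgryPgt := @cvgr_idn R; move=> /(_ x) H.
near=> n; apply: (@lt_le_trans _ _ n%:R); last by rewrite ler_nat.
by near: n.
Unshelve. all: by end_near. Qed.

End gauss1.

(** * Helicoidal Gaussian bumps *)

Lemma norm_le1Dsqr (R : realDomainType) (x : R) : `|x| <= 1 + x ^+ 2.
Proof.
rewrite -[x ^+ 2]real_normK ?num_real//; have := normr_ge0 x.
by move: `|x| => y y0; nra.
Qed.

Section gauss3.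
Variables (R : realType) (N : probability R R).
Hypothesis gN : gaussian N.
Local Notation R3 := (R * R * R)%type.
Local Notation N3 := (prob3 N).

Lemma Rintegral_prod3 (f1 f2 f3 : R -> R) (M1 M2 M3 : R) :
  measurable_fun setT f1 -> measurable_fun setT f2 -> measurable_fun setT f3 ->
  (forall x, `|f1 x| <= M1) -> (forall x, `|f2 x| <= M2) -> (forall x, `|f3 x| <= M3) ->
  \int[N3]_xi (f1 xi.1.1 * f2 xi.1.2 * f3 xi.2) =
  (\int[N]_x f1 x) * (\int[N]_x f2 x) * (\int[N]_x f3 x).
Proof.
move=> m1 m2 m3 b1 b2 b3.
have i1 := bounded_integrable N m1 b1.
have i2 := bounded_integrable N m2 b2.
have i3 := bounded_integrable N m3 b3.
have c1 := measurableT_comp m1 (@measurable_R3_1 R).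
have c2 := measurableT_comp m2 (@measurable_R3_2 R).
have c3 : measurable_fun setT (fun x : R3 => f3 x.2) by exact: measurableT_comp.
have d1 : measurable_fun setT (fun x : R * R => f1 x.1) by exact: measurableT_comp.
have d2 : measurable_fun setT (fun x : R * R => f2 x.2) by exact: measurableT_comp.
have M0 M (f : R -> R) : (forall x, `|f x| <= M) -> 0 <= M by move=> /(_ 0); apply: le_trans.
have m12 : measurable_fun setT (fun z : R * R => f1 z.1 * f2 z.2) by exact: measurable_funM.
have b12 (z : R * R) : `|f1 z.1 * f2 z.2| <= M1 * M2 by rewrite normrM ler_pM.
have i12 := bounded_integrable (prob2 N) m12 b12.
transitivity (\int[prob2 N]_z \int[N]_s (f1 z.1 * f2 z.2 * f3 s)).
  apply/esym; apply: (@Rfubini_dom12 _ _ _ _ _ (prob2 N) N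
    (fun xi : R3 => f1 xi.1.1 * f2 xi.1.2 * f3 xi.2) (cst (M1 * M2 * M3))).
  - by apply: measurable_funM => //; exact: measurable_funM.
  - exact: finite_measure_integrable_cst.
  - move=> z s; rewrite /= normrM ler_pM//.
transitivity (\int[prob2 N]_z (f1 z.1 * f2 z.2 * \int[N]_s f3 s)).
  by apply: eq_Rintegral => z _; rewrite RintegralZl.
rewrite RintegralZr//; congr (_ * _).
transitivity (\int[N]_x \int[N]_y (f1 x * f2 y)).
  apply/esym; apply: (@Rfubini_dom12 _ _ _ _ _ N N
    (fun z : R * R => f1 z.1 * f2 z.2) (cst (M1 * M2))) => //.
  exact: finite_measure_integrable_cst.
rewrite -RintegralZr//; by apply: eq_Rintegral => x _; rewrite RintegralZl.
Qed.

Section coordinate.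
Variable p : R3 -> R.
Hypothesis mp : measurable_fun setT p.
Hypothesis pE : forall F : R -> \bar R, measurable_fun setT F -> (forall x, (0 <= F x)%E) ->
  (\int[N3]_xi F (p xi) = \int[N]_x F x)%E.

Lemma N3_coordinate (f : R -> R) : N.-integrable setT (EFin \o f) ->
  N3.-integrable setT (EFin \o (f \o p)) /\ \int[N3]_xi f (p xi) = \int[N]_x f x.
Proof.
move=> fi; have /integrableP[mf fib] := fi.
split.
  apply/integrableP; split; first exact: (measurableT_comp mf mp).
  rewrite (pE (F := fun x => `|(f x)%:E|%E))//; exact: measurableT_comp.
rewrite /Rintegral; congr fine.
rewrite [RHS]integralE (integralE _ _ (fun xi => (f (p xi))%:E)); congr (_ - _)%E.
- rewrite -(pE (measurable_funepos mf) (fun x => funepos_ge0 _ x)).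
  by apply: eq_integral => xi _; rewrite !funeposE.
- rewrite -(pE (measurable_funeneg mf) (fun x => funeneg_ge0 _ x)).
  by apply: eq_integral => xi _; rewrite !funenegE.
Qed.
End coordinate.

Let N1 (e : \bar R) : (\int[N]__ e = e)%E.
Proof. by rewrite integral_cst// [X in (_ * X)%E]probability_setT mule1. Qed.

Lemma N3_1 (F : R -> \bar R) : measurable_fun setT F -> (forall x, (0 <= F x)%E) ->
  (\int[N3]_xi F xi.1.1 = \int[N]_x F x)%E.
Proof.
move=> mF F0; have mG := measurableT_comp mF (@measurable_R3_1 R).
rewrite (N3E N (F := fun xi => F xi.1.1) (fun xi => F0 _) mG)/=.
by rewrite N1 N1.
Qed.

Lemma N3_2 (F : R -> \bar R) : measurable_fun setT F -> (forall x, (0 <= F x)%E) ->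
  (\int[N3]_xi F xi.1.2 = \int[N]_x F x)%E.
Proof.
move=> mF F0; have mG := measurableT_comp mF (@measurable_R3_2 R).
rewrite (N3E N (F := fun xi => F xi.1.2) (fun xi => F0 _) mG)/= N1.
by apply: eq_integral => b _; rewrite -[RHS](N1 (F b)).
Qed.

Lemma N3_3 (F : R -> \bar R) : measurable_fun setT F -> (forall x, (0 <= F x)%E) ->
  (\int[N3]_xi F xi.2 = \int[N]_x F x)%E.
Proof.
move=> mF F0.
have mG : measurable_fun setT (fun xi : R3 => F xi.2) by exact: measurableT_comp.
rewrite (N3E N (F := fun xi => F xi.2) (fun xi => F0 _) mG)/=.
apply: eq_integral => s _; rewrite -[RHS](N1 (F s)).
by apply: eq_integral => b _; rewrite -[RHS](N1 (F s)).
Qed.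

Lemma integrable_pow4 : N.-integrable setT (EFin \o (fun x : R => x ^+ 4)).
Proof.
apply/integrableP; split; first by apply/measurable_EFinP; exact: measurable_funX.
rewrite (eq_integral (fun x : R => (x ^+ 4)%:E)); first exact: moment4.
by move=> x _ /=; rewrite ger0_norm ?exprn_even_ge0.
Qed.

Lemma integrable_id : N.-integrable setT (EFin \o (fun x : R => x)).
Proof.
apply: (@integrable_le_norm _ _ _ N setT _ (fun x : R => 1 + x ^+ 2)) => //.
- have -> : EFin \o (fun x : R => 1 + x ^+ 2) = (EFin \o cst 1) \+ (EFin \o (fun x : R => x ^+ 2)).
    by apply/funext => x /=.
  apply: integrableD => //; first exact: finite_measure_integrable_cst.
  exact: integrable_sqr.
- by move=> x _; exact: norm_le1Dsqr.
Qed.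

Lemma Rintegral_id0 : \int[N]_x x = 0.
Proof. by apply: gaussian_odd. Qed.

(** Take expectations in the lower bound: linear terms average to 0, each of the two squares to at
    most 1. The quadratic part omits the third coordinate because the barrier of [heat_min_contra]
    does not grow along the axis. *)
Lemma hs_lower (w : R3 -> R) (M c A l1 l2 B C : R) (x : R3) :
  measurable_fun setT w -> (forall x, `|w x| <= M) -> 0 <= B ->
  (forall xi : R3, A + l1 * xi.1.1 + l2 * xi.1.2 - B * (xi.1.1 ^+ 2 + xi.1.2 ^+ 2)
     - C * (xi.1.1 ^+ 4 + xi.1.2 ^+ 4 + xi.2 ^+ 4) <= w (mv x c xi)) ->
  A - 2 * B - 3 * C * \int[N]_x (x ^+ 4) <= hs N c w x.
Proof.
move=> mw wM B0 H.
have [p1 p1E] := N3_coordinate (@measurable_R3_1 R) N3_1 integrable_id.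
have [p2 p2E] := N3_coordinate (@measurable_R3_2 R) N3_2 integrable_id.
have [q1 q1E] := N3_coordinate (@measurable_R3_1 R) N3_1 (integrable_sqr gN).
have [q2 q2E] := N3_coordinate (@measurable_R3_2 R) N3_2 (integrable_sqr gN).
have [r1 r1E] := N3_coordinate (@measurable_R3_1 R) N3_1 integrable_pow4.
have [r2 r2E] := N3_coordinate (@measurable_R3_2 R) N3_2 integrable_pow4.
have [r3 r3E] := N3_coordinate (@measurable_snd _ _ _ _) N3_3 integrable_pow4.
have ID (f g : R3 -> R) : N3.-integrable setT (EFin \o f) -> N3.-integrable setT (EFin \o g) ->
   N3.-integrable setT (EFin \o (fun x => f x + g x)).
  by move=> fi gi; exact: (integrableD measurableT fi gi).
have IZ k (f : R3 -> R) : N3.-integrable setT (EFin \o f) ->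
   N3.-integrable setT (EFin \o (fun x => k * f x)).
  by move=> fi; exact: (integrableZl measurableT k fi).
have EZ k (f : R3 -> R) : N3.-integrable setT (EFin \o f) ->
  \int[N3]_x (k * f x) = k * \int[N3]_x f x.
  by move=> fi; rewrite RintegralZl.
pose L1 (xi : R3) := l1 * xi.1.1.
pose L2 (xi : R3) := l2 * xi.1.2.
pose Q (xi : R3) := xi.1.1 ^+ 2 + xi.1.2 ^+ 2.
pose P4 (xi : R3) := xi.1.1 ^+ 4 + xi.1.2 ^+ 4 + xi.2 ^+ 4.
have iL1 : N3.-integrable setT (EFin \o L1) := IZ l1 _ p1.
have iL2 : N3.-integrable setT (EFin \o L2) := IZ l2 _ p2.
have iQ : N3.-integrable setT (EFin \o Q) := ID _ _ q1 q2.
have iP12 := ID _ _ r1 r2.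
have iP : N3.-integrable setT (EFin \o P4) := ID _ _ iP12 r3.
have ic : N3.-integrable setT (EFin \o (cst A : R3 -> R)) := finite_measure_integrable_cst _ A measurableT.
have iA1 := ID _ _ ic iL1.
have iA2 := ID _ _ iA1 iL2.
have iA3 := ID _ _ iA2 (IZ (- B) _ iQ).
have iA4 := ID _ _ iA3 (IZ (- C) _ iP).
have E : \int[N3]_xi (A + L1 xi + L2 xi + - B * Q xi + - C * P4 xi) =
   A - B * (2 * \int[N]_x x ^+ 2) - C * (3 * \int[N]_x (x ^+ 4)).
  rewrite (RintegralD measurableT iA3 (IZ (- C) _ iP)) (RintegralD measurableT iA2 (IZ (- B) _ iQ)).
  rewrite (RintegralD measurableT iA1 iL2) (RintegralD measurableT ic iL1) (EZ _ _ iQ) (EZ _ _ iP).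
  rewrite (EZ l1 _ p1) (EZ l2 _ p2) Rintegral_cst1 [X in l1 * X]p1E [X in l2 * X]p2E Rintegral_id0.
  rewrite (RintegralD measurableT q1 q2) (RintegralD measurableT iP12 r3) (RintegralD measurableT r1 r2).
  rewrite [X in - B * (X + _)]q1E [X in - B * (_ + X)]q2E [X in - C * (X + _ + _)]r1E.
  rewrite [X in - C * (_ + X + _)]r2E [X in - C * (_ + X)]r3E; ring.
apply: (@le_trans _ _ (\int[N3]_xi (A + L1 xi + L2 xi + - B * Q xi + - C * P4 xi))).
  rewrite E; have := Rintegral_sqr_le1 gN; set m2 := Rintegral _ _ _ => h.
  have : B * m2 <= B by rewrite ler_piMr.
  lra.
apply: le_Rintegral => //.
- exact: (integrable_hs N mw wM).
- by move=> xi _; apply: le_trans (H xi); rewrite /L1 /L2 /Q /P4 !mulNr.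
Qed.

Definition helix (k : R) (x : R3) := x.1.2 * cos (k * x.2) - x.1.1 * sin (k * x.2).

Definition hbump (k d : R) (x : R3) := helix k x * expR (- d * (x.1.1 ^+ 2 + x.1.2 ^+ 2)).

Section hbump.
Variables (k d : R).
Hypothesis d0 : 0 < d.

Definition gb0 (a : R) := expR (- d * a ^+ 2).
Definition gb1 (a : R) := a * expR (- d * a ^+ 2).

(** Writes the bump as two products of functions of one coordinate, so that [Rintegral_prod3]
    averages it factor by factor. *)
Lemma bumpE x : hbump k d x = gb0 x.1.1 * gb1 x.1.2 * cos (k * x.2) - gb1 x.1.1 * gb0 x.1.2 * sin (k * x.2).
Proof. by rewrite /hbump /helix /gb0 /gb1 mulrDr expRD; ring. Qed.

Lemma gb0_le1 a : `|gb0 a| <= 1.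
Proof. by rewrite ger0_norm ?expR_ge0// -expR0 ler_expR mulNr oppr_le0 mulr_ge0 ?sqr_ge0// ltW. Qed.

Lemma gb1_le a : `|gb1 a| <= 1 + d^-1.
Proof.
rewrite /gb1 normrM (ger0_norm (expR_ge0 _)) mulNr expRN ler_pdivrMr ?expR_gt0//.
have h := expR_ge1Dx (d * a ^+ 2).
apply: (@le_trans _ _ ((1 + d^-1) * (1 + d * a ^+ 2))); last first.
  by rewrite ler_pM2l// addr_gt0// invr_gt0.
have -> : (1 + d^-1) * (1 + d * a ^+ 2) = 1 + a ^+ 2 + (d^-1 + d * a ^+ 2).
  by field; rewrite gt_eqF.
apply: (le_trans (norm_le1Dsqr a)); rewrite lerDl addr_ge0// ?invr_ge0 ?(ltW d0)//.
by rewrite pmulr_rge0// sqr_ge0.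
Qed.

Lemma continuous_gb0 : continuous gb0.
Proof.
move=> x; apply: continuous_comp; last exact: continuous_expR.
by apply: cvgM; [exact: cvg_cst|exact: exprn_continuous].
Qed.

Lemma continuous_gb1 : continuous gb1.
Proof. by move=> x; apply: cvgM; [exact: cvg_id|exact: continuous_gb0]. Qed.

Lemma measurable_gb0 : measurable_fun setT gb0.
Proof. by apply: continuous_measurable_fun; exact: continuous_gb0. Qed.

Lemma measurable_gb1 : measurable_fun setT gb1.
Proof. by apply: continuous_measurable_fun; exact: continuous_gb1. Qed.

Lemma gb0_gauss (a c : R) : let D := 1 + 2 * d * c ^+ 2 in
  \int[N]_x gb0 (a + c * x) = (Num.sqrt D)^-1 * expR (- d * a ^+ 2 / D).
Proof.
move=> D; apply: Rintegral_expR_sqr => //.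
by rewrite ltr_pwDl// mulr_ge0 ?sqr_ge0// mulr_ge0// ltW.
Qed.

(** Under the tilted law of [expR_sqr_gratio], of mean [a'], the average of [a + c x] is
    [a + c a' = a / D]. *)
Lemma gb1_gauss (a c : R) : let D := 1 + 2 * d * c ^+ 2 in
  \int[N]_x gb1 (a + c * x) = a / D * ((Num.sqrt D)^-1 * expR (- d * a ^+ 2 / D)).
Proof.
move=> D; have D0 : 0 < D by rewrite ltr_pwDl// mulr_ge0 ?sqr_ge0// mulr_ge0// ltW.
have sD : 0 < (Num.sqrt D)^-1 by rewrite invr_gt0 sqrtr_gt0.
set c' := (Num.sqrt D)^-1; set a' := - 2 * d * a * c / D.
set e := expR (- d * a ^+ 2 / D).
have ml u v : measurable_fun setT (fun x : R => u + v * x).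
  by apply: measurable_funD => //; exact: measurable_funM.
have il u v : N.-integrable setT (EFin \o (fun x : R => u + v * x)).
  have := integrableD measurableT (finite_measure_integrable_cst N u measurableT)
    (integrableZl measurableT v integrable_id).
  by [].
transitivity (\int[N]_x (c' * e * ((a + c * x) * gratio c' a' x))).
  apply: eq_Rintegral => x _; rewrite /gb1 (expR_sqr_gratio a x D0) -/D -/c' -/a' -/e.
  by ring.
have E : \int[N]_x ((a + c * x) * gratio c' a' x) = a / D.
  rewrite -(@Rintegral_density _ _ gN a' c' (fun y => a + c * y) sD (ml a c)).
  transitivity (\int[N]_x ((a + c * a') + (c * c') * x)).
    by apply: eq_Rintegral => x _; ring.
  rewrite RintegralD//; last 2 first.
  - exact: finite_measure_integrable_cst.
  - exact: (integrableZl measurableT (c * c') integrable_id).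
  rewrite Rintegral_cst1 RintegralZl//; last exact: integrable_id.
  rewrite Rintegral_id0 mulr0 addr0 /a' /D; field.
  by rewrite -/D gt_eqF.
rewrite RintegralZl//; first by rewrite E mulrC.
(* The tilted integrand is [gb1 (a + c x)] divided by the constant [c' * e], hence bounded by
   [gb1_le], hence integrable. *)
have [f0|f0] := pselect (N.-integrable setT (EFin \o (fun x => (a + c * x) * gratio c' a' x))).
  by [].
exfalso; apply: f0.
apply: (@integrable_le_norm _ _ _ N setT _ (fun x => (c' * e)^-1 * (1 + d^-1))) => //.
- by apply: measurable_funM => //; exact: measurable_gratio.
- exact: finite_measure_integrable_cst.
- move=> x _; have ce : 0 < c' * e by rewrite mulr_gt0 ?expR_gt0.
  rewrite ler_pdivlMl//; have := gb1_le (a + c * x).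
  rewrite /gb1 (expR_sqr_gratio a x D0) -/D -/c' -/a' -/e.
  apply: le_trans; rewrite -{1}(gtr0_norm ce) -normrM le_eqVlt; apply/orP; left.
  by apply/eqP; congr `|_|; ring.
Qed.

Lemma Rintegral_cosD (s c : R) : \int[N]_x cos (k * (s + c * x)) = cos (k * s) * gcos N (k * c).
Proof.
have ic : N.-integrable setT (EFin \o (fun x => cos (k * c * x))).
  by apply: (@bounded_integrable _ _ _ N _ 1) => [|x]; [exact: measurable_cosM|exact: norm_cos_le1].
have is_ : N.-integrable setT (EFin \o (fun x => sin (k * c * x))).
  by apply: (@bounded_integrable _ _ _ N _ 1) => [|x]; [exact: measurable_sinM|exact: norm_sin_le1].
have s0 : \int[N]_x sin (k * c * x) = 0.
  by apply: (gaussian_odd gN) => [|x]; [exact: measurable_sinM|rewrite mulrN sinN].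
transitivity (\int[N]_x (cos (k * s) * cos (k * c * x) - sin (k * s) * sin (k * c * x))).
  by apply: eq_Rintegral => x _; rewrite mulrDr mulrA cosD.
rewrite RintegralB//; last 2 first.
- exact: (integrableZl measurableT (cos (k * s)) ic).
- exact: (integrableZl measurableT (sin (k * s)) is_).
by rewrite !RintegralZl// s0 mulr0 subr0.
Qed.

Lemma Rintegral_sinD (s c : R) : \int[N]_x sin (k * (s + c * x)) = sin (k * s) * gcos N (k * c).
Proof.
have ic : N.-integrable setT (EFin \o (fun x => cos (k * c * x))).
  by apply: (@bounded_integrable _ _ _ N _ 1) => [|x]; [exact: measurable_cosM|exact: norm_cos_le1].
have is_ : N.-integrable setT (EFin \o (fun x => sin (k * c * x))).
  by apply: (@bounded_integrable _ _ _ N _ 1) => [|x]; [exact: measurable_sinM|exact: norm_sin_le1].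
have s0 : \int[N]_x sin (k * c * x) = 0.
  by apply: (gaussian_odd gN) => [|x]; [exact: measurable_sinM|rewrite mulrN sinN].
transitivity (\int[N]_x (sin (k * s) * cos (k * c * x) + cos (k * s) * sin (k * c * x))).
  by apply: eq_Rintegral => x _; rewrite mulrDr mulrA sinD.
rewrite RintegralD//; last 2 first.
- exact: (integrableZl measurableT (sin (k * s)) ic).
- exact: (integrableZl measurableT (cos (k * s)) is_).
by rewrite !RintegralZl// s0 mulr0 addr0.
Qed.

End hbump.

End gauss3.

Lemma norm_mul3_le (R : realType) (a b c A B C : R) :
  `|a| <= A -> `|b| <= B -> `|c| <= C -> `|a * b * c| <= A * B * C.
Proof. by move=> hA hB hC; rewrite !normrM !ler_pM ?mulr_ge0. Qed.

Section bump_heat.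
Variables (R : realType) (N : probability R R).
Hypothesis gN : gaussian N.
Local Notation R3 := (R * R * R)%type.
Variables (k d : R).
Hypothesis d0 : 0 < d.

Lemma continuous_helix : continuous (@helix R k).
Proof.
move=> x.
have c1 : (fun y : R3 => y.1.1) @ x --> x.1.1 by apply: continuous_comp; exact: cvg_fst.
have c2 : (fun y : R3 => y.1.2) @ x --> x.1.2 by apply: continuous_comp; [exact: cvg_fst|exact: cvg_snd].
have c3 : (fun y : R3 => k * y.2) @ x --> k * x.2 by apply: cvgM; [exact: cvg_cst|exact: cvg_snd].
apply: cvgB; apply: cvgM => //.
- by apply: continuous_cvg => //; exact: continuous_cos.
- by apply: continuous_cvg => //; exact: continuous_sin.
Qed.

Lemma continuous_bump : continuous (@hbump R k d).
Proof.
move=> x.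
have c1 : (fun y : R3 => y.1.1) @ x --> x.1.1 by apply: continuous_comp; exact: cvg_fst.
have c2 : (fun y : R3 => y.1.2) @ x --> x.1.2 by apply: continuous_comp; [exact: cvg_fst|exact: cvg_snd].
apply: cvgM; first exact: continuous_helix.
apply: continuous_cvg; first exact: continuous_expR.
apply: cvgM; first exact: cvg_cst.
rewrite /=; apply: (@cvgD _ _ _ _ _ (fun y : R3 => y.1.1 ^+ 2) (fun y : R3 => y.1.2 ^+ 2)).
- exact: (cvgM c1 c1).
- exact: (cvgM c2 c2).
Qed.

Lemma measurable_bump : measurable_fun setT (@hbump R k d).
Proof.
rewrite [X in measurable_fun _ X](_ : _ = fun x => gb0 d x.1.1 * gb1 d x.1.2 * cos (k * x.2) - gb1 d x.1.1 * gb0 d x.1.2 * sin (k * x.2)); last first.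
  by apply/funext => x; rewrite bumpE.
have r1 := @measurable_R3_1 R; have r2 := @measurable_R3_2 R.
have m0 := @measurable_gb0 R d; have m1 := @measurable_gb1 R d.
apply: measurable_funB; apply: measurable_funM.
- by apply: measurable_funM; [exact: (measurableT_comp m0 r1)|exact: (measurableT_comp m1 r2)].
- by apply: (measurableT_comp (measurable_cosM k)).
- by apply: measurable_funM; [exact: (measurableT_comp m1 r1)|exact: (measurableT_comp m0 r2)].
- by apply: (measurableT_comp (measurable_sinM k)).
Qed.

Lemma bump_bound (x : R3) : `|hbump k d x| <= 2 * (1 + d^-1).
Proof.
rewrite bumpE (le_trans (ler_normB _ _))// mulr_natl mulr2n lerD//.
- rewrite -[leRHS]mulr1 -[X in _ <= X * 1]mul1r; apply: norm_mul3_le; first exact: gb0_le1.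
    exact: gb1_le.
  exact: norm_cos_le1.
- rewrite -[leRHS]mulr1 -[X in _ <= X * 1]mulr1; apply: norm_mul3_le; first exact: gb1_le.
    exact: gb0_le1.
  exact: norm_sin_le1.
Qed.

(** The heat flow keeps the shape of the bump. Of the amplitude [1 / D^2], each planar Gaussian
    gives [1 / sqrt D] and the linear factor of [helix] gives [1 / D]; the oscillation along the
    axis is damped by [gcos (k c)]. *)
Lemma hs_bump (c : R) (x : R3) : let D := 1 + 2 * d * c ^+ 2 in
  hs N c (hbump k d) x =
  (D ^+ 2)^-1 * expR (- d * (x.1.1 ^+ 2 + x.1.2 ^+ 2) / D) * gcos N (k * c) * helix k x.
Proof.
move=> D; have D0 : 0 < D by rewrite ltr_pwDl// mulr_ge0 ?sqr_ge0// mulr_ge0// ltW.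
have ml u v : measurable_fun setT (fun x : R => u + v * x).
  by apply: measurable_funD => //; exact: measurable_funM.
have m0 a := measurableT_comp (@measurable_gb0 R d) (ml a c).
have m1 a := measurableT_comp (@measurable_gb1 R d) (ml a c).
have mcos a := measurableT_comp (measurable_cosM k) (ml a c).
have msin a := measurableT_comp (measurable_sinM k) (ml a c).
pose T1 (xi : R3) := gb0 d (x.1.1 + c * xi.1.1) * gb1 d (x.1.2 + c * xi.1.2) * cos (k * (x.2 + c * xi.2)).
pose T2 (xi : R3) := gb1 d (x.1.1 + c * xi.1.1) * gb0 d (x.1.2 + c * xi.1.2) * sin (k * (x.2 + c * xi.2)).
have b1 a := @gb1_le R d d0 a.
have b0 a := @gb0_le1 R d d0 a.
have mr1 (f : R -> R) : measurable_fun setT f -> measurable_fun setT (fun xi : R3 => f xi.1.1).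
  by move=> mf; exact: (measurableT_comp mf (@measurable_R3_1 R)).
have mr2 (f : R -> R) : measurable_fun setT f -> measurable_fun setT (fun xi : R3 => f xi.1.2).
  by move=> mf; exact: (measurableT_comp mf (@measurable_R3_2 R)).
have mr3 (f : R -> R) : measurable_fun setT f -> measurable_fun setT (fun xi : R3 => f xi.2).
  by move=> mf; exact: (measurableT_comp mf (@measurable_snd _ _ _ _)).
have iT1 : (prob3 N).-integrable setT (EFin \o T1).
  apply: (@bounded_integrable _ _ _ (prob3 N) _ (1 * (1 + d^-1) * 1)).
    apply: measurable_funM; last exact: (mr3 _ (mcos x.2)).
    by apply: measurable_funM; [exact: (mr1 _ (m0 x.1.1))|exact: (mr2 _ (m1 x.1.2))].
  by move=> xi; apply: norm_mul3_le => //; exact: norm_cos_le1.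
have iT2 : (prob3 N).-integrable setT (EFin \o T2).
  apply: (@bounded_integrable _ _ _ (prob3 N) _ ((1 + d^-1) * 1 * 1)).
    apply: measurable_funM; last exact: (mr3 _ (msin x.2)).
    by apply: measurable_funM; [exact: (mr1 _ (m1 x.1.1))|exact: (mr2 _ (m0 x.1.2))].
  by move=> xi; apply: norm_mul3_le => //; exact: norm_sin_le1.
transitivity (\int[prob3 N]_xi (T1 xi - T2 xi)).
  by apply: eq_Rintegral => xi _; rewrite bumpE.
rewrite RintegralB//.
rewrite (@Rintegral_prod3 _ N (fun a => gb0 d (x.1.1 + c * a)) (fun a => gb1 d (x.1.2 + c * a))
  (fun a => cos (k * (x.2 + c * a))) 1 (1 + d^-1) 1 (m0 _) (m1 _) (mcos _)
  (fun _ => b0 _) (fun _ => b1 _) (fun _ => norm_cos_le1 _)).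
rewrite (@Rintegral_prod3 _ N (fun a => gb1 d (x.1.1 + c * a)) (fun a => gb0 d (x.1.2 + c * a))
  (fun a => sin (k * (x.2 + c * a))) (1 + d^-1) 1 1 (m1 _) (m0 _) (msin _)
  (fun _ => b1 _) (fun _ => b0 _) (fun _ => norm_sin_le1 _)).
rewrite !(gb0_gauss gN d0) !(gb1_gauss gN d0) (Rintegral_cosD gN) (Rintegral_sinD gN) -/D.
have -> : expR (- d * (x.1.1 ^+ 2 + x.1.2 ^+ 2) / D) = expR (- d * x.1.1 ^+ 2 / D) * expR (- d * x.1.2 ^+ 2 / D).
  by rewrite -expRD; congr expR; ring.
have -> : (D ^+ 2)^-1 = D^-1 * ((Num.sqrt D)^-1 * (Num.sqrt D)^-1).
  by rewrite -invfM -expr2 sqr_sqrtr ?ltW// expr2 invfM.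
rewrite /helix; ring.
Qed.

(** Three comparisons in [hs_bump]: [D^2 <= expR (4 d c^2)] since [D <= expR (2 d c^2)]; the
    Gaussian only widens since [D >= 1]; and [gcos (k c) >= expR (- k^2 c^2 / 2)]. With [c^2 = 2 t]
    the rate is [k^2 + 8 d]. *)
Lemma hs_bump_ge (c : R) (x : R3) : 0 <= helix k x ->
  expR (- (k ^+ 2 / 2 + 4 * d) * c ^+ 2) * hbump k d x <= hs N c (hbump k d) x.
Proof.
move=> hx; rewrite hs_bump; set D := 1 + _.
have D1 : 1 <= D by rewrite lerDl mulr_ge0 ?sqr_ge0// mulr_ge0// ltW.
have D0 : 0 < D by rewrite (lt_le_trans _ D1).
rewrite /hbump mulrCA [leRHS]mulrC ler_wpM2l//.
set r := _ + _ ^+ 2; have r0 : 0 <= r by rewrite addr_ge0 ?sqr_ge0.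
have -> : expR (- (k ^+ 2 / 2 + 4 * d) * c ^+ 2) * expR (- d * r) =
    expR (- (4 * d * c ^+ 2)) * expR (- d * r) * expR (- ((k * c) ^+ 2 / 2)).
  by rewrite -!expRD; congr expR; rewrite exprMn; ring.
have g := gcos_ge_exp gN (k * c).
apply: ler_pM => //; rewrite ?mulr_ge0 ?expR_ge0//.
apply: ler_pM; rewrite ?expR_ge0//.
- rewrite expRN lef_pV2 ?posrE ?expR_gt0 ?exprn_gt0//.
  have -> : 4 * d * c ^+ 2 = 2 * d * c ^+ 2 + 2 * d * c ^+ 2 by ring.
  by rewrite expRD expr2 ler_pM ?(ltW D0) ?expR_ge1Dx.
- by rewrite ler_expR !mulNr lerN2 ler_pdivrMr// ler_peMr// mulr_ge0 // ltW.
Qed.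

End bump_heat.

(** * Functions with the symmetries of the helicoid *)

Section cone.
Variables (R : realType) (N : probability R R).
Hypothesis gN : gaussian N.
Local Notation R3 := (R * R * R)%type.
Variable k : R.
Hypothesis k0 : k != 0.

Definition scr (b : R) (x : R3) : R3 :=
  (cos b * x.1.1 - sin b * x.1.2, sin b * x.1.1 + cos b * x.1.2, x.2 + b / k).

Definition flip (x : R3) : R3 := (x.1.1, - x.1.2, - x.2).

Record screw_odd (h : R3 -> R) : Prop := ScrewOdd {
  screw_inv : forall b x, h (scr b x) = h x;
  screw_flip : forall x, h (flip x) = - h x
}.

(** The screw motion of angle [- k s] brings the point to the plane [s = 0], where [helix] is the
    second coordinate. Thus a function of the class is a function of two variables. *)
Lemma screw_slice (h : R3 -> R) (x : R3) : screw_odd h ->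
  h x = h (cos (k * x.2) * x.1.1 + sin (k * x.2) * x.1.2, helix k x, 0).
Proof.
move=> sh; rewrite -(screw_inv sh (- (k * x.2))) /scr cosN sinN /helix; congr (h (_, _, _)).
- by ring.
- by ring.
- by field.
Qed.

Lemma slice_norm (x : R3) : (cos (k * x.2) * x.1.1 + sin (k * x.2) * x.1.2) ^+ 2 + helix k x ^+ 2 =
  x.1.1 ^+ 2 + x.1.2 ^+ 2.
Proof.
rewrite /helix.
transitivity ((cos (k * x.2) ^+ 2 + sin (k * x.2) ^+ 2) * (x.1.1 ^+ 2 + x.1.2 ^+ 2)); first by ring.
by rewrite cos2Dsin2 mul1r.
Qed.

(** When [helix] vanishes, the point of the slice [s = 0] lies on the first axis, which [flip]
    fixes; oddness then gives 0. *)
Lemma screw_zero (h : R3 -> R) (x : R3) : screw_odd h -> helix k x = 0 -> h x = 0.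
Proof.
move=> sh hx; rewrite (screw_slice _ sh) hx; set y := (_, _, _).
have : h y = - h y by rewrite -(screw_flip sh) /flip /y /= oppr0.
by move/eqP; rewrite -subr_eq0 opprK -mulr2n mulrn_eq0/= => /eqP.
Qed.

Lemma helix_scr (b : R) (x : R3) : helix k (scr b x) = helix k x.
Proof.
rewrite /helix /scr/= (_ : k * (x.2 + b / k) = k * x.2 + b); last by field.
rewrite cosD sinD.
transitivity ((cos b ^+ 2 + sin b ^+ 2) * (x.1.2 * cos (k * x.2) - x.1.1 * sin (k * x.2))); first by ring.
by rewrite cos2Dsin2 mul1r.
Qed.

Lemma helix_flip (x : R3) : helix k (flip x) = - helix k x.
Proof. by rewrite /helix /flip/= mulrN cosN sinN; ring. Qed.

Lemma bump_screw_odd (d : R) : screw_odd (hbump k d).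
Proof.
split=> [b x|x]; last first.
  by rewrite /hbump helix_flip mulNr /flip/= sqrrN.
rewrite /hbump helix_scr; congr (_ * expR (_ * _)); rewrite /scr/=.
transitivity ((cos b ^+ 2 + sin b ^+ 2) * (x.1.1 ^+ 2 + x.1.2 ^+ 2)); first by ring.
by rewrite cos2Dsin2 mul1r.
Qed.

Lemma hs_screw_odd (h : R3 -> R) (M c : R) : measurable_fun setT h -> (forall x, `|h x| <= M) ->
  screw_odd h -> screw_odd (hs N c h).
Proof.
move=> mh hM sh; split=> [b x|x].
  have := hs_rotation gN mh hM c (b / k) x (cos2Dsin2 b).
  rewrite (_ : (fun z => _) = h); first by [].
  by apply/funext => z; exact: (screw_inv sh).
have := hs_flip gN mh hM c x.
rewrite (_ : (fun z => _) = (fun z => - h z)) => [<-|]; last first.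
  by apply/funext => z; exact: (screw_flip sh).
transitivity (\int[prob3 N]_xi (- 1 * h (mv x c xi))).
  by apply: eq_Rintegral => xi _; rewrite mulN1r.
by rewrite RintegralZl ?mulN1r//; exact: (integrable_hs N mh hM).
Qed.

End cone.

(** * Positivity on one side of the helicoid *)

Section cone_preservation.
Variables (R : realType) (N : probability R R).
Hypothesis gN : gaussian N.
Local Notation R3 := (R * R * R)%type.
Variable k : R.
Hypothesis k0 : k != 0.

Record cone (M : R) (h : R3 -> R) : Prop := Cone {
  cone_measurable : measurable_fun setT h;
  cone_bound : forall x, `|h x| <= M;
  cone_odd : screw_odd k h;
  cone_ge0 : forall x, 0 <= helix k x -> 0 <= h x
}.

Lemma helix_gt0_near (x0 : R3) : 0 < helix k x0 -> exists2 d : R, 0 < d &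
  forall x : R3, `|x.1.1 - x0.1.1| < d -> `|x.1.2 - x0.1.2| < d -> `|x.2 - x0.2| < d ->
    0 < helix k x.
Proof.
move=> h0; have /cvgrPdist_lt /(_ _ h0) := @continuous_helix R k x0.
move=> /nbhs_ballP[d /= d0 H]; exists d => // x h1 h2 h3.
have : ball x0 d x by split; [split|]; rewrite /ball/= /ball_/= distrC.
move=> /H /=; rewrite ltr_distlC => /andP[+ _]; by rewrite subrr.
Qed.

(** A Chebyshev bound of order four: an error supported outside the box of size [d] is charged to
    fourth moments times [c ^+ 4], which is of second order in time. *)
Lemma pow4_big (c d a b e : R) : 0 < d ->
  ~ [/\ `|c * a| < d, `|c * b| < d & `|c * e| < d] ->
  d ^+ 4 <= c ^+ 4 * (a ^+ 4 + b ^+ 4 + e ^+ 4).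
Proof.
move=> d0 H; have p4 (z : R) : 0 <= z ^+ 4 by rewrite exprn_even_ge0.
have big z : d <= `|c * z| -> d ^+ 4 <= c ^+ 4 * z ^+ 4.
  move=> dz; rewrite -exprMn; apply: (@le_trans _ _ (`|c * z| ^+ 4)).
    by rewrite lerXn2r// nnegrE// ltW.
  by rewrite -normrX ger0_norm.
have := mulr_ge0 (p4 c) (p4 a); have := mulr_ge0 (p4 c) (p4 b); have := mulr_ge0 (p4 c) (p4 e).
rewrite !mulrDr.
have [h1|/big] := ltP `|c * a| d; last by lra.
have [h2|/big] := ltP `|c * b| d; last by lra.
have [h3|/big] := ltP `|c * e| d; last by lra.
by exfalso; apply: H.
Qed.

(* A comparison that needs no time derivative: if the paraboloid touches [W] from below
   at time [t0], one short heat step contradicts its second and fourth moments. *)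
Lemma heat_min_contra (W : R -> R3 -> R) (M delta m0 t0 : R) (x0 : R3) :
  (forall t, measurable_fun setT (W t)) -> (forall t x, `|W t x| <= M) ->
  (forall t tau x, 0 <= t -> 0 <= tau -> hs N (Num.sqrt (2 * tau)) (W t) x = W (t + tau) x) ->
  0 < delta -> m0 <= 0 -> 0 < t0 -> 0 < helix k x0 ->
  (forall t x, 0 <= t <= t0 -> 0 <= helix k x ->
     m0 - delta * (x.1.1 ^+ 2 + x.1.2 ^+ 2 + 5 * t) <= W t x) ->
  W t0 x0 = m0 - delta * (x0.1.1 ^+ 2 + x0.1.2 ^+ 2 + 5 * t0) -> False.
Proof.
move=> mW WM sg d0 m00 t00 /helix_gt0_near[d dp near0] low E.
have M0 : 0 <= M := le_trans (normr_ge0 _) (WM 0 x0).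
pose m4 := \int[N]_x (x ^+ 4).
have m40 : 0 <= m4 by apply: Rintegral_ge0 => x _; rewrite exprn_even_ge0.
have Mm : 0 <= M * m4 by rewrite mulr_ge0.
(* Small enough that [12 M m4 tau / d^4 < delta]. The 12 is 3 fourth moments times the 4 of
   [c^4 = 4 tau^2]. *)
pose tau := Num.min t0 (delta * d ^+ 4 / (12 * (M * m4) + 1)).
have Q0 : 0 < 12 * (M * m4) + 1 by lra.
have d4 : 0 < d ^+ 4 by rewrite exprn_gt0.
have tau0 : 0 < tau by rewrite lt_min t00 divr_gt0// mulr_gt0.
have taut : tau <= t0 by rewrite ge_min lexx.
have tau2 : tau <= delta * d ^+ 4 / (12 * (M * m4) + 1) by rewrite ge_min lexx orbT.
pose c := Num.sqrt (2 * tau).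
have cE : c ^+ 2 = 2 * tau by rewrite sqr_sqrtr// mulr_ge0// ltW.
have c4E : c ^+ 4 = 4 * tau ^+ 2 by rewrite (_ : 4%N = (2 * 2)%N)// exprM cE; ring.
pose t := t0 - tau.
have tge : 0 <= t by rewrite subr_ge0.
have tle : t <= t0 by rewrite lerBlDr lerDl ltW.
have key := @hs_lower R N gN (W t) M c (m0 - delta * (x0.1.1 ^+ 2 + x0.1.2 ^+ 2 + 5 * t))
  (- 2 * delta * c * x0.1.1) (- 2 * delta * c * x0.1.2) (delta * c ^+ 2) (M * c ^+ 4 / d ^+ 4)
  x0 (mW t) (WM t).
have B0 : 0 <= delta * c ^+ 2 by rewrite mulr_ge0 ?sqr_ge0// ltW.
have {key} := key B0.
rewrite (sg t tau x0 tge (ltW tau0)) (_ : t + tau = t0); last by rewrite /t; ring.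
rewrite E => key.
(* Over a step [tau] the time term of the barrier gains [5 delta tau] and the second moments cost
   [4 delta tau]; the surplus [delta tau] must be covered by the quartic error, of order [tau^2]. *)
have : delta <= 12 * (M * m4) * tau / d ^+ 4.
  rewrite -(ler_pM2r tau0).
  have : 3 * (M * c ^+ 4 / d ^+ 4) * m4 = 12 * (M * m4) * tau / d ^+ 4 * tau.
    by rewrite c4E; field; rewrite gt_eqF.
  have {key} := key _; rewrite -/m4 => + HE; rewrite HE cE /t => key; move: key => /(_ _) key.
  suff : m0 - delta * (x0.1.1 ^+ 2 + x0.1.2 ^+ 2 + 5 * (t0 - tau)) - 2 * (delta * (2 * tau)) -
     12 * (M * m4) * tau / d ^+ 4 * tau <= m0 - delta * (x0.1.1 ^+ 2 + x0.1.2 ^+ 2 + 5 * t0) by lra.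
  apply: key => xi.
  set S := xi.1.1 ^+ 4 + _ + _.
  have S0 : 0 <= S by rewrite !addr_ge0// exprn_even_ge0.
  have C0 : 0 <= M * c ^+ 4 / d ^+ 4.
    by apply: divr_ge0; [apply: mulr_ge0 => //; exact: exprn_even_ge0|exact: ltW].
  pose y := mv x0 c xi.
  (* Near [x0] the point stays in the positive side and the barrier lies below [W t]. Farther out
     the quartic term exceeds the bound [M], while the paraboloid is nonpositive. *)
  have [sm|lg] := pselect [/\ `|c * xi.1.1| < d, `|c * xi.1.2| < d & `|c * xi.2| < d].
    have := low t y; rewrite tge tle => /(_ isT) low'.
    have hy : 0 <= helix k y.
      case: sm => s1 s2 s3; apply/ltW/near0; rewrite /y /mv/=.
      - by rewrite addrAC subrr add0r.
      - by rewrite addrAC subrr add0r.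
      - by rewrite addrAC subrr add0r.
    have := low' hy; apply: le_trans.
    rewrite -/t /y /mv/= -subr_ge0.
    set A := M * c ^+ 4 / d ^+ 4 in C0 *.
    rewrite -cE -/t.
    have : 0 <= A * S by rewrite mulr_ge0.
    move=> h; apply: le_trans h _; rewrite le_eqVlt; apply/orP; left; apply/eqP.
    by rewrite /S; ring.
  have big : M <= M * c ^+ 4 / d ^+ 4 * S.
    rewrite (_ : _ / _ * S = M * ((d ^+ 4)^-1 * (c ^+ 4 * S))); last by ring.
    rewrite ler_peMr// ler_pdivlMl// mulr1 /S.
    exact: pow4_big.
  have := WM t y; rewrite ler_norml => /andP[+ _]; apply: le_trans.
  have h2 : 0 <= delta * ((x0.1.1 + c * xi.1.1) ^+ 2 + (x0.1.2 + c * xi.1.2) ^+ 2 + 5 * t).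
    by rewrite mulr_ge0 ?(ltW d0)// !addr_ge0 ?sqr_ge0// mulr_ge0.
  rewrite -/t -cE.
  set A := M * c ^+ 4 / d ^+ 4 * S in big *.
  have -> : m0 - delta * (x0.1.1 ^+ 2 + x0.1.2 ^+ 2 + 5 * t) +
    - 2 * delta * c * x0.1.1 * xi.1.1 + - 2 * delta * c * x0.1.2 * xi.1.2 -
    delta * c ^+ 2 * (xi.1.1 ^+ 2 + xi.1.2 ^+ 2) - A = 
    m0 - delta * ((x0.1.1 + c * xi.1.1) ^+ 2 + (x0.1.2 + c * xi.1.2) ^+ 2 + 5 * t) - A by ring.
  lra.
apply/negP; rewrite -ltNge.
have : 12 * (M * m4) * tau / d ^+ 4 <= 12 * (M * m4) * (delta / (12 * (M * m4) + 1)).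
  rewrite -mulrA ler_wpM2l//; first by rewrite mulr_ge0.
  by rewrite ler_pdivrMr// mulrAC.
move=> /le_lt_trans; apply.
rewrite mulrA ltr_pdivrMr//.
rewrite mulrDr mulr1 mulrC; lra.
Qed.

(** A parabolic maximum principle on one side of the helicoid. The penalty [delta (a^2 + b^2 + 5 t)]
    forces a minimum on a compact set of the slice variables; the 5 exceeds the Laplacian 4 of
    [a^2 + b^2], which makes the barrier strict. *)
Lemma cone_hs_ge0 M h c : cone M h -> continuous h -> 0 <= c ->
  forall x, 0 <= helix k x -> 0 <= hs N c h x.
Proof.
move=> [mh hM sh hp] ch c0 x1 hx1; rewrite leNgt; apply/negP => neg.
have M0 : 0 <= M := le_trans (normr_ge0 _) (hM x1).
pose W t := hs N (Num.sqrt (2 * t)) h.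
have Wodd t : screw_odd k (W t) by exact: (hs_screw_odd gN _ mh hM sh).
pose a1 := cos (k * x1.2) * x1.1.1 + sin (k * x1.2) * x1.1.2.
pose b1 := helix k x1.
pose T := c ^+ 2 / 2.
have T0 : 0 <= T by rewrite divr_ge0 ?sqr_ge0.
have WT : W T x1 = hs N c h x1.
  by rewrite /W /T mulrCA divff// mulr1 sqrtr_sqr ger0_norm.
pose q := a1 ^+ 2 + b1 ^+ 2 + 5 * T.
have q0 : 0 <= q by rewrite !addr_ge0 ?sqr_ge0// mulr_ge0.
(* The penalty at the bad point, [delta * q], remains below the size of the negative value there, so
   the penalised function still takes a negative value. *)
pose delta := - hs N c h x1 / (2 * (q + 1)).
have d0 : 0 < delta by rewrite divr_gt0 ?oppr_gt0// mulr_gt0// ltr_wpDl.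
have dq : delta * q < - hs N c h x1.
  rewrite /delta mulrAC ltr_pdivrMr ?mulr_gt0 ?ltr_wpDl//.
  by rewrite ltr_pM2l ?oppr_gt0//; lra.
pose psi (p : R3) := W p.1.1 (p.1.2, p.2, 0) + delta * (p.1.2 ^+ 2 + p.2 ^+ 2 + 5 * p.1.1).
(* The rectangle contains the bad point, and [delta * L ^+ 2 >= M]: outside it the penalty alone
   makes the penalised function nonnegative. *)
pose L := `|a1| + b1 + M / delta + 1.
have Md : 0 <= M / delta by rewrite divr_ge0// ltW.
have [L1 La Lb LM] : [/\ 1 <= L, `|a1| <= L, b1 <= L & M / delta <= L].
  have := normr_ge0 a1; have : 0 <= b1 by []; move: Md; rewrite /L; split; lra.
have L0 : 0 <= L by lra.
have Ld : M <= delta * L ^+ 2.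
  by rewrite -ler_pdivrMl// mulrC (le_trans LM)// expr2 ler_peMr.
pose K : set R3 := (`[0, T] `*` `[- L, L]) `*` `[0, L].
have cK : compact K by apply: compact_setX; [apply: compact_setX|]; exact: segment_compact.
have K1 : K (T, a1, b1).
  split => /=; first split => /=; rewrite in_itv/= ?T0 ?lexx//.
  - by rewrite -ler_norml.
  - by rewrite Lb andbT.
have cpsi : {within K, continuous psi}.
  apply: continuous_subspaceT => p; apply: seq_continuous_at => u up.
  have u1 : (u n).1 @[n --> \oo] --> p.1 by apply: (cvg_comp _ _ up); exact: cvg_fst.
  have u2 : (u n).2 @[n --> \oo] --> p.2 by apply: (cvg_comp _ _ up); exact: cvg_snd.
  have u11 : (u n).1.1 @[n --> \oo] --> p.1.1 by apply: (cvg_comp _ _ u1); exact: cvg_fst.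
  have u12 : (u n).1.2 @[n --> \oo] --> p.1.2 by apply: (cvg_comp _ _ u1); exact: cvg_snd.
  apply: cvgD.
    apply: (@hs_cvg R N h M (fun n => Num.sqrt (2 * (u n).1.1)) (fun n => ((u n).1.2, (u n).2, 0)) _ _ mh hM ch).
      apply: continuous_cvg; first exact: sqrt_continuous.
      by apply: cvgM => //; exact: cvg_cst.
    by apply: cvg_pair2; [apply: cvg_pair2|exact: cvg_cst].
  apply: cvgM; first exact: cvg_cst.
  apply: cvgD; last by apply: cvgM => //; exact: cvg_cst.
  by apply: cvgD; [exact: (cvgM u12 u12)|exact: (cvgM u2 u2)].
have [[[t0 a0] b0] + minp] := compact_EVT_min (ex_intro _ _ K1) cK cpsi.
rewrite inE => -[[/=]]; rewrite !in_itv/= => /andP[t00 t0T] _ /andP[b00 _].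
set m0 := psi (t0, a0, b0).
have m00 : m0 < 0.
  apply: (@le_lt_trans _ _ (psi (T, a1, b1))); first by apply: minp; rewrite inE.
  rewrite /psi/= -(screw_slice k0 x1 (Wodd T)) WT -/q; lra.
have low t x : 0 <= t <= T -> 0 <= helix k x ->
    m0 - delta * (x.1.1 ^+ 2 + x.1.2 ^+ 2 + 5 * t) <= W t x.
  move=> tT hx; rewrite (screw_slice k0 x (Wodd t)) -(slice_norm k x).
  set a := _ * _ + _ * _; set b := helix k x in hx *.
  rewrite lerBlDr; have [ab|ab] := pselect (`|a| <= L /\ b <= L).
    apply: (minp (t, a, b)); rewrite inE; split; first split; rewrite /= in_itv//=.
    - by rewrite -ler_norml; case: ab.
    - by rewrite hx; case: ab.
  apply: (@le_trans _ _ 0); first exact: ltW.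
  have := hs_bound N mh hM (Num.sqrt (2 * t)) (a, b, 0).
  rewrite ler_norml -/(W t) => /andP[h1 _].
  apply: (@le_trans _ _ (- M + M)); first by rewrite addNr.
  apply: lerD => //; apply: (le_trans Ld); rewrite ler_wpM2l ?(ltW d0)//.
  have t5 : 0 <= 5 * t by rewrite mulr_ge0//; case/andP: tT.
  have [aL|aL] := lerP `|a| L; last first.
    have : L ^+ 2 <= a ^+ 2.
      by rewrite -(real_normK (num_real a)) lerXn2r ?nnegrE// ltW.
    have := sqr_ge0 b; lra.
  have [bL|bL] := lerP b L; first by exfalso; apply: ab.
  have : L ^+ 2 <= b ^+ 2 by rewrite lerXn2r ?nnegrE// ltW.
  have := sqr_ge0 a; lra.
have hx0 (a b : R) : helix k (a, b, 0) = b by rewrite /helix/= mulr0 cos0 sin0; ring.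
have nn : 0 <= delta * (a0 ^+ 2 + b0 ^+ 2 + 5 * t0).
  by rewrite mulr_ge0 ?(ltW d0)// !addr_ge0 ?sqr_ge0// mulr_ge0.
(* The negative minimum is not at time 0, where [h] is nonnegative on this side, nor at [b0 = 0],
   that is on the helicoid, where the class vanishes. Hence [heat_min_contra] applies. *)
have t0p : 0 < t0.
  rewrite lt_neqAle t00 andbT; apply/eqP => t0E.
  have W0 : 0 <= W t0 (a0, b0, 0).
    by rewrite -t0E /W mulr0 sqrtr0 hs0; apply: hp; rewrite hx0.
  by have := m00; rewrite ltNge => /negP; apply; exact: addr_ge0.
have b0p : 0 < b0.
  rewrite lt_neqAle b00 andbT; apply/eqP => b0E.
  have := m00; rewrite /m0 /psi/= (screw_zero k0 (Wodd t0)) ?hx0//.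
  by rewrite add0r ltNge nn.
have WM t x : `|W t x| <= M := hs_bound N mh hM _ x.
apply: (@heat_min_contra W M delta m0 t0 (a0, b0, 0)) => //.
- by move=> t; exact: measurable_hs mh hM _.
- move=> t tau x tge tauge.
  apply: (hs_semigroup gN mh hM); rewrite !sqr_sqrtr ?mulr_ge0 ?addr_ge0//; ring.
- exact: ltW.
- by rewrite hx0.
- by move=> t x /andP[h1 h2]; apply: low; rewrite h1 (le_trans h2).
- by rewrite /m0 /psi/=; ring.
Qed.

End cone_preservation.

(** * Gamma integrals and the resolvent kernel *)

Section half_line.
Variable R : realType.
Local Notation mu := (@lebesgue_measure R).
Implicit Types (f G : R -> R).

Definition poscut f (t : R) : R := if 0 < t then f t else 0.

Lemma poscut_ge0 f : (forall t : R, 0 < t -> 0 <= f t) -> forall t, 0 <= poscut f t.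
Proof. by move=> f0 t; rewrite /poscut; case: ifPn => // /f0. Qed.

Lemma poscutE f t : 0 < t -> poscut f t = f t.
Proof. by rewrite /poscut => ->. Qed.

Lemma measurable_poscut f : (forall t : R, 0 < t -> {for t, continuous f}) ->
  measurable_fun setT (poscut f).
Proof.
move=> cf; rewrite (_ : poscut f = f \_ `]0, +oo[); last first.
  apply/funext => t; rewrite /poscut /patch; case: ifPn => t0.
    by rewrite mem_set//= in_itv/= andbT.
  by rewrite memNset//= in_itv/= andbT; apply/negP.
apply/(measurable_restrictT f (measurable_itv _)).
apply: open_continuous_measurable_fun; first exact: interval_open.
by move=> t; rewrite inE/= in_itv/= andbT; exact: cf.
Qed.

Lemma exhaust_integral (f : R -> R) (a b : nat -> R) :
  measurable_fun setT f -> (forall t, 0 <= f t) ->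
  {homo a : n m / (n <= m)%N >-> m <= n} -> {homo b : n m / (n <= m)%N >-> n <= m} ->
  (forall t, f t != 0 -> exists n, a n <= t <= b n) ->
  (\int[mu]_(t in `[a n, b n]) (f t)%:E)%E @[n --> \oo] --> (\int[mu]_t (f t)%:E)%E.
Proof.
move=> mf f0 ha hb cov.
pose F n : set R := `[a n, b n]%classic.
have mfE : measurable_fun [set: R] (fun t => (f t)%:E) by exact/measurable_EFinP.
have -> : (\int[mu]_t (f t)%:E = \int[mu]_(t in \bigcup_n F n) (f t)%:E)%E.
  rewrite [RHS]integral_mkcond; apply: eq_integral => t _; rewrite patchE; case: ifPn => //.
  rewrite notin_setE/= => nt; have [->//|/cov[n tn]] := eqVneq (f t) 0.
  by exfalso; apply: nt; exists n => //; rewrite /F/= in_itv.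
apply: ge0_nondecreasing_set_cvg_integral => //.
- move=> n m nm; apply/subsetPset => t; rewrite /F/= !in_itv/= => /andP[h1 h2].
  by rewrite (le_trans (ha _ _ nm))// (le_trans h2)// hb.
- by move=> n; exact: measurable_funTS.
- by move=> n t _; rewrite lee_fin.
Qed.

Lemma exhaust_natI (f : R -> R) : measurable_fun setT f -> (forall t, 0 <= f t) ->
  (forall t, t <= 0 -> f t = 0) ->
  (\int[mu]_(t in `[(n.+1%:R^-1)%R, (n.+1%:R)%R]) (f t)%:E)%E @[n --> \oo] --> (\int[mu]_t (f t)%:E)%E.
Proof.
move=> mf f0 fN; apply: exhaust_integral => //.
- by move=> n m nm; rewrite lef_pV2 ?posrE ?ler_nat.
- by move=> n m nm; rewrite ler_nat.
move=> t; have [/fN ->|t0] := leP t 0; first by rewrite eqxx.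
move=> _; pose n := maxn (Num.truncn t) (Num.truncn t^-1); exists n.
apply/andP; split; last first.
  by rewrite ltW// (lt_le_trans (truncnS_gt _))// ler_nat ltnS leq_maxl.
rewrite -(invrK t) lef_pV2 ?posrE ?invr_gt0//.
by rewrite ltW// (lt_le_trans (truncnS_gt _))// ler_nat ltnS leq_maxr.
Qed.

Lemma measurable_EFin_R f : measurable_fun setT f ->
  measurable_fun [set: measurableTypeR R] (fun t => (f t)%:E).
Proof. by move=> mf; exact/measurable_EFinP. Qed.

(** On each [[1 / (n + 1), n + 1]] the integral is a difference of two values of [F], and these
    intervals exhaust the half-line. *)
Lemma FTC_ge0_bound (F f : R -> R) (B : R) :
  (forall t : R, 0 < t -> is_derive t 1 F (f t)) ->
  (forall t : R, 0 < t -> {for t, continuous f}) ->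
  (forall t : R, 0 < t -> 0 <= f t) -> (forall t : R, 0 < t -> `|F t| <= B) ->
  (\int[mu]_t (poscut f t)%:E <= (2 * B)%:E)%E.
Proof.
move=> dF cf f0 FB.
have := exhaust_natI (measurable_poscut cf) (poscut_ge0 f0).
move=> /(_ _)/cvg_lim-/(_ _ _) <-//; last first.
  by move=> t; rewrite /poscut leNgt; case: ifP.
apply: lime_le.
  apply: ereal_nondecreasing_is_cvgn => n m nm; apply: ge0_subset_integral => //.
  - by apply/measurable_EFinP; apply: measurable_funTS; exact: measurable_poscut.
  - by move=> t _; rewrite lee_fin poscut_ge0.
  - move=> t /=; rewrite !in_itv/= => /andP[h1 h2]; apply/andP; split.
      by rewrite (le_trans _ h1)// lef_pV2 ?posrE ?ler_nat.
    by rewrite (le_trans h2)// ler_nat.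
apply: nearW => n.
have n0 : 0 < n.+1%:R^-1 :> R by rewrite invr_gt0.
(* The fundamental theorem asks for distinct endpoints, which fails only for [n = 0], where the
   interval is the point 1. *)
have [n1|n1] := leP (n.+1%:R : R) n.+1%:R^-1.
  rewrite (_ : `[n.+1%:R^-1, n.+1%:R] = if n == 0%N then [set 1] else set0).
    case: ifP => _; rewrite ?integral_set0 ?integral_set1 lee_fin mulr_ge0// (le_trans _ (FB 1 _))//.
  case: n n0 n1 => [|n] n0 n1; first by rewrite /= invr1 set_itv1.
  exfalso; move: n1; rewrite leNgt => /negP; apply.
  by rewrite (@lt_trans _ _ 1)// ?ltr1n// invf_lt1// ltr1n.
have pos (t : R) : n.+1%:R^-1 <= t -> 0 < t by exact: lt_le_trans.
have cF (t : R) : 0 < t -> {for t, continuous F}.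
  by move=> /dF [dt _]; apply/differentiable_continuous/derivable1_diffP.
have <- : (\int[mu]_(x in `[(n.+1%:R^-1)%R, (n.+1%:R)%R]) (f x)%:E = \int[mu]_(x in `[(n.+1%:R^-1)%R, (n.+1%:R)%R]) (poscut f x)%:E)%E.
  by apply: eq_integral => t; rewrite inE/= in_itv/= => /andP[/pos t0 _]; rewrite poscutE.
rewrite (continuous_FTC2 n1 (F := F)).
- rewrite -EFinB lee_fin mulr_natl mulr2n (le_trans (ler_norm _))// (le_trans (ler_normB _ _))//.
  by rewrite lerD// FB.
- apply: continuous_in_subspaceT => t; rewrite inE/= in_itv/= => /andP[/pos t0 _]; exact: cf.
- split.
  + by move=> t; rewrite in_itv/= => /andP[/ltW/pos/dF[]].
  + by apply: cvg_at_right_filter; exact: cF.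
  + by apply: cvg_at_left_filter; exact: cF.
- by move=> t; rewrite in_itv/= => /andP[/ltW/pos/dF[_ +] _]; rewrite derive1E.
Qed.

(** The substitution [x = 1 / (t + c)], decreasing from the half-line onto []0, 1 / c[], or onto the
    half-line when [c = 0]. The value 0 turns inverse Gamma integrals into Gamma integrals, and
    [c = 1 / r] treats convolutions over []0, r[]. *)
Lemma inversion_integral G (c : R) : 0 <= c ->
  (forall t : R, 0 < t -> c * t < 1 -> {for t, continuous G}) -> (forall t : R, 0 < t -> 0 <= G t) ->
  (\int[mu]_x (if (0 < x) && (c * x < 1) then G x else 0)%:E =
   \int[mu]_x (poscut (fun t => G (t + c)^-1 * (t + c) ^- 2) x)%:E)%E.
Proof.
move=> c0 cG G0.
pose F (t : R) := (t + c)^-1.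
pose f1 (x : R) := if (0 < x) && (c * x < 1) then G x else 0.
pose f2 (t : R) := G (F t) * (t + c) ^- 2.
have F0 (t : R) : 0 < t -> 0 < F t by move=> t0; rewrite invr_gt0 ltr_pwDl.
have cF (t : R) : 0 < t -> {for t, continuous F}.
  move=> t0; apply: continuousV; first by rewrite gt_eqF// ltr_pwDl.
  by apply: cvgD; [exact: cvg_id|exact: cvg_cst].
have dF (t : R) : 0 < t -> is_derive (t : R) (1 : R) F (- (t + c) ^- 2).
  move=> t0; have tc : (shift c : R -> R) t != 0 by rewrite /= gt_eqF// ltr_pwDl.
  have H := @is_deriveV R (shift c) t 1 1 tc (is_derive_shift t 1 c).
  by apply: is_derive_eq; rewrite scaler1.
have cF' (t : R) : 0 < t -> {for t, continuous (fun t : R => - (t + c) ^- 2)}.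
  move=> t0; rewrite (_ : (fun t : R => _) = fun t => - (F t * F t)).
    by apply: cvgN; apply: cvgM; exact: cF.
  by apply/funext => z; rewrite /F expr2 invfM.
have EF' (t : R) : 0 < t -> (derive1 F) t = - (t + c) ^- 2.
  by move=> t0; rewrite derive1E; have [_ ->] := dF t t0.
have cFd (t : R) : 0 < t -> {for t, continuous (derive1 F)}.
  move=> t0; rewrite /prop_for/continuous_at EF'//; apply: cvg_trans (cF' t t0).
  by apply: near_eq_cvg; near=> z; rewrite EF'//; near: z; exact: lt_nbhsr.
have cFlt (t : R) : 0 < t -> c * F t < 1.
  by move=> t0; rewrite ltr_pdivrMr ?ltr_pwDl// mul1r ltrDr.
have cf2 (t : R) : 0 < t -> {for t, continuous f2}.
  move=> t0; apply: continuousM; first by apply: continuous_comp; [exact: cF|apply: cG; [exact: F0|exact: cFlt]].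
  rewrite (_ : (fun t : R => _) = fun t => F t * F t).
    by apply: cvgM; exact: cF.
  by apply/funext => z; rewrite /F expr2 invfM.
have f20 (t : R) : 0 < t -> 0 <= f2 t.
  by move=> t0; rewrite mulr_ge0// ?G0 ?F0// invr_ge0 sqr_ge0.
have oD : open [set x : R | 0 < x /\ c * x < 1].
  apply: openI; first exact: open_gt.
  by apply: (@open_comp _ _ (fun x : R => c * x) [set y | y < 1]); [move=> x _; exact: mulrl_continuous|exact: open_lt].
have mf1 : measurable_fun setT f1.
  rewrite (_ : f1 = G \_ [set x : R | 0 < x /\ c * x < 1]); last first.
    apply/funext => x; rewrite /f1 patchE; case: ifPn => [/andP h|/negP h]; first by rewrite mem_set.
    by rewrite memNset//= => -[h1 h2]; apply: h; rewrite h1 h2.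
  apply/(measurable_restrictT G (open_measurable oD)).
  by apply: open_continuous_measurable_fun => // x; rewrite inE/= => -[x0 cx]; exact: cG.
have f10 x : 0 <= f1 x by rewrite /f1; case: ifPn => // /andP[/G0].
pose a (n : nat) := F n.+1%:R; pose b (n : nat) := F n.+1%:R^-1.
have n0 n : (0 : R) < n.+1%:R by [].
have n1 n : (0 : R) < n.+1%:R^-1 by rewrite invr_gt0.
have H1 := @exhaust_integral f1 a b mf1 f10.
have apos n : 0 < a n by exact: F0.
have homF (x y : R) : 0 < x -> x <= y -> F y <= F x.
  by move=> x0 xy; rewrite lef_pV2 ?posrE ?ltr_pwDl// ?lerD2r// (lt_le_trans x0).
have {H1} H1 : (\int[mu]_(t in `[a n, b n]) (f1 t)%:E)%E @[n --> \oo] --> (\int[mu]_t (f1 t)%:E)%E.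
  apply: H1.
  - by move=> n m nm; apply: homF; rewrite ?ler_nat.
  - by move=> n m nm; apply: homF => //; rewrite lef_pV2 ?posrE ?ler_nat.
  move=> x; rewrite /f1; case: ifPn => [/andP[x0 cx] _|]; last by rewrite eqxx.
  have y0 : 0 < x^-1 - c by rewrite subr_gt0 -div1r ltr_pdivlMr.
  pose n := maxn (Num.truncn (x^-1 - c)) (Num.truncn (x^-1 - c)^-1); exists n.
  have xE : x = F (x^-1 - c) by rewrite /F subrK invrK.
  rewrite xE; apply/andP; split; apply: homF => //.
    by rewrite ltW// (lt_le_trans (truncnS_gt _))// ler_nat ltnS leq_maxl.
  rewrite -[leRHS]invrK lef_pV2 ?posrE ?invr_gt0//.
  by rewrite ltW// (lt_le_trans (truncnS_gt _))// ler_nat ltnS leq_maxr.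
have z2 (t : R) : t <= 0 -> poscut f2 t = 0 by move=> t0; rewrite /poscut ltNge t0.
have H2 := @exhaust_natI (poscut f2) (measurable_poscut cf2) (poscut_ge0 f20) z2.
rewrite -/f2; move: H1; rewrite (_ : (fun n => _) = 
  fun n => (\int[mu]_(t in `[(n.+1%:R^-1)%R, (n.+1%:R)%R]) (poscut f2 t)%:E)%E).
  by move=> H1; exact: (cvg_unique (@ereal_hausdorff R) H1 H2).
apply/funext => n.
have pos (t : R) : n.+1%:R^-1 <= t -> 0 < t by exact: lt_le_trans.
have apos2 (t : R) : a n <= t -> 0 < t by exact: lt_le_trans.
have abc (t : R) : a n <= t -> t <= b n -> c * t < 1.
  move=> an bn; have t0 : 0 < t := apos2 _ an.
  have sc : 0 < n.+1%:R^-1 + c by rewrite ltr_pwDl.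
  move: bn; rewrite /b /F -[leRHS]mul1r ler_pdivlMr// mulrDr [t * c]mulrC => h.
  by rewrite (lt_le_trans _ h)// ltrDr mulr_gt0.
transitivity (\int[mu]_(t in `[(n.+1%:R^-1)%R, (n.+1%:R)%R]) (((G \o F) * - (derive1 F)) t)%:E)%E; last first.
  apply: eq_integral => t; rewrite inE/= in_itv/= => /andP[/pos t0 _].
  rewrite poscutE//; congr EFin; rewrite -[LHS]/(G (F t) * - derive1 F t).
  by rewrite EF'// opprK.
transitivity (\int[mu]_(t in `[a n, b n]) (G t)%:E)%E.
  apply: eq_integral => t; rewrite inE/= in_itv/= => /andP[an bn].
  have t0 : 0 < t := apos2 _ an.
  by rewrite /f1 t0 (abc _ an bn).
rewrite /a /b; apply: integration_by_substitution_decreasing.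
- by rewrite (@le_trans _ _ 1)// ?invf_le1// ler1n.
- move=> x y; rewrite !in_itv/= => /andP[/pos x0 _] /andP[/pos y0 _] xy.
  have yc : 0 < y + c by rewrite ltr_pwDl.
  have xc : 0 < x + c by rewrite ltr_pwDl.
  by rewrite /F ltf_pV2 ?posrE// ltrD2r.
- by move=> t; rewrite in_itv/= => /andP[/ltW/pos t0 _]; exact: cFd.
- by apply/cvg_ex; exists ((derive1 F) (n.+1%:R^-1)); apply: cvg_at_right_filter; exact: cFd.
- by apply/cvg_ex; exists ((derive1 F) n.+1%:R); apply: cvg_at_left_filter; exact: cFd.
- split.
  + by move=> t; rewrite in_itv/= => /andP[/ltW/pos/dF[]].
  + by apply: cvg_at_right_filter; exact: cF.
  + by apply: cvg_at_left_filter; exact: cF.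
- by apply: continuous_in_subspaceT => t; rewrite inE/= in_itv/= => /andP[an bn]; apply: cG; [exact: apos2|exact: abc].
Unshelve. all: by end_near. Qed.

(** Cut to positive times, so that convolutions on the half-line are integrals over all of [R]. The
    exponent is shifted as in the Gamma integral. *)
Definition pw (b t : R) : R := if 0 < t then t `^ (b - 1) else 0.

Lemma pwE b t : 0 < t -> pw b t = t `^ (b - 1).
Proof. by rewrite /pw => ->. Qed.

Lemma pw_ge0 b t : 0 <= pw b t.
Proof. by rewrite /pw; case: ifP => // _; exact: powR_ge0. Qed.

Lemma pw_gt0 b t : 0 < t -> 0 < pw b t.
Proof. by move=> t0; rewrite pwE// powR_gt0. Qed.

Lemma pw_le0 b t : t <= 0 -> pw b t = 0.
Proof. by move=> t0; rewrite /pw ltNge t0. Qed.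

Lemma measurable_pw b : measurable_fun setT (pw b).
Proof.
apply: (@measurable_fun_ifT _ _ _ _ (fun t => t `^ (b - 1)) (cst 0) (fun t => 0 < t)).
- exact: measurable_fun_ltr.
- exact: measurable_powR.
- exact: measurable_cst.
Qed.

Lemma continuous_powR b (t : R) : 0 < t -> {for t, continuous (fun t : R => t `^ b)}.
Proof.
move=> t0; apply: differentiable_continuous; apply/derivable1_diffP.
by have [] := @is_derive1_powR R b t t0.
Qed.

Lemma pw_scale b (c t : R) : 0 < c -> pw b (c * t) = c `^ (b - 1) * pw b t.
Proof.
move=> c0; rewrite /pw pmulr_rgt0//; case: ifPn => [t0|]; last by rewrite mulr0.
by rewrite powRM// ltW.
Qed.

Lemma pwD b c t : 0 < t -> pw (b + c) t = pw b t * t `^ c.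
Proof.
move=> t0; rewrite !pwE// -powRD; first by congr powR; ring.
by rewrite (gt_eqF t0) implybT.
Qed.

Lemma pw1 t : 0 < t -> pw 1 t = 1.
Proof. by move=> t0; rewrite pwE// subrr powRr0. Qed.

Lemma powR_onem_bound (a t : R) : 0 < a -> 0 < t ->
  a * (t `^ (a - 1) * (1 + t) `^ (- (a + 1))) = a * (t / (1 + t)) `^ (a - 1) * (1 + t) ^- 2.
Proof.
move=> a0 t0; have t1 : 0 < 1 + t by rewrite ltr_pwDl// ltW.
rewrite powRM ?invr_ge0 ?ltW// -powR_inv1 ?ltW// -powRrM -mulrA -[in RHS]mulrA.
congr (_ * (_ * _)); rewrite -(powR_invn 2 (ltW t1)) -powRD; last by rewrite (gt_eqF t1) implybT.
by congr powR; ring.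
Qed.

(** The integrand is the derivative of [(t / (1 + t))^a / a], which lies between 0 and [1 / a]. It
    serves as majorant both for powers near 0 and for the Gamma integrand. *)
Lemma integral_tail_bound (a : R) : 0 < a ->
  (\int[mu]_t (pw a t * (1 + t) `^ (- (a + 1)))%:E <= (2 / a)%:E)%E.
Proof.
move=> a0.
pose g (t : R) := 1 - (t + 1)^-1.
pose F (t : R) := a^-1 * g t `^ a.
pose f (t : R) := t `^ (a - 1) * (1 + t) `^ (- (a + 1)).
have p1 (t : R) : 0 < t -> 0 < 1 + t by move=> t0; rewrite ltr_pwDl// ltW.
have gE (x : R) : 0 < x -> g x = x / (1 + x).
  by move=> x0; rewrite /g [x + 1]addrC; field; rewrite gt_eqF// p1.
have dF (t : R) : 0 < t -> is_derive t (1 : R) F (f t).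
  move=> t0; have tc : (shift 1 : R -> R) t != 0 by rewrite /= addrC gt_eqF// p1.
  have dg : is_derive t (1 : R) g ((1 + t) ^- 2).
    have H := @is_deriveV R (shift 1) t 1 1 tc (is_derive_shift t 1 1).
    have := @is_deriveB _ _ _ (cst (1 : R)) _ t 1 _ _ (is_derive_cst _ _ _) H.
    move=> H'; rewrite (_ : _ ^- 2 = 0 - (- (shift 1 t) ^- 2) *: (1 : R)) //.
    by rewrite [X in _ = 0 - X]mulr1 sub0r opprK/= addrC.
  have g0 : 0 < g t by rewrite gE// divr_gt0// p1.
  have H := @is_derive1_comp _ (fun t => t `^ a) g t _ _ (is_derive1_powR a g0) dg.
  have H2 := @is_deriveZ _ _ _ _ a^-1 t 1 _ H.
  rewrite (_ : f t = a^-1 * (a * g t `^ (a - 1) * (1 + t) ^- 2)); first exact: H2.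
  by rewrite /f gE// -powR_onem_bound// mulKf// gt_eqF.
have -> : (\int[mu]_t (pw a t * (1 + t) `^ (- (a + 1)))%:E = \int[mu]_t (poscut f t)%:E)%E.
  apply: eq_integral => t _; rewrite /poscut /f /pw; case: ifP => // _; by rewrite mul0r.
apply: (@FTC_ge0_bound F f a^-1) => //.
- move=> t t0; apply: continuousM; first exact: continuous_powR.
  apply: (@continuous_comp _ _ _ (fun t : R => 1 + t) (fun t : R => t `^ (- (a + 1)))).
    by apply: cvgD; [exact: cvg_cst|exact: cvg_id].
  by apply: continuous_powR; exact: p1.
- by move=> t t0; rewrite mulr_ge0 ?powR_ge0.
- move=> t t0; have h0 : 0 <= g t by rewrite gE// divr_ge0 ?ltW// p1.
  rewrite /F ger0_norm ?mulr_ge0 ?invr_ge0 ?powR_ge0 ?(ltW a0)// ler_piMr ?invr_ge0 ?(ltW a0)//.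
  apply: (@le_trans _ _ (1 `^ a)); last by rewrite powR1.
  rewrite ge0_ler_powR ?nnegrE ?(ltW a0)//.
  by rewrite /g gerBl invr_ge0 addr_ge0// ltW.
Qed.

(** For [a <= 3] the power [(1 + t)^(a + 1)] is at most [(1 + t)^4], and [1 + t <= 4 expR (t / 4)].
    The range covers the three exponents in use, [al], [1 - al] and [al + 3 / 2]. *)
Lemma expR_poly_bound (a t : R) : 0 < a <= 3 -> 0 < t ->
  expR (- t) <= 4 ^+ 4 * (1 + t) `^ (- (a + 1)).
Proof.
move=> /andP[a0 a3] t0; have t1 : 1 <= 1 + t by rewrite lerDl ltW.
have t10 : 0 < 1 + t by lra.
rewrite expRN powRN -[leLHS]div1r ler_pdivrMr ?expR_gt0// mulrAC ler_pdivlMr ?powR_gt0// mul1r.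
apply: (@le_trans _ _ ((1 + t) ^+ 4)).
  rewrite -powR_mulrn; last exact: ltW.
  by apply: ler_powR => //; lra.
have h : 1 + t <= 4 * expR (t / 4).
  have := expR_ge1Dx (t / 4); lra.
rewrite (_ : expR t = expR (t / 4) ^+ 4); last first.
  by rewrite -expRM_natl; congr expR; field.
rewrite -exprMn.
by rewrite lerXn2r ?nnegrE// ?ltW// mulr_gt0 ?expR_gt0.
Qed.

Lemma measurable_tail (a : R) : measurable_fun setT (fun t => pw a t * (1 + t) `^ (- (a + 1))).
Proof.
apply: measurable_funM; first exact: measurable_pw.
apply: (measurableT_comp (measurable_powR _)).
by apply: measurable_funD.
Qed.

Lemma ge0_integralZ (c : R) f : 0 <= c -> measurable_fun setT f -> (forall t, 0 <= f t) ->
  (\int[mu]_t (c * f t)%:E = c%:E * \int[mu]_t (f t)%:E)%E.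
Proof.
move=> c0 mf f0; rewrite -(@ge0_integralZl_EFin _ _ _ mu setT measurableT (EFin \o f))//.
- by move=> t _ /=; rewrite lee_fin.
- exact: (measurable_EFin_R mf).
Qed.

Lemma integral_pw1_lty (b : R) : 0 < b -> (\int[mu]_t (if t < 1 then pw b t else 0)%:E < +oo)%E.
Proof.
move=> b0; apply: (@le_lt_trans _ _ (\int[mu]_t ((2 `^ (b + 1)) * (pw b t * (1 + t) `^ (- (b + 1))))%:E)%E).
  apply: ge0_le_integral => //.
  - by move=> t _; rewrite lee_fin; case: ifP => // _; exact: pw_ge0.
  - apply/measurable_EFinP; apply: measurable_fun_ifT => //; last exact: measurable_pw.
    exact: measurable_fun_ltr.
  - by apply: measurable_EFin_R; apply: measurable_funM => //; exact: measurable_tail.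
  - move=> t _; rewrite lee_fin; case: ifPn => [t1|_]; last first.
      by rewrite !mulr_ge0 ?powR_ge0 ?pw_ge0.
    have [t0|t0] := leP t 0; first by rewrite pw_le0// mul0r mulr0.
    rewrite mulrCA ler_peMr ?pw_ge0// powRN ler_pdivlMr ?powR_gt0 ?addr_gt0// mul1r.
    by rewrite ge0_ler_powR ?nnegrE ?addr_ge0 ?ltW//; lra.
rewrite ge0_integralZ ?powR_ge0//; last 2 first.
- exact: measurable_tail.
- by move=> t; rewrite mulr_ge0 ?pw_ge0 ?powR_ge0.
apply: lte_mul_pinfty; rewrite ?lee_fin ?powR_ge0//.
exact: (le_lt_trans (integral_tail_bound b0) (ltry _)).
Qed.

Lemma Gamma_fin (a : R) : 0 < a <= 3 -> (\int[mu]_t (pw a t * expR (- t))%:E < +oo)%E.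
Proof.
move=> a03; have a0 : 0 < a by case/andP: a03.
apply: (@le_lt_trans _ _ (\int[mu]_t (4 ^+ 4 * (pw a t * (1 + t) `^ (- (a + 1))))%:E)%E).
  apply: ge0_le_integral => //.
  - by move=> t _; rewrite lee_fin mulr_ge0 ?pw_ge0 ?expR_ge0.
  - apply/measurable_EFinP; apply: measurable_funM; first exact: measurable_pw.
    by apply: measurableT_comp => //.
  - by apply: measurable_EFin_R; apply: measurable_funM => //; exact: measurable_tail.
  - move=> t _; rewrite lee_fin.
    have [t0|t0] := leP t 0; first by rewrite pw_le0// !mul0r mulr0.
    by rewrite mulrCA ler_wpM2l ?pw_ge0// expR_poly_bound.
rewrite ge0_integralZ//; last 2 first.
- exact: measurable_tail.
- by move=> t; rewrite mulr_ge0 ?pw_ge0 ?powR_ge0.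
apply: lte_mul_pinfty; rewrite ?lee_fin//.
exact: (le_lt_trans (integral_tail_bound a0) (ltry _)).
Qed.

Lemma GammaE (a : R) : 0 < a <= 3 -> (Gamma a)%:E = (\int[mu]_t (pw a t * expR (- t))%:E)%E.
Proof.
move=> a03.
have E : (\int[mu]_(t in `]0%R, +oo[) (t `^ (a - 1) * expR (- t))%:E = \int[mu]_t (pw a t * expR (- t))%:E)%E.
  rewrite integral_mkcond; apply: eq_integral => t _; rewrite patchE /pw.
  case: ifPn => [|]; first by rewrite inE/= in_itv/= andbT => ->.
  by rewrite notin_setE/= in_itv/= andbT => /negP/negbTE ->; rewrite mul0r.
rewrite /Gamma /Rintegral fineK; first exact: E.
rewrite E ge0_fin_numE; first exact: Gamma_fin.
by apply: integral_ge0 => t _; rewrite lee_fin mulr_ge0 ?pw_ge0 ?expR_ge0.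
Qed.

Lemma measurable_gammaf (a c : R) : measurable_fun setT (fun t => pw a t * expR (- c * t)).
Proof.
apply: measurable_funM; first exact: measurable_pw.
by apply: measurableT_comp => //; exact: measurable_funM.
Qed.

Lemma integral_gt0_on (f : R -> R) (a b e : R) : a < b -> 0 < e ->
  measurable_fun setT f -> (forall t, 0 <= f t) -> (forall t, a <= t <= b -> e <= f t) ->
  (0 < \int[mu]_t (f t)%:E)%E.
Proof.
move=> ab e0 mf f0 fe.
apply: (@lt_le_trans _ _ (\int[mu]_(t in `[a, b]) (e%:E))%E).
  rewrite integral_cst//= lebesgue_measure_itv/= lte_fin ab -EFinB -EFinM lte_fin.
  by rewrite mulr_gt0// subr_gt0.
rewrite integral_mkcond; apply: ge0_le_integral => //.
- by move=> t _; rewrite patchE; case: ifP => // _; rewrite lee_fin ltW.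
- by apply/(measurable_restrictT _ _).1 => //.
- exact: measurable_EFin_R.
- move=> t _; rewrite patchE; case: ifPn; last by rewrite lee_fin.
  by rewrite inE/= in_itv/= => /fe; rewrite lee_fin.
Qed.

Lemma Gamma_gt0 (a : R) : 0 < a <= 3 -> 0 < Gamma a.
Proof.
move=> a03; have a0 : 0 < a by case/andP: a03.
rewrite -lte_fin GammaE//.
apply: (@integral_gt0_on _ 1 2 (2^-1 * expR (- 2))) => //.
- by rewrite ltr1n.
- by have := measurable_gammaf a 1; under eq_fun do rewrite mulN1r.
- by move=> t; rewrite mulr_ge0 ?pw_ge0 ?expR_ge0.
move=> t /andP[t1 t2]; have t0 : 0 < t by lra.
apply: ler_pM; rewrite ?expR_ge0//; last by rewrite ler_expR lerN2.
rewrite pwE//; apply: (@le_trans _ _ (t `^ (-1))).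
  by rewrite (powR_inv1 (ltW t0)) lef_pV2 ?posrE.
by apply: ler_powR => //; lra.
Qed.

Lemma ge0_integral_scale (c : R) f : 0 < c -> measurable_fun setT f -> (forall t, 0 <= f t) ->
  (\int[mu]_t (f (c * t))%:E = c^-1%:E * \int[mu]_t (f t)%:E)%E.
Proof.
move=> c0 mf f0.
have H := @ge0_integral_affine R c 0 (fun t => (f t)%:E) (lt0r_neq0 c0) (measurable_EFin_R mf) (fun t => _).
rewrite H; last by move=> t; rewrite lee_fin.
rewrite muleA -EFinM gtr0_norm// mulVf ?gt_eqF// mul1e.
by apply: eq_integral => t _; rewrite addr0.
Qed.

Lemma ge0_integral_shift (c : R) f : measurable_fun setT f -> (forall t, 0 <= f t) ->
  (\int[mu]_t (f (t + c))%:E = \int[mu]_t (f t)%:E)%E.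
Proof.
move=> mf f0.
have H := @ge0_integral_affine R 1 c (fun t => (f t)%:E) (oner_neq0 _) (measurable_EFin_R mf) (fun t => _).
rewrite H; last by move=> t; rewrite lee_fin.
by rewrite normr1 mul1e; apply: eq_integral => t _; rewrite mul1r.
Qed.

Lemma ge0_integral_reflect (c : R) f : measurable_fun setT f -> (forall t, 0 <= f t) ->
  (\int[mu]_t (f (c - t))%:E = \int[mu]_t (f t)%:E)%E.
Proof.
move=> mf f0; have n1 : (- 1 : R) != 0 by rewrite oppr_eq0 oner_neq0.
have H := @ge0_integral_affine R (- 1) c (fun t => (f t)%:E) n1 (measurable_EFin_R mf) (fun t => _).
rewrite H; last by move=> t; rewrite lee_fin.
by rewrite normrN1 mul1e; apply: eq_integral => t _; rewrite mulN1r addrC.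
Qed.

Lemma gamma_scale (a c : R) : 0 < a <= 3 -> 0 < c ->
  (\int[mu]_t (pw a t * expR (- c * t))%:E = (Gamma a * c `^ (- a))%:E)%E.
Proof.
move=> a03 c0; have a0 : 0 < a by case/andP: a03.
have mg := measurable_gammaf a 1.
have g0 t : 0 <= pw a t * expR (- 1 * t) by rewrite mulr_ge0 ?pw_ge0 ?expR_ge0.
have := ge0_integral_scale c0 mg g0.
under [X in _ = (_ * X)%E -> _]eq_integral do rewrite mulN1r.
rewrite -GammaE// => E.
have : (\int[mu]_x (pw a (c * x) * expR (- 1 * (c * x)))%:E =
  (c `^ (a - 1))%:E * \int[mu]_t (pw a t * expR (- c * t))%:E)%E.
  rewrite -ge0_integralZ ?powR_ge0//; last 2 first.
  - exact: measurable_gammaf.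
  - by move=> t; rewrite mulr_ge0 ?pw_ge0 ?expR_ge0.
  by apply: eq_integral => t _; rewrite pw_scale// mulN1r mulNr mulrA.
(* Finiteness is read off the identity [E2]: an infinite integral would make the finite Gamma value
   infinite. *)
rewrite E => E2; have [z zE] : exists z, (\int[mu]_t (pw a t * expR (- c * t))%:E)%E = z%:E.
  exists (fine (\int[mu]_t (pw a t * expR (- c * t))%:E)); rewrite fineK// ge0_fin_numE.
    rewrite ltey; apply/eqP => zy; move: E2; rewrite zy -EFinM.
    by rewrite gt0_muley ?lte_fin ?powR_gt0.
  by apply: integral_ge0 => t _; rewrite lee_fin mulr_ge0 ?pw_ge0 ?expR_ge0.
move: E2; rewrite zE -!EFinM => -[]; move=> E2; congr EFin.
have cp : 0 < c `^ (a - 1) by rewrite powR_gt0.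
apply: (mulfI (lt0r_neq0 cp)); rewrite -E2 mulrCA -powRD; last by rewrite (gt_eqF c0) implybT.
by rewrite (_ : a - 1 - a = -1); [rewrite powR_inv1 ?ltW// mulrC|ring].
Qed.

Lemma inverse_gamma (a c : R) : 0 < a <= 3 -> 0 < c ->
  (\int[mu]_t (pw (- a) t * expR (- c / t))%:E = (Gamma a * c `^ (- a))%:E)%E.
Proof.
move=> a03 c0; have a0 : 0 < a by case/andP: a03.
pose G (t : R) := t `^ (- a - 1) * expR (- c / t).
have cG (t : R) : 0 < t -> {for t, continuous G}.
  move=> t0; apply: continuousM; first exact: continuous_powR.
  apply: (continuous_comp _ (@continuous_expR R _)).
  by apply: continuousM; [exact: cst_continuous|apply: continuousV; [rewrite gt_eqF|exact: cvg_id]].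
have G0 (t : R) : 0 < t -> 0 <= G t by move=> _; rewrite mulr_ge0 ?powR_ge0 ?expR_ge0.
have := inversion_integral (lexx 0) (fun t t0 _ => cG t t0) G0.
rewrite (_ : (\int[mu]_x (if (0 < x) && (0 * x < 1) then G x else 0)%:E)%E = 
  (\int[mu]_t (pw (- a) t * expR (- c / t))%:E)%E) => [->|]; last first.
  apply: eq_integral => t _; rewrite mul0r ltr01 andbT /pw; case: ifP => //; by rewrite mul0r.
rewrite -gamma_scale//; apply: eq_integral => t _; rewrite /poscut /pw; case: ifPn => [t0|]; last by rewrite mul0r.
rewrite /G addr0 invrK mulrAC; congr (_ * _)%:E.
rewrite -(powR_inv1 (ltW t0)) -powRrM -(powR_invn 2 (ltW t0)) -powRD; last by rewrite (gt_eqF t0) implybT.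
by congr powR; ring.
Qed.

End half_line.

(** * Entire power series *)

Section entire_series.
Variable R : realType.
Implicit Types (u a : nat -> R).

Lemma ratio_to0_bound u (r : nat -> R) :
  (forall n, 0 <= u n) -> (forall n, u n.+1 <= r n * u n) -> r n @[n --> \oo] --> 0 ->
  exists2 C : R, 0 <= C & forall n, u n <= C * 2^-1 ^+ n.
Proof.
move=> u0 ur /cvgrPdist_le /(_ 2^-1) []; first by rewrite invr_gt0.
move=> N _ HN; exists (\sum_(i < N.+1) 2 ^+ i * u i).
  by apply: sumr_ge0 => i _; rewrite mulr_ge0// exprn_ge0.
have small n : (n <= N)%N -> u n <= (\sum_(i < N.+1) 2 ^+ i * u i) * 2^-1 ^+ n.
  move=> nN; rewrite exprVn ler_pdivlMr ?exprn_gt0// mulrC.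
  have nN' : (n < N.+1)%N by [].
  rewrite (bigD1 (Ordinal nN'))//= lerDl; apply: sumr_ge0 => i _.
  by rewrite mulr_ge0// exprn_ge0.
elim=> [|n IH]; first exact: small.
have [nN|nN] := leqP n.+1 N; first exact: small.
apply: (le_trans (ur n)).
apply: (@le_trans _ _ (2^-1 * u n)).
  rewrite ler_wpM2r//; have := HN n; rewrite /= sub0r normrN => /(_ _).
  by move=> h; apply: (le_trans (ler_norm _)); exact: h.
by rewrite exprS mulrCA ler_pM2l// invr_gt0.
Qed.

Definition entire a := forall x : R, 0 <= x -> cvgn (series (fun n => `|a n| * x ^+ n)).

Lemma ratio_entire a (r : nat -> R) : (forall n, `|a n.+1| <= r n * `|a n|) ->
  r n @[n --> \oo] --> 0 -> entire a.
Proof.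
move=> ar r0 x x0.
have [|||C C0 HC] := @ratio_to0_bound (fun n => `|a n| * x ^+ n) (fun n => r n * x).
- by move=> n; rewrite mulr_ge0// exprn_ge0.
- by move=> n; rewrite exprS mulrACA ler_wpM2r ?ar// mulr_ge0// exprn_ge0.
- rewrite -[X in _ --> X](mul0r x); apply: cvgM => //; exact: cvg_cst.
apply: (@series_le_cvg _ _ (fun n => C * 2^-1 ^+ n)) => //.
- by move=> n; rewrite mulr_ge0// exprn_ge0.
- by move=> n; rewrite mulr_ge0// exprn_ge0// invr_ge0.
- have := @is_cvg_geometric_series R C 2^-1; apply.
  by rewrite ger0_norm ?invr_ge0// invf_lt1// ltr1n.
Qed.

Lemma entire_diffs a : entire a -> entire (pseries_diffs a).
Proof.
(* The factor [n.+1] of the differentiated series is at most [2 ^+ n.+1] and [x ^+ n] is at most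
   [(x + 1) ^+ n.+1], so the series of [a] at [2 (x + 1)] dominates. *)
move=> ea x x0; pose y := 2 * (x + 1).
have y0 : 0 <= y by rewrite mulr_ge0// addr_ge0.
apply: (@series_le_cvg _ _ (fun n => `|a n.+1| * y ^+ n.+1)).
- by move=> n; rewrite mulr_ge0// exprn_ge0.
- by move=> n; rewrite mulr_ge0// exprn_ge0.
- move=> n; rewrite /pseries_diffs normrM mulrAC mulrC ler_wpM2l//.
  rewrite ger0_norm//; apply: (@le_trans _ _ (2 ^+ n.+1 * (x + 1) ^+ n.+1)).
    rewrite ler_pM// ?exprn_ge0//.
      by rewrite -natrX ler_nat ltnW// ltn_expl.
    apply: (@le_trans _ _ ((x + 1) ^+ n)); first by rewrite lerXn2r ?nnegrE ?addr_ge0// lerDl.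
    by rewrite exprS ler_peMl ?exprn_ge0 ?addr_ge0// lerDr.
  by rewrite exprMn.
have H := ea y y0; pose u n := `|a n| * y ^+ n.
have -> : series (fun n => `|a n.+1| * y ^+ n.+1) = fun n => series u n.+1 - u 0%N.
  by apply/funext => n; rewrite /series/= big_nat_recl// addrAC subrr add0r.
apply: is_cvgB; last exact: is_cvg_cst.
by move/cvg_ex : H => [l Hl]; apply/cvg_ex; exists l; move: Hl; rewrite -cvg_shiftS.
Qed.

Lemma entire_cvg a (x : R) : entire a -> cvgn (pseries a x).
Proof.
move=> ea; apply: normed_cvg; have := ea `|x| (normr_ge0 _).
by under [X in cvgn X -> _]eq_fun do under eq_bigr do rewrite -normrX -normrM.
Qed.

Definition psum a (x : R) := limn (pseries a x).

Lemma continuous_psum a : entire a -> continuous (psum a).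
Proof.
move=> ea x; have x1 : `|x| < `|(`|x| + 1)| by rewrite [ltRHS]ger0_norm ?addr_ge0// ltrDl.
have [dP _] := @pseries_snd_diffs R a (`|x| + 1) x (@entire_cvg _ _ ea) (@entire_cvg _ _ (entire_diffs ea))
  (@entire_cvg _ _ (entire_diffs (entire_diffs ea))) x1.
by apply: differentiable_continuous; apply/derivable1_diffP.
Qed.

(** Uniform in [N] and in [x] on a ball: this is the constant in the majorants of the Volterra
    equation. *)
Lemma psum_partial_bound a x X : entire a -> `|x| <= X -> forall N,
  `|\sum_(0 <= n < N) a n * x ^+ n| <= limn (series (fun n => `|a n| * X ^+ n)).
Proof.
move=> ea xX N; have X0 : 0 <= X := le_trans (normr_ge0 _) xX.
apply: (le_trans (ler_norm_sum _ _ _)).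
apply: (@le_trans _ _ (series (fun n => `|a n| * X ^+ n) N)).
  by apply: ler_sum => n _; rewrite normrM normrX ler_wpM2l// lerXn2r.
apply: nondecreasing_cvgn_le; last exact: ea.
by apply: nondecreasing_series => n _ _; rewrite mulr_ge0// exprn_ge0.
Qed.

End entire_series.

(** * Beta integrals as convolutions of powers *)

Section beta.
Variable R : realType.
Local Notation mu := (@lebesgue_measure R).

Lemma pw_half (a s : R) : 0 < a -> 2^-1 <= s -> s < 1 -> pw a s <= 2.
Proof.
move=> a0 s2 s1; have s0 : 0 < s by rewrite (lt_le_trans _ s2)// invr_gt0.
rewrite pwE//; apply: (@le_trans _ _ (s `^ (-1))).
  by apply: ger_powR; [rewrite s0 ltW|lra].
by rewrite (powR_inv1 (ltW s0)) -[leRHS]invrK lef_pV2 ?posrE ?invr_gt0.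
Qed.

Lemma measurable_pw_refl (a t : R) : measurable_fun setT (fun s : R => pw a (t - s)).
Proof. by apply: (measurableT_comp (measurable_pw a)); exact: measurable_funB. Qed.

Lemma measurable_beta (a b t : R) : measurable_fun setT (fun s : R => pw a (t - s) * pw b s).
Proof. by apply: measurable_funM; [exact: measurable_pw_refl|exact: measurable_pw]. Qed.

(** On each half of []0, 1[] the factor that is not singular is at most 2 by [pw_half], which leaves
    one integrable singularity at each end. *)
Lemma beta_lty (a b : R) : 0 < a -> 0 < b ->
  (\int[mu]_s (pw a (1 - s) * pw b s)%:E < +oo)%E.
Proof.
move=> a0 b0; pose h c (s : R) := if s < 1 then pw c s else 0.
have h0 c s : 0 <= h c s by rewrite /h; case: ifP => // _; exact: pw_ge0.
have mh c : measurable_fun setT (h c).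
  by apply: measurable_fun_ifT => //; [exact: measurable_fun_ltr|exact: measurable_pw].
have mh1 c : measurable_fun setT (fun s : R => h c (1 - s)).
  by apply: (measurableT_comp (mh c)); exact: measurable_funB.
have mE c := measurable_EFin_R (mh c).
have mE1 c := measurable_EFin_R (mh1 c).
apply: (@le_lt_trans _ _ (\int[mu]_s (2 * (h b s + h a (1 - s)))%:E)%E).
  apply: ge0_le_integral => //.
  - by move=> s _; rewrite lee_fin mulr_ge0 ?pw_ge0.
  - by apply: measurable_EFin_R; exact: measurable_beta.
  - by apply: measurable_EFin_R; apply: measurable_funM => //; exact: measurable_funD.
  - move=> s _; rewrite lee_fin.
    have [s0|s0] := leP s 0; first by rewrite (pw_le0 _ s0) mulr0 mulr_ge0// addr_ge0.
    have [s1|s1] := leP 1 s.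
      by rewrite [pw a _]pw_le0 ?subr_le0// mul0r mulr_ge0// addr_ge0.
    have [s2|s2] := leP s 2^-1.
      apply: (@le_trans _ _ (2 * pw b s)); first by rewrite ler_wpM2r ?pw_ge0// pw_half//; lra.
      by rewrite ler_wpM2l// /h s1 lerDl h0.
    apply: (@le_trans _ _ (pw a (1 - s) * 2)); first by rewrite ler_wpM2l ?pw_ge0// pw_half//; lra.
    rewrite mulrC ler_wpM2l// {2}/h (_ : 1 - s < 1) ?lerDr ?h0//; lra.
rewrite ge0_integralZ//; last 2 first.
- exact: measurable_funD.
- by move=> s; rewrite addr_ge0.
apply: lte_mul_pinfty => //.
have -> : (\int[mu]_s (h b s + h a (1 - s))%:E = \int[mu]_s ((h b s)%:E + (h a (1 - s))%:E))%E by [].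
rewrite ge0_integralD//; last 2 first.
- by move=> s _; rewrite lee_fin.
- by move=> s _; rewrite lee_fin.
by rewrite (ge0_integral_reflect 1 (mh a) (h0 a)) lte_add_pinfty// integral_pw1_lty.
Qed.

Definition beta (a b : R) : R := \int[mu]_s (pw a (1 - s) * pw b s).

Lemma betaE (a b : R) : 0 < a -> 0 < b -> (beta a b)%:E = (\int[mu]_s (pw a (1 - s) * pw b s)%:E)%E.
Proof.
move=> a0 b0; rewrite /beta /Rintegral fineK// ge0_fin_numE; first exact: beta_lty.
by apply: integral_ge0 => s _; rewrite lee_fin mulr_ge0 ?pw_ge0.
Qed.

Lemma beta_ge0 (a b : R) : 0 <= beta a b.
Proof. by apply: Rintegral_ge0 => s _; rewrite mulr_ge0 ?pw_ge0. Qed.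

(** Substituting [t s] for [s] pulls out [t^(a + b - 1)] and leaves the integral at [t = 1]. *)
Lemma pw_convE (a b t : R) : 0 < a -> 0 < b ->
  (\int[mu]_s (pw a (t - s) * pw b s)%:E = (beta a b * pw (a + b) t)%:E)%E.
Proof.
move=> a0 b0; have [t0|t0] := leP t 0.
  rewrite (pw_le0 _ t0) mulr0; apply: integral0_eq => s _.
  have [s0|s0] := leP s 0; first by rewrite (pw_le0 _ s0) mulr0.
  by rewrite pw_le0 ?mul0r//; lra.
have m1 := measurable_beta a b t.
have p1 s : 0 <= pw a (t - s) * pw b s by rewrite mulr_ge0 ?pw_ge0.
have := ge0_integral_scale t0 m1 p1.
have -> : (\int[mu]_s (pw a (t - t * s) * pw b (t * s))%:E)%E =
    (\int[mu]_s (t `^ (a + b - 2) * (pw a (1 - s) * pw b s))%:E)%E.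
  apply: eq_integral => s _; rewrite -{1}[t]mulr1 -mulrBr !pw_scale// mulrACA.
  congr (_ * _)%:E; rewrite -powRD; last by rewrite (gt_eqF t0) implybT.
  by congr powR; ring.
rewrite ge0_integralZ ?powR_ge0//; last 2 first.
- exact: measurable_beta.
- by move=> s; rewrite mulr_ge0 ?pw_ge0.
rewrite -betaE// -EFinM => E.
have -> : (\int[mu]_s (pw a (t - s) * pw b s)%:E = t%:E * ((t^-1)%:E * \int[mu]_s (pw a (t - s) * pw b s)%:E))%E.
  by rewrite muleA -EFinM divff ?gt_eqF// mul1e.
rewrite -E -EFinM pwE//; congr EFin; rewrite mulrA mulrC; congr (_ * _).
rewrite -[X in X * _](powRr1 (ltW t0)) -powRD; last by rewrite (gt_eqF t0) implybT.
by congr powR; ring.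
Qed.

Lemma pw_conv_integrable (a b t : R) : 0 < a -> 0 < b ->
  mu.-integrable setT (fun s : R => (pw a (t - s) * pw b s)%:E).
Proof.
move=> a0 b0; apply/integrableP; split; first by apply: measurable_EFin_R; exact: measurable_beta.
under eq_integral do rewrite gee0_abs ?lee_fin ?mulr_ge0 ?pw_ge0//.
by rewrite pw_convE// ltry.
Qed.

End beta.

Lemma Rintegral_eq0 d (T : measurableType d) (R : realType) (m : {measure set T -> \bar R})
  (f : T -> R) : (forall x, f x = 0) -> \int[m]_x f x = 0.
Proof. by move=> f0; rewrite /Rintegral integral0_eq// => x _; rewrite f0. Qed.

Lemma powR_lt1 (R : realType) (s a : R) : 0 < a -> 0 < s -> s < 1 -> s `^ a < 1.
Proof.
move=> a0 s0 s1; have := @gt0_ltr_powR R a a0 s 1.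
by rewrite powR1 !nnegrE => ->//; exact: ltW.
Qed.

Lemma pw_anti (R : realType) (b x y : R) : b <= 1 -> 0 < x -> x <= y -> pw b y <= pw b x.
Proof.
move=> b1 x0 xy; have y0 : 0 < y by rewrite (lt_le_trans x0).
rewrite !pwE// -(opprB 1 b) !powRN lef_pV2 ?posrE ?powR_gt0//.
by rewrite ge0_ler_powR ?nnegrE ?subr_ge0// ltW.
Qed.

Lemma volterra_arith (R : realType) (kt k1 r r1 K q I I1 w : R) :
  kt = r + K * I -> k1 = r1 + K * I1 -> r1 <= 0 -> 0 <= q -> kt = q * k1 ->
  K * (q * I1 - w) <= K * I -> r <= K * w.
Proof.
move=> e1 e2 r10 q0 e3 H; have h1 : q * k1 <= q * (K * I1).
  by rewrite ler_wpM2l// e2 gerDr.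
have : K * (q * I1 - w) = q * (K * I1) - K * w by ring.
lra.
Qed.

(** * The Mittag-Leffler kernel: Volterra equation, sign and mass *)

Section resolvent.
Variables (R : realType) (al K : R).
Hypotheses (al0 : 0 < al) (al1 : al < 1) (K0 : 0 < K).
Local Notation mu := (@lebesgue_measure R).
Local Notation Ga := (Gamma al).

Let al3 : 0 < al <= 3. Proof. by rewrite al0 (le_trans (ltW al1))// ler1n. Qed.
Let Ga0 : 0 < Ga. Proof. exact: Gamma_gt0. Qed.

(** The kernel of [(-Delta)^(- al)] with respect to the heat semigroup: its Laplace transform is
    [s^(- al)]. *)
Definition rk (t : R) := pw al t / Ga.

(** Equal to [Gamma (al (n + 1)) / Gamma (al (n + 2))], so that [rc n] is the Mittag-Leffler
    coefficient [1 / Gamma (al (n + 1))]. The beta form is the factor that a convolution with [rk]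
    produces. *)
Definition rB n := beta al (al * n.+1%:R) / Ga.

Fixpoint rc n := if n is m.+1 then rc m * rB m else Ga^-1.

Definition ra n := (- K) ^+ n * rc n.

(* The Mittag-Leffler kernel: [((-Delta)^al + K)^-1] is the integral of [rho t] times the heat
   semigroup, and [rho] solves the Volterra equation [rk = rho + K (rk * rho)]. *)
Definition rho (t : R) := pw al t * psum ra (t `^ al).

Let aln n : 0 < al * n.+1%:R. Proof. by rewrite mulr_gt0. Qed.

Lemma pw_aln n (t : R) : pw (al * n.+1%:R) t = pw al t * (t `^ al) ^+ n.
Proof.
have [t0|t0] := leP t 0; first by rewrite !pw_le0// mul0r.
rewrite (_ : al * n.+1%:R = al + al * n%:R); last by rewrite -natr1; ring.
by rewrite pwD//; congr (_ * _); rewrite powRrM powR_mulrn ?powR_ge0.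
Qed.

Lemma rB_ge0 n : 0 <= rB n.
Proof. by apply: divr_ge0; [exact: beta_ge0|exact: ltW]. Qed.

Lemma rc_ge0 n : 0 <= rc n.
Proof. by elim: n => [|n IH] /=; rewrite ?invr_ge0 ?(ltW Ga0)// mulr_ge0// rB_ge0. Qed.

(** Dominated convergence in the beta integral: its integrand contains [(s^al)^n], and [s^al < 1] on
    []0, 1[]. *)
Lemma rB_cvg0 : rB n @[n --> \oo] --> 0.
Proof.
rewrite -[X in _ --> X](mul0r Ga^-1); apply: cvgM; last exact: cvg_cst.
have -> : 0 = \int[mu]_s (0 : R) by rewrite Rintegral_eq0.
rewrite /beta.
have [] := @Rdominated_cvg _ _ R mu setT (fun n s => pw al (1 - s) * pw (al * n.+1%:R) s) (cst 0)
  (fun s => pw al (1 - s) * pw al s) measurableT.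
- by move=> n; exact: measurable_beta.
- move=> s _ /=; under eq_fun do rewrite pw_aln mulrA.
  have [s0|s0] := leP s 0.
    by rewrite (pw_le0 _ s0) mulr0; under eq_fun do rewrite mul0r; exact: cvg_cst.
  have [s1|s1] := leP 1 s.
    by rewrite [pw al _]pw_le0 ?subr_le0// mul0r; under eq_fun do rewrite mul0r; exact: cvg_cst.
  suff : pw al (1 - s) * pw al s * (s `^ al) ^+ n @[n --> \oo] --> pw al (1 - s) * pw al s * 0.
    by rewrite mulr0.
  apply: cvgM; first exact: cvg_cst.
  apply: cvg_expr; rewrite ger0_norm ?powR_ge0//.
  exact: powR_lt1.
- exact: pw_conv_integrable.
- move=> n s _; rewrite ger0_norm ?mulr_ge0 ?pw_ge0// pw_aln.
  have [s0|s0] := leP s 0; first by rewrite (pw_le0 _ s0) mul0r mulr0.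
  have [s1|s1] := leP 1 s.
    by rewrite [pw al (1 - s)]pw_le0 ?subr_le0// !mul0r.
  rewrite ler_wpM2l ?pw_ge0// ler_piMr ?pw_ge0// exprn_ile1 ?powR_ge0//.
  by rewrite ltW// powR_lt1.
- by [].
Qed.

Lemma norm_ra n : `|ra n| = K ^+ n * rc n.
Proof. by rewrite /ra normrM normrX normrN (gtr0_norm K0) (ger0_norm (rc_ge0 _)). Qed.

Lemma ra_entire : entire ra.
Proof.
apply: (@ratio_entire _ _ (fun n => K * rB n)) => [n|].
  by rewrite !norm_ra exprS/= le_eqVlt; apply/orP; left; apply/eqP; ring.
by rewrite -[X in _ --> X](mulr0 K); apply: cvgM; [exact: cvg_cst|exact: rB_cvg0].
Qed.

Lemma measurable_rho : measurable_fun setT rho.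
Proof.
apply: measurable_funM; first exact: measurable_pw.
apply: (measurableT_comp (f := psum ra)); last exact: measurable_powR.
by apply: continuous_measurable_fun; exact: (continuous_psum ra_entire).
Qed.

Lemma rho_le0 (t : R) : t <= 0 -> rho t = 0.
Proof. by move=> t0; rewrite /rho pw_le0// mul0r. Qed.

Lemma continuous_rho (t : R) : 0 < t -> {for t, continuous rho}.
Proof.
move=> t0.
have E : {near nbhs t, (fun s => s `^ (al - 1) * psum ra (s `^ al)) =1 rho}.
  by near=> s; rewrite /rho pwE//; near: s; exact: lt_nbhsr.
have cc : {for t, continuous (fun s : R => s `^ (al - 1) * psum ra (s `^ al))}.
  apply: continuousM; first exact: continuous_powR.
  by apply: continuous_comp; [exact: continuous_powR|exact: (continuous_psum ra_entire)].
rewrite /prop_for/continuous_at; rewrite -(nbhs_singleton E).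
by apply: cvg_trans cc; apply: near_eq_cvg; exact: E.
Unshelve. all: by end_near. Qed.

Lemma rho_bound (t T : R) : t <= T ->
  `|rho t| <= pw al t * limn (series (fun n => `|ra n| * (T `^ al) ^+ n)).
Proof.
move=> tT; rewrite normrM (ger0_norm (pw_ge0 _ _)).
have [t0|t0] := leP t 0; first by rewrite pw_le0// !mul0r.
rewrite ler_wpM2l ?pw_ge0//.
have tTa : `|t `^ al| <= T `^ al.
  by rewrite ger0_norm ?powR_ge0// ge0_ler_powR ?nnegrE ?(ltW al0) ?(ltW t0)//; lra.
have H N := psum_partial_bound ra_entire tTa N.
have C := entire_cvg (x := t `^ al) ra_entire.
apply: (@closed_cvg _ _ _ _ (fun N => `|pseries ra (t `^ al) N|) _ (@closed_le _ _) _ _ (cvg_norm C)).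
by apply: nearW => N; exact: H.
Qed.

Lemma rk_rho_integrable (t : R) : mu.-integrable setT (fun s => (rk (t - s) * rho s)%:E).
Proof.
pose A := limn (series (fun n => `|ra n| * (t `^ al) ^+ n)).
apply: (@integrable_le_norm _ _ R mu setT (fun s => rk (t - s) * rho s)
  (fun s => (A / Ga) * (pw al (t - s) * pw al s)) measurableT).
- apply: measurable_funM; last exact: measurable_rho.
  by apply: measurable_funM => //; exact: measurable_pw_refl.
- exact: (integrableZl measurableT (A / Ga) (pw_conv_integrable t al0 al0)).
move=> s _; rewrite normrM /rk normrM (ger0_norm (pw_ge0 _ _)) normfV (gtr0_norm Ga0).
have [ts|ts] := leP t s.
  by rewrite [pw al (t - s)]pw_le0 ?subr_le0// !mul0r mulr0.
rewrite (_ : _ / _ * (_ * _) = pw al (t - s) / Ga * (pw al s * A)); last by ring.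
by rewrite ler_wpM2l ?divr_ge0 ?pw_ge0 ?(ltW Ga0)//; exact/rho_bound/ltW.
Qed.

(** Convolution with [rk] sends the term of index [n] of [rho] to [- 1 / K] times the term of index
    [n + 1], by [pw_convE]. So the partial sums telescope, and they are dominated by a multiple of
    [pw al]. *)
Lemma volterra (t : R) : rk t = rho t + K * \int[mu]_s (rk (t - s) * rho s).
Proof.
have [t0|t0] := leP t 0.
  rewrite rho_le0// Rintegral_eq0 ?mulr0 ?addr0; first by rewrite /rk pw_le0// mul0r.
  move=> s; have [s0|s0] := leP s 0; first by rewrite rho_le0// mulr0.
  by rewrite /rk pw_le0 ?mul0r//; lra.
pose A := limn (series (fun n => `|ra n| * (t `^ al) ^+ n)).
pose rn N (s : R) := pw al s * \sum_(0 <= n < N) ra n * (s `^ al) ^+ n.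
have mrn N : measurable_fun setT (rn N).
  apply: measurable_funM; first exact: measurable_pw.
  apply: measurable_sum => n; apply: measurable_funM => //.
  by apply: measurable_funX; exact: measurable_powR.
have [_ C] : mu.-integrable setT (fun s => (rk (t - s) * rho s)%:E) /\ 
    \int[mu]_s (rk (t - s) * rn N s) @[N --> \oo] --> \int[mu]_s (rk (t - s) * rho s).
  apply: (@Rdominated_cvg _ _ R mu setT (fun N s => rk (t - s) * rn N s) (fun s => rk (t - s) * rho s)
     (fun s => (A / Ga) * (pw al (t - s) * pw al s)) measurableT).
  - move=> N; apply: measurable_funM; last exact: mrn.
    by apply: measurable_funM => //; exact: measurable_pw_refl.
  - move=> s _; apply: cvgM; first exact: cvg_cst.
    by apply: cvgM; [exact: cvg_cst|exact: (entire_cvg (x := s `^ al) ra_entire)].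
  - exact: (integrableZl measurableT (A / Ga) (pw_conv_integrable t al0 al0)).
  - move=> N s _; rewrite normrM /rk normrM (ger0_norm (pw_ge0 _ _)) normfV (gtr0_norm Ga0).
    have [ts|ts] := leP t s.
      by rewrite [pw al (t - s)]pw_le0 ?subr_le0// !mul0r mulr0.
    rewrite (_ : A / _ * (_ * _) = pw al (t - s) / Ga * (pw al s * A)); last by ring.
    rewrite ler_wpM2l ?divr_ge0 ?pw_ge0 ?(ltW Ga0)// normrM (ger0_norm (pw_ge0 _ _)).
    have [s0|s0] := leP s 0; first by rewrite pw_le0// !mul0r.
    rewrite ler_wpM2l ?pw_ge0//; apply: (psum_partial_bound ra_entire).
    by rewrite ger0_norm ?powR_ge0// ge0_ler_powR ?nnegrE ?(ltW al0) ?(ltW t0) ?(ltW s0)// ltW.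
have tE n s : rk (t - s) * (pw al s * (ra n * (s `^ al) ^+ n)) =
    (ra n / Ga) * (pw al (t - s) * pw (al * n.+1%:R) s).
  by rewrite pw_aln /rk; ring.
have iT n : mu.-integrable setT (fun s => (rk (t - s) * (pw al s * (ra n * (s `^ al) ^+ n)))%:E).
  under eq_fun do rewrite tE.
  exact: (integrableZl measurableT (ra n / Ga) (pw_conv_integrable t al0 (aln n))).
have IT n : K * \int[mu]_s (rk (t - s) * (pw al s * (ra n * (s `^ al) ^+ n))) =
    - (pw al t * (ra n.+1 * (t `^ al) ^+ n.+1)).
  under eq_Rintegral do rewrite tE.
  rewrite RintegralZl//; last exact: pw_conv_integrable.
  have -> : \int[mu]_s (pw al (t - s) * pw (al * n.+1%:R) s) = beta al (al * n.+1%:R) * pw (al + al * n.+1%:R) t.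
    by rewrite /Rintegral pw_convE.
  rewrite (_ : al + al * n.+1%:R = al * n.+2%:R); last by rewrite -[in RHS]natr1; ring.
  by rewrite pw_aln /ra /= /rB !exprS; ring.
have E0 N : mu.-integrable setT (fun s => (rk (t - s) * rn N s)%:E) /\
    K * \int[mu]_s (rk (t - s) * rn N s) = rk t - pw al t * \sum_(0 <= n < N.+1) ra n * (t `^ al) ^+ n.
  elim: N => [|N [IH1 IH2]].
    have z s : rk (t - s) * rn 0%N s = 0 by rewrite /rn big_nil !mulr0.
    under eq_fun do rewrite z; split; first exact: integrable0.
    by rewrite Rintegral_eq0// mulr0 big_nat1 /ra/= !expr0 mulr1 mul1r subrr.
  have sE s : rk (t - s) * rn N.+1 s = rk (t - s) * rn N s + rk (t - s) * (pw al s * (ra N * (s `^ al) ^+ N)).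
    by rewrite /rn big_nat_recr//= -mulrDr -mulrDr.
  under eq_fun do rewrite sE; split; first exact: (integrableD measurableT IH1 (iT N)).
  have -> : \int[mu]_s (rk (t - s) * rn N.+1 s) = \int[mu]_s (rk (t - s) * rn N s) +
      \int[mu]_s (rk (t - s) * (pw al s * (ra N * (s `^ al) ^+ N))).
    by rewrite -(RintegralD measurableT IH1 (iT N)); apply: eq_Rintegral => s _; exact: sE.
  by rewrite mulrDr IH2 IT [in RHS]big_nat_recr//= mulrDr opprD addrA.
have E N := (E0 N).2.
have C1 : K * \int[mu]_s (rk (t - s) * rn N s) @[N --> \oo] --> K * \int[mu]_s (rk (t - s) * rho s).
  by apply: cvgM => //; exact: cvg_cst.
have C2 : K * \int[mu]_s (rk (t - s) * rn N s) @[N --> \oo] --> rk t - rho t.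
  under eq_fun do rewrite E; apply: cvgB; first exact: cvg_cst.
  apply: cvgM; first exact: cvg_cst.
  by have := entire_cvg (x := t `^ al) ra_entire; rewrite -cvg_shiftS.
have := cvg_unique (@norm_hausdorff _ _) C1 C2 => ->; ring.
Qed.

Lemma rk_ge0 (t : R) : 0 <= rk t.
Proof. by apply: divr_ge0; [exact: pw_ge0|exact: ltW]. Qed.

Lemma psum0 (a : nat -> R) : psum a 0 = a 0%N.
Proof.
apply: cvg_lim; first exact: norm_hausdorff.
rewrite -cvg_shiftS; apply: cvg_near_cst; apply: nearW => n.
rewrite /pseries /series/= big_nat_recl// expr0 mulr1 big1_seq ?addr0// => i _.
by rewrite expr0n mulr0.
Qed.

Lemma rho_gt0_near0 : exists2 e : R, 0 < e & forall t, 0 < t -> t < e -> 0 < rho t.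
Proof.
have : psum ra (t `^ al) @[t --> 0^'+] --> psum ra 0.
  apply: (cvg_comp _ _ (powR_cvg0 al0)); exact: (continuous_psum ra_entire).
rewrite psum0 /ra/= expr0 mul1r => /cvgrPdist_lt /(_ Ga^-1).
rewrite invr_gt0 => /(_ Ga0); rewrite near_withinE => /nbhs_ballP[e /= e0 H].
exists e => // t t0 te; rewrite /rho mulr_gt0 ?pw_gt0//.
have := H t; rewrite /ball/= sub0r normrN gtr0_norm// => /(_ te t0).
by rewrite ltr_distlC subrr => /andP[].
Qed.

(** Since [rho t1 <= 0], the Volterra equation at [t1] bounds [rk t1] by its convolution term.
    Multiply by [q = rk t / rk t1] and compare with the equation at [t]: as
    [(t - s) t1 <= t (t1 - s)] and the exponent is negative, [q rk (t1 - s) <= rk (t - s)] for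
    [s < t]. Only the integral over [[t, t1[], where [rho <= m], is left. *)
Lemma rho_le_before (t t1 m : R) : 0 < t -> t < t1 -> 0 <= m ->
  (forall s, 0 < s -> s < t1 -> 0 <= rho s) -> rho t1 <= 0 ->
  (forall s, t <= s -> s < t1 -> rho s <= m) ->
  rho t <= rk t / rk t1 * K * m * (beta 1 al / Ga) * (2 * (t1 - t)) `^ al.
Proof.
move=> t0 tt1 m0 r0 rt1 rm.
have t10 : 0 < t1 := lt_trans t0 tt1.
have h0 : 0 < t1 - t by rewrite subr_gt0.
have kt1 : 0 < rk t1 by rewrite divr_gt0// pw_gt0.
pose q := rk t / rk t1; have q0 : 0 <= q by rewrite divr_ge0 ?rk_ge0.
have kE : rk t = q * rk t1 by rewrite /q mulfVK// gt_eqF.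
(* [pw 1] is the indicator of the positive numbers: [w] is the kernel cut to [t1 - s < 2 (t1 - t)].
   This window contains [[t, t1[] with a margin, and [pw_convE] evaluates its integral. *)
pose w s := pw 1 (2 * (t1 - t) - (t1 - s)) * pw al (t1 - s).
have w0 s : 0 <= w s by rewrite mulr_ge0 ?pw_ge0.
have mw : measurable_fun setT w.
  apply: (measurableT_comp (measurable_beta 1 al (2 * (t1 - t)))).
  exact: measurable_funB.
have Ew : (\int[mu]_s (w s)%:E = (beta 1 al * (2 * (t1 - t)) `^ al)%:E)%E.
  have := ge0_integral_reflect t1 (measurable_beta 1 al (2 * (t1 - t))) (fun s => mulr_ge0 (pw_ge0 _ _) (pw_ge0 _ _)).
  rewrite /w => ->; rewrite pw_convE// pwE ?mulr_gt0// (_ : 1 + al - 1 = al)//; ring.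
have iw : mu.-integrable setT (fun s => (w s)%:E).
  apply/integrableP; split; first exact: measurable_EFin_R.
  under eq_integral do rewrite gee0_abs ?lee_fin//.
  by rewrite Ew ltry.
have Iw : \int[mu]_s w s = beta 1 al * (2 * (t1 - t)) `^ al by rewrite /Rintegral Ew.
have i1 := rk_rho_integrable t; have i2 := rk_rho_integrable t1.
have j1 := integrableZl measurableT q i2; have j2 := integrableZl measurableT (- (q * m / Ga)) iw.
have qm : 0 <= q * m / Ga by apply: divr_ge0; [exact: mulr_ge0|exact: ltW].
have H : \int[mu]_s (q * (rk (t1 - s) * rho s) + (- (q * m / Ga)) * w s) <= \int[mu]_s (rk (t - s) * rho s).
  apply: le_Rintegral => //; first exact: (integrableD measurableT j1 j2).
  move=> s _; have qw : 0 <= (q * m / Ga) * w s by rewrite mulr_ge0.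
  have [s0|s0] := leP s 0.
    by rewrite rho_le0// !mulr0 add0r mulNr oppr_le0.
  have [st|st] := ltP s t.
    have rs0 : 0 <= rho s by apply: r0 => //; exact: lt_trans tt1.
    rewrite mulNr lerBlDr (@le_trans _ _ (rk (t - s) * rho s)) ?lerDl//.
    rewrite mulrA ler_wpM2r// /q mulrAC ler_pdivrMr// /rk.
    rewrite mulrACA [leRHS]mulrACA ler_wpM2r ?mulr_ge0 ?invr_ge0 ?(ltW Ga0)//.
    have ts0 : 0 < t - s by rewrite subr_gt0.
    have t1s0 : 0 < t1 - s by rewrite subr_gt0 (lt_trans st).
    rewrite !pwE// -!powRM ?(ltW t0) ?(ltW t10) ?(ltW ts0) ?(ltW t1s0)//.
    have P1 : 0 < (t - s) * t1 by rewrite mulr_gt0.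
    have P2 : 0 < t * (t1 - s) by rewrite mulr_gt0.
    rewrite -!pwE//; apply: pw_anti => //; first exact: ltW.
    by rewrite mulrBl mulrBr lerD2l lerN2 mulrC ler_wpM2l// ltW.
  have z1 : rk (t - s) = 0 by rewrite /rk pw_le0 ?mul0r// subr_le0.
  have [st1|st1] := ltP s t1; last first.
    have z2 : pw al (t1 - s) = 0 by rewrite pw_le0// subr_le0.
    by rewrite z1 /rk /w z2 !(mul0r, mulr0) addr0.
  have z3 : w s = pw al (t1 - s) by rewrite /w pw1 ?mul1r//; lra.
  rewrite z1 z3 mul0r /rk (_ : _ + _ = - (q * (pw al (t1 - s) / Ga) * (m - rho s))); last by ring.
  rewrite oppr_le0; apply: mulr_ge0; last by rewrite subr_ge0 rm.
  by apply: mulr_ge0 => //; exact: rk_ge0.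
have E1 : \int[mu]_s (q * (rk (t1 - s) * rho s) + (- (q * m / Ga)) * w s) =
   q * \int[mu]_s (rk (t1 - s) * rho s) - (q * m / Ga) * (beta 1 al * (2 * (t1 - t)) `^ al).
  have e1 : \int[mu]_s (q * (rk (t1 - s) * rho s)) = q * \int[mu]_s (rk (t1 - s) * rho s) by rewrite RintegralZl.
  have e2 : \int[mu]_s (- (q * m / Ga) * w s) = - (q * m / Ga) * \int[mu]_s w s by rewrite RintegralZl.
  by rewrite (RintegralD measurableT j1 j2) [X in X + _]e1 [X in _ + X]e2 Iw mulNr.
move: H; rewrite E1 -(ler_pM2l K0).
have V := volterra t; have V1 := volterra t1.
move=> H; have := volterra_arith V V1 rt1 q0 kE H.
by rewrite (_ : K * (q * m / Ga * _) = q * K * m * (beta 1 al / Ga) * (2 * (t1 - t)) `^ al)//; ring.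
Qed.

(* Just before a first zero, the Volterra equation bounds [rho] by half of its supremum there. *)
Lemma rho_no_first_zero (t1 : R) : 0 < t1 -> (forall s, 0 < s -> s < t1 -> 0 < rho s) ->
  rho t1 <= 0 -> False.
Proof.
move=> t10 rpos rt1.
have b0 : 0 <= beta 1 al := beta_ge0 _ _.
pose B := 2 * K * (beta 1 al / Ga); have B0 : 0 <= B by rewrite !mulr_ge0 ?invr_ge0 ?(ltW K0) ?(ltW Ga0).
pose e := (B + 1)^-1; have e0 : 0 < e by rewrite invr_gt0 ltr_wpDl.
(* [h <= t1 / 2] keeps [rk ts / rk t1] below 2, and [(2 h)^al <= e]; the bound of [rho_le_before] is
   then at most [B e = B / (B + 1) < 1] times [rho ts]. *)
pose h := Num.min (t1 / 2) (e `^ al^-1 / 2).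
have h0 : 0 < h by rewrite lt_min !divr_gt0// powR_gt0.
have ht : h <= t1 / 2 by rewrite ge_min lexx.
have he : (2 * h) `^ al <= e.
  rewrite [leRHS](_ : e = (e `^ al^-1) `^ al); last by rewrite -powRrM mulVf ?gt_eqF// powRr1// ltW.
  rewrite ge0_ler_powR ?nnegrE ?(ltW al0) ?powR_ge0 ?mulr_ge0 ?(ltW h0)//.
  by rewrite mulrC -ler_pdivlMr// ge_min lexx orbT.
pose t0 := t1 - h.
have t00 : 0 < t0 by rewrite /t0; lra.
have t01 : t0 < t1 by rewrite /t0; lra.
have cr : {within `[t0, t1], continuous rho}.
  apply: continuous_in_subspaceT => t; rewrite inE/= in_itv/= => /andP[tt _].
  by apply: continuous_rho; exact: lt_le_trans tt.
have [ts] := EVT_max (ltW t01) cr; rewrite in_itv/= => /andP[ts0 ts1] mx.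
have M0 : 0 < rho ts.
  apply: (@lt_le_trans _ _ (rho t0)); first exact: rpos.
  by apply: mx; rewrite in_itv/= lexx ltW.
have ts1' : ts < t1.
  by rewrite lt_neqAle ts1 andbT; apply/eqP => E; move: M0; rewrite E ltNge rt1.
have ts00 : 0 < ts by exact: lt_le_trans ts0.
have := @rho_le_before ts t1 (rho ts) ts00 ts1' (ltW M0) (fun s s0 s1 => ltW (rpos s s0 s1)) rt1.
have mx' s : ts <= s -> s < t1 -> rho s <= rho ts.
  by move=> s0 s1; rewrite mx// in_itv/= (le_trans ts0 s0) ltW.
move=> /(_ mx'); rewrite leNgt => /negP; apply.
have kt1 : 0 < rk t1 by rewrite divr_gt0// pw_gt0.
have q2 : rk ts / rk t1 <= 2.
  rewrite ler_pdivrMr// /rk mulrA ler_pM2r ?invr_gt0//.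
  apply: (@le_trans _ _ (pw al (2^-1 * t1))).
    apply: pw_anti; rewrite ?(ltW al1)//; first by rewrite mulr_gt0// invr_gt0.
    by apply: le_trans ts0; rewrite /t0; lra.
  rewrite pw_scale ?invr_gt0// ler_wpM2r ?pw_ge0//.
  rewrite -powR_inv1// -powRrM; apply: (@le_trans _ _ (2 `^ 1)); last by rewrite powRr1.
  by apply: ler_powR; [rewrite ler1n|rewrite mulN1r opprB gerBl ltW].
apply: (@le_lt_trans _ _ (2 * K * rho ts * (beta 1 al / Ga) * e)).
  rewrite ler_pM ?powR_ge0//.
  - have bG : 0 <= beta 1 al / Ga by apply: divr_ge0 => //; exact: ltW.
    apply: mulr_ge0 => //; apply: mulr_ge0; last exact: ltW.
    by apply: mulr_ge0; [apply: divr_ge0; exact: rk_ge0|exact: ltW].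
  - rewrite ler_wpM2r ?divr_ge0 ?(ltW Ga0)// ler_wpM2r ?(ltW M0)// ler_wpM2r// ltW//.
  - apply: le_trans he; rewrite ge0_ler_powR ?nnegrE ?(ltW al0)//; [|by rewrite mulr_ge0 ?(ltW h0)|].
      by rewrite mulr_ge0// subr_ge0 ltW.
    by rewrite ler_wpM2l//; move: ts0; rewrite /t0; lra.
have -> : 2 * K * rho ts * (beta 1 al / Ga) * e = rho ts * (B * e) by rewrite /B; ring.
have B1 : 0 < B + 1 by rewrite ltr_wpDl.
by rewrite gtr_pMr// /e ltr_pdivrMr// mul1r ltrDl.
Qed.

(** If [rho] were negative somewhere, the infimum of the times where [rho <= 0] would be positive by
    [rho_gt0_near0] and a first zero by continuity, against [rho_no_first_zero]. *)
Lemma rho_ge0 (t : R) : 0 <= rho t.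
Proof.
rewrite leNgt; apply/negP => rt.
have t0 : 0 < t by rewrite ltNge; apply/negP => /rho_le0 z; move: rt; rewrite z ltxx.
pose A := [set s : R | 0 < s /\ rho s <= 0].
have [e e0 He] := rho_gt0_near0.
have lbA s : A s -> e <= s.
  by move=> [s0 rs]; rewrite leNgt; apply/negP => se; move: rs; rewrite leNgt He.
have At : A t by split=> //; exact: ltW.
have hA : has_inf A by split; [exists t|exists e].
pose t1 := inf A.
have et1 : e <= t1 by apply: lb_le_inf; [exists t|].
have t10 : 0 < t1 := lt_le_trans e0 et1.
apply: (@rho_no_first_zero t1 t10).
  move=> s s0 s1; rewrite ltNge; apply/negP => rs.
  have : t1 <= s by apply: (inf_lbound hA.2); split.
  by rewrite leNgt s1.
rewrite leNgt; apply/negP => r1.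
have := continuous_rho t10; move=> /cvgrPdist_lt /(_ _ r1) /nbhs_ballP[d /= d0 Hd].
have [s [s0 rs] st] := @inf_adherent _ A d d0 hA.
have t1s : t1 <= s by apply: (inf_lbound hA.2); split.
have := Hd s; rewrite /ball/= ltr_distlC => /(_ _).
rewrite ltr_distlC subrr => /(_ _)/andP[|+ _]; last by rewrite ltNge rs.
by rewrite -/t1 in st; rewrite st andbT (lt_le_trans _ t1s)// ltrBlDr ltrDl.
Qed.

Lemma rho_convE (t : R) :
  ((rk t)%:E = (rho t)%:E + K%:E * \int[mu]_s (rk (t - s) * rho s)%:E)%E.
Proof.
have <- : (\int[mu]_s (rk (t - s) * rho s))%:E = (\int[mu]_s (rk (t - s) * rho s)%:E)%E.
  by rewrite /Rintegral fineK//; exact: (integrable_fin_num measurableT (rk_rho_integrable t)).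
by rewrite -EFinM -EFinD -volterra.
Qed.

(** As [rk] decreases, [rk T] times the mass of [rho] before [T] is at most the convolution at [T],
    and the Volterra equation bounds [K] times the latter by [rk T]. *)
Lemma rho_mass (T : R) : (\int[mu]_s (if s < T then rho s else 0)%:E <= (K^-1)%:E)%E.
Proof.
have [T0|T0] := leP T 0.
  rewrite integral0_eq ?lee_fin ?invr_ge0 ?(ltW K0)// => s _; case: ifPn => // sT.
  by rewrite rho_le0// ltW// (lt_le_trans sT).
have kT : 0 < rk T by rewrite divr_gt0// pw_gt0.
pose g s := if s < T then rho s else 0.
have mg : measurable_fun setT g.
  by apply: measurable_fun_ifT => //; [exact: measurable_fun_ltr|exact: measurable_rho].
have g0 s : 0 <= g s by rewrite /g; case: ifP => // _; exact: rho_ge0.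
have H : ((rk T)%:E * \int[mu]_s (g s)%:E <= \int[mu]_s (rk (T - s) * rho s)%:E)%E.
  rewrite -ge0_integralZ ?(ltW kT)//; apply: ge0_le_integral => //.
  - by move=> s _; rewrite lee_fin mulr_ge0 ?(ltW kT).
  - by apply: measurable_EFin_R; exact: measurable_funM.
  - by case/integrableP: (rk_rho_integrable T).
  move=> s _; rewrite lee_fin /g; case: ifPn => sT; last first.
    by rewrite mulr0 mulr_ge0 ?rk_ge0 ?rho_ge0.
  have [s0|s0] := leP s 0; first by rewrite rho_le0// !mulr0.
  rewrite ler_wpM2r ?rho_ge0// /rk ler_wpM2r ?invr_ge0 ?(ltW Ga0)//.
  by apply: pw_anti; rewrite ?(ltW al1) ?subr_gt0// gerBl ltW.
have V := rho_convE T.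
have H2 : (K%:E * \int[mu]_s (rk (T - s) * rho s)%:E <= (rk T)%:E)%E.
  by rewrite V leeDr// lee_fin rho_ge0.
have : (K%:E * ((rk T)%:E * \int[mu]_s (g s)%:E) <= (rk T)%:E)%E.
  by apply: le_trans H2; rewrite lee_pmul2l ?fin_numE// lte_fin.
rewrite muleA -EFinM -/g.
have Kr : 0 < K * rk T by rewrite mulr_gt0.
case: (integral _ _ _) => [r| |]; last by rewrite leNye.
  by rewrite -EFinM !lee_fin mulrAC -ler_pdivlMr// divff ?gt_eqF// mulrC -ler_pdivlMr// div1r.
by rewrite gt0_muley ?lte_fin.
Qed.

Lemma rho_mass_le : (\int[mu]_s (rho s)%:E <= (K^-1)%:E)%E.
Proof.
have H := @exhaust_natI R rho measurable_rho rho_ge0 rho_le0.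
move/cvg_lim : H => <-//.
apply: lime_le.
  apply: ereal_nondecreasing_is_cvgn => n m nm; apply: ge0_subset_integral => //.
  - by apply: measurable_funTS; apply: measurable_EFin_R; exact: measurable_rho.
  - by move=> t _; rewrite lee_fin rho_ge0.
  - move=> t /=; rewrite !in_itv/= => /andP[h1 h2]; apply/andP; split.
      by rewrite (le_trans _ h1)// lef_pV2 ?posrE ?ler_nat.
    by rewrite (le_trans h2)// ler_nat.
apply: nearW => n; apply: le_trans (rho_mass n.+2%:R).
rewrite integral_mkcond; apply: ge0_le_integral => //.
- by move=> s _; rewrite patchE; case: ifP => // _; rewrite lee_fin rho_ge0.
- apply/(measurable_restrictT _ _).1 => //; apply: measurable_funTS.
  by apply: measurable_EFin_R; exact: measurable_rho.
- apply: measurable_EFin_R; apply: measurable_fun_ifT => //; last exact: measurable_rho.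
  exact: measurable_fun_ltr.
- move=> s _; rewrite patchE; case: ifPn => [|_].
    by rewrite inE/= in_itv/= => /andP[_ h]; rewrite (le_lt_trans h)// ltr_nat.
  by rewrite lee_fin; case: ifP => // _; exact: rho_ge0.
Qed.

Lemma rho_integrable : mu.-integrable setT (fun s => (rho s)%:E).
Proof.
apply/integrableP; split; first by apply: measurable_EFin_R; exact: measurable_rho.
under eq_integral do rewrite gee0_abs ?lee_fin ?rho_ge0//.
exact: (le_lt_trans rho_mass_le (ltry _)).
Qed.

Lemma rk_laplace (s : R) : 0 < s -> (\int[mu]_t (rk t * expR (- s * t))%:E = (s `^ (- al))%:E)%E.
Proof.
move=> s0; have := @gamma_scale R al s al3 s0.
move=> E; have -> : (\int[mu]_t (rk t * expR (- s * t))%:E = \int[mu]_t (Ga^-1 * (pw al t * expR (- s * t)))%:E)%E.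
  by apply: eq_integral => t _; rewrite /rk; congr EFin; ring.
rewrite ge0_integralZ ?invr_ge0 ?(ltW Ga0)//; last 2 first.
- exact: measurable_gammaf.
- by move=> t; rewrite mulr_ge0 ?pw_ge0 ?expR_ge0.
by rewrite E -EFinM mulKf ?gt_eqF.
Qed.

End resolvent.

Lemma subr4 (R : realType) (a b c d : R) : (a - b) - (c - d) = (a - c) - (b - d).
Proof. ring. Qed.

Lemma subr_of_add (R : realType) (a b c e : R) : a + b = c + e -> c - b = a - e.
Proof. lra. Qed.

(** * Convolutions of nonnegative functions *)

Section convolution.
Variable R : realType.
Local Notation mu := (@lebesgue_measure R).
Implicit Types f g h : R -> R.

Lemma integrableM_bounded g h (B : R) : measurable_fun setT g -> (forall t, 0 <= g t) ->
  mu.-integrable setT (fun t => (g t)%:E) -> measurable_fun setT h -> (forall t, `|h t| <= B) ->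
  mu.-integrable setT (fun t => (g t * h t)%:E).
Proof.
move=> mg g0 ig mh hB; apply: (@integrable_le_norm _ _ R mu setT (fun t => g t * h t)
  (fun t => B * g t) measurableT (measurable_funM mg mh)).
  exact: (integrableZl measurableT B ig).
by move=> t _; rewrite normrM (ger0_norm (g0 _)) mulrC ler_wpM2r.
Qed.

Definition conv f g (t : R) : \bar R := (\int[mu]_s (f (t - s) * g s)%:E)%E.

Lemma ge0_swap (F : R * R -> R) : measurable_fun setT F -> (forall z, 0 <= F z) ->
  (\int[mu]_x \int[mu]_y (F (x, y))%:E = \int[mu]_y \int[mu]_x (F (x, y))%:E)%E.
Proof.
move=> mF F0.
have mFE : measurable_fun [set: (measurableTypeR R * measurableTypeR R)%type] (EFin \o F).
  by exact/measurable_EFinP.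
exact: (@fubini_tonelli _ _ _ _ _ mu mu (EFin \o F) mFE (fun z => F0 z)).
Qed.

Lemma measurable_sub2 f : measurable_fun setT f -> measurable_fun setT (fun z : R * R => f (z.1 - z.2)).
Proof. by move=> mf; apply: (measurableT_comp mf); exact: measurable_funB. Qed.

Lemma measurable_add2 f : measurable_fun setT f -> measurable_fun setT (fun z : R * R => f (z.1 + z.2)).
Proof. by move=> mf; apply: (measurableT_comp mf); exact: measurable_funD. Qed.

Lemma measurable_fst2 f : measurable_fun setT f -> measurable_fun setT (fun z : R * R => f z.1).
Proof. by move=> mf; exact: (measurableT_comp mf (@measurable_fst _ _ _ _)). Qed.

Lemma measurable_snd2 f : measurable_fun setT f -> measurable_fun setT (fun z : R * R => f z.2).
Proof. by move=> mf; exact: (measurableT_comp mf (@measurable_snd _ _ _ _)). Qed.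

Lemma measurable_subl f (t : R) : measurable_fun setT f -> measurable_fun setT (fun s : R => f (t - s)).
Proof. by move=> mf; apply: (measurableT_comp mf); exact: measurable_funB. Qed.

Lemma measurable_addl f (t : R) : measurable_fun setT f -> measurable_fun setT (fun s : R => f (t + s)).
Proof. by move=> mf; apply: (measurableT_comp mf); exact: measurable_funD. Qed.

Lemma conv_ge0 f g t : (forall t, 0 <= f t) -> (forall t, 0 <= g t) -> (0 <= conv f g t)%E.
Proof. by move=> f0 g0; apply: integral_ge0 => s _; rewrite lee_fin mulr_ge0. Qed.

Lemma convC f g t : measurable_fun setT f -> measurable_fun setT g ->
  (forall t, 0 <= f t) -> (forall t, 0 <= g t) -> conv f g t = conv g f t.
Proof.
move=> mf mg f0 g0.
have m1 : measurable_fun setT (fun s : R => f (t - s) * g s).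
  by apply: measurable_funM => //; exact: measurable_subl.
rewrite /conv -(ge0_integral_reflect t m1 (fun s => mulr_ge0 (f0 _) (g0 _))).
by apply: eq_integral => s _; rewrite subKr mulrC.
Qed.

Lemma ge0_integralZr_R (c : R) f : 0 <= c -> measurable_fun setT f -> (forall t, 0 <= f t) ->
  ((\int[mu]_t (f t)%:E) * c%:E = \int[mu]_t (f t * c)%:E)%E.
Proof.
move=> c0 mf f0; rewrite muleC -ge0_integralZ//.
by apply: eq_integral => t _; rewrite mulrC.
Qed.

(** Associativity and commutativity in the one form used: the order of two successive convolutions
    is exchanged by Tonelli. *)
Lemma conv_swap f g h r : measurable_fun setT f -> measurable_fun setT g -> measurable_fun setT h ->
  (forall t, 0 <= f t) -> (forall t, 0 <= g t) -> (forall t, 0 <= h t) ->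
  (\int[mu]_s (conv f g (r - s) * (h s)%:E) = \int[mu]_s (conv f h (r - s) * (g s)%:E))%E.
Proof.
move=> mf mg mh f0 g0 h0.
have mz c a : measurable_fun setT a -> measurable_fun setT (fun s : R => f (c - s) * a s).
  by move=> ma; apply: measurable_funM => //; exact: measurable_subl.
transitivity (\int[mu]_s \int[mu]_z (f (r - s - z) * g z * h s)%:E)%E.
  apply: eq_integral => s _; rewrite /conv ge0_integralZr_R//; first exact: mz.
  by move=> t; rewrite mulr_ge0.
transitivity (\int[mu]_z \int[mu]_s (f (r - z - s) * h s * g z)%:E)%E; last first.
  apply: eq_integral => s _; rewrite /conv ge0_integralZr_R//; first exact: mz.
  by move=> t; rewrite mulr_ge0.
pose F (z : R * R) := f (r - z.1 - z.2) * g z.2 * h z.1.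
have mF : measurable_fun setT F.
  apply: measurable_funM; last exact: measurable_fst2.
  apply: measurable_funM; last exact: measurable_snd2.
  apply: (measurableT_comp mf); apply: measurable_funB => //; exact: measurable_funB.
have F0 z : 0 <= F z by rewrite !mulr_ge0.
rewrite [LHS](ge0_swap mF F0); apply: eq_integral => z _; apply: eq_integral => s _.
by rewrite /F/= -!addrA [- s - z]addrC mulrAC.
Qed.

Lemma integral_conv f g h : measurable_fun setT f -> measurable_fun setT g ->
  measurable_fun setT h -> (forall t, 0 <= f t) -> (forall t, 0 <= g t) -> (forall t, 0 <= h t) ->
  (\int[mu]_t (conv f g t * (h t)%:E) = \int[mu]_s ((g s)%:E * \int[mu]_t (f t * h (s + t))%:E))%E.
Proof.
move=> mf mg mh f0 g0 h0.
pose F (z : R * R) := f (z.1 - z.2) * g z.2 * h z.1.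
have mF : measurable_fun setT F.
  apply: measurable_funM; last exact: measurable_fst2.
  by apply: measurable_funM; [exact: measurable_sub2|exact: measurable_snd2].
have F0 z : 0 <= F z by rewrite !mulr_ge0.
transitivity (\int[mu]_t \int[mu]_s (F (t, s))%:E)%E.
  apply: eq_integral => t _; rewrite /conv ge0_integralZr_R//.
    by apply: measurable_funM => //; exact: measurable_subl.
  by move=> s; rewrite mulr_ge0.
rewrite (ge0_swap mF F0); apply: eq_integral => s _.
have m1 : measurable_fun setT (fun t : R => f t * h (s + t)).
  by apply: measurable_funM => //; exact: measurable_addl.
rewrite -ge0_integralZ//; last by move=> t; rewrite mulr_ge0.
have m2 : measurable_fun setT (fun t : R => g s * (f t * h (s + t))) by exact: measurable_funM.
rewrite -(ge0_integral_shift (- s) m2 (fun t => mulr_ge0 (g0 _) (mulr_ge0 (f0 _) (h0 _)))).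
apply: eq_integral => t _; rewrite /F/= (_ : s + (t - s) = t); last by ring.
by congr EFin; ring.
Qed.

Lemma measurable_conv f g : measurable_fun setT f -> measurable_fun setT g ->
  (forall t, 0 <= f t) -> (forall t, 0 <= g t) ->
  measurable_fun [set: measurableTypeR R] (conv f g).
Proof.
move=> mf mg f0 g0.
pose F (z : R * R) := f (z.1 - z.2) * g z.2.
have mF : measurable_fun setT F.
  by apply: measurable_funM; [exact: measurable_sub2|exact: measurable_snd2].
have mFE : measurable_fun [set: (measurableTypeR R * measurableTypeR R)%type] (EFin \o F).
  by exact/measurable_EFinP.
have F0 z : (0 <= (EFin \o F) z)%E by rewrite lee_fin mulr_ge0.
exact: (@measurable_fun_fubini_tonelli_F _ _ _ _ _ mu (EFin \o F) mFE F0).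
Qed.

End convolution.

Lemma measurable_invr (R : realType) : measurable_fun setT (fun x : R => x^-1).
Proof.
have m0 : measurable_fun setT (fun x : R => if x == 0 then 0 else x^-1).
  rewrite (_ : (fun x : R => _) = (fun x : R => x^-1) \_ [set x : R | x != 0]); last first.
    apply/funext => x; rewrite patchE; case: eqVneq => [->|x0]; first by rewrite memNset//= eqxx.
    by rewrite mem_set.
  have oD : open [set x : R | x != 0].
    have := @closed_eq R 0; rewrite -openC; congr open.
    by apply/seteqP; split => x /= /eqP.
  apply/(measurable_restrictT _ (open_measurable oD)).
  by apply: open_continuous_measurable_fun => // x; rewrite inE/=; exact: inv_continuous.
rewrite (_ : (fun x : R => x^-1) = fun x : R => if x == 0 then 0 else x^-1)//.
by apply/funext => x; case: eqVneq => // ->; rewrite invr0.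
Qed.

(** * Subordination kernels and the resolvent identity *)

Section subordinator.
Variables (R : realType) (al K : R).
Hypotheses (al0 : 0 < al) (al1 : al < 1) (K0 : 0 < K).
Local Notation mu := (@lebesgue_measure R).
Local Notation Ga := (Gamma al).
Local Notation rho := (rho al K).
Local Notation rk := (rk al).

Let al3 : 0 < al <= 3. Proof. by rewrite al0 (le_trans (ltW al1))// ler1n. Qed.
Let Ga0 : 0 < Ga. Proof. exact: Gamma_gt0. Qed.

(* Law of the heat time: the extension of [u] at height [y] averages the heat flow of [u]
   against [igamma (y^2 / 4)]. *)
Definition igamma (c t : R) := c `^ al / Ga * (pw (- al) t * expR (- c / t)).

(** The closed form of the convolution of [rk] with [igamma c]; its dependence on [c] is simple
    enough to be differentiated. *)
Definition kc (c t : R) := rk t * expR (- c / t).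

Lemma measurable_rk : measurable_fun setT rk.
Proof. by apply: measurable_funM => //; exact: measurable_pw. Qed.

Lemma measurable_expV (c : R) : measurable_fun setT (fun t : R => expR (- c / t)).
Proof.
apply: (measurableT_comp (@measurable_expR R)); apply: measurable_funM => //.
exact: measurable_invr.
Qed.

Lemma igamma_ge0 (c t : R) : 0 <= igamma c t.
Proof.
apply: mulr_ge0; first by apply: divr_ge0; [exact: powR_ge0|exact: ltW].
by apply: mulr_ge0; [exact: pw_ge0|exact: expR_ge0].
Qed.

Lemma kc_ge0 (c t : R) : 0 <= kc c t.
Proof. by apply: mulr_ge0; [exact: rk_ge0|exact: expR_ge0]. Qed.

Lemma measurable_ig (a c : R) : measurable_fun setT (fun t : R => pw a t * expR (- c / t)).
Proof. by apply: measurable_funM; [exact: measurable_pw|exact: measurable_expV]. Qed.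

Lemma measurable_igamma (c : R) : measurable_fun setT (igamma c).
Proof. by apply: measurable_funM => //; exact: measurable_ig. Qed.

Lemma measurable_kc (c : R) : measurable_fun setT (kc c).
Proof. by apply: measurable_funM; [exact: measurable_rk|exact: measurable_expV]. Qed.

Lemma igamma_mass (c : R) : 0 < c -> (\int[mu]_t (igamma c t)%:E = 1)%E.
Proof.
move=> c0; rewrite ge0_integralZ; last 3 first.
- by apply: divr_ge0; [exact: powR_ge0|exact: ltW].
- exact: measurable_ig.
- by move=> t; apply: mulr_ge0; [exact: pw_ge0|exact: expR_ge0].
rewrite inverse_gamma// -EFinM; congr EFin; rewrite powRN; field.
by rewrite !gt_eqF ?powR_gt0.
Qed.

(** The substitution [s = 1 / (t + 1 / r)] gives [r - s = r t s] and splits the exponential into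
    [expR (- c / r)] and [expR (- c t)], which leaves a Gamma integral. *)
Lemma conv_rk_igamma (c r : R) : 0 < c -> conv rk (igamma c) r = (kc c r)%:E.
Proof.
move=> c0; rewrite /conv; have [r0|r0] := leP r 0.
  rewrite /kc /rk pw_le0// !mul0r; apply: integral0_eq => s _.
  have [s0|s0] := leP s 0; first by rewrite /igamma (pw_le0 _ s0) !(mul0r, mulr0).
  by rewrite [pw al _]pw_le0 ?mul0r//; lra.
pose C := c `^ al / (Ga * Ga).
have C0 : 0 <= C by apply: divr_ge0; [exact: powR_ge0|apply: mulr_ge0; exact: ltW].
pose G (s : R) := C * (`|r - s| `^ (al - 1) * (s `^ (- al - 1) * expR (- c / s))).
have G0 (s : R) : 0 < s -> 0 <= G s.
  by move=> s0; apply: mulr_ge0 => //; rewrite !mulr_ge0 ?powR_ge0 ?expR_ge0.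
have cG (s : R) : 0 < s -> r^-1 * s < 1 -> {for s, continuous G}.
  move=> s0; rewrite mulrC ltr_pdivrMr// mul1r => sr.
  apply: continuousM; first exact: cst_continuous.
  apply: continuousM.
    apply: (@continuous_comp _ _ _ (fun s : R => `|r - s|) (fun x : R => x `^ (al - 1))).
      apply: (@continuous_comp _ _ _ (fun s : R => r - s) (fun x : R => `|x|)); last exact: norm_continuous.
      by apply: continuousB; [exact: cst_continuous|exact: cvg_id].
    by apply: continuous_powR; rewrite normr_gt0 subr_eq0 gt_eqF.
  apply: continuousM; first exact: continuous_powR.
  apply: (continuous_comp _ (@continuous_expR R _)).
  by apply: continuousM; [exact: cst_continuous|apply: continuousV; [rewrite gt_eqF|exact: cvg_id]].
have ri : 0 <= r^-1 by rewrite invr_ge0 ltW.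
have := inversion_integral ri cG G0.
have -> : (\int[mu]_x (if ((0 < x) && (r^-1 * x < 1))%R then G x else 0%R)%:E = \int[mu]_s (rk (r - s) * igamma c s)%:E)%E.
  apply: eq_integral => s _; congr EFin; rewrite /rk /igamma /pw mulrC ltr_pdivrMr// mul1r subr_gt0.
  case: (ltP 0 s) => s0 /=; last by rewrite !(mul0r, mulr0).
  case: ifPn => sr; last by rewrite !mul0r.
  rewrite /G gtr0_norm ?subr_gt0// /C; field; exact: lt0r_neq0.
move=> ->.
transitivity (\int[mu]_t (C * r `^ (al - 1) * expR (- c / r) * (pw al t * expR (- c * t)))%:E)%E.
  apply: eq_integral => t _; congr EFin; rewrite /poscut; case: ifPn => [t0|t0]; last first.
    by rewrite pw_le0 ?leNgt// !(mul0r, mulr0).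
  have q0 : 0 < t + r^-1 by rewrite addr_gt0// invr_gt0.
  have rq : 0 < r * t * (t + r^-1)^-1 by rewrite !mulr_gt0// invr_gt0.
  rewrite /G invrK.
  have -> : r - (t + r^-1)^-1 = r * t * (t + r^-1)^-1.
    field.
    rewrite gt_eqF//= (_ : t * r + 1 = (t + r^-1) * r); first by rewrite mulf_neq0// gt_eqF.
    by rewrite mulrDl mulVf// gt_eqF.
  rewrite gtr0_norm// pwE// powRM ?mulr_ge0 ?invr_ge0 ?(ltW r0) ?(ltW t0) ?(ltW q0)//.
  rewrite powRM ?(ltW r0) ?(ltW t0)//.
  have -> : expR (- c * (t + r^-1)) = expR (- c / r) * expR (- c * t).
    by rewrite -expRD; congr expR; ring.
  set e1 := expR _; set e2 := expR _; set p1 := r `^ _; set p2 := t `^ _.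
  set z := (t + r^-1)^-1; have z0 : 0 < z by rewrite invr_gt0.
  (* The exponents of [z], including the Jacobian, add up to 0. *)
  have zz : z `^ (al - 1) * z `^ (- al - 1) * (t + r^-1) ^- 2 = 1.
    rewrite -powRD; last by rewrite (gt_eqF z0) implybT.
    by rewrite -(powR_invn 2 (ltW q0)) -(invrK (t + r^-1)) -/z -powR_inv1 ?(ltW z0)// -powRrM -powRD ?(gt_eqF z0) ?implybT// -[RHS](powRr0 z); congr powR; ring.
  transitivity (C * p1 * e1 * (p2 * e2) * (z `^ (al - 1) * z `^ (- al - 1) * (t + r^-1) ^- 2)).
    ring.
  by rewrite zz mulr1.
rewrite ge0_integralZ; last 3 first.
- by apply: mulr_ge0; [apply: mulr_ge0 => //; exact: powR_ge0|exact: expR_ge0].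
- exact: measurable_gammaf.
- by move=> t; rewrite mulr_ge0 ?pw_ge0 ?expR_ge0.
rewrite gamma_scale// -EFinM; congr EFin; rewrite /kc /rk pwE// /C powRN; field.
by rewrite !gt_eqF ?powR_gt0.
Qed.

Let mrho : measurable_fun setT rho. Proof. exact: measurable_rho. Qed.
Let rho0 t : 0 <= rho t. Proof. exact: rho_ge0. Qed.

Lemma rk_conv (t : R) : ((rk t)%:E = (rho t)%:E + K%:E * conv rk rho t)%E.
Proof. exact: rho_convE. Qed.

Lemma rk_conv_mul (t c : R) : 0 <= c ->
  ((rk t * c)%:E = (rho t * c)%:E + K%:E * (conv rk rho t * c%:E))%E.
Proof.
move=> c0; have C0 : (0 <= conv rk rho t)%E by apply: conv_ge0 => // s; exact: rk_ge0.
rewrite EFinM rk_conv ge0_muleDl; first by rewrite -muleA -EFinM.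
- by rewrite lee_fin.
- by apply: mule_ge0 => //; rewrite lee_fin ltW.
Qed.

Lemma measurable_expM (s : R) : measurable_fun setT (fun t : R => expR (- s * t)).
Proof. by apply: (measurableT_comp (@measurable_expR R)); exact: measurable_funM. Qed.

(** The Volterra equation becomes [s^(- al) = L (1 + K s^(- al))] for the transform [L] of [rho].
    All terms are nonnegative and the left side is finite, so [L] is finite and can be solved
    for. *)
Lemma rho_laplace (s : R) : 0 < s ->
  (\int[mu]_t (rho t * expR (- s * t))%:E = ((s `^ al + K)^-1)%:E)%E.
Proof.
move=> s0; pose h (t : R) := expR (- s * t).
have mh : measurable_fun setT h := measurable_expM s.
have h0 t : 0 <= h t by exact: expR_ge0.
have mc : measurable_fun [set: measurableTypeR R] (conv rk rho).
  by apply: measurable_conv => //; [exact: measurable_rk|move=> t; exact: rk_ge0].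
have E1 : (\int[mu]_t (rk t * h t)%:E = \int[mu]_t ((rho t * h t)%:E + K%:E * (conv rk rho t * (h t)%:E)))%E.
  by apply: eq_integral => t _; exact: rk_conv_mul.
move: E1; rewrite rk_laplace// ge0_integralD//; last 4 first.
- by move=> t _; rewrite lee_fin mulr_ge0.
- by apply: measurable_EFin_R; exact: measurable_funM.
- by move=> t _; rewrite !mule_ge0 ?lee_fin ?conv_ge0 ?(ltW K0)//; exact: rk_ge0.
- by do 2 apply: emeasurable_funM => //; exact: measurable_EFin_R.
rewrite ge0_integralZl//; last 3 first.
- by apply: emeasurable_funM => //; exact: measurable_EFin_R.
- by move=> t _; rewrite mule_ge0 ?lee_fin ?conv_ge0//; exact: rk_ge0.
- by rewrite lee_fin ltW.
rewrite integral_conv//; last 2 first.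
- exact: measurable_rk.
- by move=> t; exact: rk_ge0.
have -> : (\int[mu]_s0 ((rho s0)%:E * \int[mu]_t (rk t * h (s0 + t))%:E) = \int[mu]_t (s `^ (- al) * (rho t * h t))%:E)%E.
  apply: eq_integral => t _.
  have -> : (\int[mu]_t0 (rk t0 * h (t + t0))%:E = \int[mu]_t0 (h t * (rk t0 * h t0))%:E)%E.
    by apply: eq_integral => z _; rewrite /h mulrDr expRD mulrCA.
  rewrite ge0_integralZ//; last 2 first.
  - by apply: measurable_funM => //; exact: measurable_rk.
  - by move=> z; rewrite mulr_ge0//; exact: rk_ge0.
  by rewrite rk_laplace// -!EFinM; congr EFin; ring.
rewrite ge0_integralZ ?powR_ge0//; last 2 first.
- exact: measurable_funM.
- by move=> z; rewrite mulr_ge0.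
have sp : 0 < s `^ al by rewrite powR_gt0.
have Kp : 0 < K * s `^ (- al) by rewrite mulr_gt0// powR_gt0.
have I0 : (0 <= \int[mu]_t (rho t * h t)%:E)%E by apply: integral_ge0 => t _; rewrite lee_fin mulr_ge0.
move: I0; case: (integral _ _ _) => [p| |] //=.
  move=> _; rewrite -!EFinM -EFinD => -[E]; congr EFin.
  have : s `^ (- al) = p * (1 + K * s `^ (- al)) by rewrite {1}E; ring.
  rewrite powRN => E2; apply: (mulIf (lt0r_neq0 (addr_gt0 sp K0))).
  rewrite mulVf ?gt_eqF ?addr_gt0//.
  have -> : p * (s `^ al + K) = s `^ al * (p * (1 + K * (s `^ al)^-1)) by field; rewrite gt_eqF.
  by rewrite -E2 divff// gt_eqF.
by move=> _; rewrite muleA -EFinM gt0_muley ?lte_fin.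
Qed.

(** The Volterra equation convolved with [igamma c]: both occurrences of [rk] turn into [kc c] by
    [conv_rk_igamma]. *)
Lemma kc_conv (c r : R) : 0 < c ->
  ((kc c r)%:E = conv rho (igamma c) r + K%:E * conv rho (kc c) r)%E.
Proof.
move=> c0.
have me := measurable_igamma c; have mk := measurable_kc c; have mr := measurable_rk.
have r0 t : 0 <= rk t by exact: rk_ge0.
have e0 := igamma_ge0 c; have k0 := kc_ge0 c.
rewrite -conv_rk_igamma// {1}/conv.
transitivity (\int[mu]_s ((rho (r - s) * igamma c s)%:E + K%:E * (conv rk rho (r - s) * (igamma c s)%:E)))%E.
  apply: eq_integral => s _.
  exact: rk_conv_mul.
have mc : measurable_fun [set: measurableTypeR R] (fun s : R => conv rk rho (r - s)).
  apply: (measurableT_comp (measurable_conv mr mrho r0 rho0)).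
  exact: measurable_funB.
have mre : measurable_fun setT (fun s : R => rho (r - s) * igamma c s).
  exact: (measurable_funM (measurable_subl r mrho) me).
have mce : measurable_fun [set: measurableTypeR R] (fun s : R => (conv rk rho (r - s) * (igamma c s)%:E)%E).
  by apply: emeasurable_funM => //; exact: measurable_EFin_R.
rewrite ge0_integralD//; last 4 first.
- by move=> t _; rewrite lee_fin mulr_ge0.
- exact: (measurable_EFin_R mre).
- by move=> t _; rewrite !mule_ge0 ?lee_fin ?conv_ge0 ?(ltW K0).
- by apply: emeasurable_funM.
rewrite ge0_integralZl//; last 2 first.
- by move=> t _; rewrite mule_ge0 ?lee_fin ?conv_ge0.
- by rewrite lee_fin ltW.
congr (_ + _ * _)%E.
rewrite conv_swap// convC//.
by apply: eq_integral => s _; rewrite conv_rk_igamma.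
Qed.

Definition wrho (w : R -> R) (t : R) := \int[mu]_s (rho s * w (t + s)).

Lemma rho_w_integrable (w : R -> R) (M t : R) : measurable_fun setT w -> (forall t, `|w t| <= M) ->
  mu.-integrable setT (fun s => (rho s * w (t + s))%:E).
Proof.
move=> mw wM; apply: (@integrable_le_norm _ _ R mu setT (fun s => rho s * w (t + s))
  (fun s => M * rho s) measurableT).
- by apply: measurable_funM => //; exact: measurable_addl.
- exact: (integrableZl measurableT M (rho_integrable al0 al1 K0)).
- by move=> s _; rewrite normrM (ger0_norm (rho0 _)) mulrC ler_wpM2r.
Qed.

Lemma wrhoE (w : R -> R) (M t : R) : measurable_fun setT w -> (forall t, `|w t| <= M) ->
  (wrho w t)%:E = (\int[mu]_s (rho s * w (t + s))%:E)%E.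
Proof.
move=> mw wM; rewrite /wrho /Rintegral fineK//.
exact: (integrable_fin_num measurableT (rho_w_integrable t mw wM)).
Qed.

Lemma Rintegral_rho_le : 0 <= \int[mu]_s rho s <= K^-1.
Proof.
apply/andP; split; first by apply: Rintegral_ge0.
rewrite -lee_fin /Rintegral fineK; first exact: rho_mass_le.
exact: (integrable_fin_num measurableT (rho_integrable al0 al1 K0)).
Qed.

Lemma wrho_bound (w : R -> R) (M t : R) : measurable_fun setT w -> (forall t, `|w t| <= M) ->
  `|wrho w t| <= M / K.
Proof.
move=> mw wM; have M0 : 0 <= M := le_trans (normr_ge0 _) (wM 0).
have iw := rho_w_integrable t mw wM.
apply: (le_trans (le_normr_Rintegral measurableT iw)).
apply: (@le_trans _ _ (\int[mu]_s (M * rho s))).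
  apply: le_Rintegral => //.
  - exact: (integrable_norm iw).
  - exact: (integrableZl measurableT M (rho_integrable al0 al1 K0)).
  - by move=> s _; rewrite normrM (ger0_norm (rho0 _)) mulrC ler_wpM2r.
rewrite RintegralZl//; last exact: rho_integrable.
by rewrite ler_wpM2l//; case/andP: Rintegral_rho_le.
Qed.

Lemma measurable_wrho (w : R -> R) (M : R) : measurable_fun setT w -> (forall t, `|w t| <= M) ->
  measurable_fun setT (wrho w).
Proof.
move=> mw wM; have M0 : 0 <= M := le_trans (normr_ge0 _) (wM 0).
pose F (z : R * R) := rho z.2 * (w (z.1 + z.2) + M).
have wM0 t : 0 <= w t + M by have := wM t; rewrite ler_norml => /andP[+ _]; lra.
have mF : measurable_fun setT F.
  apply: measurable_funM; first exact: measurable_snd2.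
  by apply: measurable_funD => //; exact: measurable_add2.
have mFE : measurable_fun [set: (measurableTypeR R * measurableTypeR R)%type] (EFin \o F).
  by exact/measurable_EFinP.
have F0 z : (0 <= (EFin \o F) z)%E by rewrite lee_fin mulr_ge0.
have H := @measurable_fun_fubini_tonelli_F _ _ _ _ _ mu (EFin \o F) mFE F0.
have E t : (wrho w t + M * \int[mu]_s rho s)%:E = fubini_F mu (EFin \o F) t.
  rewrite EFinD (wrhoE t mw wM) /fubini_F/=.
  have i1 := rho_w_integrable t mw wM.
  have i2 := integrableZl measurableT M (rho_integrable al0 al1 K0).
  have -> : (M * \int[mu]_s rho s)%:E = (\int[mu]_s (M * rho s)%:E)%E.
    rewrite -RintegralZl//; last exact: rho_integrable.
    by rewrite /Rintegral fineK//; exact: (integrable_fin_num measurableT i2).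
  rewrite -(integralD measurableT i1 i2); apply: eq_integral => s _.
  by rewrite -EFinD /F/=; congr EFin; ring.
have mE : measurable_fun setT (fun t => wrho w t + M * \int[mu]_s rho s).
  apply/measurable_EFinP; rewrite (_ : EFin \o _ = fubini_F mu (EFin \o F)); first exact: H.
  by apply/funext => t; exact: E.
rewrite (_ : wrho w = fun t => (wrho w t + M * \int[mu]_s rho s) - M * \int[mu]_s rho s).
  by apply: measurable_funB.
by apply/funext => t; ring.
Qed.

(** Minus the derivative of [kc c t] in [c]; the factor [1 / t] lowers the exponent of the power to
    [al - 1]. *)
Definition dk (c t : R) := pw (al - 1) t / Ga * expR (- c / t).

Lemma measurable_dk c : measurable_fun setT (dk c).
Proof.
apply: measurable_funM; last exact: measurable_expV.
by apply: measurable_funM => //; exact: measurable_pw.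
Qed.

Lemma dk_ge0 c t : 0 <= dk c t.
Proof.
apply: mulr_ge0; last exact: expR_ge0.
by apply: divr_ge0; [exact: pw_ge0|exact: ltW].
Qed.

Lemma dk_mass (c : R) : 0 < c ->
  (\int[mu]_t (dk c t)%:E = (Gamma (1 - al) * c `^ (al - 1) / Ga)%:E)%E.
Proof.
move=> c0; have a3 : 0 < 1 - al <= 3.
  by rewrite subr_gt0 al1 (@le_trans _ _ 1)// ?ler1n// gerBl ltW.
transitivity (\int[mu]_t (Ga^-1 * (pw (- (1 - al)) t * expR (- c / t)))%:E)%E.
  by apply: eq_integral => t _; rewrite /dk opprB; congr EFin; ring.
rewrite ge0_integralZ ?invr_ge0 ?(ltW Ga0)//; last 2 first.
- exact: measurable_ig.
- by move=> t; apply: mulr_ge0; [exact: pw_ge0|exact: expR_ge0].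
by rewrite inverse_gamma// -EFinM opprB; congr EFin; ring.
Qed.

Lemma dk_integrable (c : R) : 0 < c -> mu.-integrable setT (fun t => (dk c t)%:E).
Proof.
move=> c0; apply/integrableP; split; first by apply: measurable_EFin_R; exact: measurable_dk.
under eq_integral do rewrite gee0_abs ?lee_fin ?dk_ge0//.
by rewrite dk_mass// ltry.
Qed.

(** From [1 - expR (- z) <= z] at [z = (c2 - c1) / t]. The additional [1 / t] makes the difference
    integrable at infinity, which [kc] itself is not. *)
Lemma kcB_bound (c1 c2 t : R) : 0 < c1 -> c1 <= c2 -> 0 <= kc c1 t - kc c2 t <= (c2 - c1) * dk c1 t.
Proof.
move=> c10 c12; have [t0|t0] := leP t 0.
  by rewrite /kc /rk /dk !pw_le0// !(mul0r, mulr0) subrr lexx.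
have E : kc c1 t - kc c2 t = rk t * expR (- c1 / t) * (1 - expR (- (c2 - c1) / t)).
  rewrite mulrBr mulr1 -[rk t * _ * _]mulrA -expRD /kc; congr (_ - _ * expR _); ring.
have ct0 : 0 <= (c2 - c1) / t by rewrite divr_ge0 ?subr_ge0// ltW.
have k0 : 0 <= rk t * expR (- c1 / t) by apply: mulr_ge0; [exact: rk_ge0|exact: expR_ge0].
rewrite E mulr_ge0//=; last by rewrite subr_ge0 mulNr -expR0 ler_expR oppr_le0.
have -> : (c2 - c1) * dk c1 t = rk t * expR (- c1 / t) * ((c2 - c1) / t).
  rewrite /dk /rk (_ : pw (al - 1) t = pw al t / t); first by ring.
  by rewrite pwD// powR_inv1// ltW.
rewrite ler_wpM2l// lerBlDr addrC -lerBlDr.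
by have := expR_ge1Dx (- ((c2 - c1) / t)); rewrite -mulNr.
Qed.

Lemma wrho_tonelli (g w : R -> R) (M : R) : measurable_fun setT g -> (forall t, 0 <= g t) ->
  measurable_fun setT w -> (forall t, 0 <= w t <= M) ->
  (\int[mu]_t (conv rho g t * (w t)%:E) = \int[mu]_t (g t * wrho w t)%:E)%E.
Proof.
move=> mg g0 mw wM; have w0 t : 0 <= w t by case/andP: (wM t).
have wM' t : `|w t| <= M by rewrite ger0_norm//; case/andP: (wM t).
rewrite (integral_conv mrho mg mw rho0 g0 w0); apply: eq_integral => s _.
by rewrite EFinM (wrhoE s mw wM').
Qed.

(** The identity [kc_conv] at [c1] and at [c2], subtracted. Both sides are arranged as sums of
    nonnegative terms, and the finiteness of [kc] excludes infinite convolutions. *)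
Lemma kc_conv_diff (c1 c2 r : R) : 0 < c1 -> c1 <= c2 ->
  ((kc c1 r - kc c2 r)%:E + conv rho (igamma c2) r =
   conv rho (igamma c1) r + K%:E * conv rho (fun t => (kc c1 t - kc c2 t)%R) r)%E.
Proof.
move=> c10 c12; have c20 : 0 < c2 := lt_le_trans c10 c12.
pose d t := kc c1 t - kc c2 t.
have d0 t : 0 <= d t by case/andP: (kcB_bound t c10 c12).
have md : measurable_fun setT d by apply: measurable_funB; exact: measurable_kc.
have mk2 := measurable_kc c2.
have p2 : measurable_fun setT (fun s : R => rho (r - s) * kc c2 s) := measurable_funM (measurable_subl r mrho) mk2.
have pd : measurable_fun setT (fun s : R => rho (r - s) * d s) := measurable_funM (measurable_subl r mrho) md.
have E : (conv rho (kc c1) r = conv rho (kc c2) r + conv rho d r)%E.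
  rewrite /conv -ge0_integralD//; last 4 first.
  - by move=> s _; rewrite lee_fin mulr_ge0// kc_ge0.
  - exact: (measurable_EFin_R p2).
  - by move=> s _; rewrite lee_fin mulr_ge0.
  - exact: (measurable_EFin_R pd).
  by apply: eq_integral => s _; rewrite -EFinD /d; congr EFin; ring.
have := kc_conv r c10; rewrite E; have := kc_conv r c20.
have e1 : (0 <= conv rho (igamma c1) r)%E by apply: conv_ge0 => // t; exact: igamma_ge0.
have e2 : (0 <= conv rho (igamma c2) r)%E by apply: conv_ge0 => // t; exact: igamma_ge0.
have C2 : (0 <= conv rho (kc c2) r)%E by apply: conv_ge0 => // t; exact: kc_ge0.
have D0 : (0 <= conv rho d r)%E by exact: conv_ge0.
rewrite -/d; move: e1 e2 C2 D0.
case: (conv rho (igamma c1) r) => [e1| |]//=; case: (conv rho (igamma c2) r) => [e2| |]//=;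
case: (conv rho (kc c2) r) => [C2| |]//=; case: (conv rho d r) => [D| |]//= _ _ _ _;
  rewrite -?EFinM -?EFinD ?gt0_muley ?lte_fin//=.
move=> [k2] [k1]; congr EFin; rewrite /d k1 k2; ring.
Qed.

Lemma igamma_integrable (c : R) : 0 < c -> mu.-integrable setT (fun t => (igamma c t)%:E).
Proof.
move=> c0; apply/integrableP; split; first exact: (measurable_EFin_R (measurable_igamma c)).
by under eq_integral do rewrite gee0_abs ?lee_fin ?igamma_ge0//; rewrite igamma_mass// ltry.
Qed.

Lemma kcB_integrable (c1 c2 : R) : 0 < c1 -> c1 <= c2 ->
  mu.-integrable setT (fun t => (kc c1 t - kc c2 t)%:E).
Proof.
move=> c10 c12.
apply: (@integrable_le_norm _ _ R mu setT (fun t => kc c1 t - kc c2 t) (fun t => (c2 - c1) * dk c1 t) measurableT).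
- by apply: measurable_funB; exact: measurable_kc.
- exact: (integrableZl measurableT (c2 - c1) (dk_integrable c10)).
- by move=> t _; have /andP[h1 h2] := kcB_bound t c10 c12; rewrite ger0_norm.
Qed.

(** Integrate [kc_conv_diff] against [w]; [wrho_tonelli] moves [rho] from the kernels onto [w]. *)
Lemma resolvent_identity_ge0 (w : R -> R) (M c1 c2 : R) : measurable_fun setT w ->
  (forall t, 0 <= w t <= M) -> 0 < c1 -> c1 <= c2 ->
  \int[mu]_t (igamma c1 t * wrho w t) - \int[mu]_t (igamma c2 t * wrho w t) =
  \int[mu]_t ((kc c1 t - kc c2 t) * (w t - K * wrho w t)).
Proof.
move=> mw wM c10 c12; have c20 : 0 < c2 := lt_le_trans c10 c12.
have w0 t : 0 <= w t by case/andP: (wM t).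
have wM' t : `|w t| <= M by rewrite ger0_norm//; case/andP: (wM t).
pose W := wrho w.
have W0 t : 0 <= W t by apply: Rintegral_ge0 => s _; rewrite mulr_ge0.
have mW : measurable_fun setT W := measurable_wrho mw wM'.
have WM t : `|W t| <= M / K := wrho_bound t mw wM'.
pose d t := kc c1 t - kc c2 t.
have d0 t : 0 <= d t by case/andP: (kcB_bound t c10 c12).
have md : measurable_fun setT d by apply: measurable_funB; exact: measurable_kc.
have idk := kcB_integrable c10 c12.
have i1 := integrableM_bounded (measurable_igamma c1) (igamma_ge0 c1) (igamma_integrable c10) mW WM.
have i2 := integrableM_bounded (measurable_igamma c2) (igamma_ge0 c2) (igamma_integrable c20) mW WM.
have idW := integrableM_bounded md d0 idk mW WM.
have idw := integrableM_bounded md d0 idk mw wM'.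
have Efin (g h : R -> R) : mu.-integrable setT (fun t => (g t * h t)%:E) ->
   (\int[mu]_t (g t * h t)%:E = (\int[mu]_t (g t * h t))%:E)%E.
  by move=> ig; rewrite /Rintegral fineK//; exact: (integrable_fin_num measurableT ig).
have mc (g : R -> R) : measurable_fun setT g -> (forall t, 0 <= g t) ->
   measurable_fun [set: measurableTypeR R] (fun t => conv rho g t * (w t)%:E)%E.
  move=> mg g0; apply: emeasurable_funM; first exact: measurable_conv.
  exact: (measurable_EFin_R mw).
have pc (g : R -> R) : (forall t, 0 <= g t) -> forall t, setT t -> (0 <= conv rho g t * (w t)%:E)%E.
  by move=> g0 t _; apply: mule_ge0; [exact: conv_ge0|rewrite lee_fin].
have H : ((\int[mu]_t (d t * w t))%:E + (\int[mu]_t (igamma c2 t * W t))%:E =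
   (\int[mu]_t (igamma c1 t * W t))%:E + K%:E * (\int[mu]_t (d t * W t))%:E)%E.
  rewrite -!Efin// -(wrho_tonelli (measurable_igamma c2) (igamma_ge0 c2) mw wM).
  rewrite -(wrho_tonelli (measurable_igamma c1) (igamma_ge0 c1) mw wM) -(wrho_tonelli md d0 mw wM).
  rewrite -ge0_integralZl//; last 3 first.
  - exact: mc.
  - exact: pc.
  - by rewrite lee_fin ltW.
  rewrite -ge0_integralD//; last 4 first.
  - by move=> t _; rewrite lee_fin mulr_ge0.
  - exact: (measurable_EFin_R (measurable_funM md mw)).
  - by apply: pc; exact: igamma_ge0.
  - by apply: mc; [exact: measurable_igamma|exact: igamma_ge0].
  rewrite -ge0_integralD//; last 4 first.
  - by apply: pc; exact: igamma_ge0.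
  - by apply: mc; [exact: measurable_igamma|exact: igamma_ge0].
  - by move=> t tT; apply: mule_ge0; [rewrite lee_fin ltW|exact: pc].
  - by apply: emeasurable_funM => //; exact: mc.
  apply: eq_integral => t _; have := kc_conv_diff t c10 c12; rewrite -/d => E.
  have h1 : (0 <= conv rho (igamma c1) t)%E by apply: conv_ge0 => // s; exact: igamma_ge0.
  have h2 : (0 <= conv rho (igamma c2) t)%E by apply: conv_ge0 => // s; exact: igamma_ge0.
  have h3 : (0 <= K%:E * conv rho d t)%E by apply: mule_ge0; [rewrite lee_fin ltW|exact: conv_ge0].
  have h4 : (0 <= (d t)%:E)%E by rewrite lee_fin.
  transitivity (((d t)%:E + conv rho (igamma c2) t) * (w t)%:E)%E.
    by rewrite (ge0_muleDl _ h4 h2) EFinM.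
  by rewrite E (ge0_muleDl _ h1 h3) muleA.
have -> : \int[mu]_t (d t * (w t - K * W t)) = \int[mu]_t (d t * w t) - K * \int[mu]_t (d t * W t).
  rewrite -RintegralZl// -(RintegralB measurableT idw (integrableZl measurableT K idW)).
  by apply: eq_Rintegral => t _; ring.
by move: H; rewrite -EFinM -!EFinD => -[H]; exact: subr_of_add.
Qed.

(* For [w t = S_t g (x)], [wrho w t = S_t u (x)] and [w - K wrho w = S_t (f u) (x)]: the variation
   in [y] of the extension of [u] only involves the latter function, which is continuous at [0]. *)
Lemma resolvent_identity (w : R -> R) (M c1 c2 : R) : measurable_fun setT w ->
  (forall t, `|w t| <= M) -> 0 < c1 -> c1 <= c2 ->
  \int[mu]_t (igamma c1 t * wrho w t) - \int[mu]_t (igamma c2 t * wrho w t) =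
  \int[mu]_t ((kc c1 t - kc c2 t) * (w t - K * wrho w t)).
Proof.
move=> mw wM c10 c12; have c20 : 0 < c2 := lt_le_trans c10 c12.
have M0 : 0 <= M := le_trans (normr_ge0 _) (wM 0).
(* Every term is linear in the function, and [w] is the difference of [w + M] and the constant [M],
   both covered by the nonnegative case. *)
pose w1 t := w t + M; pose w2 (t : R) := M.
have mw1 : measurable_fun setT w1 by exact: measurable_funD.
have mw2 : measurable_fun setT w2 by exact: measurable_cst.
have b1 t : 0 <= w1 t <= 2 * M.
  by have := wM t; rewrite ler_norml /w1 => /andP[h1 h2]; apply/andP; split; lra.
have b2 t : 0 <= w2 t <= M by rewrite M0 lexx.
have b1' t : `|w1 t| <= 2 * M by rewrite ger0_norm; case/andP: (b1 t).
have b2' t : `|w2 t| <= M by rewrite ger0_norm.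
have Ew t : wrho w t = wrho w1 t - wrho w2 t.
  rewrite /wrho -(RintegralB measurableT (rho_w_integrable t mw1 b1') (rho_w_integrable t mw2 b2')).
  by apply: eq_Rintegral => s _; rewrite /w1 /w2; ring.
have m1 := measurable_wrho mw1 b1'; have m2 := measurable_wrho mw2 b2'.
have B1 t := wrho_bound t mw1 b1'; have B2 t := wrho_bound t mw2 b2'.
have Ee c : 0 < c -> \int[mu]_t (igamma c t * wrho w t) =
    \int[mu]_t (igamma c t * wrho w1 t) - \int[mu]_t (igamma c t * wrho w2 t).
  move=> c0.
  have j1 := integrableM_bounded (measurable_igamma c) (igamma_ge0 c) (igamma_integrable c0) m1 B1.
  have j2 := integrableM_bounded (measurable_igamma c) (igamma_ge0 c) (igamma_integrable c0) m2 B2.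
  rewrite -(RintegralB measurableT j1 j2).
  by apply: eq_Rintegral => s _; rewrite Ew; ring.
pose d t := kc c1 t - kc c2 t.
have d0 t : 0 <= d t by case/andP: (kcB_bound t c10 c12).
have md : measurable_fun setT d by apply: measurable_funB; exact: measurable_kc.
have bX (v : R -> R) B : measurable_fun setT v -> (forall t, `|v t| <= B) ->
   mu.-integrable setT (fun t => (d t * (v t - K * wrho v t))%:E).
  move=> mv vB; apply: (integrableM_bounded md d0 (kcB_integrable c10 c12) (B := B + B)).
    apply: measurable_funB => //; apply: measurable_funM => //.
    exact: (measurable_wrho mv vB).
  move=> t; rewrite (le_trans (ler_normB _ _))// lerD// normrM (gtr0_norm K0).
  rewrite -ler_pdivlMl// mulrC.
  exact: (wrho_bound t mv vB).
have -> : \int[mu]_t (d t * (w t - K * wrho w t)) =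
   \int[mu]_t (d t * (w1 t - K * wrho w1 t)) - \int[mu]_t (d t * (w2 t - K * wrho w2 t)).
  rewrite -(RintegralB measurableT (bX _ _ mw1 b1') (bX _ _ mw2 b2')).
  by apply: eq_Rintegral => s _; rewrite Ew /w1 /w2; ring.
rewrite -(resolvent_identity_ge0 mw1 b1 c10 c12) -(resolvent_identity_ge0 mw2 b2 c10 c12).
by rewrite (Ee _ c10) (Ee _ c20); exact: subr4.
Qed.

End subordinator.

(** * The conormal derivative *)

Section under_integral.
Context {R : realType} d {Y : measurableType d} (m : {measure set Y -> \bar R}).

Lemma is_derive_under_integral (f df : R -> Y -> R) (a e : R) (G : Y -> R) : 0 < e ->
  (forall x, `|x - a| < e -> m.-integrable setT (EFin \o f x)) ->
  (forall x y, `|x - a| < e -> is_derive x (1 : R) (f ^~ y) (df x y)) ->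
  m.-integrable setT (EFin \o G) ->
  (forall x y, `|x - a| < e -> `|df x y| <= G y) ->
  is_derive a (1 : R) (fun x => \int[m]_y f x y) (\int[m]_y df a y).
Proof.
move=> e0 intf dff iG bG.
have Iab x : (`](a - e), (a + e)[ : set R) x -> `|x - a| < e.
  by rewrite /= in_itv/= => /andP[h1 h2]; rewrite ltr_distlC; apply/andP; split; lra.
have Ia : (`](a - e), (a + e)[ : set R) a by rewrite /= in_itv/=; apply/andP; split; lra.
have aa : `|a - a| < e by rewrite subrr normr0.
have G0 y : 0 <= G y := le_trans (normr_ge0 _) (bG a y aa).
have pE x y : `|x - a| < e -> partial1of2 f x y = df x y.
  by move=> xa; rewrite partial1of2E; have [_ ->] := dff x y xa.
have h1 x : (`](a - e), (a + e)[ : set R) x -> m.-integrable setT (EFin \o f x).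
  by move=> /Iab; exact: intf.
have h2 x y : (`](a - e), (a + e)[ : set R) x -> setT y -> derivable (f ^~ y) x 1.
  by move=> /Iab xa _; have [] := dff x y xa.
have h3 x y : (`](a - e), (a + e)[ : set R) x -> setT y -> `|partial1of2 f x y| <= G y.
  by move=> /Iab xa _; rewrite pE//; exact: bG.
split; first exact: (derivable_under_integral measurableT Ia h1 h2 G0 iG h3).
rewrite -derive1E (differentiation_under_integral measurableT Ia h1 h2 G0 iG h3).
by apply: eq_Rintegral => y _; rewrite pE.
Qed.

End under_integral.

Section neumann.
Variables (R : realType) (al : R).
Hypotheses (al0 : 0 < al) (al1 : al < 1).
Local Notation mu := (@lebesgue_measure R).
Local Notation Ga := (Gamma al).
Local Notation kc := (kc al).
Local Notation dk := (dk al).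

Let al3 : 0 < al <= 3. Proof. by rewrite al0 (le_trans (ltW al1))// ler1n. Qed.
Let Ga0 : 0 < Ga. Proof. exact: Gamma_gt0. Qed.

Lemma is_derive_kc (t c : R) : is_derive c (1 : R) (fun c => kc c t) (- dk c t).
Proof.
have [t0|t0] := leP t 0.
  have -> : (fun c => kc c t) = cst 0 by apply/funext => x; rewrite /kc /rk pw_le0// !mul0r.
  by rewrite /dk pw_le0// !mul0r oppr0; exact: is_derive_cst.
have H0 : is_derive c (1 : R) (- t^-1 \*: (id : R -> R)) (- t^-1 *: 1).
  by apply: is_deriveZ; exact: is_derive_id.
have H := @is_derive1_comp _ (@expR R) _ c _ _ (is_derive_expR _) H0.
have H2 := @is_deriveZ _ _ _ _ (rk al t) c 1 _ H.
rewrite (_ : (fun c => kc c t) = rk al t \*: (expR \o (- t^-1 \*: (id : R -> R)))); last first.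
  apply/funext => x; rewrite /kc/= -[LHS]/(rk al t * expR (- x / t)); congr (_ * expR _).
  by rewrite -[RHS]/(- t^-1 * x); ring.
apply: is_derive_eq; rewrite /dk /rk (_ : pw (al - 1) t = pw al t / t); last first.
  by rewrite pwD// powR_inv1// ltW.
rewrite -[LHS]/(pw al t / Ga * (expR (- t^-1 * c) * (- t^-1 * 1))) (_ : - t^-1 * c = - c / t); ring.
Qed.

Variables (X : R -> R) (MX : R).
Hypotheses (mX : measurable_fun setT X) (XM : forall t, `|X t| <= MX).

Lemma dk_anti (c c' t : R) : c <= c' -> dk c' t <= dk c t.
Proof.
move=> cc; have [t0|t0] := leP t 0; first by rewrite /dk pw_le0// !mul0r.
rewrite /dk ler_wpM2l ?divr_ge0 ?pw_ge0 ?(ltW Ga0)// ler_expR ler_wpM2r ?invr_ge0 ?(ltW t0)//.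
by rewrite lerN2.
Qed.

(** Subtracting [kc c0] makes the integral converge without changing the derivative. For parameters
    near [c] the derivative of the integrand is dominated through [dk (c / 2)], since [dk] decreases
    in [c]. *)
Lemma is_derive_kc_integral (c0 c : R) : 0 < c0 -> 0 < c ->
  is_derive c (1 : R) (fun c => \int[mu]_t ((kc c t - kc c0 t) * X t)) (- \int[mu]_t (dk c t * X t)).
Proof.
move=> c00 cp.
have mk x : measurable_fun setT (kc x) := measurable_kc al x.
have iG : mu.-integrable setT (EFin \o (fun t => MX * dk (c / 2) t)).
  have c2 : 0 < c / 2 by rewrite divr_gt0.
  exact: (integrableZl measurableT MX (dk_integrable al0 al1 c2)).
have mdX x : measurable_fun setT (fun t => dk x t * X t).
  by apply: measurable_funM => //; exact: measurable_dk.
have half x : `|x - c| < c / 2 -> c / 2 < x by rewrite ltr_distl => /andP[h1 h2]; lra.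
have M0 : 0 <= MX := le_trans (normr_ge0 _) (XM 0).
have bd x t : `|x - c| < c / 2 -> `|- dk x t * X t| <= MX * dk (c / 2) t.
  move=> /half hx; rewrite normrM normrN (ger0_norm (dk_ge0 _ al1 _ _))// mulrC ler_pM// ?dk_ge0//.
  by apply: dk_anti; exact: ltW.
have H := @is_derive_under_integral R _ _ mu (fun x t => (kc x t - kc c0 t) * X t)
  (fun x t => - dk x t * X t) c (c / 2) (fun t => MX * dk (c / 2) t) _ _ _ iG bd.
have idX : mu.-integrable setT (fun t => (dk c t * X t)%:E).
  exact: (integrableM_bounded (measurable_dk al c) (dk_ge0 al0 al1 c) (dk_integrable al0 al1 cp) mX XM).
rewrite (_ : - _ = \int[mu]_t (- dk c t * X t)); last first.
  rewrite -mulN1r -RintegralZl//; apply: eq_Rintegral => t _; ring.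
apply: H.
- by rewrite divr_gt0.
- move=> x /half hx; have x0 : 0 < x by rewrite (lt_trans _ hx)// divr_gt0.
  have [xc|cx] := leP x c0.
    apply: (integrableM_bounded _ _ (kcB_integrable al0 al1 x0 xc) mX XM).
      by apply: measurable_funB; exact: measurable_kc.
    by move=> t; case/andP: (kcB_bound al0 al1 t x0 xc).
  have md : measurable_fun setT (fun t => kc c0 t - kc x t) by apply: measurable_funB; exact: measurable_kc.
  have pd t : 0 <= kc c0 t - kc x t by case/andP: (kcB_bound al0 al1 t c00 (ltW cx)).
  have HH := integrableZl measurableT (- 1)
    (integrableM_bounded md pd (kcB_integrable al0 al1 c00 (ltW cx)) mX XM).
  rewrite (_ : EFin \o _ = (fun t => (- 1 * ((kc c0 t - kc x t) * X t))%:E)); first exact: HH.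
  by apply/funext => t /=; congr EFin; ring.
- move=> x t _.
  have H1 := @is_deriveB _ _ _ _ _ x 1 _ _ (is_derive_kc t x) (is_derive_cst (kc c0 t) x 1).
  have H2 := @is_deriveZ _ _ _ _ (X t) x 1 _ H1.
  rewrite (_ : (fun x => (kc x t - kc c0 t) * X t) = X t \*: ((fun c => kc c t) - cst (kc c0 t))); last first.
    by apply/funext => z; rewrite mulrC.
  by apply: is_derive_eq; rewrite subr0 mulrC.
Qed.

Lemma dk_scale (c t : R) : 0 < c -> dk c (c * t) = c `^ (al - 2) * dk 1 t.
Proof.
move=> c0; rewrite /dk pw_scale// (_ : al - 1 - 1 = al - 2); last by ring.
have [t0|t0] := leP t 0; first by rewrite pw_le0// !(mul0r, mulr0).
have -> : - c / (c * t) = - 1 / t by field; rewrite !gt_eqF.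
ring.
Qed.

Lemma dk_integral_scale (Y : R -> R) (c : R) : 0 < c -> measurable_fun setT Y -> (forall t, 0 <= Y t) ->
  (\int[mu]_t (dk c t * Y t)%:E = (c `^ (al - 1))%:E * \int[mu]_t (dk 1 t * Y (c * t))%:E)%E.
Proof.
move=> c0 mY Y0.
have m1 : measurable_fun setT (fun t => dk c t * Y t) := measurable_funM (measurable_dk al c) mY.
have mYc : measurable_fun setT (fun t : R => Y (c * t)).
  by apply: (measurableT_comp mY); exact: measurable_funM.
have m2 : measurable_fun setT (fun t => dk 1 t * Y (c * t)) := measurable_funM (measurable_dk al 1) mYc.
have p1 t : 0 <= dk c t * Y t by rewrite mulr_ge0// dk_ge0.
have p2 t : 0 <= dk 1 t * Y (c * t) by rewrite mulr_ge0// dk_ge0.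
have H := ge0_integral_scale c0 m1 p1.
have {H} : (\int[mu]_t (dk c t * Y t)%:E = c%:E * \int[mu]_t (dk c (c * t) * Y (c * t))%:E)%E.
  by rewrite H muleA -EFinM divff ?gt_eqF// mul1e.
move=> ->.
have -> : (\int[mu]_t (dk c (c * t) * Y (c * t))%:E = (c `^ (al - 2))%:E * \int[mu]_t (dk 1 t * Y (c * t))%:E)%E.
  rewrite -ge0_integralZ ?powR_ge0//; apply: eq_integral => t _.
  by rewrite dk_scale// mulrA.
rewrite muleA -EFinM -[X in X * _](powRr1 (ltW c0)) -powRD; last by rewrite (gt_eqF c0) implybT.
by rewrite (_ : 1 + (al - 2) = al - 1)//; ring.
Qed.

(** By scaling, the weights [c^(1 - al) dk c] concentrate at time 0 as [c] tends to 0, and their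
    mass is constant, equal to [Gamma (1 - al) / Gamma al]. *)
Lemma dk_integral_cvg (X0 : R) : X t @[t --> 0^'+] --> X0 ->
  c `^ (1 - al) * \int[mu]_t (dk c t * X t) @[c --> 0^'+] --> X0 * (Gamma (1 - al) / Ga).
Proof.
move=> Xc; apply: seq_cvg_within => u u0 uc.
have XcS (v : nat -> R) : (forall n, 0 < v n) -> v n @[n --> \oo] --> 0 -> X (v n) @[n --> \oo] --> X0.
  move=> v0 vc; apply: (cvg_comp _ _ _ Xc).
  by move=> A [e /= e0 He]; move/cvgrPdist_lt : vc => /(_ e e0); apply: filterS => n ne; apply: He.
have idk1 := dk_integrable al0 al1 (ltr01 : 0 < 1 :> R).
pose h n t := dk 1 t * `|X (u n * t) - X0|.
have mX' n : measurable_fun setT (fun t : R => `|X (u n * t) - X0|).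
  apply: measurableT_comp => //; apply: measurable_funB => //.
  by apply: (measurableT_comp mX); exact: measurable_funM.
have mh n : measurable_fun setT (h n) by apply: measurable_funM => //; exact: measurable_dk.
have M0 : 0 <= MX := le_trans (normr_ge0 _) (XM 0).
have hb n t : `|h n t| <= (MX + `|X0|) * dk 1 t.
  rewrite /h normrM (ger0_norm (dk_ge0 al0 al1 _ _)) normr_id mulrC ler_wpM2r ?dk_ge0//.
  by rewrite (le_trans (ler_normB _ _))// lerD2r.
have hcv t : h n t @[n --> \oo] --> 0.
  have [t0|t0] := leP t 0.
    by rewrite /h /dk pw_le0//; under eq_fun do rewrite !mul0r; exact: cvg_cst.
  have H1 : X (u n * t) @[n --> \oo] --> X0.
    apply: XcS; first by move=> n; rewrite mulr_gt0.
    by rewrite -[X in _ --> X](mul0r t); apply: cvgM => //; exact: cvg_cst.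
  suff : h n t @[n --> \oo] --> dk 1 t * `|X0 - X0| by rewrite subrr normr0 mulr0.
  apply: cvgM; first exact: cvg_cst.
  by apply: cvg_norm; apply: cvgB => //; exact: cvg_cst.
have [_ Hc] := @Rdominated_cvg _ _ R mu setT h (cst 0) (fun t => (MX + `|X0|) * dk 1 t) measurableT mh
  (fun t _ => hcv t) (integrableZl measurableT (MX + `|X0|) idk1) (fun n t _ => hb n t).
rewrite (@Rintegral_eq0 _ _ _ mu (cst 0)) in Hc; last by [].
have mass (c : R) : 0 < c -> c `^ (1 - al) * \int[mu]_t dk c t = Gamma (1 - al) / Ga.
  move=> c0; rewrite /Rintegral dk_mass//= mulrC -!mulrA; congr (_ * _); rewrite mulrCA -[RHS]mulr1; congr (_ * _).
  rewrite -powRD; last by rewrite (gt_eqF c0) implybT.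
  by rewrite (_ : al - 1 + (1 - al) = 0) ?powRr0//; ring.
apply/cvgrPdist_le => e e0; move/cvgrPdist_le : Hc => /(_ e e0); apply: filterS => n.
rewrite sub0r normrN => He; apply: le_trans He.
have un := u0 n.
have iX : mu.-integrable setT (fun t => (dk (u n) t * X t)%:E).
  exact: (integrableM_bounded (measurable_dk al _) (dk_ge0 al0 al1 _) (dk_integrable al0 al1 un) mX XM).
have id := dk_integrable al0 al1 un.
have idX0 := integrableZl measurableT X0 id.
have -> : X0 * (Gamma (1 - al) / Ga) - u n `^ (1 - al) * \int[mu]_t (dk (u n) t * X t) =
    - (u n `^ (1 - al) * \int[mu]_t (dk (u n) t * (X t - X0))).
  rewrite -(mass _ un).
  have -> : \int[mu]_t (dk (u n) t * (X t - X0)) = \int[mu]_t (dk (u n) t * X t) - X0 * \int[mu]_t dk (u n) t.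
    rewrite -RintegralZl// -(RintegralB measurableT iX idX0); apply: eq_Rintegral => t _; ring.
  set a := Rintegral _ _ _; set b := Rintegral _ _ _; ring.
rewrite normrN normrM (ger0_norm (powR_ge0 _ _)).
have mXX : measurable_fun setT (fun t => X t - X0) by exact: measurable_funB.
have XXM t : `|X t - X0| <= MX + `|X0| by rewrite (le_trans (ler_normB _ _))// lerD2r.
have iXX := integrableM_bounded (measurable_dk al _) (dk_ge0 al0 al1 _) id mXX XXM.
apply: (@le_trans _ _ (u n `^ (1 - al) * \int[mu]_t (dk (u n) t * `|X t - X0|))).
  rewrite ler_wpM2l ?powR_ge0// (le_trans (le_normr_Rintegral measurableT iXX))//.
  by under eq_Rintegral do rewrite normrM (ger0_norm (dk_ge0 al0 al1 _ _)).
have mXn : measurable_fun setT (fun t => `|X t - X0|) by exact: measurableT_comp.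
have H := dk_integral_scale un mXn (fun t => normr_ge0 _).
have -> : \int[mu]_t (dk (u n) t * `|X t - X0|) = u n `^ (al - 1) * \int[mu]_t h n t.
  rewrite /Rintegral H; rewrite fineM//.
  have ih := integrableM_bounded (measurable_dk al 1) (dk_ge0 al0 al1 1) idk1 (mX' n) (B := MX + `|X0|).
  apply: (integrable_fin_num measurableT); apply: ih => t.
  by rewrite normr_id.
rewrite mulrA -powRD; last by rewrite (gt_eqF un) implybT.
rewrite (_ : 1 - al + (al - 1) = 0); last by ring.
by rewrite powRr0 mul1r ler_norm.
Qed.

End neumann.

Section neumann_limit.
Variables (R : realType) (al K : R).
Hypotheses (al0 : 0 < al) (al1 : al < 1) (K0 : 0 < K).
Local Notation mu := (@lebesgue_measure R).
Variables (w : R -> R) (M X0 : R).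
Hypotheses (mw : measurable_fun setT w) (wM : forall t, `|w t| <= M).
Local Notation W := (wrho al K w).
Local Notation X := (fun t => w t - K * W t).
Hypothesis Xc : X t @[t --> 0^'+] --> X0.

Let mX : measurable_fun setT X.
Proof.
apply: measurable_funB => //; apply: measurable_funM => //.
exact: (measurable_wrho al0 al1 K0 mw wM).
Qed.

Let XM t : `|X t| <= M + M.
Proof.
rewrite (le_trans (ler_normB _ _))// lerD// normrM (gtr0_norm K0) -ler_pdivlMl// mulrC.
exact: (wrho_bound al0 al1 K0 t mw wM).
Qed.

Definition ext1 (y : R) := \int[mu]_t (igamma al (y ^+ 2 / 4) t * W t).

Definition dext1 (y : R) := - (y / 2) * \int[mu]_t (dk al (y ^+ 2 / 4) t * X t).

(** By [resolvent_identity], [ext1 z - ext1 y] is the integral of [kc (z^2 / 4) - kc (y^2 / 4)]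
    against [X]. Apply [is_derive_kc_integral] and the chain rule, where [y^2 / 4] has derivative
    [y / 2]. *)
Lemma is_derive_ext1 (y : R) : 0 < y -> is_derive y (1 : R) ext1 (dext1 y).
Proof.
move=> y0; pose c0 := y ^+ 2 / 4; have c00 : 0 < c0 by rewrite divr_gt0// exprn_gt0.
pose Phi (c : R) := \int[mu]_t ((kc al c t - kc al c0 t) * X t).
have Ephi (z : R) : 0 < z -> ext1 z = ext1 y + Phi (z ^+ 2 / 4).
  move=> z0; have z20 : 0 < z ^+ 2 / 4 by rewrite divr_gt0// exprn_gt0.
  have [zc|cz] := leP (z ^+ 2 / 4) c0.
    by rewrite /Phi -(resolvent_identity al0 al1 K0 mw wM z20 zc) /ext1 addrC subrK.
  have := resolvent_identity al0 al1 K0 mw wM c00 (ltW cz).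
  rewrite -/(ext1 y) -/(ext1 z) => E.
  have -> : Phi (z ^+ 2 / 4) = - (ext1 y - ext1 z).
    rewrite E -mulN1r -RintegralZl//.
      by apply: eq_Rintegral => t _; ring.
    apply: (integrableM_bounded _ _ (kcB_integrable al0 al1 c00 (ltW cz)) mX XM).
      by apply: measurable_funB; exact: measurable_kc.
    by move=> t; case/andP: (kcB_bound al0 al1 t c00 (ltW cz)).
  ring.
have D1 := is_derive_kc_integral al0 al1 mX XM c00 c00.
have Di : is_derive y (1 : R) (id : R -> R) 1 by exact: is_derive_id.
have Dq : is_derive y (1 : R) (4^-1 \*: ((id : R -> R) * id)) (4^-1 *: (y *: (1 : R) + y *: (1 : R))).
  by apply: is_deriveZ; exact: is_deriveM.
have qE : (4^-1 \*: ((id : R -> R) * id)) y = c0.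
  by rewrite -[LHS]/(4^-1 * (y * y)) /c0 expr2 mulrC.
have D2 := @is_derive1_comp _ Phi (4^-1 \*: ((id : R -> R) * id)) y (- \int[mu]_t (dk al c0 t * X t)) _ _ Dq.
rewrite qE in D2; have {}D2 := D2 D1.
have D3 := @is_deriveD _ _ _ (cst (ext1 y)) _ y 1 _ _ (is_derive_cst _ _ _) D2.
have E : {near y, (cst (ext1 y) + (Phi \o (4^-1 \*: ((id : R -> R) * id)))) =1 ext1}.
  near=> z; have z0 : 0 < z by near: z; exact: lt_nbhsr.
  rewrite [RHS]Ephi// -[LHS]/(ext1 y + Phi (4^-1 * (z * z))) expr2; congr (_ + Phi _); exact: mulrC.
suff -> : dext1 y = 0 + - (\int[mu]_t (dk al c0 t * X t)) * (4^-1 *: (y *: (1 : R) + y *: (1 : R))).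
  exact: (near_eq_is_derive E D3).
have -> : 4^-1 *: (y *: (1 : R) + y *: (1 : R)) = y / 2 by rewrite /GRing.scale/=; field.
by rewrite /dext1 -/c0 add0r mulNr [in RHS]mulNr mulrC.
Unshelve. all: by end_near. Qed.

(** With [c = y^2 / 4], the weight [y^(1 - 2 al) y / 2] is [(4^(1 - al) / 2) c^(1 - al)], and
    [4^(1 - al) / 2 = 2^(1 - 2 al)] is the power in [c_ al]. *)
Lemma dext1_cvg : y `^ (1 - 2 * al) * dext1 y @[y --> 0^'+] --> - (c_ al * X0).
Proof.
have H := dk_integral_cvg al0 al1 mX XM Xc.
have cq : y ^+ 2 / 4 @[y --> 0^'+] --> (0 : R)^'+.
  move=> A [e /= e0 He]; exists (Num.min 1 e) => /=; first by rewrite lt_min ltr01.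
  move=> y; rewrite /ball/= sub0r normrN => ye y0; rewrite gtr0_norm// in ye.
  move: ye; rewrite lt_min => /andP[y1 ye].
  have y2 : 0 < y ^+ 2 / 4 by rewrite divr_gt0// exprn_gt0.
  apply: He => //=; rewrite sub0r normrN gtr0_norm//.
  rewrite (le_lt_trans _ ye)// ler_pdivrMr// (le_trans _ (_ : y <= _))//.
    by rewrite expr2 ler_piMl// ltW.
  by rewrite ler_peMr ?ler1n// ltW.
have H2 := cvg_comp _ _ cq H.
have E (y : R) : 0 < y -> y `^ (1 - 2 * al) * dext1 y = 
  - (4 `^ (1 - al) / 2) * ((y ^+ 2 / 4) `^ (1 - al) * \int[mu]_t (dk al (y ^+ 2 / 4) t * X t)).
  move=> y0; rewrite /dext1.
  have y20 : 0 <= y ^+ 2 by rewrite sqr_ge0.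
  have -> : (y ^+ 2 / 4) `^ (1 - al) = y `^ (2 * (1 - al)) / 4 `^ (1 - al).
    rewrite powRM ?invr_ge0// -powR_mulrn ?(ltW y0)// -powRrM -powR_inv1// -powRrM; congr (_ * _).
    by rewrite -powRN; congr powR; ring.
  have -> : y `^ (2 * (1 - al)) = y `^ (1 - 2 * al) * y.
    transitivity (y `^ (1 - 2 * al) * y `^ 1); last by rewrite powRr1// ltW.
    by rewrite -powRD ?(gt_eqF y0) ?implybT//; congr powR; ring.
  by field; rewrite gt_eqF// powR_gt0.
have -> : - (c_ al * X0) = - (4 `^ (1 - al) / 2) * (X0 * (Gamma (1 - al) / Gamma al)).
  rewrite /c_.
  have -> : 4 `^ (1 - al) = 2 `^ (1 - 2 * al) * 2 :> R.
    rewrite (_ : 4 = 2 `^ 2%:R :> R); last by rewrite powR_mulrn// -natrX.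
    rewrite -powRrM; transitivity ((2 : R) `^ (1 - 2 * al) * 2 `^ 1); last by rewrite powRr1.
    by rewrite (_ : 2 * (1 - al) = (1 - 2 * al) + 1) ?powRD ?pnatr_eq0 ?implybT//; ring.
  by field; rewrite gt_eqF// Gamma_gt0// al0 (le_trans (ltW al1))// ler1n.
apply: (@cvg_trans _ ((fun y : R => - (4 `^ (1 - al) / 2) * ((y ^+ 2 / 4) `^ (1 - al) * \int[mu]_t (dk al (y ^+ 2 / 4) t * X t))) @ 0^'+)).
  by apply: near_eq_cvg; near=> y; rewrite E.
by apply: cvgM; [exact: cvg_cst|exact: H2].
Unshelve. all: by end_near. Qed.

End neumann_limit.

(** * The resolvent and the monotone iteration *)

Section density.
Variables (R : realType) (N : probability R R).
Hypothesis gN : gaussian N.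
Local Notation R3 := (R * R * R)%type.
Local Notation N3 := (prob3 N).
Implicit Types (h : R3 -> R) (x xi : R3) (c M : R).

(** The density of [x + c xi] relative to the law of [xi]: it moves the dependence on the base point
    from [h] to an explicit smooth weight. *)
Definition gratio3 (c : R) (x xi : R3) : R :=
  gratio c x.1.1 xi.1.1 * gratio c x.1.2 xi.1.2 * gratio c x.2 xi.2.

Lemma gratio3_gt0 c x xi : 0 < c -> 0 < gratio3 c x xi.
Proof. by move=> c0; apply: mulr_gt0; [apply: mulr_gt0|]; exact: gratio_gt0. Qed.

Lemma measurable_gratio3 c x : measurable_fun setT (gratio3 c x).
Proof.
apply: measurable_funM; first apply: measurable_funM.
- exact: (measurableT_comp (measurable_gratio c _) (@measurable_R3_1 R)).
- exact: (measurableT_comp (measurable_gratio c _) (@measurable_R3_2 R)).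
- exact: (measurableT_comp (measurable_gratio c _) (@measurable_snd _ _ _ _)).
Qed.

Lemma hsE_density c x (F : R3 -> \bar R) : 0 < c -> (forall x, (0 <= F x)%E) ->
  measurable_fun setT F -> hsE N c F x = (\int[N3]_xi (F xi * (gratio3 c x xi)%:E))%E.
Proof.
move=> c0 F0 mF; rewrite /hsE.
have g0 a y : (0 <= (gratio c a y)%:E)%E by rewrite lee_fin ltW// gratio_gt0.
have mg a : measurable_fun setT (fun y => (gratio c a y)%:E).
  by apply/measurable_EFinP; exact: measurable_gratio.
pose G xi := F (mv x c xi).
have mG : measurable_fun setT G by apply: measurableT_comp => //; exact: measurable_mv.
rewrite (@N3E R N G (fun z => F0 _) mG).
pose G' xi := (F xi * (gratio3 c x xi)%:E)%E.
have G'0 z : (0 <= G' z)%E by rewrite mule_ge0// lee_fin ltW// gratio3_gt0.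
have mG' : measurable_fun setT G'.
  by apply: emeasurable_funM => //; apply/measurable_EFinP; exact: measurable_gratio3.
rewrite (@N3E R N G' G'0 mG').
pose F' (z : R * R * R) := (F (z.2, z.1.1, z.1.2) * (gratio c x.1.1 z.2)%:E)%E.
have F'0 z : (0 <= F' z)%E by rewrite mule_ge0.
have mF' : measurable_fun setT F'.
  apply: emeasurable_funM.
    apply: measurableT_comp => //; apply: measurable_R3 => //.
    - exact: measurable_R3_1.
    - exact: measurable_R3_2.
  by apply: (measurableT_comp (mg _)).
pose H2 (z : R * R) := (\int[N]_a (F (a, z.1, z.2) * (gratio c x.1.1 a)%:E))%E.
have mH2 : measurable_fun setT H2.
  exact: (@measurable_fun_fubini_tonelli_F _ _ _ _ _ N F' mF' F'0).
have H20 z : (0 <= H2 z)%E by apply: integral_ge0 => a _; exact: mule_ge0.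
pose H2' (z : R * R) := (H2 z * (gratio c x.1.2 z.1)%:E)%E.
have mH2' : measurable_fun setT H2'.
  by apply: emeasurable_funM => //; apply: (measurableT_comp (mg _)).
have H2'0 z : (0 <= H2' z)%E by exact: mule_ge0.
pose H3 s := (\int[N]_b (H2 (b, s) * (gratio c x.1.2 b)%:E))%E.
have mH3 : measurable_fun setT H3.
  exact: (@measurable_fun_fubini_tonelli_G _ _ _ _ _ N H2' mH2' H2'0).
have H30 s : (0 <= H3 s)%E by apply: integral_ge0 => b _; exact: mule_ge0.
have mFa b s : measurable_fun setT (fun a => F (a, b, s)).
  by apply: measurableT_comp => //; do 2 (apply: measurable_fun_pair => //).
have mHb s : measurable_fun setT (fun b => H2 (b, s)).
  by apply: measurableT_comp => //; apply: measurable_fun_pair.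
transitivity (\int[N]_s H3 (x.2 + c * s)%R)%E.
  apply: eq_integral => s _; rewrite /H3 -(gaussian_density gN _ c0 (mHb _))//.
  by apply: eq_integral => b _; rewrite /H2 -(gaussian_density gN _ c0 (mFa _ _)).
rewrite (gaussian_density gN _ c0 mH3 H30).
apply: eq_integral => s _; rewrite /H3 -ge0_integralZr//; last 2 first.
- by apply: emeasurable_funM.
- by move=> b _; exact: mule_ge0.
apply: eq_integral => b _; rewrite /H2/= -[(_ * _ * _)%E]muleA -ge0_integralZr//; last 3 first.
- by apply: emeasurable_funM.
- by move=> a _; exact: mule_ge0.
- exact: mule_ge0.
by apply: eq_integral => a _; rewrite /G' /gratio3/= !EFinM !muleA.
Qed.

Lemma gratio3_mass c x : 0 < c -> (\int[N3]_xi (gratio3 c x xi)%:E = 1)%E.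
Proof.
move=> c0; have := hsE_density x c0 (fun=> lee01) (measurable_cst (1%E : \bar R)).
rewrite /hsE integral_cst// [X in (_ * X)%E](@probability_setT _ _ _ N3) mule1 => ->.
by apply: eq_integral => xi _; rewrite mul1e.
Qed.

Lemma gratio3_integrable c x : 0 < c -> N3.-integrable setT (fun xi => (gratio3 c x xi)%:E).
Proof.
move=> c0; apply/integrableP; split; first by apply/measurable_EFinP; exact: measurable_gratio3.
under eq_integral do rewrite gee0_abs ?lee_fin ?(ltW (gratio3_gt0 _ _ c0))//.
by rewrite gratio3_mass// ltry.
Qed.

Lemma gratio3_integrableM c x h M : 0 < c -> measurable_fun setT h -> (forall x, `|h x| <= M) ->
  N3.-integrable setT (fun xi => (h xi * gratio3 c x xi)%:E).
Proof.
move=> c0 mh hM; apply: (@integrable_le_norm _ _ _ _ _ _ (fun xi => M * gratio3 c x xi) measurableT).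
- by apply: measurable_funM => //; exact: measurable_gratio3.
- exact: (integrableZl measurableT M (gratio3_integrable x c0)).
- by move=> xi _; rewrite normrM (gtr0_norm (gratio3_gt0 _ _ c0)) ler_wpM2r// ltW// gratio3_gt0.
Qed.

Lemma hs_density c x h M : 0 < c -> measurable_fun setT h -> (forall x, `|h x| <= M) ->
  hs N c h x = \int[N3]_xi (h xi * gratio3 c x xi).
Proof.
move=> c0 mh hM.
have i1 := gratio3_integrableM x c0 mh hM.
have i2 := integrableZl measurableT M (gratio3_integrable x c0).
have : (hs N c h x + M)%:E = (\int[N3]_xi (h xi * gratio3 c x xi) + M)%:E.
  rewrite (hs_hsE N mh hM) (hsE_density _ c0 (shift_ge0 hM)); last first.
    by apply/measurable_EFinP; exact: measurable_funD.
  under eq_integral do rewrite -EFinM mulrDl EFinD.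
  rewrite integralD_EFin//.
  rewrite EFinD /Rintegral fineK; last exact: integrable_fin_num.
  congr (_ + _)%E; rewrite (_ : M%:E = (M%:E * \int[N3]_xi (gratio3 c x xi)%:E)%E); last by rewrite gratio3_mass// mule1.
  by rewrite -integralZl//; exact: gratio3_integrable.
by case; exact: addIr.
Qed.

Lemma hs_shift c x (a : R3) h M : measurable_fun setT h -> (forall x, `|h x| <= M) ->
  hs N c h (mv x c a) = \int[N3]_xi (h (mv x c xi) * gratio3 1 a xi).
Proof.
move=> mh hM.
rewrite -(hs_density a ltr01 (measurable_mv1 mh x c) (fun xi => hM _)).
by apply: eq_Rintegral => xi _; rewrite /mv/=; congr (h (_, _, _)); ring.
Qed.

Definition sqn (a : R3) : R := a.1.1 ^+ 2 + a.1.2 ^+ 2 + a.2 ^+ 2.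

Lemma gratio_sqr (a xi : R) : gratio 1 a xi ^+ 2 = expR (a ^+ 2) * gratio 1 (2 * a) xi.
Proof.
by rewrite /gratio invr1 !mul1r -expRM_natl -expRD; congr expR; field.
Qed.

(** As the last factor has mass 1, the second moment of the shift density is [expR (sqn a)], which
    tends to 1 with [a]. *)
Lemma gratio3_sqr a xi :
  gratio3 1 a xi ^+ 2 = expR (sqn a) * gratio3 1 (2 * a.1.1, 2 * a.1.2, 2 * a.2) xi.
Proof. by rewrite /gratio3 2!exprMn 3!gratio_sqr /sqn !expRD /=; ring. Qed.

(* Strong Feller property, from [2 |g - 1| <= e + (g - 1)^2 / e] for the density [g] of a shift. *)
Lemma hs_shift_diff c x (a : R3) h M (e : R) : measurable_fun setT h -> (forall x, `|h x| <= M) -> 0 < e ->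
  `|hs N c h (mv x c a) - hs N c h x| <= M * ((e + (expR (sqn a) - 1) / e) / 2).
Proof.
move=> mh hM e0; have M0 : 0 <= M := le_trans (normr_ge0 _) (hM (0, 0, 0)).
have mhx := measurable_mv1 mh x c.
rewrite (hs_shift c x a mh hM) /hs.
have i1 := gratio3_integrableM a ltr01 mhx (fun xi => hM _).
have i2 := integrable_hs N mh hM x c.
rewrite -RintegralB//.
pose a2 : R3 := (2 * a.1.1, 2 * a.1.2, 2 * a.2).
have j1 := gratio3_integrable a ltr01.
have j2 := gratio3_integrable a2 ltr01.
(* This is [M (e + (gratio3 1 a xi - 1)^2 / e) / 2], with the square expanded by [gratio3_sqr] so
   that its integral only involves masses of shift densities. *)
pose B xi := M * ((e + (expR (sqn a) * gratio3 1 a2 xi - 2 * gratio3 1 a xi + 1) / e) / 2).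
pose A1 : R := M * (expR (sqn a) / e / 2).
pose A2 : R := - M * (1 / e).
pose A3 : R := M * ((e + 1 / e) / 2).
have BE xi : B xi = A1 * gratio3 1 a2 xi + A2 * gratio3 1 a xi + A3.
  by rewrite /B /A1 /A2 /A3; field; rewrite gt_eqF.
have k1 := integrableZl measurableT A1 j2.
have k2 := integrableZl measurableT A2 j1.
have k3 : N3.-integrable setT (cst A3%:E) by exact: finite_measure_integrable_cst.
have k12 : N3.-integrable setT (fun xi => (A1 * gratio3 1 a2 xi + A2 * gratio3 1 a xi)%:E).
  exact: (integrableD measurableT k1 k2).
have iB : N3.-integrable setT (fun xi => (B xi)%:E).
  rewrite (_ : (fun xi => _) = (fun xi => (A1 * gratio3 1 a2 xi + A2 * gratio3 1 a xi)%:E + A3%:E)%E).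
    exact: (integrableD measurableT k12 k3).
  by apply/funext => xi; rewrite BE EFinD.
have mass b : \int[N3]_xi gratio3 1 b xi = 1.
  by rewrite /Rintegral gratio3_mass.
have massZ b A : \int[N3]_xi (A * gratio3 1 b xi) = A.
  by rewrite RintegralZl ?mass ?mulr1//; exact: gratio3_integrable.
have IB : \int[N3]_xi B xi = M * ((e + (expR (sqn a) - 1) / e) / 2).
  transitivity (\int[N3]_xi (A1 * gratio3 1 a2 xi + A2 * gratio3 1 a xi + A3)).
    by apply: eq_Rintegral => xi _; rewrite BE.
  rewrite RintegralD// RintegralD// 2!massZ Rintegral_cst1.
  by rewrite /A1 /A2 /A3; field; rewrite gt_eqF.
rewrite -IB.
have i12 : N3.-integrable setT (fun xi => (h (mv x c xi) * gratio3 1 a xi - h (mv x c xi))%:E).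
  exact: (integrableB measurableT i1 i2).
apply: (le_trans (le_normr_Rintegral measurableT i12)).
apply: le_Rintegral => //; first exact: (integrable_norm i12).
move=> xi _; rewrite -[X in _ - X]mulr1 -mulrBr normrM ler_pM//.
have -> : expR (sqn a) * gratio3 1 a2 xi - 2 * gratio3 1 a xi + 1 = `|gratio3 1 a xi - 1| ^+ 2.
  by rewrite real_normK ?num_real// -gratio3_sqr; ring.
set z := `|_ - 1|.
rewrite -subr_ge0 (_ : _ - z = (z - e) ^+ 2 / (2 * e)); last by field; rewrite gt_eqF.
by rewrite divr_ge0 ?sqr_ge0// mulr_ge0// ltW.
Qed.

(** In [hs_shift_diff] take for its parameter [q = e / (M + 1)] and a shift with
    [expR (sqn a) - 1 < q^2]: the bound becomes [M q < e]. *)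
Lemma hs_feller c h M : 0 < c -> measurable_fun setT h -> (forall x, `|h x| <= M) ->
  continuous (hs N c h).
Proof.
move=> c0 mh hM x; have M0 : 0 <= M := le_trans (normr_ge0 _) (hM (0, 0, 0)).
pose a (y : R3) : R3 := ((y.1.1 - x.1.1) / c, (y.1.2 - x.1.2) / c, (y.2 - x.2) / c).
have aE y : mv x c (a y) = y.
  rewrite /mv /a/=; have q (u v : R) : u + c * ((v - u) / c) = v by field; rewrite gt_eqF.
  by rewrite !q; case: y => [[]].
have sc : expR (sqn (a y)) - 1 @[y --> x] --> (0 : R).
  have c1 : (fun y : R3 => y.1.1) @ x --> x.1.1 by apply: continuous_comp; exact: cvg_fst.
  have c2 : (fun y : R3 => y.1.2) @ x --> x.1.2 by apply: continuous_comp; [exact: cvg_fst|exact: cvg_snd].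
  have c3 : (fun y : R3 => y.2) @ x --> x.2 by exact: cvg_snd.
  have d (f : R3 -> R) : f @ x --> f x -> ((f y - f x) / c) ^+ 2 @[y --> x] --> (0 : R).
    move=> fx; have q : (f y - f x) / c @[y --> x] --> (f x - f x) / c.
      apply: cvgM; last exact: cvg_cst.
      by apply: cvgB => //; exact: cvg_cst.
    have H := cvgM q q; rewrite subrr mul0r mulr0 in H; exact: H.
  rewrite -[X in _ --> X](subrr 1); apply: cvgB; last exact: cvg_cst.
  rewrite -[X in _ --> X](@expR0 R); apply: continuous_cvg; first exact: continuous_expR.
  rewrite -[X in _ --> X]addr0 -[X in _ --> X + _]addr0.
  apply: cvgD; last exact: (d _ c3).
  by apply: cvgD; [exact: (d _ c1)|exact: (d _ c2)].
apply/cvgrPdist_lt => e e0.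
pose q := e / (M + 1).
have q0 : 0 < q by rewrite divr_gt0// ltr_wpDl.
have /cvgrPdist_lt /(_ (q ^+ 2) (exprn_gt0 _ q0)) := sc.
apply: filterS => y /=; rewrite sub0r normrN => ya.
rewrite distrC -{1}(aE y).
apply: (le_lt_trans (hs_shift_diff c x (a y) mh hM q0)).
apply: (@le_lt_trans _ _ (M * q)).
  rewrite ler_wpM2l// ler_pdivrMr// mulr_natr mulr2n lerD2l ler_pdivrMr// -expr2.
  by rewrite (le_trans (ler_norm _))// ltW.
by rewrite /q mulrCA gtr_pMr// ltr_pdivrMr ?mul1r ?ltrDl ?ltr01// ltr_wpDl.
Qed.

End density.

(** * The resolvent as an average of the heat semigroup *)

Section resolvent_operator.
Variables (R : realType) (N : probability R R).
Hypothesis gN : gaussian N.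
Local Notation R3 := (R * R * R)%type.
Local Notation N3 := (prob3 N).
Local Notation mu := (@lebesgue_measure R).
Variables (al K : R).
Hypotheses (al0 : 0 < al) (al1 : al < 1) (K0 : 0 < K).
Local Notation rho := (rho al K).
Implicit Types (h : R3 -> R) (x : R3) (t M : R).

Definition heat h x t := hs N (Num.sqrt (2 * t)) h x.

Definition resolve h x := \int[mu]_t (rho t * heat h x t).

Let rho0 t : 0 <= rho t := rho_ge0 al0 al1 K0 t.

Lemma measurable_sqrt2 : measurable_fun setT (fun t => Num.sqrt (2 * t)).
Proof.
by apply: (measurableT_comp (continuous_measurable_fun (@sqrt_continuous R))); exact: measurable_funM.
Qed.

Lemma heat_cvg_fun (hn : nat -> R3 -> R) h M x t : (forall n, measurable_fun setT (hn n)) ->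
  (forall n x, `|hn n x| <= M) -> (forall x, hn n x @[n --> \oo] --> h x) ->
  heat (hn n) x t @[n --> \oo] --> heat h x t.
Proof.
move=> mh hM hc; apply: (@bounded_cvg_Rintegral _ _ _ _ _ _ M) => [n|n xi|xi].
- exact: (measurable_mv1 (mh n)).
- exact: hM.
- exact: hc.
Qed.

Section bounded.
Variables (h : R3 -> R) (M : R).
Hypotheses (mh : measurable_fun setT h) (hM : forall x, `|h x| <= M).

Lemma heat_bound x t : `|heat h x t| <= M.
Proof. exact: hs_bound. Qed.

Lemma measurable_heat x : measurable_fun setT (heat h x).
Proof.
exact: (@measurable_hs_param _ N h M mh hM _ _ (0 : R) (fun t => Num.sqrt (2 * t)) (cst x) measurable_sqrt2).
Qed.

Lemma resolve_integrable x : mu.-integrable setT (fun t => (rho t * heat h x t)%:E).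
Proof.
exact: (integrableM_bounded (measurable_rho al0 al1 K0) rho0 (rho_integrable al0 al1 K0) (measurable_heat x) (heat_bound x)).
Qed.

Lemma resolve_wrho x : resolve h x = wrho al K (heat h x) 0.
Proof. by apply: eq_Rintegral => t _; rewrite add0r. Qed.

Lemma resolve_bound x : `|resolve h x| <= M / K.
Proof. by rewrite resolve_wrho; exact: (wrho_bound al0 al1 K0 0 (measurable_heat x) (heat_bound x)). Qed.

Lemma measurable_heat2 : measurable_fun setT (fun z : R * R3 => rho z.1 * heat h z.2 z.1).
Proof.
apply: measurable_funM; first exact: (measurableT_comp (measurable_rho al0 al1 K0)).
exact: (@measurable_hs_param _ N h M mh hM _ _ ((0, (0, 0, 0)) : R * R3) (fun z => Num.sqrt (2 * z.1)) snd
  (measurableT_comp measurable_sqrt2 (@measurable_fst _ _ _ _))).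
Qed.

Lemma measurable_resolve : measurable_fun setT (resolve h).
Proof.
apply: (@measurable_Rfubini_dom2 _ _ _ _ R mu (\d_((0, 0, 0) : R3) : probability R3 R)
  (fun z => rho z.1 * heat h z.2 z.1) (fun t => M * rho t)).
- exact: measurable_heat2.
- exact: (integrableZl measurableT M (rho_integrable al0 al1 K0)).
- by move=> t x /=; rewrite normrM (ger0_norm (rho0 _)) mulrC ler_wpM2r// heat_bound.
Qed.

(** The heat semigroup smooths at every [t > 0] by [hs_feller], and [rho] vanishes for [t <= 0];
    dominated convergence does the rest. *)
Lemma continuous_resolve : continuous (resolve h).
Proof.
move=> x; apply: seq_continuous_at => u ux.
have [||||_ //] := @Rdominated_cvg _ _ R mu setT (fun n t => rho t * heat h (u n) t)
   (fun t => rho t * heat h x t) (fun t => M * rho t) measurableT.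
- by move=> n; apply: measurable_funM; [exact: (measurable_rho al0 al1 K0)|exact: measurable_heat].
- move=> t _; have [t0|t0] := leP t 0.
    by rewrite rho_le0// mul0r; under eq_fun do rewrite mul0r; exact: cvg_cst.
  apply: cvgM; first exact: cvg_cst.
  apply: (cvg_comp _ _ ux); apply: (hs_feller gN _ mh hM).
  by rewrite sqrtr_gt0 mulr_gt0.
- exact: (integrableZl measurableT M (rho_integrable al0 al1 K0)).
- by move=> n t _; rewrite normrM (ger0_norm (rho0 _)) mulrC ler_wpM2r// heat_bound.
Qed.

Lemma resolve_screw_odd (k : R) : k != 0 -> screw_odd k h -> screw_odd k (resolve h).
Proof.
move=> k0 sh; split=> [b x|x].
  by apply: eq_Rintegral => t _; rewrite /heat (screw_inv (hs_screw_odd gN _ mh hM sh)).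
transitivity (\int[mu]_t (- 1 * (rho t * heat h x t))).
  apply: eq_Rintegral => t _; rewrite /heat (screw_flip (hs_screw_odd gN _ mh hM sh)); ring.
by rewrite RintegralZl ?mulN1r//; exact: resolve_integrable.
Qed.

End bounded.

Lemma resolve_lin h1 h2 M1 M2 (c : R) x : measurable_fun setT h1 -> measurable_fun setT h2 ->
  (forall x, `|h1 x| <= M1) -> (forall x, `|h2 x| <= M2) ->
  resolve (fun z => h1 z + c * h2 z) x = resolve h1 x + c * resolve h2 x.
Proof.
move=> m1 m2 b1 b2; have i1 := resolve_integrable m1 b1 x; have i2 := resolve_integrable m2 b2 x.
rewrite /resolve -RintegralZl// -RintegralD//; last exact: (integrableZl measurableT c i2).
by apply: eq_Rintegral => t _; rewrite /heat (hs_lin N _ _ _ m1 m2 b1 b2); ring.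
Qed.

Lemma resolve_cvg (hn : nat -> R3 -> R) h M x : (forall n, measurable_fun setT (hn n)) ->
  (forall n x, `|hn n x| <= M) -> (forall x, hn n x @[n --> \oo] --> h x) ->
  resolve (hn n) x @[n --> \oo] --> resolve h x.
Proof.
move=> mh hM hc.
have [||||_ //] := @Rdominated_cvg _ _ R mu setT (fun n t => rho t * heat (hn n) x t)
   (fun t => rho t * heat h x t) (fun t => M * rho t) measurableT.
- by move=> n; apply: measurable_funM; [exact: (measurable_rho al0 al1 K0)|exact: (measurable_heat (mh n) (hM n))].
- move=> t _; apply: cvgM; first exact: cvg_cst.
  exact: (heat_cvg_fun mh hM hc).
- exact: (integrableZl measurableT M (rho_integrable al0 al1 K0)).
- move=> n t _; rewrite normrM (ger0_norm (rho0 _)) mulrC ler_wpM2r//.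
  exact: (heat_bound (mh n) (hM n)).
Qed.

Lemma resolve_ge0 (k : R) h M x : k != 0 -> cone k M h -> continuous h -> 0 <= helix k x ->
  0 <= resolve h x.
Proof.
move=> k0 ch hc hx; apply: Rintegral_ge0 => t _; apply: mulr_ge0 => //.
by apply: (cone_hs_ge0 gN k0 ch hc) => //; exact: sqrtr_ge0.
Qed.

(** [hs_bump_ge] with [c^2 = 2 t], averaged in [t]: the constant is the Laplace transform of [rho]
    at [k^2 + 8 d]. *)
Lemma resolve_bump_ge (k d : R) x : 0 < d -> 0 <= helix k x ->
  hbump k d x / ((k ^+ 2 + 8 * d) `^ al + K) <= resolve (hbump k d) x.
Proof.
move=> d0 hx.
have s0 : 0 < k ^+ 2 + 8 * d by rewrite ltr_wpDl ?sqr_ge0// mulr_gt0.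
have L := rho_laplace al0 al1 K0 s0.
have me := measurable_expM (k ^+ 2 + 8 * d).
have ie : mu.-integrable setT (fun t => (rho t * expR (- (k ^+ 2 + 8 * d) * t))%:E).
  apply/integrableP; split.
    by apply: measurable_EFin_R; apply: measurable_funM; [exact: (measurable_rho al0 al1 K0)|exact: me].
  rewrite (_ : (\int[mu]_t _)%E = (((k ^+ 2 + 8 * d) `^ al + K)^-1)%:E) ?ltry// -L.
  by apply: eq_integral => t _; rewrite gee0_abs// lee_fin; apply: mulr_ge0 => //; exact: expR_ge0.
have -> : hbump k d x / ((k ^+ 2 + 8 * d) `^ al + K) =
    \int[mu]_t (hbump k d x * (rho t * expR (- (k ^+ 2 + 8 * d) * t))).
  by rewrite RintegralZl// /Rintegral L.
apply: le_Rintegral => //.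
- exact: (integrableZl measurableT _ ie).
- exact: (resolve_integrable (@measurable_bump R k d) (@bump_bound R k d d0)).
move=> t _; have [t0|t0] := leP t 0; first by rewrite rho_le0// !mul0r mulr0.
rewrite mulrCA ler_wpM2l//.
have := hs_bump_ge gN d0 (Num.sqrt (2 * t)) hx.
rewrite sqr_sqrtr ?mulr_ge0 ?(ltW t0)// /heat; apply: le_trans.
by rewrite mulrC le_eqVlt; apply/orP; left; apply/eqP; congr (expR _ * _); field.
Qed.

End resolvent_operator.

(** * Monotone iteration from the bump *)

Section monotone_iteration.
Variables (R : realType) (N : probability R R).
Hypothesis gN : gaussian N.
Local Notation R3 := (R * R * R)%type.
Variables (al K k m1 e0 : R) (f : R -> R).
Hypotheses (al0 : 0 < al) (al1 : al < 1) (K0 : 0 < K) (k0 : k != 0).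
Hypotheses (cf : continuous f) (fodd : forall t, f (- t) = - f t) (f1 : f 1 = 0).
Hypothesis fK : forall s t, - 1 <= s -> s <= t -> t <= 1 -> f s + K * s <= f t + K * t.
Hypotheses (km1 : (k ^+ 2) `^ al < m1) (e00 : 0 < e0) (e01 : e0 <= 1).
Hypothesis fm1 : forall t, 0 <= t -> t <= e0 -> m1 * t <= f t.
Implicit Types (h : R3 -> R) (x : R3) (t : R).
Local Notation resolve := (resolve N al K).

Let g t := f t + K * t.

Let f0 : f 0 = 0.
Proof.
have : f 0 = - f 0 by rewrite -fodd oppr0.
by move/eqP; rewrite -subr_eq0 opprK -mulr2n mulrn_eq0/= => /eqP.
Qed.

Let cg : continuous g.
Proof. by move=> t; apply: cvgD; [exact: cf|apply: cvgM; [exact: cvg_cst|exact: cvg_id]]. Qed.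

Let godd t : g (- t) = - g t.
Proof. by rewrite /g fodd mulrN opprD. Qed.

Let g_bound t : `|t| <= 1 -> `|g t| <= K.
Proof.
rewrite !ler_norml => /andP[t1 t2].
have g1 : g 1 = K by rewrite /g f1 add0r mulr1.
by rewrite -g1 -godd; apply/andP; split; apply: fK => //; rewrite lerN10.
Qed.

Let g_ge0 t : 0 <= t -> t <= 1 -> 0 <= g t.
Proof.
move=> t0 t1; have := @fK 0 t; rewrite f0 mulr0 addr0; apply => //.
Qed.

Let bounded_le h M x : (forall x, `|h x| <= M) -> h x <= M.
Proof. by move=> /(_ x); rewrite ler_norml => /andP[]. Qed.

Let mg h : measurable_fun setT h -> measurable_fun setT (g \o h).
Proof. by move=> mh; apply: (measurableT_comp (continuous_measurable_fun cg)). Qed.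

Lemma cone_nonlinear h : cone k 1 h -> cone k K (g \o h).
Proof.
case=> mh hM [hs hf] hp; split.
- exact: mg.
- by move=> x; exact: g_bound.
- by split=> [b x|x] /=; rewrite ?hs// hf godd.
- by move=> x hx; apply: g_ge0; [exact: hp|exact: bounded_le hM].
Qed.

Lemma continuous_nonlinear h : continuous h -> continuous (g \o h).
Proof. by move=> ch x; apply: continuous_comp; [exact: ch|exact: cg]. Qed.

Lemma cone_diff M1 M2 h1 h2 (c : R) : cone k M1 h1 -> cone k M2 h2 ->
  (forall x, 0 <= helix k x -> 0 <= h1 x + c * h2 x) ->
  cone k (M1 + `|c| * M2) (fun x => h1 x + c * h2 x).
Proof.
move=> [m1' b1 [s1 f1'] _] [m2 b2 [s2 f2] _] p; split=> //.
- by apply: measurable_funD => //; exact: measurable_funM.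
- by move=> x; rewrite (le_trans (ler_normD _ _))// lerD// normrM ler_wpM2l.
- by split=> [b x|x]; rewrite ?s1 ?s2// f1' f2; ring.
Qed.

Lemma continuous_lin h1 h2 (c : R) : continuous h1 -> continuous h2 ->
  continuous (fun x => h1 x + c * h2 x).
Proof.
move=> c1 c2 x; apply: cvgD; first exact: c1.
by apply: cvgM; [exact: cvg_cst|exact: c2].
Qed.

Record admissible h : Prop := Admissible {
  admissible_cone : cone k 1 h;
  admissible_continuous : continuous h
}.

(** The unit ball is preserved because [g] is nondecreasing on [[-1, 1]] with [g 1 = K], so that
    [|g| <= K] there, and [resolve] divides bounds by [K]. *)
Lemma admissible_resolve h : admissible h -> admissible (resolve (g \o h)).
Proof.
move=> [ch hc]; have cgh := cone_nonlinear ch.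
have m := cone_measurable cgh; have b := cone_bound cgh.
split; last exact: (continuous_resolve gN al0 al1 K0 m b).
split.
- exact: (measurable_resolve N al0 al1 K0 m b).
- by move=> x; rewrite (le_trans (resolve_bound N al0 al1 K0 m b x))// divff// gt_eqF.
- exact: (resolve_screw_odd gN al0 al1 K0 m b k0 (cone_odd cgh)).
- by move=> x hx; exact: (resolve_ge0 gN al0 al1 K0 k0 cgh (continuous_nonlinear hc) hx).
Qed.

(** Positivity of [resolve] applied to [h1 - c h2], which belongs to the cone by the inequality on
    the positive side. *)
Lemma resolve_le h1 h2 M1 M2 (c : R) x : cone k M1 h1 -> cone k M2 h2 -> continuous h1 ->
  continuous h2 -> (forall x, 0 <= helix k x -> c * h2 x <= h1 x) -> 0 <= helix k x ->
  c * resolve h2 x <= resolve h1 x.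
Proof.
move=> ch1 ch2 c1 c2 le12 hx.
have cd : cone k (M1 + `|- c| * M2) (fun x => h1 x + - c * h2 x).
  by apply: cone_diff => // z hz; rewrite mulNr subr_ge0 le12.
have := resolve_ge0 gN al0 al1 K0 k0 cd (continuous_lin c1 c2) hx.
rewrite (resolve_lin N al0 al1 K0 _ _ (cone_measurable ch1) (cone_measurable ch2) (cone_bound ch1) (cone_bound ch2)).
by rewrite mulNr subr_ge0.
Qed.

(** Solves [(k^2 + 8 d)^al = m1]; it is positive because [m1] exceeds [(k^2)^al]. *)
Let d := (m1 `^ al^-1 - k ^+ 2) / 8.

Let m10 : 0 < m1. Proof. by apply: le_lt_trans km1; exact: powR_ge0. Qed.

Let d0 : 0 < d.
Proof.
rewrite divr_gt0// subr_gt0 ltNge; apply/negP => H.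
have : m1 <= (k ^+ 2) `^ al.
  rewrite -[leLHS](powRr1 (ltW m10)) -[X in _ `^ X <= _](mulVf (lt0r_neq0 al0)) powRrM.
  by apply: ge0_ler_powR; rewrite ?nnegrE ?powR_ge0 ?sqr_ge0// ltW.
by rewrite leNgt km1.
Qed.

Let dE : (k ^+ 2 + 8 * d) `^ al = m1.
Proof.
have -> : k ^+ 2 + 8 * d = m1 `^ al^-1 by rewrite /d; field.
by rewrite -powRrM mulVf ?gt_eqF// powRr1// ltW.
Qed.

Let B := 2 * (1 + d^-1).

Let B0 : 0 < B. Proof. by rewrite mulr_gt0// addr_gt0// invr_gt0. Qed.

(** Scaled to stay within [[- e0, e0]], the range in which the slope bound [fm1] is available. *)
Let bump0 x := e0 / B * hbump k d x.

Let bump0_bound x : `|bump0 x| <= e0.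
Proof.
rewrite normrM (ger0_norm (ltW (divr_gt0 e00 B0))) mulrAC ler_pdivrMr// ler_wpM2l ?(ltW e00)//.
exact: bump_bound.
Qed.

Let hbump_ge0 x : 0 <= helix k x -> 0 <= hbump k d x.
Proof. by move=> hx; rewrite /hbump mulr_ge0// expR_ge0. Qed.

Let cone_hbump : cone k B (hbump k d).
Proof.
split; [exact: measurable_bump|exact: bump_bound|exact: bump_screw_odd|exact: hbump_ge0].
Qed.

Let admissible_bump0 : admissible bump0.
Proof.
have [m b [s fl] p] := cone_hbump; split; first split.
- exact: measurable_funM.
- by move=> x; rewrite (le_trans (bump0_bound x)).
- by split=> [c x|x]; rewrite /bump0 ?s// fl mulrN.
- by move=> x hx; apply: mulr_ge0; [apply/ltW/divr_gt0|exact: p].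
- by move=> x; apply: cvgM; [exact: cvg_cst|exact: continuous_bump].
Qed.

Fixpoint iterate n := if n is n'.+1 then resolve (g \o iterate n') else bump0.

Let admissible_iterate n : admissible (iterate n).
Proof. by elim: n => [|n IH]; [exact: admissible_bump0|exact: admissible_resolve]. Qed.

(** The bump is a subsolution: [fm1] gives [g (bump0 z) >= (m1 + K) bump0 z] on the positive side,
    and there [resolve] returns at least the bump divided by [m1 + K]. *)
Let iterate_le0 x : 0 <= helix k x -> iterate 0 x <= iterate 1 x.
Proof.
move=> hx; have [cb bc] := admissible_bump0.
have cgb := cone_nonlinear cb.
pose c := (m1 + K) * (e0 / B).
have c0 : 0 < c by rewrite mulr_gt0 ?addr_gt0// divr_gt0.
apply: (@le_trans _ _ (c * resolve (hbump k d) x)).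
  have := resolve_bump_ge gN al0 al1 K0 d0 hx.
  rewrite dE ler_pdivrMr ?addr_gt0// => H.
  rewrite /= /bump0 /c [leRHS]mulrAC [leRHS]mulrC ler_wpM2l//; first by apply/ltW/divr_gt0.
  by rewrite mulrC.
apply: (resolve_le cgb cone_hbump (continuous_nonlinear bc) (@continuous_bump R k d)) => // z hz.
rewrite /= /g; have -> : c * hbump k d z = (m1 + K) * bump0 z by rewrite /c -mulrA.
rewrite mulrDl lerD2r fm1//; first exact: (cone_ge0 cb).
exact: bounded_le bump0_bound.
Qed.

Let iterate_le n x : 0 <= helix k x -> iterate n x <= iterate n.+1 x.
Proof.
elim: n x => [|n IH] x hx; first exact: iterate_le0.
have [cn nc] := admissible_iterate n; have [cn1 nc1] := admissible_iterate n.+1.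
have := @resolve_le (g \o iterate n.+1) (g \o iterate n) K K 1 x (cone_nonlinear cn1) (cone_nonlinear cn)
  (continuous_nonlinear nc1) (continuous_nonlinear nc).
rewrite mul1r; apply => // z hz; rewrite mul1r /= /g.
have := cone_bound cn z; rewrite ler_norml => /andP[h1 _].
have := cone_bound cn1 z; rewrite ler_norml => /andP[_ h2].
by apply: fK => //; exact: IH.
Qed.

Let iterate_homo x : 0 <= helix k x -> {homo iterate^~ x : n m / (n <= m)%N >-> n <= m}.
Proof. by move=> hx; apply: homo_leq => // [y|n]; [exact: le_trans|exact: iterate_le]. Qed.

Let iterate_is_cvg_pos x : 0 <= helix k x -> cvgn (iterate^~ x).
Proof.
move=> hx; apply: nondecreasing_is_cvgn; first exact: iterate_homo.
by exists 1 => _ [n _ <-]; apply: bounded_le (cone_bound (admissible_cone (admissible_iterate n))).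
Qed.

Let iterate_flip n x : iterate n (flip x) = - iterate n x.
Proof. exact: (screw_flip (cone_odd (admissible_cone (admissible_iterate n)))). Qed.

Let flipK x : flip (flip x) = x.
Proof. by rewrite /flip/= !opprK; case: x => [[]]. Qed.

Let iterate_is_cvg x : cvgn (iterate^~ x).
Proof.
have [hx|hx] := leP 0 (helix k x); first exact: iterate_is_cvg_pos.
rewrite -(flipK x); under eq_fun do rewrite iterate_flip.
by apply: is_cvgN; apply: iterate_is_cvg_pos; rewrite helix_flip oppr_ge0 ltW.
Qed.

(** On the positive side the iterates increase and stay below 1; on the other side they converge by
    oddness. The pointwise limit passes through [resolve] by dominated convergence, and it is
    positive because it lies above the bump. *)
Theorem resolve_fixpoint : exists u : R3 -> R, [/\ admissible u,
  forall x, 0 < helix k x -> 0 < u x &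
  forall x, u x = resolve (fun z => f (u z) + K * u z) x].
Proof.
pose u x := limn (iterate^~ x).
have uc x : iterate n x @[n --> \oo] --> u x by exact: iterate_is_cvg.
have bn n x := cone_bound (admissible_cone (admissible_iterate n)) x.
have mn n := cone_measurable (admissible_cone (admissible_iterate n)).
have cu : cone k 1 u.
  split.
  - by apply: (measurable_fun_cvg mn) => x _; exact: uc.
  - move=> x; have := cvg_norm (uc x) => H.
    have <- : limn (fun n => `|iterate n x|) = `|u x|.
      by apply: cvg_lim => //; exact: H.
    by apply: limr_le; [by apply/cvg_ex; exists `|u x|; exact: H|near=> n].
  - split=> [b x|x].
      by rewrite /u; congr (limn _); apply/funext => n; rewrite (screw_inv (cone_odd (admissible_cone (admissible_iterate n)))).
    have H := cvgN (uc x); rewrite /u; under eq_fun do rewrite iterate_flip.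
    by apply: cvg_lim => //; exact: H.
  - move=> x hx; apply: limr_ge; first exact: iterate_is_cvg.
    by near=> n; exact: (cone_ge0 (admissible_cone (admissible_iterate n))).
have cgu := cone_nonlinear cu.
have uE x : u x = resolve (g \o u) x.
  have H : resolve (g \o iterate n) x @[n --> \oo] --> resolve (g \o u) x.
    apply: (resolve_cvg al0 al1 K0 (M := K)).
    - by move=> n; exact: mg.
    - by move=> n z; exact: (cone_bound (cone_nonlinear (admissible_cone (admissible_iterate n)))).
    - by move=> z; apply: continuous_cvg; [exact: cg|exact: uc].
  have H2 : iterate n.+1 x @[n --> \oo] --> u x by rewrite (cvg_shiftS (iterate^~ x)); exact: uc.
  exact: (cvg_unique _ H2 H).
exists u; split=> //.
(* A pointwise limit need not be continuous; the fixed point is, because it lies in the range of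
   [resolve]. *)
- split=> //; rewrite (_ : u = resolve (g \o u)); last exact/funext.
  exact: (continuous_resolve gN al0 al1 K0 (cone_measurable cgu) (cone_bound cgu)).
- move=> x hx; apply: (@lt_le_trans _ _ (iterate 0 x)).
    by rewrite /= /bump0 mulr_gt0 ?divr_gt0// /hbump mulr_gt0// expR_gt0.
  apply: limr_ge; first exact: iterate_is_cvg.
  by near=> n; exact: (iterate_homo (ltW hx) (leq0n n)).
Unshelve. all: by end_near. Qed.

End monotone_iteration.

(** * Regularity of the extension *)

Section poisson.
Variables (R : realType) (N : probability R R).
Hypothesis gN : gaussian N.
Local Notation R3 := (R * R * R)%type.
Local Notation N3 := (prob3 N).
Local Notation mu := (@lebesgue_measure R).
Variables (al : R).
Hypotheses (al0 : 0 < al) (al1 : al < 1).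
Local Notation Ga := (Gamma al).
Implicit Types (h : R3 -> R) (x xi : R3) (t y M : R).

Definition nq x xi : R := (x.1.1 - xi.1.1) ^+ 2 + (x.1.2 - xi.1.2) ^+ 2 + (x.2 - xi.2) ^+ 2.

Lemma nq_ge0 x xi : 0 <= nq x xi.
Proof. by rewrite /nq !addr_ge0 ?sqr_ge0. Qed.

Lemma gratio3E (c : R) x xi : c != 0 ->
  gratio3 c x xi = c^-1 ^+ 3 * expR (sqn xi / 2 - nq x xi / (2 * c ^+ 2)).
Proof.
move=> c0; rewrite /gratio3 /gratio.
have -> : sqn xi / 2 - nq x xi / (2 * c ^+ 2) =
  (xi.1.1 ^+ 2 / 2 - (xi.1.1 - x.1.1) ^+ 2 / (2 * c ^+ 2)) +
  (xi.1.2 ^+ 2 / 2 - (xi.1.2 - x.1.2) ^+ 2 / (2 * c ^+ 2)) +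
  (xi.2 ^+ 2 / 2 - (xi.2 - x.2) ^+ 2 / (2 * c ^+ 2)) by rewrite /sqn /nq; field.
by rewrite !expRD; ring.
Qed.

(** Half of [n + 2 al] for [n = 3], the exponent of the Poisson kernel of the extension problem. *)
Definition pdim : R := al + 3 / 2.

Definition pcst : R := Gamma pdim / Ga * 4 `^ (- al) * 4 `^ pdim * (Num.sqrt 2)^-1 ^+ 3.

(** The last factor compensates the Gaussian weight of the reference law; without it this is the
    Poisson kernel of the extension up to a constant. *)
Definition pkernel x y xi : R :=
  pcst * y `^ (2 * al) * (y ^+ 2 + nq x xi) `^ (- pdim) * expR (sqn xi / 2).

Let p03 : 0 < pdim <= 3. Proof.
have h32 : 0 < (3 / 2 : R) by rewrite divr_gt0.
rewrite /pdim addr_gt0//=; apply: (@le_trans _ _ (1 + 3 / 2)); first by rewrite lerD2r ltW.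
by rewrite (_ : 1 + 3 / 2 = 3 - 2^-1 :> R) ?gerBl ?invr_ge0//; field.
Qed.
Let a03 : 0 < al <= 3. Proof. by rewrite al0 (le_trans (ltW al1))// ler1n. Qed.

Lemma pcst_gt0 : 0 < pcst.
Proof.
rewrite /pcst; apply: mulr_gt0; last by rewrite exprn_gt0// invr_gt0 sqrtr_gt0.
apply: mulr_gt0; last exact: powR_gt0.
by apply: mulr_gt0; [apply: divr_gt0; exact: Gamma_gt0|exact: powR_gt0].
Qed.

Let Ay y xi := (y ^+ 2 / 4) `^ al / Ga * (Num.sqrt 2)^-1 ^+ 3 * expR (sqn xi / 2).

Lemma igamma_gratio3 x y xi t : 0 < y ->
  igamma al (y ^+ 2 / 4) t * gratio3 (Num.sqrt (2 * t)) x xi =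
  Ay y xi * (pw (- pdim) t * expR (- ((y ^+ 2 + nq x xi) / 4) / t)).
Proof.
move=> y0; have [t0|t0] := leP t 0; first by rewrite /igamma !pw_le0// !(mul0r, mulr0).
have s0 : Num.sqrt (2 * t) != 0 by rewrite gt_eqF// sqrtr_gt0 mulr_gt0.
rewrite gratio3E// sqr_sqrtr; last by rewrite mulr_ge0// ltW.
have -> : (Num.sqrt (2 * t))^-1 ^+ 3 = (Num.sqrt 2)^-1 ^+ 3 * t `^ (- (3 / 2)).
  rewrite sqrtrM// invfM exprMn; congr (_ * _).
  rewrite -[Num.sqrt t]powR12_sqrt ?(ltW t0)// -powRN -powR_mulrn ?powR_ge0// -powRrM.
  by congr powR; field.
have -> : - pdim = - al + - (3 / 2) by rewrite /pdim; ring.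
rewrite (pwD _ _ t0) /igamma /Ay.
have -> : expR (sqn xi / 2 - nq x xi / (2 * (2 * t))) = expR (sqn xi / 2) * expR (- (nq x xi / 4) / t).
  by rewrite -expRD; congr expR; field; rewrite gt_eqF.
have -> : expR (- ((y ^+ 2 + nq x xi) / 4) / t) = expR (- (y ^+ 2 / 4) / t) * expR (- (nq x xi / 4) / t).
  by rewrite -expRD; congr expR; field; rewrite gt_eqF.
move: (expR _) (expR _) (expR _) (t `^ _) (pw _ _) => e1 e2 e3 e4 e5; ring.
Qed.

(** In [t], the inverse Gamma density of parameter [y^2 / 4] times the Gaussian density of variance
    [2 t] is an inverse Gamma integrand of exponent [pdim] and parameter [(y^2 + nq x xi) / 4], so
    [inverse_gamma] evaluates it. *)
Lemma integral_igamma_gratio3 x y xi : 0 < y ->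
  (\int[mu]_t (igamma al (y ^+ 2 / 4) t * gratio3 (Num.sqrt (2 * t)) x xi)%:E = (pkernel x y xi)%:E)%E.
Proof.
move=> y0; under eq_integral do rewrite (igamma_gratio3 _ _ _ y0).
have Q0 : 0 < (y ^+ 2 + nq x xi) / 4 by rewrite divr_gt0// ltr_pwDl ?nq_ge0// exprn_gt0.
rewrite ge0_integralZ; last 3 first.
- apply: mulr_ge0; last exact: expR_ge0.
  apply: mulr_ge0; last by rewrite exprn_ge0// invr_ge0 sqrtr_ge0.
  by apply: divr_ge0; [exact: powR_ge0|apply/ltW/Gamma_gt0].
- exact: measurable_ig.
- by move=> t; apply: mulr_ge0; [exact: pw_ge0|exact: expR_ge0].
rewrite inverse_gamma// -EFinM; congr EFin.
rewrite /Ay /pkernel /pcst.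
have inv4 (b : R) : 4^-1 `^ b = 4 `^ (- b) by rewrite -powR_inv1// -powRrM mulN1r.
have -> : (y ^+ 2 / 4) `^ al = y `^ (2 * al) * 4 `^ (- al).
  by rewrite powRM ?sqr_ge0 ?invr_ge0// inv4 -[y ^+ 2]powR_mulrn ?(ltW y0)// -powRrM.
have -> : ((y ^+ 2 + nq x xi) / 4) `^ (- pdim) = (y ^+ 2 + nq x xi) `^ (- pdim) * 4 `^ pdim.
  by rewrite powRM ?invr_ge0// ?inv4 ?opprK// addr_ge0 ?sqr_ge0 ?nq_ge0.
move: (_ `^ (2 * al)) (4 `^ _) (4 `^ _) (_ `^ (- pdim)) (Gamma pdim) => *; ring.
Qed.

Lemma measurable_igamma_gratio3 x y h : measurable_fun setT h ->
  measurable_fun setT (fun z : R * R3 => igamma al (y ^+ 2 / 4) z.1 * gratio3 (Num.sqrt (2 * z.1)) x z.2 * h z.2).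
Proof.
move=> mh.
have m1 : measurable_fun setT (fun z : R * R3 => z.1) by exact: measurable_fst.
have m2 : measurable_fun setT (fun z : R * R3 => z.2) by exact: measurable_snd.
have s1 : measurable_fun setT (fun z : R * R3 => Num.sqrt (2 * z.1)).
  by apply: (measurableT_comp (@measurable_sqrt2 R)).
have i1 : measurable_fun setT (fun z : R * R3 => (Num.sqrt (2 * z.1))^-1).
  by apply: (measurableT_comp (@measurable_invr R)).
have g (a : R) (f : R * R3 -> R) : measurable_fun setT f ->
    measurable_fun setT (fun z : R * R3 => gratio (Num.sqrt (2 * z.1)) a (f z)).
  move=> mf; apply: measurable_funM => //.
  apply: (measurableT_comp (@measurable_expR R)); apply: measurable_funB.
    by apply: measurable_funM => //; exact: measurable_funX.
  apply: measurable_funM; first by apply: measurable_funX; exact: measurable_funB.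
  by apply: (measurableT_comp (@measurable_invr R)); apply: measurable_funM => //; exact: measurable_funX.
apply: measurable_funM; last exact: (measurableT_comp mh).
apply: measurable_funM; first exact: (measurableT_comp (measurable_igamma al _)).
apply: measurable_funM; first apply: measurable_funM.
- by apply: g; apply: (measurableT_comp (@measurable_R3_1 R)).
- by apply: g; apply: (measurableT_comp (@measurable_R3_2 R)).
- by apply: g; apply: (measurableT_comp (@measurable_snd _ _ _ _)).
Qed.

Let ig0 y t : 0 <= igamma al (y ^+ 2 / 4) t := igamma_ge0 al0 al1 _ t.

Lemma pkernel_ge0 x y xi : 0 <= pkernel x y xi.
Proof.
apply: mulr_ge0; last exact: expR_ge0.
by apply: mulr_ge0; [apply: mulr_ge0; [exact: ltW pcst_gt0|]|]; exact: powR_ge0.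
Qed.

Lemma measurable_nq x : measurable_fun setT (nq x).
Proof.
apply: measurable_funD; first apply: measurable_funD; apply: measurable_funX; apply: measurable_funB => //.
- exact: measurable_R3_1.
- exact: measurable_R3_2.
Qed.

Lemma measurable_sqn : measurable_fun setT (@sqn R).
Proof.
apply: measurable_funD; first apply: measurable_funD; apply: measurable_funX => //.
- exact: measurable_R3_1.
- exact: measurable_R3_2.
Qed.

Lemma measurable_pkernel x y : measurable_fun setT (pkernel x y).
Proof.
apply: measurable_funM; first apply: measurable_funM => //.
- apply: (measurableT_comp (measurable_powR _)); apply: measurable_funD => //.
  exact: measurable_nq.
- apply: (measurableT_comp (@measurable_expR R)); apply: measurable_funM => //.
  exact: measurable_sqn.
Qed.

(** Write the heat average through its density, exchange time and space by Tonelli, and integrate in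
    time first. *)
Lemma ge0_poisson x y h M : 0 < y -> measurable_fun setT h -> (forall xi, 0 <= h xi <= M) ->
  (\int[mu]_t (igamma al (y ^+ 2 / 4) t * heat N h x t)%:E = \int[N3]_xi (pkernel x y xi * h xi)%:E)%E.
Proof.
move=> y0 mh h0M.
have h0 xi : 0 <= h xi by case/andP: (h0M xi).
have hM xi : `|h xi| <= M by rewrite ger0_norm//; case/andP: (h0M xi).
pose F (z : R * R3) := igamma al (y ^+ 2 / 4) z.1 * gratio3 (Num.sqrt (2 * z.1)) x z.2 * h z.2.
have mF : measurable_fun setT F by exact: measurable_igamma_gratio3.
have mFE : measurable_fun [set: (measurableTypeR R * R3)%type] (EFin \o F) by exact/measurable_EFinP.
have g30 t xi : 0 < t -> 0 < gratio3 (Num.sqrt (2 * t)) x xi.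
  by move=> t0; apply: gratio3_gt0; rewrite sqrtr_gt0 mulr_gt0.
have F0 z : (0 <= (EFin \o F) z)%E.
  rewrite lee_fin; apply: mulr_ge0 => //.
  have [t0|t0] := leP z.1 0; first by rewrite /igamma pw_le0// !(mul0r, mulr0).
  by apply: mulr_ge0 => //; apply/ltW/g30.
transitivity (\int[mu]_t \int[N3]_xi (F (t, xi))%:E)%E.
  apply: eq_integral => t _; rewrite /F/=.
  have [t0|t0] := leP t 0.
    rewrite /igamma pw_le0// !(mul0r, mulr0).
    by under eq_integral do rewrite !mul0r; rewrite integral_cst// mul0e.
  rewrite /heat (hs_density gN _ _ mh hM); last by rewrite sqrtr_gt0 mulr_gt0.
  rewrite EFinM /Rintegral fineK; last first.
    apply: integrable_fin_num => //; apply: (gratio3_integrableM gN _ _ mh hM).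
    by rewrite sqrtr_gt0 mulr_gt0.
  rewrite -ge0_integralZl_EFin//.
  - by apply: eq_integral => xi _; rewrite -EFinM; congr EFin; ring.
  - by move=> xi _; rewrite lee_fin; apply: mulr_ge0 => //; apply/ltW/g30.
  - by apply/measurable_EFinP; apply: measurable_funM => //; exact: measurable_gratio3.
transitivity (\int[N3]_xi \int[mu]_t (F (t, xi))%:E)%E.
  exact: (@fubini_tonelli _ _ _ _ _ mu N3 (EFin \o F) mFE F0).
apply: eq_integral => xi _; rewrite /F/= EFinM -(integral_igamma_gratio3 x xi y0).
rewrite -ge0_integralZr//.
- apply: measurable_EFin_R.
  have := measurableT_comp (measurable_igamma_gratio3 x y (measurable_cst (1 : R))) (@pair2_measurable _ _ _ _ xi).
  by apply: eq_measurable_fun => t _ /=; rewrite mulr1.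
- move=> t _; rewrite lee_fin.
  have [t0|t0] := leP t 0; first by rewrite /igamma pw_le0// !(mul0r, mulr0).
  by apply: mulr_ge0 => //; apply/ltW/g30.
- by rewrite lee_fin.
Qed.

Lemma pkernel_mass x y : 0 < y -> (\int[N3]_xi (pkernel x y xi)%:E = 1)%E.
Proof.
move=> y0; have := @ge0_poisson x y (cst 1) 1 y0 (measurable_cst _).
have -> : heat N (cst 1) x = cst 1 by apply/funext => t; rewrite /heat hs_cst.
under eq_integral do rewrite mulr1.
rewrite igamma_mass//; last by rewrite divr_gt0// exprn_gt0.
move=> ->; last by move=> xi; rewrite ler01 lexx.
by apply: eq_integral => xi _; rewrite mulr1.
Qed.

Lemma pkernel_integrable x y : 0 < y -> N3.-integrable setT (fun xi => (pkernel x y xi)%:E).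
Proof.
move=> y0; apply/integrableP; split; first by apply/measurable_EFinP; exact: measurable_pkernel.
rewrite (_ : (\int[N3]_xi _)%E = 1%E) ?ltry// -(pkernel_mass x y0).
by apply: eq_integral => xi _; rewrite gee0_abs// lee_fin pkernel_ge0.
Qed.

Lemma pkernel_integrableM x y h M : 0 < y -> measurable_fun setT h -> (forall xi, `|h xi| <= M) ->
  N3.-integrable setT (fun xi => (pkernel x y xi * h xi)%:E).
Proof.
move=> y0 mh hM.
apply: (@integrable_le_norm _ _ _ _ _ _ (fun xi => M * pkernel x y xi) measurableT).
- by apply: measurable_funM => //; exact: measurable_pkernel.
- exact: (integrableZl measurableT M (pkernel_integrable x y0)).
- by move=> xi _; rewrite normrM (ger0_norm (pkernel_ge0 _ _ _)) mulrC ler_wpM2r// pkernel_ge0.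
Qed.

Lemma poisson_formula x y h M : 0 < y -> measurable_fun setT h -> (forall xi, `|h xi| <= M) ->
  \int[mu]_t (igamma al (y ^+ 2 / 4) t * heat N h x t) = \int[N3]_xi (pkernel x y xi * h xi).
Proof.
move=> y0 mh hM; have M0 : 0 <= M := le_trans (normr_ge0 _) (hM (0, 0, 0)).
have c0 : 0 < y ^+ 2 / 4 by rewrite divr_gt0// exprn_gt0.
pose h1 xi := h xi + M.
have mh1 : measurable_fun setT h1 by exact: measurable_funD.
have h1M xi : 0 <= h1 xi <= M + M.
  by have := hM xi; rewrite ler_norml /h1 => /andP[a b]; rewrite lerD2r b andbT -lerBlDr sub0r.
have h1b xi : `|h1 xi| <= M + M by rewrite ger0_norm; case/andP: (h1M xi).
have hh t : heat N h1 x t = heat N h x t + M.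
  rewrite /heat /h1 (_ : (fun _ => _) = fun z => h z + 1 * cst M z); last by apply/funext => z; rewrite mul1r.
  rewrite (@hs_lin _ N h (cst M) M M)//; first by rewrite hs_cst mul1r.
  by move=> z; rewrite ger0_norm.
have ii := igamma_integrable al0 al1 c0.
have i1 := integrableM_bounded (measurable_igamma al (y ^+ 2 / 4)) (ig0 y) ii (measurable_heat N mh hM x) (heat_bound N mh hM x).
have i2 := integrableZl measurableT M ii.
have j1 := pkernel_integrableM x y0 mh hM.
have j2 := integrableZl measurableT M (pkernel_integrable x y0).
have E := ge0_poisson x y0 mh1 h1M.
have {}E : \int[mu]_t (igamma al (y ^+ 2 / 4) t * heat N h x t) + M = \int[N3]_xi (pkernel x y xi * h xi) + M.
  transitivity (\int[mu]_t (igamma al (y ^+ 2 / 4) t * heat N h1 x t)).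
    transitivity (\int[mu]_t (igamma al (y ^+ 2 / 4) t * heat N h x t + M * igamma al (y ^+ 2 / 4) t)).
      rewrite RintegralD// RintegralZl//; congr (_ + _).
      by rewrite /Rintegral igamma_mass//= mulr1.
    by apply: eq_Rintegral => t _; rewrite hh; ring.
  rewrite /Rintegral E -/(Rintegral N3 setT _).
  transitivity (\int[N3]_xi (pkernel x y xi * h xi + M * pkernel x y xi)).
    by apply: eq_Rintegral => xi _; rewrite /h1; ring.
  rewrite RintegralD// RintegralZl//; last exact: pkernel_integrable.
  by rewrite /Rintegral pkernel_mass//= mulr1.
exact: addIr E.
Qed.

End poisson.

Lemma is_derive_line (R : realType) (V : normedModType R) (f : V -> R) (Z v : V) (df : R) :
  is_derive (0 : R) (1 : R) (fun t : R => f (t *: v + Z)) df -> is_derive Z v f df.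
Proof.
move=> [d dE].
have E : (fun h : R => h^-1 *: (((fun t : R => f (t *: v + Z)) \o shift 0) (h *: 1) - f (0 *: v + Z))) =
         (fun h : R => h^-1 *: ((f \o shift Z) (h *: v) - f Z)).
  by apply/funext => h; rewrite /= addr0 scale0r add0r /GRing.scale/= mulr1.
split; first by apply/derivable1P.
by rewrite -dE /derive E.
Qed.

(** * The kernels: derivatives and decay *)

Section kernels.
Variables (R : realType).
Local Notation R3 := (R * R * R)%type.
Implicit Types (w : 'I_4 -> R) (a b p t x : R) (i j : 'I_4).

Definition qd w : R := \sum_i w i ^+ 2.

Definition sh w j t : 'I_4 -> R := fun i => w i + (i == j)%:R * t.

Lemma qd_ge0 w : 0 <= qd w.
Proof. by apply: sumr_ge0 => i _; rewrite sqr_ge0. Qed.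

Lemma sqr_le_qd w i : w i ^+ 2 <= qd w.
Proof. by rewrite /qd (bigD1 i)//= lerDl sumr_ge0// => j _; rewrite sqr_ge0. Qed.

Lemma qd_sh w j t : qd (sh w j t) = qd w + (2 * w j) * t + t ^+ 2.
Proof.
rewrite /qd (bigD1 j)//= [in RHS](bigD1 j)//= /sh eqxx mul1r.
under eq_bigr => i ij do rewrite (negbTE ij) mul0r addr0.
ring.
Qed.

Lemma is_derive_qd w j x : is_derive x (1 : R) (fun t => qd (sh w j t)) (2 * sh w j x j).
Proof.
rewrite (_ : (fun t => _) = (fun t => qd w + (2 * w j) * t + t * t)); last first.
  by apply/funext => t; rewrite qd_sh expr2.
apply: is_derive_eq.
by rewrite /sh eqxx/= /GRing.scale/=; ring.
Qed.

Lemma is_derive_qd_powR w j p x : 0 < qd (sh w j x) ->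
  is_derive x (1 : R) (fun t => qd (sh w j t) `^ (- p))
    (- p * (2 * sh w j x j) * qd (sh w j x) `^ (- (p + 1))).
Proof.
move=> q0; have D1 := is_derive_qd w j x.
have D2 := is_derive1_powR (- p) q0.
have D := @is_derive1_comp _ (fun y => y `^ (- p)) (fun t => qd (sh w j t)) x _ _ D2 D1.
rewrite (_ : _ * _ = - p * qd (sh w j x) `^ (- p - 1) * (2 * sh w j x j)); first exact: D.
by rewrite opprD; ring.
Qed.

Lemma is_derive_sh w j i x : is_derive x (1 : R) (fun t => sh w j t i) (i == j)%:R.
Proof.
apply: is_derive_eq.
by rewrite add0r mul1r /GRing.scale/= mulr1.
Qed.

Section tame.
Variable a : R.

(* With [a] the exponent of the Poisson kernel, its mass dominates the integrals of all tame kernels. *)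
Record tame (phi : ('I_4 -> R) -> R) : Prop := Tame {
  tame_cvg : forall (wn : nat -> 'I_4 -> R) w, 0 < qd w ->
    (forall i, wn n i @[n --> \oo] --> w i) -> phi (wn n) @[n --> \oo] --> phi w;
  tame_bound : forall q0, 0 < q0 -> exists2 B, 0 <= B &
    forall w, q0 <= qd w -> `|phi w| <= B * qd w `^ (- a);
  tame_measurable : forall w : R3 -> 'I_4 -> R, (forall i, measurable_fun setT (w ^~ i)) ->
    measurable_fun setT (fun xi => phi (w xi))
}.

Lemma tameD f g : tame f -> tame g -> tame (fun w => f w + g w).
Proof.
move=> [fc fb fm] [gc gb gm]; split.
- by move=> wn w q0 H; apply: cvgD; [exact: fc|exact: gc].
- move=> q0 q00; have [B1 B10 H1] := fb _ q00; have [B2 B20 H2] := gb _ q00.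
  exists (B1 + B2); first exact: addr_ge0.
  by move=> w qw; rewrite (le_trans (ler_normD _ _))// mulrDl lerD ?H1 ?H2.
- by move=> w mw; apply: measurable_funD; [exact: fm|exact: gm].
Qed.

Lemma tameZ c f : tame f -> tame (fun w => c * f w).
Proof.
move=> [fc fb fm]; split.
- by move=> wn w q0 H; apply: cvgM; [exact: cvg_cst|exact: fc].
- move=> q0 q00; have [B B0 H] := fb _ q00; exists (`|c| * B); first exact: mulr_ge0.
  by move=> w qw; rewrite normrM -mulrA ler_wpM2l// H.
- by move=> w mw; apply: measurable_funM => //; exact: fm.
Qed.

Lemma cvg_qd (wn : nat -> 'I_4 -> R) w : (forall i, wn n i @[n --> \oo] --> w i) ->
  qd (wn n) @[n --> \oo] --> qd w.
Proof.
move=> H; have H2 i := cvgM (H i) (H i).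
rewrite /qd !big_ord_recl big_ord0.
under eq_fun do rewrite !big_ord_recl big_ord0.
by do 4 (apply: cvgD; first exact: H2); exact: cvg_cst.
Qed.

(** Away from [qd w = 0] the extra power [- b] absorbs a prefactor of size [qd w] to the power [b];
    the monomials below have [b] equal to 0, 1 or 2. *)
Lemma tame_monomial (m : ('I_4 -> R) -> R) b :
  (forall (wn : nat -> 'I_4 -> R) w, (forall i, wn n i @[n --> \oo] --> w i) ->
     m (wn n) @[n --> \oo] --> m w) ->
  (forall q0, 0 < q0 -> exists2 B, 0 <= B & forall w, q0 <= qd w -> `|m w| * qd w `^ (- b) <= B) ->
  (forall w : R3 -> 'I_4 -> R, (forall i, measurable_fun setT (w ^~ i)) ->
    measurable_fun setT (fun xi => m (w xi))) ->
  tame (fun w => m w * qd w `^ (- (a + b))).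
Proof.
move=> mc mb mm; split.
- move=> wn w q0 H; apply: cvgM; first exact: mc.
  exact: (cvg_comp _ _ (cvg_qd H) (continuous_powR (b := - (a + b)) q0)).
- move=> q0 q00; have [B B0 H] := mb _ q00; exists B => // w qw.
  have qp : 0 < qd w by exact: lt_le_trans qw.
  rewrite normrM (ger0_norm (powR_ge0 _ _)) opprD powRD; last by rewrite (gt_eqF qp) implybT.
  by rewrite [_ * qd w `^ (- b)]mulrC mulrA ler_wpM2r ?powR_ge0// H.
- move=> w mw; apply: measurable_funM; first exact: mm.
  apply: (measurableT_comp (measurable_powR _)); apply: measurable_sum => i.
  exact: measurable_funX.
Qed.

Lemma powRN1 q : 0 < q -> q `^ (- 1) = q^-1 :> R.
Proof. by move=> q0; rewrite powR_inv1// ltW. Qed.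

Lemma tame0 : tame (fun w => 1 * qd w `^ (- (a + 0))).
Proof.
apply: tame_monomial.
- by move=> wn w _; exact: cvg_cst.
- by move=> q0 q00; exists 1 => // w qw; rewrite normr1 mul1r oppr0 powRr0.
- by [].
Qed.

Lemma tame1 : tame (fun w => 1 * qd w `^ (- (a + 1))).
Proof.
apply: tame_monomial.
- by move=> wn w _; exact: cvg_cst.
- move=> q0 q00; exists q0^-1; first by rewrite invr_ge0 ltW.
  move=> w qw; have qp : 0 < qd w by exact: lt_le_trans qw.
  by rewrite normr1 mul1r powRN1// lef_pV2.
- by [].
Qed.

Lemma tame_coord i : tame (fun w => w i * qd w `^ (- (a + 1))).
Proof.
apply: tame_monomial.
- by move=> wn w H; exact: H.
- move=> q0 q00; exists (1 + q0^-1); first by rewrite addr_ge0// invr_ge0 ltW.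
  move=> w qw; have qp : 0 < qd w by exact: lt_le_trans qw.
  rewrite powRN1// ler_pdivrMr// (le_trans (norm_le1Dsqr _))//.
  rewrite mulrDl mul1r addrC lerD ?sqr_le_qd//.
  by rewrite -ler_pdivrMl ?invr_gt0// invrK mulr1.
- by move=> w mw; exact: mw.
Qed.

Lemma tame_coord2 i j : tame (fun w => (w i * w j) * qd w `^ (- (a + 2))).
Proof.
apply: tame_monomial.
- by move=> wn w H; exact: cvgM.
- move=> q0 q00; exists q0^-1; first by rewrite invr_ge0 ltW.
  move=> w qw; have qp : 0 < qd w by exact: lt_le_trans qw.
  have -> : qd w `^ (- 2) = (qd w)^-1 * (qd w)^-1.
    by rewrite -powRN1// -powRD ?(gt_eqF qp) ?implybT//; congr powR; ring.
  have H : `|w i * w j| <= qd w.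
    rewrite normrM -ler_sqr ?nnegrE ?qd_ge0 ?mulr_ge0// exprMn !real_normK ?num_real//.
    by rewrite [leRHS]expr2 ler_pM ?sqr_ge0 ?sqr_le_qd.
  rewrite mulrA ler_pdivrMr// (@le_trans _ _ 1)//.
    by rewrite ler_pdivrMr// mul1r.
  by rewrite -ler_pdivrMl ?invr_gt0// invrK mulr1.
- by move=> w mw; exact: measurable_funM.
Qed.

(** The factor 1 and the term 0 give it the form of [tame_monomial]. [ker1] and [ker2] are its first
    and second partial derivatives. *)
Definition ker0 w := 1 * qd w `^ (- (a + 0)).

Definition ker1 i w := - 2 * a * (w i * qd w `^ (- (a + 1))).

Definition ker2 i j w := - 2 * a * (i == j)%:R * (1 * qd w `^ (- (a + 1))) +
  4 * a * (a + 1) * ((w i * w j) * qd w `^ (- (a + 2))).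

Lemma tame_ker1 i : tame (ker1 i).
Proof. by apply: tameZ; exact: tame_coord. Qed.

Lemma tame_ker2 i j : tame (ker2 i j).
Proof. by apply: tameD; apply: tameZ; [exact: tame1|exact: tame_coord2]. Qed.

Lemma is_derive_ker0 w j x : 0 < qd (sh w j x) ->
  is_derive x (1 : R) (fun t => ker0 (sh w j t)) (ker1 j (sh w j x)).
Proof.
move=> q0; have D := is_derive_qd_powR (a + 0) q0.
rewrite (_ : (fun t => _) = (fun t => qd (sh w j t) `^ (- (a + 0)))); last by apply/funext => t; rewrite /ker0 mul1r.
rewrite (_ : ker1 _ _ = - (a + 0) * (2 * sh w j x j) * qd (sh w j x) `^ (- (a + 0 + 1))); first exact: D.
by rewrite /ker1 !addr0; ring.
Qed.

Lemma is_derive_ker1 i w j x : 0 < qd (sh w j x) ->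
  is_derive x (1 : R) (fun t => ker1 i (sh w j t)) (ker2 i j (sh w j x)).
Proof.
move=> q0; have D1 := is_derive_qd_powR (a + 1) q0.
have D2 := is_derive_sh w j i x.
have D := @is_deriveM _ _ _ _ x 1 _ _ D2 D1.
have D' := @is_deriveZ _ _ _ _ (- 2 * a) x 1 _ D.
rewrite (_ : (fun t => _) = (- 2 * a) \*: ((fun t => sh w j t i) * (fun t => qd (sh w j t) `^ (- (a + 1))))); last first.
  by [].
apply: (is_derive_eq D').
rewrite /ker2 /GRing.scale/= (_ : a + 1 + 1 = a + 2); last by ring.
ring.
Qed.

(* The pointwise form of div(y^(1-2 al) grad v) = 0, in the exponent a = al + 3/2. *)
Lemma ker_pde w : 0 < qd w ->
  w ord_max * \sum_i ker2 i i w + (2 * a - 2) * ker1 ord_max w = 0.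
Proof.
move=> q0.
have E2 : qd w `^ (- (a + 1)) = qd w * qd w `^ (- (a + 2)).
  rewrite -[X in _ = X * _]powRr1 ?qd_ge0// -powRD ?(gt_eqF q0) ?implybT//; congr powR; ring.
have -> : \sum_i ker2 i i w = (- 8 * a + 4 * a * (a + 1)) * (qd w * qd w `^ (- (a + 2))).
  rewrite /ker2 big_split/=.
  under eq_bigr => i _ do rewrite eqxx mulr1 mul1r E2.
  rewrite sumr_const card_ord -mulr_sumr -mulr_suml.
  under eq_bigr => i _ do rewrite -expr2.
  rewrite -/(qd w); ring.
rewrite /ker1 E2; ring.
Qed.

End tame.

End kernels.

(** * Potentials and differentiation under the integral *)

Section potential.
Variables (R : realType) (N : probability R R).
Hypothesis gN : gaussian N.
Local Notation R3 := (R * R * R)%type.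
Local Notation N3 := (prob3 N).
Variables (al : R).
Hypotheses (al0 : 0 < al) (al1 : al < 1).
Variables (u : R3 -> R) (M : R).
Hypotheses (mu_ : measurable_fun setT u) (uM : forall x, `|u x| <= M).
Local Notation a := (pdim al).
Implicit Types (Z : 'rV[R]_4) (xi : R3) (phi : ('I_4 -> R) -> R) (i j : 'I_4).

Definition em xi i : R := [:: xi.1.1; xi.1.2; xi.2; 0]`_i.

Definition base Z : R3 := (Z ord0 (inord 0), Z ord0 (inord 1), Z ord0 (inord 2)).

Definition diff4 Z xi i : R := Z ord0 i - em xi i.

Lemma I4E (P : 'I_4 -> Prop) : P (inord 0) -> P (inord 1) -> P (inord 2) -> P ord_max -> forall i, P i.
Proof.
move=> h0 h1 h2 h3 [[|[|[|[|//]]]] lt]; set i := Ordinal _.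
- by rewrite (_ : i = inord 0)//; apply: val_inj; rewrite /= inordK.
- by rewrite (_ : i = inord 1)//; apply: val_inj; rewrite /= inordK.
- by rewrite (_ : i = inord 2)//; apply: val_inj; rewrite /= inordK.
- by rewrite (_ : i = ord_max)//; apply: val_inj.
Qed.

Lemma sum_I4 (f : 'I_4 -> R) : \sum_i f i = f (inord 0) + f (inord 1) + f (inord 2) + f ord_max.
Proof.
rewrite !big_ord_recl big_ord0 addr0 !addrA; congr (f _ + f _ + f _ + f _);
  by apply: val_inj; rewrite /= ?inordK.
Qed.

Lemma measurable_em i : measurable_fun setT (em ^~ i).
Proof.
move: i; apply: I4E; rewrite /em ?inordK//=.
- exact: measurable_R3_1.
- exact: measurable_R3_2.
- exact: measurable_snd.
Qed.

Lemma measurable_diff4 Z i : measurable_fun setT (fun xi => diff4 Z xi i).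
Proof. by apply: measurable_funB => //; exact: measurable_em. Qed.

Lemma qd_diff4 Z xi : qd (diff4 Z xi) = height Z ^+ 2 + nq (base Z) xi.
Proof.
rewrite /qd sum_I4 /diff4 /em !inordK//= subr0 /height /nq /base/=.
by rewrite [LHS]addrC !addrA.
Qed.

Lemma height_le_qd Z xi : height Z ^+ 2 <= qd (diff4 Z xi).
Proof. by rewrite qd_diff4 lerDl nq_ge0. Qed.

Lemma diff4_shift Z xi j (t : R) : diff4 (t *: delta_mx ord0 j + Z) xi = sh (diff4 Z xi) j t.
Proof. by apply/funext => i; rewrite /diff4 /sh !mxE eqxx/=; ring. Qed.

(** The exponential undoes the Gaussian weight, so that [pot phi] is, up to a constant, the integral
    of [phi] against [u] in Lebesgue measure. *)
Definition dens xi : R := u xi * expR (sqn xi / 2).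

Lemma measurable_dens : measurable_fun setT dens.
Proof.
apply: measurable_funM => //; apply: (measurableT_comp (@measurable_expR R)).
by apply: measurable_funM => //; exact: measurable_sqn.
Qed.

Definition pot phi Z : R := \int[N3]_xi (phi (diff4 Z xi) * dens xi).

(** The Poisson kernel up to a factor depending on the height of [Z], whence its integrability. *)
Definition dom Z xi : R := qd (diff4 Z xi) `^ (- a) * expR (sqn xi / 2).

Lemma dom_integrable Z : 0 < height Z -> N3.-integrable setT (EFin \o dom Z).
Proof.
move=> y0; have c0 : 0 < pcst al * height Z `^ (2 * al) by rewrite mulr_gt0 ?pcst_gt0 ?powR_gt0.
have := integrableZl measurableT (pcst al * height Z `^ (2 * al))^-1 (pkernel_integrable gN al0 al1 (base Z) y0).
rewrite (_ : (fun _ => _) = EFin \o dom Z)//; apply/funext => xi.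
rewrite /= -EFinM /pkernel -qd_diff4 /dom; congr EFin.
by rewrite -[_ * _ * expR _]mulrA mulKf// gt_eqF.
Qed.

Let M0 : 0 <= M := le_trans (normr_ge0 _) (uM (0, 0, 0)).

Lemma measurable_pot_integrand phi Z : tame a phi ->
  measurable_fun setT (fun xi => phi (diff4 Z xi) * dens xi).
Proof.
move=> tp; apply: measurable_funM; last exact: measurable_dens.
by apply: (tame_measurable tp) => i; exact: measurable_diff4.
Qed.

Definition close Z Z' := forall i, `|Z' ord0 i - Z ord0 i| <= height Z / 4.

(** Each coordinate satisfies [(w + e)^2 >= w^2 / 2 - e^2]; the four errors total at most
    [height Z ^+ 2 / 4], which is at most a quarter of [qd]. *)
Lemma close_qd Z Z' xi : 0 < height Z -> close Z Z' ->
  qd (diff4 Z xi) / 4 <= qd (diff4 Z' xi).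
Proof.
move=> y0 cl.
have H : \sum_i (diff4 Z xi i ^+ 2 / 2 - (height Z / 4) ^+ 2) <= qd (diff4 Z' xi).
  apply: ler_sum => i _; set w := diff4 Z xi i.
  have -> : diff4 Z' xi i = w + (Z' ord0 i - Z ord0 i) by rewrite /w /diff4; ring.
  set e := Z' ord0 i - Z ord0 i; have : e ^+ 2 <= (height Z / 4) ^+ 2.
    rewrite -(real_normK (num_real e)) lerXn2r ?nnegrE ?divr_ge0 ?(ltW y0)//.
    exact: cl.
  have : 0 <= (w + 2 * e) ^+ 2 / 2 by rewrite divr_ge0 ?sqr_ge0.
  rewrite (_ : (w + 2 * e) ^+ 2 / 2 = (w + e) ^+ 2 - w ^+ 2 / 2 + e ^+ 2); last by field.
  by move: ((w + e) ^+ 2) (w ^+ 2) (e ^+ 2) ((height Z / 4) ^+ 2) => *; lra.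
apply: le_trans H; rewrite big_split/= sumr_const card_ord -mulr_suml -/(qd _).
have := height_le_qd Z xi; rewrite expr_div_n -mulr_natr.
by move: (qd _) (height Z ^+ 2) => q h; lra.
Qed.

(** Over the neighbourhood [close Z], [qd] drops at most by the factor 4, so one multiple of [dom Z]
    dominates all the integrands. It is the majorant for continuity and for differentiation. *)
Lemma pot_dom phi Z : tame a phi -> 0 < height Z -> exists2 B, 0 <= B &
  forall Z' xi, close Z Z' -> `|phi (diff4 Z' xi) * dens xi| <= B * dom Z xi.
Proof.
move=> tp y0.
have q0 : 0 < height Z ^+ 2 / 4 by rewrite divr_gt0// exprn_gt0.
have [B B0 H] := tame_bound tp q0.
exists (B * 4 `^ a * M); first by rewrite !mulr_ge0// powR_ge0.
move=> Z' xi cl; have cq := close_qd xi y0 cl.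
have qZ : 0 < qd (diff4 Z xi) by apply: lt_le_trans (height_le_qd _ _); rewrite exprn_gt0.
have h : `|phi (diff4 Z' xi)| <= B * 4 `^ a * qd (diff4 Z xi) `^ (- a).
  have q2 : height Z ^+ 2 / 4 <= qd (diff4 Z' xi).
    by apply: le_trans cq; rewrite ler_pM2r ?invr_gt0// height_le_qd.
  apply: (le_trans (H _ q2)); rewrite -mulrA ler_wpM2l//.
  have -> : 4 `^ a * qd (diff4 Z xi) `^ (- a) = ((qd (diff4 Z xi) / 4) `^ a)^-1.
    have inv4 : 4^-1 `^ a = (4 `^ a)^-1 by rewrite -powRN -powR_inv1// -powRrM mulN1r.
    by rewrite powRM ?invr_ge0 ?qd_ge0// invfM inv4 invrK powRN mulrC.
  rewrite powRN lef_pV2 ?posrE ?powR_gt0//; last by rewrite divr_gt0.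
    by apply: ge0_ler_powR; rewrite ?nnegrE ?qd_ge0 ?divr_ge0 ?qd_ge0// /pdim addr_ge0 ?divr_ge0// ltW.
  exact: lt_le_trans q2.
rewrite normrM /dens normrM (ger0_norm (expR_ge0 _)) /dom.
rewrite (_ : B * _ * M * _ = (B * 4 `^ a * qd (diff4 Z xi) `^ (- a)) * (M * expR (sqn xi / 2))); last by ring.
by apply: ler_pM => //; apply: ler_wpM2r.
Qed.

Lemma close_near Z : 0 < height Z -> \forall Z' \near Z, close Z Z'.
Proof.
move=> y0.
have H i : \forall Z' \near Z, `|(Z' : 'rV[R]_4) ord0 i - Z ord0 i| <= height Z / 4.
  have /cvgrPdist_le := @coord_continuous R 1 4 ord0 i Z.
  move=> /(_ (height Z / 4)); rewrite divr_gt0// => /(_ isT).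
  by apply: filterS => Z' /=; rewrite distrC.
near=> Z'; rewrite /close; apply: I4E; near: Z'; exact: H.
Unshelve. all: by end_near. Qed.

Lemma closexx Z : 0 < height Z -> close Z Z.
Proof. by move=> y0 i; rewrite subrr normr0 divr_ge0// ltW. Qed.

Lemma pot_integrable phi Z : tame a phi -> 0 < height Z ->
  N3.-integrable setT (fun xi => (phi (diff4 Z xi) * dens xi)%:E).
Proof.
move=> tp y0; have [B B0 H] := pot_dom tp y0.
apply: (@integrable_le_norm _ _ _ _ _ _ (fun xi => B * dom Z xi) measurableT).
- exact: measurable_pot_integrand.
- exact: (integrableZl measurableT B (dom_integrable y0)).
- by move=> xi _; apply: H; exact: closexx.
Qed.

Lemma pot_continuous phi Z : tame a phi -> 0 < height Z -> {for Z, continuous (pot phi)}.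
Proof.
move=> tp y0; have [B B0 H] := pot_dom tp y0.
apply: seq_continuous_at => v vZ.
have [n0 _ cl] := vZ _ (close_near y0).
rewrite -(cvg_shiftn n0).
have [||||_ //] := @Rdominated_cvg _ _ R N3 setT (fun n xi => phi (diff4 (v (n + n0)%N) xi) * dens xi)
   (fun xi => phi (diff4 Z xi) * dens xi) (fun xi => B * dom Z xi) measurableT.
- by move=> n; exact: measurable_pot_integrand.
- move=> xi _; apply: cvgM; last exact: cvg_cst.
  apply: (tame_cvg tp); first by apply: lt_le_trans (height_le_qd _ _); rewrite exprn_gt0.
  move=> i; apply: cvgB; last exact: cvg_cst.
  rewrite (cvg_shiftn n0 (fun n => v n ord0 i)).
  exact: (cvg_comp _ _ vZ (@coord_continuous R 1 4 ord0 i Z)).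
- exact: (integrableZl measurableT B (dom_integrable y0)).
- by move=> n xi _; apply: H; apply: cl; rewrite /= leq_addl.
Qed.

Lemma pot_derive phi dphi j Z : tame a phi -> tame a dphi ->
  (forall w x, 0 < qd (sh w j x) -> is_derive x (1 : R) (fun t => phi (sh w j t)) (dphi (sh w j x))) ->
  0 < height Z -> is_derive Z (delta_mx ord0 j) (pot phi) (pot dphi Z).
Proof.
move=> tp td D y0; apply: is_derive_line.
have y40 : 0 < height Z / 4 by rewrite divr_gt0.
have [B B0 H] := pot_dom td y0.
have cl (t : R) : `|t - 0| < height Z / 4 -> close Z (t *: delta_mx ord0 j + Z).
  rewrite subr0 => tZ i; rewrite !mxE eqxx/= addrK.
  case: (i == j); first by rewrite mulr1 ltW.
  by rewrite mulr0 normr0 ltW.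
have hp Z' : close Z Z' -> 0 < height Z'.
  move=> /(_ ord_max); rewrite -/(height Z') -/(height Z) ler_norml => /andP[h _].
  apply: (@lt_le_trans _ _ (height Z - height Z / 4)); first by move: y0; move: (height Z) => h'; lra.
  by move: h; move: (height Z) (height Z') => h1 h2; lra.
have := @is_derive_under_integral R _ _ N3 (fun t xi => phi (sh (diff4 Z xi) j t) * dens xi)
  (fun t xi => dphi (sh (diff4 Z xi) j t) * dens xi) 0 (height Z / 4) (fun xi => B * dom Z xi) y40.
have E (f : ('I_4 -> R) -> R) t : pot f (t *: delta_mx ord0 j + Z) = \int[N3]_xi (f (sh (diff4 Z xi) j t) * dens xi).
  by apply: eq_Rintegral => xi _; rewrite diff4_shift.
rewrite (_ : (fun t : R => pot phi _) = fun t => \int[N3]_xi (phi (sh (diff4 Z xi) j t) * dens xi)); last first.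
  by apply/funext => t; rewrite E.
rewrite (_ : pot dphi Z = \int[N3]_xi (dphi (sh (diff4 Z xi) j 0) * dens xi)); last first.
  by rewrite -E scale0r add0r.
apply.
- move=> t /cl /hp h; have := pot_integrable tp h.
  by under eq_fun do rewrite diff4_shift.
- move=> t xi /cl /hp h.
  have q0 : 0 < qd (sh (diff4 Z xi) j t).
    by rewrite -diff4_shift; apply: lt_le_trans (height_le_qd _ _); rewrite exprn_gt0.
  rewrite (_ : (fun t => _) = dens xi \*: (fun t => phi (sh (diff4 Z xi) j t))); last first.
    by apply/funext => s; rewrite /GRing.scale/= mulrC.
  by rewrite mulrC; exact: (is_deriveZ _ (D _ _ q0)).
- exact: (integrableZl measurableT B (dom_integrable y0)).
- by move=> t xi /cl c; rewrite -diff4_shift; exact: H.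
Qed.

End potential.

Lemma near_eq_continuous (R : realType) (T : topologicalType) (f g : T -> R) (Z : T) :
  (\forall W \near Z, f W = g W) -> {for Z, continuous f} -> {for Z, continuous g}.
Proof.
move=> fg; rewrite /prop_for /continuous_at -(nbhs_singleton fg) => fc.
apply/cvgrPdist_lt => e e0; move/cvgrPdist_lt/(_ _ e0): fc => H.
near=> W; have <- : f W = g W by near: W.
by near: W.
Unshelve. all: by end_near. Qed.

(** * Regularity of the extension and its equation in the half-space *)

Section extension_regularity.
Variables (R : realType) (N : probability R R).
Hypothesis gN : gaussian N.
Local Notation R3 := (R * R * R)%type.
Local Notation N3 := (prob3 N).
Variables (al : R).
Hypotheses (al0 : 0 < al) (al1 : al < 1).
Variables (u : R3 -> R) (M : R).
Hypotheses (mu_ : measurable_fun setT u) (uM : forall x, `|u x| <= M).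
Local Notation a := (pdim al).
Local Notation pot := (pot N u).
Implicit Types (Z : 'rV[R]_4) (xi : R3) (phi : ('I_4 -> R) -> R) (i j : 'I_4) (b : R).
Local Notation e_ j := (delta_mx ord0 j : 'rV[R]_4).

Lemma height_continuous : continuous (@height R).
Proof. exact: coord_continuous. Qed.

Lemma height_near Z : 0 < height Z -> \forall W \near Z, 0 < height W.
Proof. move=> y0; have /cvgrPdist_lt/(_ _ y0) := @height_continuous Z.
by apply: filterS => W /=; rewrite ltr_norml => /andP[_]; rewrite gtrBl. Qed.

Lemma is_derive_height b j Z : 0 < height Z ->
  is_derive Z (e_ j) (fun W => height W `^ b) ((j == ord_max)%:R * b * height Z `^ (b - 1)).
Proof.
move=> y0; apply: is_derive_line.
have hE (t : R) : height (t *: e_ j + Z) = height Z + (j == ord_max)%:R * t.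
  by rewrite /height !mxE eqxx/= eq_sym; ring.
have D1 : is_derive (0 : R) (1 : R) (fun t => height Z + (j == ord_max)%:R * t) (j == ord_max)%:R.
  by apply: is_derive_eq; rewrite add0r mul1r /GRing.scale/= mulr1.
have y1 : 0 < height Z + (j == ord_max)%:R * 0 by rewrite mulr0 addr0.
have D := @is_derive1_comp _ (fun y => y `^ b) (fun t => height Z + (j == ord_max)%:R * t) 0 _ _ (is_derive1_powR b y1) D1.
rewrite (_ : (fun t : R => _) = (fun y => y `^ b) \o (fun t => height Z + (j == ord_max)%:R * t)); last first.
  by apply/funext => t /=; rewrite hE.
apply: (is_derive_eq D); rewrite mulr0 addr0; ring.
Qed.

Lemma for_continuousD (f g : 'rV[R]_4 -> R) Z : {for Z, continuous f} -> {for Z, continuous g} ->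
  {for Z, continuous (fun W => f W + g W)}.
Proof. by rewrite /prop_for /continuous_at => cf cg; exact: (cvgD cf cg). Qed.

Lemma for_continuousM (f g : 'rV[R]_4 -> R) Z : {for Z, continuous f} -> {for Z, continuous g} ->
  {for Z, continuous (fun W => f W * g W)}.
Proof. by rewrite /prop_for /continuous_at => cf cg; exact: (cvgM cf cg). Qed.

Lemma for_continuousZ (k : R) (g : 'rV[R]_4 -> R) Z : {for Z, continuous g} ->
  {for Z, continuous (fun W => k * g W)}.
Proof. by move=> cg; exact: (@for_continuousM (fun=> k) g Z (@cst_continuous _ _ k Z) cg). Qed.

(** Sums of such terms are stable under partial derivatives: the kernel is differentiated, and in
    the last direction the power of the height too. *)
Definition mono b phi Z : R := height Z `^ b * pot phi Z.

Lemma mono_continuous b phi Z : tame a phi -> 0 < height Z -> {for Z, continuous (mono b phi)}.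
Proof.
move=> tp y0; apply: for_continuousM; last exact: (pot_continuous gN al0 al1 mu_ uM tp y0).
exact: (continuous_comp (@height_continuous Z) (continuous_powR (b := b) y0)).
Qed.

Lemma mono_derive b phi dphi j Z : tame a phi -> tame a dphi ->
  (forall w x, 0 < qd (sh w j x) -> is_derive x (1 : R) (fun t => phi (sh w j t)) (dphi (sh w j x))) ->
  0 < height Z ->
  is_derive Z (e_ j) (mono b phi) (mono b dphi Z + (j == ord_max)%:R * b * mono (b - 1) phi Z).
Proof.
move=> tp td D y0.
have D1 := is_derive_height b j y0.
have D2 := pot_derive gN al0 al1 mu_ uM tp td D y0.
apply: (is_derive_eq (is_deriveM D1 D2)).
by rewrite /mono /GRing.scale/=; ring.
Qed.

Let t0 := tame0 a.
Let t1 := tame_ker1 a.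
Let t2 := tame_ker2 a.

Definition dmono i b Z : R := mono b (ker1 a i) Z + (i == ord_max)%:R * b * mono (b - 1) (ker0 a) Z.

Lemma mono_derive0 b i Z : 0 < height Z -> is_derive Z (e_ i) (mono b (ker0 a)) (dmono i b Z).
Proof.
by move=> y0; apply: mono_derive => // w x; exact: is_derive_ker0.
Qed.

Definition ddmono i j b Z : R :=
  (mono b (ker2 a i j) Z + (j == ord_max)%:R * b * mono (b - 1) (ker1 a i) Z) +
  (i == ord_max)%:R * b * dmono j (b - 1) Z.

Lemma mono_derive1 b i j Z : 0 < height Z -> is_derive Z (e_ j) (dmono i b) (ddmono i j b Z).
Proof.
move=> y0.
have D1 : is_derive Z (e_ j) (mono b (ker1 a i)) (mono b (ker2 a i j) Z + (j == ord_max)%:R * b * mono (b - 1) (ker1 a i) Z).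
  by apply: (mono_derive b (t1 i) (t2 i j) _ y0) => w x; exact: is_derive_ker1.
have D2 := is_deriveZ ((i == ord_max)%:R * b) (mono_derive0 (b - 1) j y0).
exact: (is_deriveD D1 D2).
Qed.

Lemma dmono_continuous i b Z : 0 < height Z -> {for Z, continuous (dmono i b)}.
Proof.
move=> y0; apply: for_continuousD; first exact: (mono_continuous (t1 i) y0).
by apply: for_continuousZ; exact: (mono_continuous t0 y0).
Qed.

Lemma ddmono_continuous i j b Z : 0 < height Z -> {for Z, continuous (ddmono i j b)}.
Proof.
move=> y0; apply: for_continuousD; first apply: for_continuousD.
- exact: (mono_continuous (t2 i j) y0).
- by apply: for_continuousZ; exact: (mono_continuous (t1 i) y0).
- by apply: for_continuousZ; exact: dmono_continuous.
Qed.

Variable v : 'rV[R]_4 -> R.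
Variable c : R.
Hypothesis vE : forall Z, 0 < height Z -> v Z = c * mono (2 * al) (ker0 a) Z.

Lemma partialE i Z : 0 < height Z -> is_derive Z (e_ i) v (c * dmono i (2 * al) Z).
Proof.
move=> y0; apply: near_eq_is_derive (is_deriveZ c (mono_derive0 (2 * al) i y0)).
by apply: filterS (height_near y0) => W W0; rewrite vE.
Qed.

Lemma partial_near i Z : 0 < height Z ->
  \forall W \near Z, c * dmono i (2 * al) W = partial i v W.
Proof.
move=> y0; apply: filterS (height_near y0) => W W0.
by have [_ <-] := partialE i W0.
Qed.

Lemma partial2E i j Z : 0 < height Z -> is_derive Z (e_ j) (partial i v) (c * ddmono i j (2 * al) Z).
Proof.
move=> y0; apply: near_eq_is_derive (is_deriveZ c (mono_derive1 (2 * al) i j y0)).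
exact: partial_near.
Qed.

(** [v] is given by a formula only at positive height, an open condition; each property of the
    explicit derivatives is transferred by equality near [Z]. *)
Lemma C2_mono : C2_on (@half_space R) v.
Proof.
move=> Z y0 i; split.
- by case: (partialE i y0).
- apply: near_eq_continuous (partial_near i y0) _.
  by apply: for_continuousZ; exact: dmono_continuous.
- move=> j; split; first by case: (partial2E i j y0).
  apply: (@near_eq_continuous _ _ (fun W => c * ddmono i j (2 * al) W)).
    apply: filterS (height_near y0) => W W0.
    by have [_ <-] := partial2E i j W0.
  by apply: for_continuousZ; exact: ddmono_continuous.
Qed.

Lemma pot_lin phi psi k Z : tame a phi -> tame a psi -> 0 < height Z ->
  pot (fun w => phi w + k * psi w) Z = pot phi Z + k * pot psi Z.
Proof.
move=> tp tq y0; have i1 := pot_integrable gN al0 al1 mu_ uM tp y0.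
have i2 := pot_integrable gN al0 al1 mu_ uM tq y0.
rewrite /pot -RintegralZl// -RintegralD//; last exact: (integrableZl measurableT k i2).
by apply: eq_Rintegral => xi _; ring.
Qed.

(** [ker_pde] integrated against [dens], where [1 + 2 al] is [2 a - 2]. The height is factored out
    to bring all the kernels under one integral. *)
Lemma pot_pde Z : 0 < height Z ->
  height Z * \sum_i pot (ker2 a i i) Z + (1 + 2 * al) * pot (ker1 a ord_max) Z = 0.
Proof.
move=> y0; have y0' : height Z != 0 by rewrite gt_eqF.
pose k2 (i : nat) := ker2 a (inord i) (inord i).
pose K1 w := k2 0%N w + 1 * k2 1%N w; have tK1 : tame a K1 by exact: (tameD (t2 _ _) (tameZ 1 (t2 _ _))).
pose K2 w := K1 w + 1 * k2 2%N w; have tK2 : tame a K2 by exact: (tameD tK1 (tameZ 1 (t2 _ _))).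
pose K3 w := K2 w + 1 * ker2 a ord_max ord_max w; have tK3 : tame a K3 by exact: (tameD tK2 (tameZ 1 (t2 _ _))).
rewrite sum_I4.
have -> : pot (ker2 a (inord 0) (inord 0)) Z + pot (ker2 a (inord 1) (inord 1)) Z +
    pot (ker2 a (inord 2) (inord 2)) Z + pot (ker2 a ord_max ord_max) Z = pot K3 Z.
  by rewrite /K3 (pot_lin 1 tK2 (t2 _ _) y0) /K2 (pot_lin 1 tK1 (t2 _ _) y0) /K1 (pot_lin 1 (t2 _ _) (t2 _ _) y0) !mul1r.
have -> : height Z * pot K3 Z + (1 + 2 * al) * pot (ker1 a ord_max) Z =
    height Z * (pot K3 Z + ((1 + 2 * al) / height Z) * pot (ker1 a ord_max) Z) by field.
rewrite -(pot_lin _ tK3 (t1 _) y0).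
suff -> : pot (fun w => K3 w + ((1 + 2 * al) / height Z) * ker1 a ord_max w) Z = 0 by rewrite mulr0.
apply: Rintegral_eq0 => xi; set w := diff4 Z xi.
have q0 : 0 < qd w by apply: lt_le_trans (height_le_qd _ _); rewrite exprn_gt0.
have wy : w ord_max = height Z by rewrite /w /diff4 /em/= subr0.
have := ker_pde a q0; rewrite sum_I4 wy => E.
have -> : K3 w + ((1 + 2 * al) / height Z) * ker1 a ord_max w = 0; last by rewrite mul0r.
apply: (mulfI y0'); rewrite mulr0 -[RHS]E /K3 /K2 /K1 /k2 /pdim.
by field.
Qed.

(** The weight turns [y^(2 al)] into [y], and the term from differentiating this power into a
    multiple of [y^0]. The divergence is then [c] times the left side of [pot_pde], where [1 + 2 al]
    collects the 1 from differentiating [y] and the [2 al] of the other term. *)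
Lemma div_mono Z : 0 < height Z ->
  \sum_(i < 4) partial i (fun W => height W `^ (1 - 2 * al) * partial i v W) Z = 0.
Proof.
move=> y0.
have E i W : 0 < height W -> height W `^ (1 - 2 * al) * partial i v W =
    c * (mono 1 (ker1 a i) W + (i == ord_max)%:R * (2 * al) * mono 0 (ker0 a) W).
  move=> W0; have -> : partial i v W = c * dmono i (2 * al) W by have [_ <-] := partialE i W0.
  have hh b : height W `^ (1 - 2 * al) * height W `^ b = height W `^ (1 - 2 * al + b).
    by rewrite -powRD// (gt_eqF W0) implybT.
  rewrite /dmono /mono.
  have := hh (2 * al); rewrite subrK => <-.
  have := hh (2 * al - 1); rewrite (_ : 1 - 2 * al + (2 * al - 1) = 0); last by ring.
  move=> <-; ring.
have D i : partial i (fun W => height W `^ (1 - 2 * al) * partial i v W) Z =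
    c * ((height Z * pot (ker2 a i i) Z + (i == ord_max)%:R * pot (ker1 a i) Z) +
      (i == ord_max)%:R * (2 * al) * pot (ker1 a i) Z).
  have D1 : is_derive Z (e_ i) (mono 1 (ker1 a i)) (mono 1 (ker2 a i i) Z + (i == ord_max)%:R * 1 * mono (1 - 1) (ker1 a i) Z).
    by apply: (mono_derive 1 (t1 i) (t2 i i) _ y0) => w x; exact: is_derive_ker1.
  have D2 := is_deriveZ ((i == ord_max)%:R * (2 * al)) (mono_derive0 0 i y0).
  have D3 := is_deriveZ c (is_deriveD D1 D2).
  have nE : \forall W \near Z, c * (mono 1 (ker1 a i) W + (i == ord_max)%:R * (2 * al) * mono 0 (ker0 a) W) =
      height W `^ (1 - 2 * al) * partial i v W.
    by apply: filterS (height_near y0) => W W0; rewrite E.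
  have [_ DE] := near_eq_is_derive nE D3; rewrite /partial in DE *; rewrite DE.
  rewrite /dmono /mono subrr powRr0 powRr1 ?(ltW y0)// /GRing.scale/=; ring.
under eq_bigr => i _ do rewrite D.
rewrite -mulr_sumr !big_split/= -mulr_sumr.
have S (k : R) : \sum_(i < 4) (i == ord_max)%:R * k * pot (ker1 a i) Z = k * pot (ker1 a ord_max) Z.
  rewrite (bigD1 ord_max)//= mul1r big1 ?addr0// => i /negbTE ->.
  by rewrite !mul0r.
have S1 : \sum_(i < 4) (i == ord_max)%:R * pot (ker1 a i) Z = pot (ker1 a ord_max) Z.
  by rewrite -[RHS]mul1r -S; apply: eq_bigr => i _; rewrite mulr1.
rewrite S S1.
by rewrite -[RHS](mulr0 c) -[in RHS](pot_pde y0); ring.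
Qed.

End extension_regularity.

(** * The extension, its trace and its conormal derivative *)

Section cs_extension_existence.
Variables (R : realType) (N : probability R R).
Hypothesis gN : gaussian N.
Local Notation R3 := (R * R * R)%type.
Local Notation N3 := (prob3 N).
Local Notation mu := (@lebesgue_measure R).
Variables (al : R).
Hypotheses (al0 : 0 < al) (al1 : al < 1).
Implicit Types (Z : 'rV[R]_4) (x : R3) (t y : R).

Let q14 : 0 < (1 / 4 : R). Proof. by rewrite divr_gt0. Qed.

Let ig0 (c t : R) : 0 <= igamma al c t := igamma_ge0 al0 al1 c t.

Lemma igamma_scale (c t : R) : 0 < c -> igamma al (c / 4) (c * t) = c^-1 * igamma al (1 / 4) t.
Proof.
move=> c0; have [t0|t0] := leP t 0.
  by rewrite /igamma !pw_le0 ?mul0r ?mulr0// pmulr_rle0.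
rewrite /igamma pw_scale// powRM ?(ltW c0)// mul1r.
have -> : - (c / 4) / (c * t) = - 4^-1 / t by field; rewrite !gt_eqF.
have -> : c `^ (- al - 1) = (c `^ al)^-1 * c^-1.
  by rewrite powRD ?(gt_eqF c0) ?implybT// powRN powR_inv1// ltW.
by field; rewrite !gt_eqF ?powR_gt0//= Gamma_gt0// al0 (le_trans (ltW al1))// ler1n.
Qed.

Lemma ge0_integral_igamma_scale (w : R -> R) (c : R) : 0 < c -> measurable_fun setT w ->
  (forall t, 0 <= w t) ->
  (\int[mu]_t (igamma al (c / 4) t * w t)%:E = \int[mu]_t (igamma al (1 / 4) t * w (c * t))%:E)%E.
Proof.
move=> c0 mw w0.
have mi := measurable_igamma al (c / 4).
have m1 : measurable_fun setT (fun t => igamma al (c / 4) t * w t) by exact: measurable_funM.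
have p1 t : 0 <= igamma al (c / 4) t * w t by exact: mulr_ge0.
have mwc : measurable_fun setT (fun t : R => w (c * t)).
  by apply: (measurableT_comp mw); exact: measurable_funM.
have H := ge0_integral_scale c0 m1 p1.
transitivity (c%:E * \int[mu]_t (igamma al (c / 4) (c * t) * w (c * t))%:E)%E.
  by rewrite H muleA -EFinM divff ?gt_eqF// mul1e.
rewrite -ge0_integralZ ?(ltW c0)//.
- apply: eq_integral => t _; rewrite igamma_scale// -mulrA mulrA divff ?gt_eqF// !mul1r.
  by [].
- apply: measurable_funM => //; apply: (measurableT_comp mi).
  exact: measurable_funM.
Qed.

Lemma integral_igamma_shift (w : R -> R) (M c : R) : 0 < c -> measurable_fun setT w ->
  (forall t, `|w t| <= M) ->
  \int[mu]_t (igamma al c t * (w t + M)) = \int[mu]_t (igamma al c t * w t) + M.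
Proof.
move=> c0 mw wM.
have ii := igamma_integrable al0 al1 c0.
have i1 := integrableM_bounded (measurable_igamma al c) (ig0 c) ii mw wM.
have i2 := integrableZl measurableT M ii.
transitivity (\int[mu]_t (igamma al c t * w t + M * igamma al c t)).
  by apply: eq_Rintegral => t _; ring.
rewrite RintegralD// RintegralZl//; congr (_ + _).
by rewrite /Rintegral igamma_mass//= mulr1.
Qed.

Lemma integral_igamma_scale (w : R -> R) (M c : R) : 0 < c -> measurable_fun setT w ->
  (forall t, `|w t| <= M) ->
  \int[mu]_t (igamma al (c / 4) t * w t) = \int[mu]_t (igamma al (1 / 4) t * w (c * t)).
Proof.
move=> c0 mw wM.
have mwc : measurable_fun setT (fun t : R => w (c * t)).
  by apply: (measurableT_comp mw); exact: measurable_funM.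
apply: (@addIr _ M).
rewrite -(integral_igamma_shift _ mw wM) ?divr_gt0//.
rewrite -(integral_igamma_shift q14 mwc (fun t => wM _)).
rewrite /Rintegral (@ge0_integral_igamma_scale (fun t => w t + M))//.
- exact: measurable_funD.
- by move=> t; have := wM t; rewrite ler_norml -lerBlDr sub0r => /andP[].
Qed.

Lemma integral_igamma_bound (w : R -> R) (M c : R) : 0 < c -> measurable_fun setT w ->
  (forall t, `|w t| <= M) -> `|\int[mu]_t (igamma al c t * w t)| <= M.
Proof.
move=> c0 mw wM.
have ii := igamma_integrable al0 al1 c0.
have i1 := integrableM_bounded (measurable_igamma al c) (ig0 c) ii mw wM.
apply: (le_trans (le_normr_Rintegral measurableT i1)).
have i2 := integrableZl measurableT M ii.
apply: (@le_trans _ _ (\int[mu]_t (M * igamma al c t))).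
  apply: le_Rintegral => //; first exact: (integrable_norm i1).
  by move=> t _; rewrite normrM (ger0_norm (ig0 _ _)) mulrC ler_wpM2r.
by rewrite RintegralZl// /Rintegral igamma_mass//= mulr1.
Qed.

Definition base3 (x : 'rV[R]_3) : R3 := (x ord0 0, x ord0 1, x ord0 ord_max).

Lemma height_half (x : 'rV[R]_3) y : height (half_point x y) = y.
Proof.
rewrite /height /half_point (_ : ord_max = rshift 3 (ord0 : 'I_1)); last exact: val_inj.
transitivity ((y%:M : 'rV[R]_1) ord0 ord0); first exact: row_mxEr.
by rewrite mxE.
Qed.

Lemma base_half (x : 'rV[R]_3) y : base (half_point x y) = base3 x.
Proof.
rewrite /base /base3 /half_point.
rewrite (_ : inord 0 = lshift 1 (0 : 'I_3)); last by apply: val_inj; rewrite /= inordK.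
rewrite (_ : inord 1 = lshift 1 (1 : 'I_3)); last by apply: val_inj; rewrite /= inordK.
rewrite (_ : inord 2 = lshift 1 (ord_max : 'I_3)); last by apply: val_inj; rewrite /= inordK.
by congr (_, _, _); exact: row_mxEl.
Qed.

Section one_function.
Variables (u : R3 -> R) (M : R).
Hypotheses (mu_ : measurable_fun setT u) (uM : forall x, `|u x| <= M) (uc : continuous u).

(** Substituting [y^2 t] for the heat time freezes the law at [igamma (1 / 4)] and puts the height
    into the scale of the heat average. The formula thus makes sense at height 0 and is continuous
    there. *)
Definition cs_ext Z : R :=
  \int[mu]_t (igamma al (1 / 4) t * hs N (Num.sqrt (2 * t) * height Z) u (base Z)).

Let measurable_ext_integrand Z : measurable_fun setT (fun t => hs N (Num.sqrt (2 * t) * height Z) u (base Z)).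
Proof.
apply: (@measurable_hs_param _ N u M mu_ uM _ _ (0 : R) (fun t => Num.sqrt (2 * t) * height Z) (cst (base Z))) => //.
by apply: measurable_funM => //; exact: measurable_sqrt2.
Qed.

Lemma cs_ext_bound Z : `|cs_ext Z| <= M.
Proof. by apply: integral_igamma_bound => // t; exact: hs_bound. Qed.

Lemma cs_ext_continuous : continuous cs_ext.
Proof.
move=> Z; apply: seq_continuous_at => v vZ.
have vc i : v n ord0 i @[n --> \oo] --> Z ord0 i.
  exact: (cvg_comp _ _ vZ (@coord_continuous R 1 4 ord0 i Z)).
have [||||_ //] := @Rdominated_cvg _ _ R mu setT
   (fun n t => igamma al (1 / 4) t * hs N (Num.sqrt (2 * t) * height (v n)) u (base (v n)))
   (fun t => igamma al (1 / 4) t * hs N (Num.sqrt (2 * t) * height Z) u (base Z))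
   (fun t => M * igamma al (1 / 4) t) measurableT.
- by move=> n; exact: (measurable_funM (measurable_igamma al _) (measurable_ext_integrand _)).
- move=> t _; apply: cvgM; first exact: cvg_cst.
  apply: (@hs_cvg R N u M (fun n => Num.sqrt (2 * t) * height (v n)) (fun n => base (v n)) _ _ mu_ uM uc).
    by apply: cvgM; [exact: cvg_cst|exact: vc].
  by apply: cvg_pair2; [apply: cvg_pair2|]; exact: vc.
- exact: (integrableZl measurableT M (igamma_integrable al0 al1 q14)).
- by move=> n t _; rewrite normrM (ger0_norm (ig0 _ _)) mulrC ler_wpM2r// hs_bound.
Qed.

Lemma cs_ext_trace Z : height Z = 0 -> cs_ext Z = u (base Z).
Proof.
move=> h0; rewrite /cs_ext h0.
transitivity (\int[mu]_t (u (base Z) * igamma al (1 / 4) t)).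
  by apply: eq_Rintegral => t _; rewrite mulr0 hs0 mulrC.
rewrite RintegralZl//; last exact: igamma_integrable.
by rewrite /Rintegral igamma_mass//= mulr1.
Qed.

Lemma cs_ext_heat Z : 0 < height Z ->
  cs_ext Z = \int[mu]_t (igamma al (height Z ^+ 2 / 4) t * heat N u (base Z) t).
Proof.
move=> y0; have y20 : 0 < height Z ^+ 2 by rewrite exprn_gt0.
rewrite (integral_igamma_scale y20 (measurable_heat N mu_ uM _) (heat_bound N mu_ uM _)).
apply: eq_Rintegral => t _; rewrite /heat; congr (_ * hs N _ u _).
have -> : 2 * (height Z ^+ 2 * t) = height Z ^+ 2 * (2 * t) by ring.
by rewrite [in RHS]sqrtrM ?(ltW y20)// sqrtr_sqr gtr0_norm// mulrC.
Qed.

Lemma cs_ext_mono Z : 0 < height Z ->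
  cs_ext Z = pcst al * mono N u (2 * al) (ker0 (pdim al)) Z.
Proof.
move=> y0; rewrite cs_ext_heat// (poisson_formula gN al0 al1 (base Z) y0 mu_ uM).
rewrite /mono /pot mulrA -RintegralZl//.
  by apply: eq_Rintegral => xi _; rewrite /pkernel /ker0 /dens -qd_diff4 addr0; ring.
exact: (pot_integrable gN al0 al1 mu_ uM (tame0 _) y0).
Qed.

Lemma cs_ext_extension : cs_extension al (u \o base3) cs_ext.
Proof.
split.
- by exists M => Z _; exact: cs_ext_bound.
- by apply: continuous_subspaceT; exact: cs_ext_continuous.
- exact: (C2_mono gN al0 al1 mu_ uM cs_ext_mono).
- by move=> Z; exact: (div_mono gN al0 al1 mu_ uM cs_ext_mono).
- by move=> x; rewrite cs_ext_trace ?height_half// base_half.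
Qed.

End one_function.

Section neumann.
Variables (K : R) (g0 u : R3 -> R) (M : R).
Hypothesis K0 : 0 < K.
Hypotheses (mg : measurable_fun setT g0) (gM : forall x, `|g0 x| <= M) (gc : continuous g0).
Hypothesis uE : forall x, u x = resolve N al K g0 x.

Let uE' : u = resolve N al K g0. Proof. exact/funext. Qed.

Let mu_ : measurable_fun setT u.
Proof. by rewrite uE'; exact: (measurable_resolve N al0 al1 K0 mg gM). Qed.

Let uM x : `|u x| <= M / K.
Proof. by rewrite uE'; exact: (resolve_bound N al0 al1 K0 mg gM). Qed.

Let uc : continuous u.
Proof. by rewrite uE'; exact: (continuous_resolve gN al0 al1 K0 mg gM). Qed.

(** Fubini, then the semigroup law inside the integral in [s]. The condition [0 <= t] matters, since
    [Num.sqrt] sends negative times to 0. *)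
Lemma wrho_heat x t : 0 <= t -> wrho al K (heat N g0 x) t = heat N u x t.
Proof.
move=> t0; rewrite uE' /heat /hs /resolve.
pose F (z : R * R3) := rho al K z.1 * heat N g0 (mv x (Num.sqrt (2 * t)) z.2) z.1.
have mF : measurable_fun setT F.
  apply: measurable_funM; first exact: (measurableT_comp (measurable_rho al0 al1 K0)).
  apply: (@measurable_hs_param _ N g0 M mg gM _ _ ((0, (0, 0, 0)) : R * R3) (fun z => Num.sqrt (2 * z.1))
    (fun z => mv x (Num.sqrt (2 * t)) z.2)).
    exact: (measurableT_comp (@measurable_sqrt2 R)).
  by apply: measurable_mv.
have Fb s xi : `|F (s, xi)| <= M * rho al K s.
  by rewrite normrM (ger0_norm (rho_ge0 al0 al1 K0 _)) mulrC ler_wpM2r ?rho_ge0// (heat_bound N mg gM).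
have <- : \int[mu]_s \int[N3]_xi F (s, xi) = \int[N3]_xi \int[mu]_s F (s, xi).
  apply: (@Rfubini_dom _ _ _ _ R mu N3 F (fun s => M * rho al K s)).
  - exact: mF.
  - exact: (integrableZl measurableT M (rho_integrable al0 al1 K0)).
  - exact: Fb.
rewrite /F/=.
apply: eq_Rintegral => s _.
have [s0|s0] := leP s 0.
  by rewrite rho_le0// mul0r Rintegral_eq0// => xi; rewrite mul0r.
rewrite RintegralZl//; last first.
  exact: (integrable_hs N (measurable_hs N mg gM _) (hs_bound N mg gM _)).
congr (_ * _); apply/esym; apply: (hs_semigroup gN mg gM).
by rewrite !sqr_sqrtr ?mulr_ge0 ?addr_ge0// ?(ltW s0)//; ring.
Qed.

Lemma heat_cvg0 (h : R3 -> R) (B : R) x : measurable_fun setT h -> (forall x, `|h x| <= B) ->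
  continuous h -> heat N h x t @[t --> 0^'+] --> h x.
Proof.
move=> mh hB hc; apply: seq_cvg_within => v _ v0.
rewrite -[X in _ --> X](hs0 N h x) /heat.
apply: (@hs_cvg R N h B (fun n => Num.sqrt (2 * v n)) (fun=> x) 0 x mh hB hc); last exact: cvg_cst.
rewrite -[X in _ --> X](@sqrtr0 R) -(mulr0 2).
by apply: continuous_cvg; [exact: sqrt_continuous|apply: cvgM => //; exact: cvg_cst].
Qed.

(** Above a fixed [x] the extension is [ext1] for [w t = S_t g0 (x)]. By [wrho_heat], [w - K wrho w]
    tends to [g0 - K u] at [x] as [t] tends to 0, and [dext1_cvg] gives the limit; the constant
    [c_ al] cancels. *)
Lemma cs_ext_neumann (x : 'rV[R]_3) :
  - (c_ al)^-1 * (y `^ (1 - 2 * al) * partial ord_max (cs_ext u) (half_point x y))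
    @[y --> 0^'+] --> g0 (base3 x) - K * u (base3 x).
Proof.
set b := base3 x; pose w := heat N g0 b; pose X0 := g0 b - K * u b.
have mw : measurable_fun setT w := measurable_heat N mg gM b.
have wM t : `|w t| <= M := heat_bound N mg gM b t.
have Xc : w t - K * wrho al K w t @[t --> 0^'+] --> X0.
  apply: cvgB; first exact: heat_cvg0.
  apply: cvgM; first exact: cvg_cst.
  apply: (@cvg_trans _ (heat N u b t @[t --> 0^'+])); last exact: heat_cvg0.
  by apply: near_eq_cvg; near=> t; rewrite /w wrho_heat.
have E1 y : 0 < y -> cs_ext u (half_point x y) = ext1 al K w y.
  move=> y0; rewrite (cs_ext_heat mu_ uM); last by rewrite height_half.
  rewrite height_half base_half /ext1.
  apply: eq_Rintegral => t _; have [t0|t0] := leP t 0; first by rewrite /igamma pw_le0// !(mul0r, mulr0).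
  by rewrite /w wrho_heat// ltW.
have D y : 0 < y -> partial ord_max (cs_ext u) (half_point x y) = dext1 al K w y.
  move=> y0.
  have sE t : t *: delta_mx ord0 ord_max + half_point x y = half_point x (y + t).
    apply/rowP => i; rewrite /half_point !mxE eqxx/=.
    case: splitP => j ij.
      rewrite (_ : (i == ord_max) = false) ?mulr0 ?add0r//.
      by apply/negbTE/eqP => /(congr1 val) /=; rewrite ij => e; have := ltn_ord j; rewrite e.
    rewrite (_ : (i == ord_max) = true); last by apply/eqP/val_inj; rewrite /= ij (ord1 j).
    by rewrite !mxE (ord1 j)/= !mulr1n mulr1 addrC.
  have D1 := is_derive_ext1 al0 al1 K0 mw wM y0.
  have D2 : is_derive (0 : R) (1 : R) (fun t => y + t) 1.
    by rewrite -[X in is_derive _ _ _ X]add0r; exact: (is_deriveD (is_derive_cst y (0 : R) (1 : R)) (is_derive_id (0 : R) (1 : R))).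
  have y0' : is_derive (y + 0) (1 : R) (ext1 al K w) (dext1 al K w y) by rewrite addr0.
  have D3 := @is_derive1_comp _ (ext1 al K w) (fun t => y + t) 0 _ _ y0' D2.
  have [_ //] : is_derive (half_point x y) (delta_mx ord0 ord_max) (cs_ext u) (dext1 al K w y).
  apply: is_derive_line; rewrite -[dext1 _ _ _ _]mulr1.
  have n0 : \forall t \near (0 : R), `|t| < y.
    by exists y => //= t; rewrite /ball_/= sub0r normrN.
  apply: near_eq_is_derive D3; near=> t; rewrite /= sE E1//.
  suff : `|t| < y by rewrite ltr_norml => /andP[+ _]; rewrite -ltrBlDl sub0r.
  by near: t.
have c0 : c_ al != 0.
  rewrite /c_ gt_eqF// divr_gt0 ?mulr_gt0 ?powR_gt0// Gamma_gt0 ?al0//=.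
    by rewrite subr_gt0 al1 (@le_trans _ _ 1)// ?ler1n// gerBl ltW.
  by rewrite (le_trans (ltW al1))// ler1n.
rewrite -/X0 (_ : X0 = - (c_ al)^-1 * - (c_ al * X0)); last by field.
apply: cvgM; first exact: cvg_cst.
apply: (@cvg_trans _ (y `^ (1 - 2 * al) * dext1 al K w y @[y --> 0^'+])); last first.
  exact: (dext1_cvg al0 al1 K0 mw wM Xc).
by apply: near_eq_cvg; near=> y; rewrite D.
Unshelve. all: by end_near. Qed.

End neumann.

End cs_extension_existence.

Lemma ltr_half (R : realFieldType) (e : R) : 0 < e -> e / 2 < e.
Proof. by move=> e0; rewrite gtr_pMr// invf_lt1// ltr1n. Qed.

Lemma shift_norm_ge0 (R : realDomainType) (c d C : R) : `|c - d| <= C -> 0 <= - c + (`|d| + C + 1).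
Proof.
move=> h; rewrite addrC subr_ge0; apply: (le_trans (ler_norm c)).
rewrite -[X in `|X|](subrK d); apply: (le_trans (ler_normD _ _)).
by rewrite [leLHS]addrC -addrA lerD2l; apply: (le_trans h); rewrite lerDl ler01.
Qed.

(** * The solution *)

Section double_well_nonlinearity.
Variables (R : realType) (alpha : R) (F : R -> R).
Hypothesis dw : double_well alpha F.
Local Notation f := (fun t : R => - derive1 F t).
Local Notation m := (- derive1 (derive1 F) 0).

Lemma is_derive_dw (t : R) : is_derive t (1 : R) F (derive1 F t).
Proof.
have [gamma _ [_ d _ _]] := dw_reg dw; rewrite derive1E.
exact: (DeriveDef (d t) erefl).
Qed.

Lemma is_derive_dw' (t : R) : is_derive t (1 : R) (derive1 F) (derive1 (derive1 F) t).
Proof.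
have [gamma _ [_ _ d _]] := dw_reg dw; rewrite [derive1 (derive1 F) t]derive1E.
exact: (DeriveDef (d t) erefl).
Qed.

Lemma dw_odd (t : R) : derive1 F (- t) = - derive1 F t.
Proof.
have D1 := @is_derive1_comp R F (fun x => - x) t _ _ (is_derive_dw (- t)) (is_deriveN (is_derive_id t (1 : R))).
have E : F \o (fun x => - x) = F by apply/funext => x /=; exact: (dw_even dw).
rewrite E in D1; have D2 := is_derive_dw t.
have [_ e1] := D1; have [_ e2] := D2.
by have := e1; rewrite e2 mulrN1 => ->; rewrite opprK.
Qed.

Lemma dw_crit1 : derive1 F 1 = 0.
Proof.
have D : is_derive (1 : R) (1 : R) F 0.
  apply: (@derive1_at_min R F 0 2 1).
  - by [].
  - by move=> t _; case: (is_derive_dw t).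
  - by rewrite in_itv/= ltr01 ltr1n.
  - by move=> t _; case: (dw_min dw t).
by have [_ <-] := D; have [_ <-] := is_derive_dw 1.
Qed.

Lemma dw_continuous' : continuous f.
Proof.
move=> t; apply: cvgN; apply: differentiable_continuous; apply/derivable1_diffP.
by case: (is_derive_dw' t).
Qed.

(** The derivative of [f + K id] is [K - F'']. On [[-1, 1]] the Hölder estimate between a point and
    0 bounds [F''] by [|F''(0)| + |C|], whence the choice of [K]. *)
Lemma dw_lipschitz : exists2 K : R, 0 < K &
  forall s t, - 1 <= s -> s <= t -> t <= 1 -> f s + K * s <= f t + K * t.
Proof.
have [gamma g0 [g01 _ _ H]] := dw_reg dw; have [C HC] := H 1.
have gp : 0 < gamma by case/andP: g01.
exists (`|derive1 (derive1 F) 0| + `|C| + 1).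
  by rewrite ltr_wpDl// addr_ge0.
move=> s t s1 st t1; set K := _ + 1.
have D (x : R) : is_derive x (1 : R) (fun x => f x + K * x) (- derive1 (derive1 F) x + K).
  have D1 := is_deriveD (is_deriveN (is_derive_dw' x)) (is_deriveZ K (is_derive_id x (1 : R))).
  rewrite (_ : _ + K = - derive1 (derive1 F) x + K *: (1 : R)); first exact: D1.
  by rewrite /GRing.scale/= mulr1.
have [|c] := @MVT_segment R (fun x => f x + K * x) (fun x => - derive1 (derive1 F) x + K) s t st (fun x _ => D x).
  apply: continuous_subspaceT => x; apply: differentiable_continuous; apply/derivable1_diffP.
  by case: (D x).
rewrite in_itv/= => /andP[sc ct] E; rewrite -subr_ge0 E mulr_ge0 ?subr_ge0//.
have c1 : `|c| <= 1 by rewrite ler_norml (le_trans s1)//= (le_trans ct).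
have := HC c 0 c1; rewrite normr0 ler01 subr0 => /(_ isT) h.
have h2 : C * `|c| `^ gamma <= `|C|.
  apply: (@le_trans _ _ (`|C| * `|c| `^ gamma)).
    by apply: ler_wpM2r; [exact: powR_ge0|exact: ler_norm].
  have e1 : (1 : R) `^ gamma = 1 by rewrite powR1.
  by rewrite ler_piMr// -[leRHS]e1 ge0_ler_powR ?nnegrE// ltW.
exact: (shift_norm_ge0 (le_trans h h2)).
Qed.

(** [F'] vanishes at 0 by oddness and its difference quotient there tends to [F''(0) < - m1]. *)
Lemma dw_slope (m1 : R) : m1 < m -> exists2 e0 : R, 0 < e0 <= 1 &
  forall t, 0 <= t -> t <= e0 -> m1 * t <= f t.
Proof.
move=> m1m; have f0 : derive1 F 0 = 0.
  have := dw_odd 0; rewrite oppr0 => /eqP; rewrite -subr_eq0 opprK -mulr2n mulrn_eq0/=.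
  by move/eqP.
have [d dE] := is_derive_dw' 0.
have dc : h^-1 *: (derive1 F (h *: (1 : R) + 0) - derive1 F 0) @[h --> (0 : R)^'] --> derive1 (derive1 F) 0.
  by rewrite -dE; exact: d.
have {}m1m : 0 < m - m1 by rewrite subr_gt0.
have /cvgrPdist_lt/(_ _ m1m)[e /= e0 He] := dc.
have ep : 0 < e / 2 by rewrite divr_gt0.
exists (Num.min 1 (e / 2)); first by rewrite lt_min ltr01 ep ge_min lexx.
move=> t; rewrite le_eqVlt => /predU1P[<- _|t0]; first by rewrite f0 oppr0 mulr0.
rewrite le_min => /andP[_ te].
have te' : t < e := le_lt_trans te (ltr_half e0).
have tb : ball_ [eta Num.Def.normr] 0 e t by rewrite /ball_/= sub0r normrN gtr0_norm.
have := He t tb (lt0r_neq0 t0).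
rewrite f0 subr0 addr0 /GRing.scale/= mulr1 ltr_norml => /andP[h _].
move: h; rewrite opprB -ltrBlDr => h.
have {}h : t^-1 * derive1 F t < - m1 by move: h; move: (t^-1 * _) (derive1 (derive1 F) 0) => p q h; lra.
by rewrite lerNr -mulNr -(ler_pdivrMr _ _ t0) mulrC (ltW h).
Qed.

End double_well_nonlinearity.

(** * Coordinates on R^3 and the helicoid *)

Section coordinates.
Variable R : realType.
Implicit Types (x : 'rV[R]_3).

Lemma base3_vec3 (a b s : R) : base3 (vec3 a b s) = (a, b, s).
Proof. by rewrite /base3 /vec3 !mxE. Qed.

Lemma vec3_base3 x : vec3 (base3 x).1.1 (base3 x).1.2 (base3 x).2 = x.
Proof.
apply/rowP => -[[|[|[|//]]] lt]; rewrite !mxE /base3/=; congr (x _ _); exact: val_inj.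
Qed.

Lemma base3_screw (lambda beta : R) x : 0 < lambda ->
  base3 (screw lambda beta x) = scr (pi / lambda) beta (base3 x).
Proof.
move=> l0; rewrite /screw base3_vec3 /scr/=; congr (_, _, _ + _).
by rewrite invf_div mulrC.
Qed.

(** For the converse let [th = k s]: vanishing of [helix] says that [(a, b)] is parallel to
    [(cos th, sin th)], and the parameter along the ruling is their scalar product. *)
Lemma helicoidE (lambda : R) x : 0 < lambda ->
  helicoid lambda x <-> helix (pi / lambda) (base3 x) = 0.
Proof.
move=> l0; have p0 := pi_gt0 R.
have kl : pi / lambda * (lambda / pi) = 1 :> R.
  by rewrite -[pi / lambda]invf_div mulVf// gt_eqF// divr_gt0.
rewrite /helix; split.
  move=> [t [theta ->]]; rewrite base3_vec3/=.
  rewrite mulrA kl mul1r.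
  ring.
set k := pi / lambda; move: (vec3_base3 x); set y := base3 x => xE h.
pose th := k * y.2.
exists (y.1.1 * cos th + y.1.2 * sin th), th; rewrite -xE.
have q := cos2Dsin2 th; rewrite -/th in h.
have h' : y.1.2 * cos th = y.1.1 * sin th by apply/eqP; rewrite -subr_eq0 h.
congr vec3.
- rewrite mulrDl -[y.1.2 * _ * _]mulrAC h' -!mulrA -mulrDr -!expr2 q mulr1.
  by [].
- rewrite mulrDl [y.1.1 * _ * _]mulrAC -h' -!mulrA -mulrDr -!expr2 q mulr1.
  by [].
- by rewrite /th /k mulrA [lambda / pi * _]mulrC kl mul1r.
Qed.

End coordinates.

Theorem theorem1p1 (R : realType) (alpha : R) (F : R -> R) (lambda : R)
  (halpha : 0 < alpha < 1)
  (hF : double_well alpha F)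
  (hF0 : derive1 (derive1 F) 0 < 0)
  (hF1 : forall t : R, 0 <= t -> derive1 (derive1 F) 0 * t <= derive1 F t)
  (hlambda : lambda_star alpha F < lambda) :
  exists u : 'rV[R]_3 -> R,
    [/\ allen_cahn_solution alpha F u,
        [set x | u x = 0] = helicoid lambda &
        forall beta : R, u \o screw lambda beta = u].
Proof.
have /andP[al0 al1] := halpha.
have [N gN] := normal_gaussian R.
set m := - derive1 (derive1 F) 0; have m0 : 0 < m by rewrite oppr_gt0.
have p0 := pi_gt0 R.
have ml0 : 0 < m `^ (2 * alpha)^-1 by exact: powR_gt0.
have l0 : 0 < lambda by apply: lt_trans hlambda; rewrite /lambda_star divr_gt0.
pose k : R := pi / lambda; have kp : 0 < k by exact: divr_gt0.
have km : (k ^+ 2) `^ alpha < m.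
  have kl : k < m `^ (2 * alpha)^-1.
    by move: hlambda; rewrite /lambda_star ltr_pdivrMr// mulrC -ltr_pdivrMr.
  have a20 : 0 < 2 * alpha by rewrite mulr_gt0.
  have -> : (k ^+ 2) `^ alpha = k `^ (2 * alpha) by rewrite -powR_mulrn ?(ltW kp)// -powRrM.
  have -> : m = (m `^ (2 * alpha)^-1) `^ (2 * alpha).
    by rewrite -powRrM mulVf ?gt_eqF// powRr1// ltW.
  by apply: gt0_ltr_powR => //; rewrite nnegrE ltW.
(* Strictly in between: the gap above [k^(2 alpha)] pays for the Gaussian cut-off of the bump, the
   gap below [- F''(0)] for linearising [- F'] near 0. *)
pose m1 := ((k ^+ 2) `^ alpha + m) / 2.
have [km1 m1m] : (k ^+ 2) `^ alpha < m1 /\ m1 < m.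
  by have [h1 h2] := midf_lt km; split.
have [e0 /andP[e00 e01] slope] := dw_slope hF m1m.
have [K K0 fK] := dw_lipschitz hF.
have fodd t : - derive1 F (- t) = - - derive1 F t by rewrite (dw_odd hF).
have f1 : - derive1 F 1 = 0 by rewrite (dw_crit1 hF) oppr0.
have [u [[[mu_ uM uodd u0] uc] upos uE]] :=
  resolve_fixpoint gN al0 al1 K0 (lt0r_neq0 kp) (dw_continuous' hF) fodd f1 fK km1 e00 e01 slope.
exists (u \o @base3 R); split.
- pose g0 z := - derive1 F (u z) + K * u z.
  have fc := dw_continuous' hF.
  have gc : continuous g0.
    move=> z; apply: cvgD; last by apply: cvgM; [exact: cvg_cst|exact: uc].
    exact: (continuous_comp (uc z) (fc (u z))).
  have mg : measurable_fun setT g0.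
    apply: measurable_funD; last exact: measurable_funM.
    exact: (measurableT_comp (continuous_measurable_fun fc) mu_).
  have gM z : `|g0 z| <= K.
    have := uM z; rewrite !ler_norml => /andP[h1 h2].
    have g1 : - derive1 F 1 + K * 1 = K by rewrite f1 add0r mulr1.
    have gN1 : - derive1 F (- 1) + K * - 1 = - K by rewrite fodd f1 mulrN1 oppr0 add0r.
    by apply/andP; split; [rewrite -gN1|rewrite -g1]; apply: fK => //; rewrite lerN10.
  exists (cs_ext N alpha u); first exact: (cs_ext_extension gN al0 al1 mu_ uM uc).
  (* The conormal derivative is [g0 - K u], in which the auxiliary term [K u] cancels. *)
  move=> x; have H := cs_ext_neumann gN al0 al1 K0 mg gM gc uE (x := x).
  by rewrite /g0 addrK in H.
- apply/seteqP; split => x /=.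
    (* Off the helicoid [u] is positive on one side and, by the half-turn, negative on the other. *)
    move=> ux; apply/(helicoidE x l0); rewrite -/k.
    have [hx|hx|//] := ltgtP (helix k (base3 x)) 0; last first.
      by have := upos _ hx; rewrite ux ltxx.
    have := upos (flip (base3 x)); rewrite helix_flip oppr_gt0 => /(_ hx).
    by rewrite (screw_flip uodd) ux oppr0 ltxx.
  by move=> /(helicoidE x l0) hx; exact: (screw_zero (lt0r_neq0 kp) uodd hx).
- move=> beta; apply/funext => x /=.
  by rewrite base3_screw// (screw_inv uodd).
Qed.
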